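(* Let $K\subset\mathbb R^d$ be a convex body with $0\in\operatorname{Int}K$, and assume that $K$ is strictly convex and regular. Let $\xi_1,\xi_2,\dots$ be independent random points uniformly distributed in $K$, and let $X_n:=\bigcap_{i=1}^n(K-\xi_i)$. Let $Z$ be the zero cell of the Poisson hyperplane tessellation associated with $K$ (see context). Then for every $m\in\mathbb N$ the random vector of convex bodies $$\bigl(n^{-1}(X_n^{o})_{[1]},\dots,n^{-1}(X_n^{o})_{[m]}\bigr)$$ converges in distribution, as $n\to\infty$, on the space $(\mathcal K^d_{(0)})^m$ endowed with the product topology, to $$\bigl(Z^{o}_{[1]},\dots,Z^{o}_{[m]}\bigr).$$ Moreover, $\bigl(\mathrm{wr}_{[1]}(nX_n),\dots,\mathrm{wr}_{[m]}(nX_n)\bigr)$ converges in distribution to $\bigl(\mathrm{wr}_{[1]}(Z),\dots,\mathrm{wr}_{[m]}(Z)\bigr)$ as $n\to\infty$.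
   Context: **Spaces.** $\mathcal K^d_{(0)}$ is the family of compact convex sets in $\mathbb R^d$ containing the origin in the interior, with the Hausdorff metric. $\mathfrak K^d_{(0)}$ is the family of closed convex sets in $\mathbb R^d$ containing the origin in the interior. The polar of $A\subset\mathbb R^d$ is $A^{o}=\{y:\sup_{x\in A}\langle x,y\rangle\le 1\}$. $\mathrm{conv}$ and $\overline{\mathrm{conv}}$ denote the convex hull and the closed convex hull; for a family $\mathcal L$ of sets, $\mathrm{conv}(\mathcal L)$ means the convex hull of the union of its members. $\dim$ is the affine dimension. **Regularity.** $K$ is regular if the normal cone $N(K,x)$ is one-dimensional for every $x\in\partial K$. **Recursive peeling.** Let $\mathcal L=\{L_i:i\in I\}$ be a family of pairwise distinct compact convex sets with $\mathrm{conv}(\mathcal L)$ compact and of positive dimension $d_1$. Put $I_1=I$. Given $I_m$, let $\mathcal L^{(m)}=\{L_i:i\in I_m\}$ and $$\mathcal C^{(m)}(\mathcal L)=\Bigl\{i\in I_m:\mathrm{conv}\Bigl(\bigcup_{k\in I_m}L_k\Bigr)\ne\mathrm{conv}\Bigl(\bigcup_{k\in I_m\setminus\{i\}}L_k\Bigr)\Bigr\}.$$ If $\dim\mathrm{conv}(\mathcal L^{(m)})<d_1$ or $\mathcal C^{(m)}(\mathcal L)=\varnothing$, the procedure terminates; otherwise $I_{m+1}=I_m\setminus\mathcal C^{(m)}(\mathcal L)$. Let $D(\mathcal L)=\inf\{m\in\mathbb N:\dim\mathrm{conv}(\mathcal L^{(m)})<d_1\text{ or }\mathcal C^{(m)}(\mathcal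 L)=\varnothing\}$ ($\inf\varnothing=+\infty$). For $m<D(\mathcal L)$ the $m$-th recursive convex hull peeling is $\mathrm{conv}_{[m]}(\mathcal L)=\overline{\mathrm{conv}}\bigl(\bigcup_{i\in I_m}L_i\bigr)$. **Recursive wrapping.** For a family $\mathcal L=\{L_i:i\in I\}\subset\mathfrak K^d_{(0)}$ whose polar family $\mathcal L^{o}=\{L_i^{o}:i\in I\}$ satisfies the assumptions above, and $m<D(\mathcal L^{o})$, put $\mathrm{wr}_{[m]}(\mathcal L)=\bigl(\mathrm{conv}_{[m]}(\mathcal L^{o})\bigr)^{o}$. Equivalently it is $\bigcap_{i\in I^{o}_m}L_i$, where $I_m^{o}$ is the index set at step $m$ of the recursive peeling of $\mathcal L^{o}$. **Limit object.** Let $\mathcal P_K=\{(t_i,u_i):i\ge1\}$ be a Poisson process on $(0,\infty)\times S^{d-1}$ with intensity measure $V_d(K)^{-1}\,dt\,S_{d-1}(K,du)$, where $V_d$ is volume and $S_{d-1}(K,\cdot)$ is the surface area measure of $K$. With $H_u^-(t)=\{x:\langle x,u\rangle\le t\}$, put $Z=\bigcap_{(t_i,u_i)\in\mathcal P_K}H^-_{u_i}(t_i)$. Let $\Pi_K=\{t_i^{-1}u_i:i\ge1\}$; then $Z^{o}=\mathrm{conv}\bigl(\bigcup_{x\in\Pi_K}[0,x]\bigr)$ almost surely. **Meaning of the peelings and wrappings of the represented sets.** They are taken with respect to the representing families: - $n^{-1}(X_n^{o})_{[r]}:=\mathrm{conv}_{[r]}\bigl(\{n^{-1}(K-\xi_i)^{o}:1\le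 i\le n\}\bigr)$; - $Z^{o}_{[r]}:=\mathrm{conv}_{[r]}\bigl(\{[0,x]:x\in\Pi_K\}\bigr)$; - $\mathrm{wr}_{[r]}(nX_n)$ is the recursive wrapping of the family $\{n(K-\xi_i):1\le i\le n\}$; - $\mathrm{wr}_{[r]}(Z)$ is the recursive wrapping of the family $\{H^-_{u_i}(t_i):i\ge1\}$. On the event (of probability tending to $0$ as $n\to\infty$) where one of the pre-limit objects is undefined, it is set equal to an arbitrary fixed element of $\mathcal K^d_{(0)}$. *)

(* Defs.v *)
From HB Require Import structures.
From mathcomp Require Import all_boot all_order all_algebra.
From mathcomp Require Import all_classical all_reals all_analysis.
From mathcomp Require Import ring lra.

Set Implicit Arguments.
Unset Strict Implicit.
Unset Printing Implicit Defensive.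

Import Order.TTheory GRing.Theory Num.Theory.
Import numFieldNormedType.Exports.

Local Open Scope classical_set_scope.
Local Open Scope ring_scope.

Definition dot (R : realType) (d : nat) (x y : 'rV[R]_d) : R :=
  \sum_(i < d) x 0 i * y 0 i.

(* The library norm on ['rV[R]_d] is the sup norm; it induces the usual topology
   (used below for [compact], [closure], [open], ...), while metric notions
   (unit sphere, Hausdorff distance, parallel sets) use the Euclidean norm. *)
Definition enorm (R : realType) (d : nat) (x : 'rV[R]_d) : R :=
  Num.sqrt (dot x x).

Section EuclideanNorm.
Context {R : realType} {d : nat}.
Implicit Types x y z : 'rV[R]_d.

Lemma dot_ge0 x : 0 <= dot x x.
Proof. by apply: sumr_ge0 => i _; rewrite -expr2 sqr_ge0. Qed.

Lemma enorm_ge0 x : 0 <= enorm x.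
Proof. exact: sqrtr_ge0. Qed.

Lemma enorm_sqr x : enorm x ^+ 2 = dot x x.
Proof. by rewrite sqr_sqrtr// dot_ge0. Qed.

Lemma coord_le_enorm x i : `|x 0 i| <= enorm x.
Proof.
rewrite -sqrtr_sqr; apply: ler_wsqrtr.
rewrite /dot (bigD1 i)//= expr2 lerDl.
by apply: sumr_ge0 => j _; rewrite -expr2 sqr_ge0.
Qed.

Lemma enorm_eq0 x : enorm x = 0 -> x = 0.
Proof.
move=> x0; apply/rowP => i; rewrite mxE; apply/eqP.
by rewrite -normr_le0 -x0 coord_le_enorm.
Qed.

Lemma enorm0 : enorm (0 : 'rV[R]_d) = 0.
Proof. by rewrite /enorm /dot big1 ?sqrtr0// => i _; rewrite !mxE mul0r. Qed.

Lemma enormN x : enorm (- x) = enorm x.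
Proof.
by congr Num.sqrt; apply: eq_bigr => i _; rewrite !mxE mulrNN.
Qed.

Lemma dot_comb (a b : R) x y : dot (a *: x + b *: y) (a *: x + b *: y) =
  a ^+ 2 * dot x x + a * b * dot x y *+ 2 + b ^+ 2 * dot y y.
Proof.
rewrite /dot !mulr_sumr -sumrMnl -!big_split/=; apply: eq_bigr => i _.
rewrite !mxE; ring.
Qed.

Lemma dot_le_enorm x y : dot x y <= enorm x * enorm y.
Proof.
have [/enorm_eq0->|nx] := eqVneq (enorm x) 0.
  by rewrite enorm0 mul0r /dot big1// => i _; rewrite mxE mul0r.
have [/enorm_eq0->|ny] := eqVneq (enorm y) 0.
  by rewrite enorm0 mulr0 /dot big1// => i _; rewrite mxE mulr0.
have xy0 : 0 < enorm x * enorm y.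
  by rewrite mulr_gt0// lt_neqAle eq_sym ?nx ?ny enorm_ge0.
have := dot_ge0 (enorm y *: x + (- enorm x) *: y).
rewrite dot_comb -!enorm_sqr.
set a := enorm x; set b := enorm y => H.
rewrite -(ler_pM2l xy0) -subr_ge0 -(@pmulrn_lge0 _ _ 2)//.
apply: le_trans H _; rewrite le_eqVlt; apply/orP; left; apply/eqP.
by rewrite /a /b; ring.
Qed.

Lemma enormD x y : enorm (x + y) <= enorm x + enorm y.
Proof.
rewrite -(ler_pXn2r (ltn0Sn 1)) ?nnegrE ?addr_ge0 ?enorm_ge0//.
rewrite enorm_sqr -[x in dot (x + _) _]scale1r -[y in dot (_ + y) _]scale1r.
rewrite -[x in dot _ (x + _)]scale1r -[y in dot _ (_ + y)]scale1r.
rewrite dot_comb -!enorm_sqr sqrrD !mul1r expr1n !mul1r.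
by rewrite lerD2r lerD2l lerMn2r/= dot_le_enorm.
Qed.

Lemma enorm_dist x y z : enorm (x - z) <= enorm (x - y) + enorm (y - z).
Proof. by rewrite -[x - z](subrKA y) enormD. Qed.

Lemma enorm_le (M : R) x : (forall i, `|x 0 i| <= M) ->
  enorm x <= Num.sqrt (\sum_(i < d) M ^+ 2).
Proof.
move=> xM; apply: ler_wsqrtr; apply: ler_sum => i _.
rewrite -expr2 -[x 0 i ^+ 2]real_normK ?num_real//.
by apply: lerXn2r; rewrite ?nnegrE//; apply: le_trans (xM i).
Qed.

Lemma mx_norm_coord x i : `|x 0 i| <= `|x|.
Proof.
rewrite [leRHS]/Num.Def.normr/= mx_normrE.
exact: (le_bigmax _ (fun ij : 'I_1 * 'I_d => `|x ij.1 ij.2|) (0, i)).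
Qed.

Lemma closure_enorm (A : set 'rV[R]_d) x :
  (forall e, 0 < e -> exists2 y, A y & enorm (x - y) <= e) -> closure A x.
Proof.
move=> H B /nbhs_ballP[e /= e0 eB].
have [y Ay xy] := H (e / 2) (divr_gt0 e0 (ltr0Sn _ _)).
exists y; split => //; apply: eB; split => // i j.
rewrite ord1; apply: (@le_lt_trans _ _ (e / 2)); last lra.
apply: le_trans xy; apply: le_trans (coord_le_enorm _ j).
by rewrite !mxE.
Qed.

End EuclideanNorm.

Section Convex.
Context {R : realType} {d : nat}.
Local Notation V := 'rV[R]_d.
Implicit Types (A K : set V) (x u : V).

Definition chull A : set V := smallest (@convex_set R V) A.

Definition polar A : set V := [set y | forall x, A x -> dot x y <= 1].

(* Largest k such that A contains k + 1 affinely independent points. The empty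
   set gets 0 (not -1), which is immaterial when comparing with a positive
   dimension. *)
Definition affdim A : nat :=
  \max_(k < d.+1 | `[< exists x0 : V, exists X : 'M[R]_(k, d),
      [/\ A x0, forall i, A (x0 + row i X) & row_free X] >]) k.

Definition normal_cone K x : set V :=
  [set u | forall y, K y -> dot u (y - x) <= 0].

Definition regular_body K : Prop :=
  forall x, (closure K `\` K°) x -> affdim (normal_cone K x) = 1%N.

Definition strictly_convex K : Prop :=
  forall x y (t : R), K x -> K y -> x != y -> 0 < t < 1 ->
    K° ((1 - t) *: x + t *: y).

(* K^d_(0) and its unbounded analogue *)
Definition in_K0 A : Prop := [/\ compact A, convex_set A & A° 0].
Definition in_frakK0 A : Prop := [/\ closed A, convex_set A & A° 0].

End Convex.

Record body0 (R : realType) (d : nat) :=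
  Body0 { body0_set :> set 'rV[R]_d; body0P : in_K0 body0_set }.

Section Hausdorff.
Context {R : realType} {d : nat}.
Implicit Types A B C : body0 R d.

Lemma body0_inj A B : A = B :> set _ -> A = B.
Proof.
case: A => A hA; case: B => B hB /= AB; move: AB hA hB => -> hA hB.
by rewrite (Prop_irrelevance hA hB).
Qed.

HB.instance Definition _ := gen_eqMixin (body0 R d).
HB.instance Definition _ := gen_choiceMixin (body0 R d).

Definition parallel_set (A : set 'rV[R]_d) (e : R) : set 'rV[R]_d :=
  [set x | exists2 y, A y & enorm (x - y) <= e].

Definition hausdorff_radii A B : set R :=
  [set e | [/\ 0 <= e, A `<=` parallel_set B e & B `<=` parallel_set A e]].

Definition hausdorff_dist A B : R := inf (hausdorff_radii A B).

Lemma body0_bounded A : exists M : R, forall x, body0_set A x -> enorm x <= M.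
Proof.
have [/compact_bounded bA _ _] := body0P A.
have [M [_ HM]] := bA.
exists (Num.sqrt (\sum_(i < d) (M + 1) ^+ 2)) => x Ax; apply: enorm_le => i.
by apply: le_trans (mx_norm_coord x i) _; apply: (HM (M + 1)); rewrite ?ltrDl.
Qed.

Lemma body0_0 A : body0_set A 0.
Proof. by have [_ _ /interior_subset] := body0P A. Qed.

Lemma hausdorff_radii_inf A B : has_inf (hausdorff_radii A B).
Proof.
split; last by exists 0 => e [].
have [M HM] := body0_bounded A; have [N HN] := body0_bounded B.
have M0 : 0 <= M by apply: le_trans (HM 0 (body0_0 A)); rewrite enorm_ge0.
have N0 : 0 <= N by apply: le_trans (HN 0 (body0_0 B)); rewrite enorm_ge0.
exists (M + N); split; first exact: addr_ge0.
- move=> x Ax; exists 0; first exact: body0_0.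
  by rewrite subr0 (le_trans (HM _ Ax))// lerDl.
- move=> x Bx; exists 0; first exact: body0_0.
  by rewrite subr0 (le_trans (HN _ Bx))// lerDr.
Qed.

Lemma hausdorff_distxx A : hausdorff_dist A A = 0.
Proof.
apply/eqP; rewrite eq_le; apply/andP; split.
- apply: ge_inf; first by have [] := hausdorff_radii_inf A A.
  by split => // x Ax; exists x => //; rewrite subrr enorm0.
- apply: lb_le_inf; first by have [] := hausdorff_radii_inf A A.
  by move=> e [].
Qed.

Lemma hausdorff_dist_sym A B : hausdorff_dist A B = hausdorff_dist B A.
Proof.
by congr inf; apply/seteqP; split => e [? ? ?]; split.
Qed.

Lemma parallel_setD (X Y Z : set 'rV[R]_d) (e f : R) :
  X `<=` parallel_set Y e -> Y `<=` parallel_set Z f ->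
  X `<=` parallel_set Z (e + f).
Proof.
move=> XY YZ x /XY[y /YZ[z Zz yz] xy]; exists z => //.
by apply: le_trans (enorm_dist x y z) _; exact: lerD.
Qed.

Lemma hausdorff_dist_triangle B A C :
  hausdorff_dist A C <= hausdorff_dist A B + hausdorff_dist B C.
Proof.
apply/ler_addgt0Pr => e e0; have e20 : 0 < e / 2 by rewrite divr_gt0.
have [r [r0 AB BA] rlt] := inf_adherent e20 (hausdorff_radii_inf A B).
have [s [s0 BC CB] slt] := inf_adherent e20 (hausdorff_radii_inf B C).
apply: (@le_trans _ _ (r + s)).
  apply: ge_inf; first by have [] := hausdorff_radii_inf A C.
  split; [exact: addr_ge0|exact: parallel_setD AB BC|].
  by rewrite addrC; exact: parallel_setD CB BA.
apply: ltW; rewrite (splitr e) addrACA; exact: ltrD.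
Qed.

Lemma hausdorff_dist_sub A B : hausdorff_dist A B = 0 -> A `<=` B.
Proof.
move=> AB0 x Ax.
have [cB _ _] := body0P B.
have clB : closed B by apply: compact_closed => //; exact: norm_hausdorff.
apply: clB; apply: closure_enorm => e e0.
have [r [r0 /(_ _ Ax)[y By xy] _]] :=
  inf_adherent e0 (hausdorff_radii_inf A B).
rewrite -/(hausdorff_dist A B) AB0 add0r => re.
by exists y => //; apply: le_trans xy (ltW re).
Qed.

Lemma hausdorff_dist_positivity A B : hausdorff_dist A B = 0 -> A = B.
Proof.
move=> AB0; apply: body0_inj; apply/seteqP; split.
- exact: hausdorff_dist_sub.
- by apply: hausdorff_dist_sub; rewrite hausdorff_dist_sym.
Qed.

HB.instance Definition _ := isMetric.Build R (body0 R d)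
  hausdorff_distxx hausdorff_dist_positivity hausdorff_dist_sym
  hausdorff_dist_triangle.

End Hausdorff.

Section Peeling.
Context {R : realType} {d : nat} {I : Type}.
Local Notation V := 'rV[R]_d.
Implicit Types (L : I -> set V) (J : set I) (m : nat).

Definition family_hull L J : set V := chull (\bigcup_(i in J) L i).

Definition critical L J : set I :=
  [set i | J i /\ family_hull L J <> family_hull L (J `\ i)].

(* I_m for m >= 1, with I_1 the full index set (the value at m = 0 is unused) *)
Definition peel_index L m : set I :=
  iter m.-1 (fun J => J `\` critical L J) setT.

Definition peel_admissible L : Prop :=
  [/\ injective L, forall i, compact (L i) /\ convex_set (L i),
      compact (family_hull L setT) & (0 < affdim (family_hull L setT))%N].

Definition peel_stops L m : Prop :=
  (affdim (family_hull L (peel_index L m)) < affdim (family_hull L setT))%N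
  \/ critical L (peel_index L m) = set0.

Definition peel_depth L : \bar R :=
  ereal_inf [set (m%:R)%:E | m in [set m | (0 < m)%N /\ peel_stops L m]].

Definition peel_defined L m : Prop :=
  [/\ peel_admissible L, (0 < m)%N & ((m%:R)%:E < peel_depth L)%E].

Definition peel L m : set V := closure (family_hull L (peel_index L m)).

Definition wrap_defined L m : Prop :=
  (forall i, in_frakK0 (L i)) /\ peel_defined (polar \o L) m.

Definition wrap L m : set V := polar (peel (polar \o L) m).

(* Peelings and wrappings as elements of K^d_(0), with the default value B0
   where they are undefined or fall outside K^d_(0). *)
Definition body0_or (B0 : body0 R d) (defined : Prop) (A : set V) : body0 R d :=
  match pselect (defined /\ in_K0 A) with
  | left h => Body0 (proj2 h)
  | right _ => B0
  end.

Definition peel_body0 B0 L m := body0_or B0 (peel_defined L m) (peel L m).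
Definition wrap_body0 B0 L m := body0_or B0 (wrap_defined L m) (wrap L m).

End Peeling.

Definition borel_rV (R : realType) (d : nat) :=
  g_sigma_algebraType (@open 'rV[R]_d).

Section Volume.
Context {R : realType} {d : nat}.
Local Notation V := 'rV[R]_d.

Definition box (a b : V) : set V := [set x | forall i, a 0 i <= x 0 i <= b 0 i].

Definition box_vol (a b : V) : R := \prod_(i < d) (b 0 i - a 0 i).

(* d-dimensional Lebesgue outer measure, i.e. Lebesgue measure on Borel sets *)
Definition vol (A : set V) : \bar R :=
  ereal_inf [set (\sum_(k <oo) (box_vol (c k).1 (c k).2)%:E)%E | c in
    [set c : nat -> V * V | (forall k i, (c k).1 0 i <= (c k).2 0 i) /\
       A `<=` \bigcup_k box (c k).1 (c k).2]].

(* {x : 0 < d(x, K) <= e, (x - p_K x) / d(x, K) in B}, where p_K is the metric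
   projection onto K; p_K (y + s u) = y for u a unit normal of K at y. *)
Definition local_parallel_set (K : set V) (e : R) (B : set V) : set V :=
  [set x | exists y u s, [/\ K y, B u, normal_cone K y u, enorm u = 1 &
     0 < s <= e /\ x = y + s *: u]].

(* S_{d-1}(K, .) through the local Steiner formula: the volume of the local
   parallel set is e * S_{d-1}(K, B) + O(e^2). As a measure on R^d it is
   concentrated on the unit sphere, by the definition of local_parallel_set. *)
Definition is_surface_area_measure (K : set V)
    (S : set (borel_rV R d) -> \bar R) : Prop :=
  forall B : set (borel_rV R d), measurable B ->
    (e^-1%:E * vol (local_parallel_set K e B))%E @[e --> 0^'+] --> S B.

End Volume.

Section Probability.
Context {R : realType} {d : nat}.
Context {dO : measure_display} {O : measurableType dO}.
Variable P : probability O R.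

Definition uniform_on (K : set 'rV[R]_d) (X : O -> borel_rV R d) : Prop :=
  forall A : set (borel_rV R d), measurable A ->
    P (X @^-1` A) = (fine (vol (K `&` A)) / fine (vol K))%:E.

Definition independent_seq (X : nat -> O -> borel_rV R d) : Prop :=
  forall (s : seq nat) (A : nat -> set (borel_rV R d)), uniq s ->
    (forall i, measurable (A i)) ->
    P (\bigcap_(i in [set` s]) (X i @^-1` A i)) =
      (\prod_(i <- s) P (X i @^-1` A i))%E.

(* V_d(K)^-1 dt S(du), restricted to t > 0 *)
Definition hyperplane_intensity (K : set 'rV[R]_d)
    (S : {finite_measure set (borel_rV R d) -> \bar R})
    (A : set (measurableTypeR R * borel_rV R d)) : \bar R :=
  ((fine (vol K))^-1%:E *
    (lebesgue_measure \x S) (A `&` [set x | (0 < x.1)%R]))%E.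

Definition point_count (p : nat -> O -> measurableTypeR R * borel_rV R d)
    (A : set (measurableTypeR R * borel_rV R d)) (w : O) : \bar R :=
  (\sum_(i <oo) (\1_A (p i w))%:E)%E.

(* poisson_pmf from the library is not used because it is constantly 1 at rate
   0; here rate 0 gives the Dirac mass at 0. *)
Definition poisson_weight (r : R) (n : nat) : R := expR (- r) * r ^+ n / n`!%:R.

(* A point process given by a measurable enumeration of its points is Poisson
   with intensity mu when counts in disjoint sets of finite intensity are
   independent Poisson variables. The joint law determines the process, mu
   being sigma-finite. *)
Definition poisson_process (mu : set (measurableTypeR R * borel_rV R d) -> \bar R)
    (p : nat -> O -> measurableTypeR R * borel_rV R d) : Prop :=
  (forall i, measurable_fun setT (p i)) /\
  forall (k : nat) (A : 'I_k -> set (measurableTypeR R * borel_rV R d))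
      (n : 'I_k -> nat),
    (forall j, measurable (A j)) -> (forall j, (mu (A j) < +oo)%E) ->
    trivIset setT A ->
    P [set w | forall j, point_count p (A j) w = ((n j)%:R)%:E] =
      (\prod_(j < k) poisson_weight (fine (mu (A j))) (n j))%:E.

End Probability.

Section CvgInDistribution.
Context {R : realType} {T : topologicalType}.

(* Borel measurability up to a null set: the underlying probability space is
   not assumed to be complete. *)
Definition random_element {dO} {O : measurableType dO} (P : probability O R)
    (X : O -> T) : Prop :=
  exists2 Y : O -> T, forall U : set T, open U -> measurable (Y @^-1` U)
    & {ae P, forall w, X w = Y w}.

Definition cvg_in_distribution {dO} {O : measurableType dO}
    (P : probability O R) {dO'} {O' : measurableType dO'}
    (Q : probability O' R) (X : nat -> O -> T) (Y : O' -> T) : Prop :=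
  [/\ forall n, random_element P (X n), random_element Q Y &
      forall f : T -> R, continuous f -> (exists M, forall x, `|f x| <= M) ->
        ('E_P[f \o X n] @[n --> \oo] --> 'E_Q[f \o Y])%E].

End CvgInDistribution.

Section Families.
Context {R : realType} {d : nat}.
Local Notation V := 'rV[R]_d.
Implicit Types (K : set V) (xi : nat -> V) (p : nat -> R * V).

(* {n^-1 (K - xi_i)^o : i < n}; the points are numbered from 0. *)
Definition scaled_polar_family K xi (n : nat) (i : 'I_n) : set V :=
  [set n%:R^-1 *: x | x in polar [set y - xi i | y in K]].

(* {n (K - xi_i) : i < n} *)
Definition scaled_translate_family K xi (n : nat) (i : 'I_n) : set V :=
  [set n%:R *: (y - xi i) | y in K].

(* {[0, t_i^-1 u_i]}, for p i = (t_i, u_i) *)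
Definition segment_family p (i : nat) : set V :=
  [set s *: ((p i).1^-1 *: (p i).2) | s in `[0, 1]%classic].

(* {H^-_{u_i}(t_i)}, for p i = (t_i, u_i) *)
Definition halfspace_family p (i : nat) : set V :=
  [set x | dot x (p i).2 <= (p i).1].

End Families.

(* Main.v *)
(* The bodies n^-1 (K - xi_i)^o are close to segments [0, u / t] when xi_i = y - t/n u is within
   O(1/n) of a boundary point y with normal u, and small otherwise; by regularity the normal u is
   unique and varies uniformly continuously with y.  Cut (0, T) x S^(d-1) into small cells, with
   angular cells separated by margins of small surface measure.  Each cell corresponds to a thin
   region of K with about the same intensity, computed by tilting the region into a cylinder.
   On the event that every cell contains at most one point, the pattern C of occupied cells
   matches the family of the sample with the limiting family of segments.

   Recursive peeling is stable under such matchings at almost every configuration of the Poisson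
   process: a tip on the gauge level 1 of a hull of finitely many other tips would have to lie in
   a null window.  Hence for a bounded continuous f >= 0 the infimum of f over all samples with
   pattern C converges, along finer cells, to f of the limit, and since the probability of each
   pattern is asymptotically at least its Poisson weight, dominated convergence yields
   E f(limit) <= liminf E f(sample).  Applied to B + f and B - f this is convergence in
   distribution.  For wrappings the same argument runs with polarity, which is continuous,
   composed with the peelings. *)
Require Import Defs.
From mathcomp Require Import all_boot all_order all_algebra.
From mathcomp Require Import all_classical all_reals all_analysis.
From mathcomp Require Import measurable_realfun.
From mathcomp Require Import ring lra.

Set Implicit Arguments.
Unset Strict Implicit.
Unset Printing Implicit Defensive.

Import Order.TTheory GRing.Theory Num.Theory.
Import numFieldNormedType.Exports.

Local Open Scope classical_set_scope.
Local Open Scope ring_scope.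

(** * Inner product and convex sets *)

(** [vol] is only an outer measure, so additivity is borrowed from the law of a uniform point, and
    volume arguments are confined to bounded Borel sets. Each angular cell gets one fixed
    displacement direction, because translation invariance then makes the volume of a strip exactly
    linear in its thickness; the price is a cosine factor, absorbed by taking the angular cells
    small. Peeling is discontinuous in the family: an arbitrarily small change can decide whether a
    member is critical. The threshold below which a matching preserves all such decisions therefore
    depends on the limiting configuration, and no uniform rate is available. This is why a pattern
    is valued by the worst sample that shows it, at any sample size, and why only one-sided
    estimates occur. The errors [2^-(j+1)] of the meshes are summable, so almost every configuration
    is resolved by all but finitely many meshes. Peelings are shown measurable only up to null sets;
    expectations are compared through measurable modifications. *)

Section Inner.
Context {R : realType} {d : nat}.
Local Notation V := 'rV[R]_d.
Implicit Types (x y z u v w : V) (a b t : R).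

Lemma dotC x y : dot x y = dot y x.
Proof. by apply: eq_bigr => i _; rewrite mulrC. Qed.

Lemma dotDl x y z : dot (x + y) z = dot x z + dot y z.
Proof. by rewrite /dot -big_split; apply: eq_bigr => i _; rewrite mxE mulrDl. Qed.

Lemma dotZl a x y : dot (a *: x) y = a * dot x y.
Proof. by rewrite /dot mulr_sumr; apply: eq_bigr => i _; rewrite mxE mulrA. Qed.

Lemma dotDr x y z : dot x (y + z) = dot x y + dot x z.
Proof. by rewrite dotC dotDl !(dotC x). Qed.

Lemma dotZr a x y : dot x (a *: y) = a * dot x y.
Proof. by rewrite dotC dotZl dotC. Qed.

Lemma dotNl x y : dot (- x) y = - dot x y.
Proof. by rewrite -scaleN1r dotZl mulN1r. Qed.

Lemma dotNr x y : dot x (- y) = - dot x y.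
Proof. by rewrite dotC dotNl dotC. Qed.

Lemma dotBl x y z : dot (x - y) z = dot x z - dot y z.
Proof. by rewrite dotDl dotNl. Qed.

Lemma dotBr x y z : dot x (y - z) = dot x y - dot x z.
Proof. by rewrite dotDr dotNr. Qed.

Lemma dot0l x : dot 0 x = 0.
Proof. by rewrite -(scale0r x) dotZl mul0r. Qed.

Lemma dot0r x : dot x 0 = 0.
Proof. by rewrite dotC dot0l. Qed.

Definition dotE := (dotDl, dotDr, dotNl, dotNr, dotZl, dotZr, dot0l, dot0r).

Lemma enormZ a x : enorm (a *: x) = `|a| * enorm x.
Proof. by rewrite /enorm dotZl dotZr mulrA -expr2 sqrtrM ?sqr_ge0// sqrtr_sqr. Qed.

Lemma enormB x y : enorm (x - y) = enorm (y - x).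
Proof. by rewrite -enormN opprB. Qed.

Lemma dot_normr x y : `|dot x y| <= enorm x * enorm y.
Proof.
by rewrite ler_norml dot_le_enorm andbT lerNl -dotNl (le_trans (dot_le_enorm _ _))// enormN.
Qed.

Lemma dot_unit u : enorm u = 1 -> dot u u = 1.
Proof. by rewrite -enorm_sqr => ->; rewrite expr1n. Qed.

Lemma unit_dot u : dot u u = 1 -> enorm u = 1.
Proof. by rewrite /enorm => ->; rewrite sqrtr1. Qed.

Lemma dot_unitl u v : enorm u = 1 -> dot u v <= enorm v.
Proof. by move=> u1; rewrite (le_trans (dot_le_enorm _ _))// u1 mul1r. Qed.

Lemma dot_unitr u v : enorm u = 1 -> dot v u <= enorm v.
Proof. by move=> u1; rewrite dotC dot_unitl. Qed.

Lemma enorm_gt0 x : x != 0 -> 0 < enorm x.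
Proof. by move=> x0; rewrite lt_neqAle enorm_ge0 andbT eq_sym; apply: contra_neq x0; exact: enorm_eq0. Qed.

Lemma enorm_normalize x : x != 0 -> enorm ((enorm x)^-1 *: x) = 1.
Proof.
by move=> /enorm_gt0 x0; rewrite enormZ ger0_norm ?invr_ge0 ?enorm_ge0// mulVf// gt_eqF.
Qed.

Lemma enorm_sqrB u v : enorm u = 1 -> enorm v = 1 ->
  enorm (u - v) ^+ 2 = 2 * (1 - dot u v).
Proof.
move=> u1 v1; rewrite enorm_sqr dotBl !dotBr !dot_unit// (dotC v u); ring.
Qed.

Lemma le_enorm_unit x c : 0 <= c ->
  (forall u, enorm u = 1 -> dot u x <= c) -> enorm x <= c.
Proof.
move=> c0 H; have [->|x0] := eqVneq x 0; first by rewrite enorm0.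
have := H _ (enorm_normalize x0); rewrite dotZl -enorm_sqr expr2 mulrA.
by rewrite mulVf ?mul1r// gt_eqF// enorm_gt0.
Qed.

Lemma le_sup_enorm x : enorm x <= Num.sqrt d%:R * `|x|.
Proof.
apply: le_trans (enorm_le (M := `|x|) _) _; first by move=> i; exact: mx_norm_coord.
rewrite sumr_const card_ord -[_ *+ d]mulr_natl sqrtrM ?ler0n// sqrtr_sqr.
by rewrite normr_id.
Qed.

Lemma le_enorm_sup x : `|x| <= enorm x.
Proof.
rewrite [leLHS]/Num.Def.normr/= mx_normrE.
by apply/bigmax_leP; split => [|[i j] _]; rewrite ?enorm_ge0// ord1 coord_le_enorm.
Qed.

Lemma nbhs_enormP x (A : set V) :
  nbhs x A <-> exists2 e, 0 < e & forall y, enorm (y - x) < e -> A y.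
Proof.
split.
  move=> /nbhs_ballP[e /= e0 eA]; exists e => // y ye; apply: eA.
  rewrite -ball_normE /ball_ /= -normrN opprB.
  exact: le_lt_trans (le_enorm_sup _) ye.
(* The two norms differ by at most the factor [Num.sqrt d%:R]; adding 1 keeps the divisor positive
   when [d] is 0. *)
move=> [e e0 eA]; apply/nbhs_ballP; exists (e / (Num.sqrt d%:R + 1)) => /=.
  by rewrite divr_gt0// ltr_wpDl// sqrtr_ge0.
move=> y; rewrite -ball_normE /ball_ /= -normrN opprB => xy; apply: eA.
apply: le_lt_trans (le_sup_enorm _) _.
rewrite ltr_pdivlMr ?ltr_wpDl// ?sqrtr_ge0// in xy.
apply: le_lt_trans xy; rewrite mulrC ler_wpM2l// lerDl ler01//.
Qed.

Lemma interior_enormP x (A : set V) :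
  A° x <-> exists2 e, 0 < e & forall y, enorm (y - x) < e -> A y.
Proof. exact: nbhs_enormP. Qed.

Lemma closed_enormP (A : set V) :
  closed A <-> forall x, (forall e, 0 < e -> exists2 y, A y & enorm (x - y) <= e) -> A x.
Proof.
split=> [cA x /closure_enorm|H x clx]; first exact: cA.
apply: H => e e0.
have /clx[y [Ay /= xy]] : nbhs x [set y | enorm (y - x) < e].
  by apply/nbhs_enormP; exists e.
by exists y => //; rewrite enormB ltW.
Qed.

Lemma compact_enormP (A : set V) : compact A <->
  closed A /\ exists M, forall x, A x -> enorm x <= M.
Proof.
split=> [cA|[cA [M AM]]].
  split; first by apply: compact_closed => //; exact: norm_hausdorff.
  have [M [_ HM]] := compact_bounded cA.
  exists (Num.sqrt d%:R * (M + 1)) => x Ax; apply: le_trans (le_sup_enorm _) _.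
  by rewrite ler_wpM2l ?sqrtr_ge0//; apply: (HM (M + 1)); rewrite ?ltrDl.
apply: bounded_closed_compact => //; exists M; split; first exact: num_real.
move=> N MN x Ax; apply: le_trans (le_enorm_sup _) (le_trans (AM x Ax) (ltW MN)).
Qed.

Lemma dot_continuous {T : topologicalType} (f g : T -> V) :
  continuous f -> continuous g -> continuous (fun s => dot (f s) (g s)).
Proof.
move=> cf cg; rewrite /dot.
apply: continuous_big => // [|i _].
  by move=> [a b]; apply: add_continuous.
move=> s; apply: continuousM.
  apply: (@continuous_comp _ _ _ f (fun M : V => M 0 i)); first exact: cf.
  exact: coord_continuous.
apply: (@continuous_comp _ _ _ g (fun M : V => M 0 i)); first exact: cg.
exact: coord_continuous.
Qed.

Lemma enorm_continuous {T : topologicalType} (f : T -> V) :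
  continuous f -> continuous (fun s => enorm (f s)).
Proof.
move=> cf s; apply: (@continuous_comp _ _ _ (fun s => dot (f s) (f s))).
  exact: dot_continuous.
exact: sqrt_continuous.
Qed.

Lemma addV_continuous {T : topologicalType} (f g : T -> V) :
  continuous f -> continuous g -> continuous (fun s => f s + g s).
Proof. by move=> cf cg s; exact: cvgD (cf s) (cg s). Qed.

Lemma subV_continuous {T : topologicalType} (f g : T -> V) :
  continuous f -> continuous g -> continuous (fun s => f s - g s).
Proof. by move=> cf cg s; exact: cvgB (cf s) (cg s). Qed.

Lemma scaleV_continuous {T : topologicalType} (h : T -> R) (f : T -> V) :
  continuous h -> continuous f -> continuous (fun s => h s *: f s).
Proof. by move=> ch cf s; exact: cvgZ (ch s) (cf s). Qed.

Lemma cstV_continuous {T U : topologicalType} (c : U) : continuous (fun _ : T => c).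
Proof. by move=> s; exact: cvg_cst. Qed.

Lemma idV_continuous {T : topologicalType} : continuous (fun s : T => s).
Proof. by move=> s; exact: cvg_id. Qed.

Lemma closed_le_fun {T : topologicalType} (f g : T -> R) :
  continuous f -> continuous g -> closed [set s | f s <= g s].
Proof.
move=> cf cg.
have -> : [set s | f s <= g s] = (fun s => g s - f s) @^-1` [set r | 0 <= r].
  by apply/seteqP; split => s /=; rewrite subr_ge0.
apply: preimage_closed; last exact: closed_ge.
by move=> s _; apply: continuousB; [exact: cg|exact: cf].
Qed.

Lemma closed_eq_fun {T : topologicalType} (f g : T -> R) :
  continuous f -> continuous g -> closed [set s | f s = g s].
Proof.
move=> cf cg.
have -> : [set s | f s = g s] = [set s | f s <= g s] `&` [set s | g s <= f s].
  apply/seteqP; split => s /= => [->//|[fg gf]].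
  by apply/eqP; rewrite eq_le fg gf.
by apply: closedI; exact: closed_le_fun.
Qed.

(** The sets form a filter base, and a cluster point of the filter in the compact [F 0] belongs to
    every closed member. *)
Lemma nested_compact {T : topologicalType} (F : nat -> set T) :
  compact (F 0%N) -> (forall n, closed (F n)) ->
  (forall n m, (n <= m)%N -> F m `<=` F n) -> (forall n, F n !=set0) ->
  exists s, forall n, F n s.
Proof.
move=> cF0 clF decF neF.
pose G : set_system T := filter_from setT F.
have FG : Filter G.
  apply: filter_from_filter; first by exists 0%N.
  move=> i j _ _; exists (maxn i j) => //; rewrite subsetI.
  by split; apply: decF; rewrite ?leq_maxl ?leq_maxr.
have PG : ProperFilter G by apply: filter_from_proper => // i _; exact: neF.
have [x [_ cx]] : F 0%N `&` cluster G !=set0 by apply: cF0; exists 0%N.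
exists x => n; apply: clF => B /cx; apply; by exists n.
Qed.

End Inner.

(** * Convex hulls, nearest points and polars *)

Section ConvexSets.
Context {R : realType} {d : nat}.
Local Notation V := 'rV[R]_d.
Implicit Types (x y z u v w : V) (A B K : set V).

Lemma convex_setP A : convex_set A <->
  forall x y (t : R), A x -> A y -> 0 <= t <= 1 -> A (t *: x + (1 - t) *: y).
Proof.
split=> [cA x y t Ax Ay /andP[t0 t1]|H x y l /set_mem Ax /set_mem Ay].
  have tI : Itv.spec (@Itv.num_sem R) (Itv.Real `[0%Z, 1%Z]) t.
    by rewrite /= /Itv.num_sem/= num_real in_itv/= t0 t1.
  have := cA x y (Itv.mk tI) (mem_set Ax) (mem_set Ay).
  by rewrite inE /conv/=.
apply/mem_set; have := H x y l%:num Ax Ay; rewrite /conv/=; apply.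
by rewrite ge0 le1.
Qed.

Lemma chull_sub A : A `<=` chull A.
Proof. exact: sub_smallest. Qed.

Lemma chull_min A B : convex_set B -> A `<=` B -> chull A `<=` B.
Proof. by move=> cB AB; exact: smallest_sub. Qed.

Lemma chull_convex A : convex_set (chull A).
Proof.
apply/convex_setP => x y t Ax Ay t01 B [cB AB].
by move/convex_setP: (cB); apply => //; [exact: Ax|exact: Ay].
Qed.

Lemma chull_sub_chull A B : A `<=` chull B -> chull A `<=` chull B.
Proof. by move=> AB; apply: chull_min => //; exact: chull_convex. Qed.

Lemma chullS A B : A `<=` B -> chull A `<=` chull B.
Proof. by move=> AB; apply: chull_sub_chull => x /AB; exact: chull_sub. Qed.

Lemma chull_id A : convex_set A -> chull A = A.
Proof. by move=> cA; apply/seteqP; split; [exact: chull_min|exact: chull_sub]. Qed.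

Lemma parallel_convex A (e : R) : convex_set A -> convex_set (parallel_set A e).
Proof.
move=> /convex_setP cA; apply/convex_setP => x y t [x' Ax' xx'] [y' Ay' yy'] /andP[t0 t1].
exists (t *: x' + (1 - t) *: y'); first by apply: cA => //; rewrite t0.
have -> : t *: x + (1 - t) *: y - (t *: x' + (1 - t) *: y') =
    t *: (x - x') + (1 - t) *: (y - y').
  by rewrite !scalerBr opprD addrACA.
apply: le_trans (enormD _ _) _; rewrite !enormZ !ger0_norm ?subr_ge0//.
apply: (@le_trans _ _ (t * e + (1 - t) * e)); last by rewrite -mulrDl subrKC mul1r.
by apply: lerD; rewrite ler_wpM2l// subr_ge0.
Qed.

Lemma chull_parallel A B (e : R) : A `<=` parallel_set B e ->
  chull A `<=` parallel_set (chull B) e.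
Proof.
move=> AB; apply: chull_min; first exact/parallel_convex/chull_convex.
by move=> x /AB[y By xy]; exists y => //; exact: chull_sub.
Qed.

Lemma halfspace_convex u (c : R) : convex_set [set x | dot u x <= c].
Proof.
apply/convex_setP => x y t /= xc yc /andP[t0 t1]; rewrite !dotE.
apply: (@le_trans _ _ (t * c + (1 - t) * c)); last by rewrite -mulrDl subrKC mul1r.
by apply: lerD; rewrite ler_wpM2l// subr_ge0.
Qed.

Lemma chull_cvx_union A B x y (t : R) : chull A x -> chull B y -> 0 <= t <= 1 ->
  chull (A `|` B) (t *: x + (1 - t) *: y).
Proof.
move=> Ax By t01; have /convex_setP := @chull_convex (A `|` B); apply => //.
  exact: (chullS _ Ax).
exact: (chullS _ By).
Qed.

Definition join_map (q : V * V * R) : V := q.2 *: q.1.1 + (1 - q.2) *: q.1.2.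

Lemma join_map_continuous : continuous join_map.
Proof.
move=> q; rewrite /join_map; apply: cvgD.
  by apply: cvgZ; [exact: cvg_snd|apply: cvg_comp; [exact: cvg_fst|exact: cvg_fst]].
apply: cvgZ; last by apply: cvg_comp; [exact: cvg_fst|exact: cvg_snd].
by apply: cvgB; [exact: cvg_cst|exact: cvg_snd].
Qed.

(** The union of all segments joining [A] to [B] is a continuous image of a compact product. It is
    already convex: in a combination of two joins, the contributions from [A] merge into one point
    of [A], those from [B] into one point of [B]. *)
Lemma compact_chullU A B : compact A -> convex_set A -> A !=set0 ->
  compact B -> convex_set B -> B !=set0 -> compact (chull (A `|` B)).
Proof.
move=> kA cA [a0 Aa0] kB cB [b0 Bb0].
pose C := join_map @` ((A `*` B) `*` `[0%R, 1%R]%classic).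
have -> : chull (A `|` B) = C.
  apply/seteqP; split.
    apply: chull_min; last first.
      move=> x [Ax|Bx].
        exists (x, b0, 1); first by split; [|rewrite /= in_itv/= ler01 lexx].
        by rewrite /join_map/= subrr scale0r addr0 scale1r.
      exists (a0, x, 0); first by split; [|rewrite /= in_itv/= ler01 lexx].
      by rewrite /join_map/= subr0 scale0r add0r scale1r.
    apply/convex_setP => _ _ t [[[a b] s] [[/= Aa Bb]]] + <- [[[a' b'] s'] [[/= Aa' Bb']]] + <-.
    rewrite /= !in_itv/= => /andP[s0 s1] /andP[s'0 s'1] /andP[t0 t1].
    rewrite /join_map/=.
    (* [m] is the total weight carried by [A]. If [m] or [1 - m] vanishes, the corresponding
       endpoint is arbitrary, and the point at hand is taken. *)
    have [m mE] : exists m, m = t * s + (1 - t) * s' by eexists.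
    have m0 : 0 <= m by rewrite mE addr_ge0// mulr_ge0// subr_ge0.
    have m1 : m <= 1.
      rewrite mE (@le_trans _ _ (t * 1 + (1 - t) * 1))//; last by rewrite !mulr1 subrKC.
      by apply: lerD; rewrite ler_wpM2l// subr_ge0.
    have [p Ap pE] : exists2 p, A p & m *: p = (t * s) *: a + ((1 - t) * s') *: a'.
      have [m00|mN0] := eqVneq m 0.
        exists a => //; rewrite m00.
        have ts0 : t * s = 0 by apply/eqP; rewrite eq_le mulr_ge0// andbT -m00 mE lerDl mulr_ge0// subr_ge0.
        have ts'0 : (1 - t) * s' = 0 by rewrite -m00 mE ts0 add0r.
        by rewrite ts0 ts'0 !scale0r addr0.
      exists ((t * s / m) *: a + (1 - (t * s / m)) *: a').
        move/convex_setP: cA; apply => //; rewrite divr_ge0 ?mulr_ge0//= ler_pdivrMr ?lt0r ?mN0//.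
        by rewrite mul1r mE lerDl mulr_ge0// subr_ge0.
      rewrite scalerDr !scalerA; congr (_ *: _ + _ *: _); first by rewrite mulrC divfK.
      by rewrite mulrBr mulr1 [m * _]mulrC divfK// mE; ring.
    have [q Bq qE] : exists2 q, B q & (1 - m) *: q = (t * (1 - s)) *: b + ((1 - t) * (1 - s')) *: b'.
      have nE : 1 - m = t * (1 - s) + (1 - t) * (1 - s') by rewrite mE; ring.
      have [m00|mN0] := eqVneq (1 - m) 0.
        exists b => //; rewrite m00.
        have ts0 : t * (1 - s) = 0.
          by apply/eqP; rewrite eq_le mulr_ge0// ?subr_ge0// andbT -m00 nE lerDl mulr_ge0// subr_ge0.
        have ts'0 : (1 - t) * (1 - s') = 0 by rewrite -m00 nE ts0 add0r.
        by rewrite ts0 ts'0 !scale0r addr0.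
      have mp : 0 < 1 - m by rewrite lt0r mN0 subr_ge0.
      exists ((t * (1 - s) / (1 - m)) *: b + (1 - (t * (1 - s) / (1 - m))) *: b').
        move/convex_setP: cB; apply => //; rewrite divr_ge0 ?mulr_ge0 ?subr_ge0//= ler_pdivrMr//.
        by rewrite mul1r nE lerDl mulr_ge0// subr_ge0.
      rewrite scalerDr !scalerA; congr (_ *: _ + _ *: _); first by rewrite mulrC divfK.
      by rewrite mulrBr mulr1 [(1 - m) * _]mulrC divfK// nE; ring.
    exists (p, q, m); first by split => //=; rewrite in_itv/= m0 m1.
    rewrite /join_map/= pE qE !scalerDr !scalerA addrACA; congr (_ + _).
  move=> _ [[[a b] s] [[/= Aa Bb]]] + <-; rewrite /= in_itv/= => s01.
  by apply: chull_cvx_union => //; exact: chull_sub.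
apply: continuous_compact.
  exact/continuous_subspaceT/join_map_continuous.
apply: compact_setX; first exact: compact_setX.
exact: segment_compact.
Qed.

Lemma chullUl A B : chull (chull A `|` B) = chull (A `|` B).
Proof.
apply/seteqP; split; apply: chull_sub_chull.
  move=> x [|Bx]; first by apply: chullS => y; left.
  by apply: chull_sub; right.
by move=> x [Ax|Bx]; apply: chull_sub; [left; exact: chull_sub|right].
Qed.

(** Adding the sets one at a time reduces the claim to [compact_chullU], with no appeal to
    Caratheodory's theorem. *)
Lemma compact_chull_finite (I : choiceType) (L : I -> set V) (J : set I) :
  finite_set J -> J !=set0 ->
  (forall i, J i -> [/\ compact (L i), convex_set (L i) & L i !=set0]) ->
  compact (chull (\bigcup_(i in J) L i)).
Proof.
move=> /finite_seqP[s ->]; case: s => [|i s]; first by move=> [].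
move=> _; elim: s i => [|j s IH] i H.
  rewrite set_cons1 bigcup_set1; have [? ? _] := H i (mem_head _ _).
  by rewrite chull_id.
have -> : [set` i :: j :: s] = i |` [set` j :: s].
  apply/seteqP; split=> k /=; rewrite ![_ \in _ :: _]in_cons.
    by case/orP => [/eqP|]; [left|right].
  by case=> [->|H1]; rewrite ?eqxx// H1 orbT.
rewrite bigcup_setU1 setUC -chullUl.
have [? ? ?] := H i (mem_head _ _).
have Hs k : [set` j :: s] k -> [/\ compact (L k), convex_set (L k) & L k !=set0].
  by move=> /= ks; apply: H; rewrite /= inE ks orbT.
apply: compact_chullU => //; first exact: IH.
  exact: chull_convex.
have [_ _ [x Lx]] := Hs j (mem_head _ _).
by exists x; apply: chull_sub; exists j => //=; rewrite mem_head.
Qed.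

Lemma proj_exists A z : compact A -> convex_set A -> A !=set0 ->
  exists2 p, A p & forall a, A a -> dot (z - p) (a - p) <= 0.
Proof.
move=> kA cA A0.
have cf : continuous (fun a : V => enorm (z - a)).
  by apply: enorm_continuous; apply: subV_continuous; [exact: cstV_continuous|exact: idV_continuous].
have [p /set_mem Ap pmin] := compact_EVT_min A0 kA (continuous_subspaceT cf).
exists p => // a Aa; rewrite leNgt; apply/negP => c0.
set c := dot _ _ in c0; set D := dot (a - p) (a - p).
have D0 : 0 <= D by exact: dot_ge0.
(* Moving from [p] to [a] by the fraction [t] changes the squared distance by [- 2 t c + t^2 D].
   This [t] makes it negative, against the minimality of [p]; the 1 in [D + 1] guards against
   [D = 0]. *)
pose t : R := Num.min 1 (c / (D + 1)).
have t0 : 0 < t by rewrite lt_min ltr01 divr_gt0// ltr_wpDl.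
have t1 : t <= 1 by rewrite ge_min lexx.
have : enorm (z - p) <= enorm (z - (t *: a + (1 - t) *: p)).
  by apply: pmin; apply/mem_set; move/convex_setP: cA; apply => //; rewrite ltW.
have -> : z - (t *: a + (1 - t) *: p) = (z - p) - t *: (a - p).
  by rewrite scalerBl scale1r scalerBr; apply/rowP => i; rewrite !mxE; ring.
rewrite -(ler_pXn2r (ltn0Sn 1)) ?nnegrE ?enorm_ge0// !enorm_sqr.
move: (z - p) (a - p) @c @D c0 D0 @t t0 t1 => u w c D c0 D0 t t0 t1.
rewrite dotBl !dotBr !dotE -/D (dotC w u) -/c => H.
have : t * (2 * c - t * D) <= 0 by nra.
rewrite pmulr_rle0// => H2.
have : t * (D + 1) <= c by rewrite -ler_pdivlMr ?ltr_wpDl// ge_min lexx orbT.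
nra.
Qed.

(** If [z] lay outside [A], the point at distance [r] from [z] in the outward normal direction would
    be farther than [e] from [A]. This cancellation is how a ball in one hull is transferred to a
    nearby hull. *)
Lemma erode_parallel A z (r e : R) : compact A -> convex_set A -> A !=set0 ->
  0 <= e -> e < r -> (forall y, enorm (y - z) <= r -> parallel_set A e y) -> A z.
Proof.
move=> kA cA A0 e0 er H; have [p Ap pP] := proj_exists z kA cA A0.
have [->//|zp] := eqVneq z p.
have zp0 : z - p != 0 by rewrite subr_eq0.
have np := enorm_gt0 zp0.
have u1 := enorm_normalize zp0.
set u := (enorm (z - p))^-1 *: (z - p) in u1.
have zpu : z - p = enorm (z - p) *: u by rewrite scalerA divff ?scale1r ?gt_eqF.
have r0 : 0 <= r by exact: le_trans (ltW er).
have /H[y Ay yz] : enorm (z + r *: u - z) <= r.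
  by rewrite [z + _]addrC addrK enormZ u1 mulr1 ger0_norm.
exfalso.
  have := dot_unitl (z + r *: u - y) u1.
  have := pP _ Ay; rewrite {1}zpu dotZl pmulr_rle0// dotBr => uy.
  rewrite dotBr dotDr dotZr dot_unit// mulr1 => ur.
  have : dot u z = dot u p + enorm (z - p).
    by rewrite -[z in LHS](subrK p) dotDr {1}zpu dotZr dot_unit// mulr1 addrC.
  lra.
Qed.

Lemma cball_parallel A B z (r e : R) : compact B -> convex_set B -> B !=set0 ->
  0 <= e -> e < r -> (forall y, enorm (y - z) <= r -> A y) ->
  A `<=` parallel_set B e -> B z.
Proof.
by move=> kB cB B0 e0 er Ar AB; apply: (erode_parallel kB cB B0 e0 er) => y /Ar/AB.
Qed.

Lemma polar_compact A : A° 0 -> compact (polar A).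
Proof.
move=> /interior_enormP[e e0 Ae]; apply/compact_enormP; split.
  have -> : polar A = \bigcap_(x in A) [set y | dot x y <= 1] by [].
  apply: closed_bigI => x _; apply: closed_le_fun; last exact: cstV_continuous.
  by apply: dot_continuous; [exact: cstV_continuous|exact: idV_continuous].
exists (2 / e) => y Hy; apply: le_enorm_unit; first by rewrite divr_ge0// ltW.
move=> u u1; have := Hy ((e / 2) *: u) _; rewrite dotZl => H.
rewrite ler_pdivlMr// mulrC; suff : e / 2 * dot u y <= 1 by lra.
apply: H; apply: Ae; rewrite subr0 enormZ u1 mulr1 ger0_norm; lra.
Qed.

Lemma polar_convex A : convex_set (polar A).
Proof.
apply/convex_setP => x y t Hx Hy /andP[t0 t1] z Az; rewrite !dotE.
have := Hx z Az; have := Hy z Az; nra.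
Qed.

Lemma polar_interior A M : (forall x, A x -> enorm x <= M) -> (polar A)° 0.
Proof.
move=> AM; apply/interior_enormP.
have M0 : 0 < `|M| + 1 by rewrite ltr_wpDl.
exists (`|M| + 1)^-1; first by rewrite invr_gt0.
move=> y; rewrite subr0 => yM x /AM xM.
apply: le_trans (dot_le_enorm _ _) _.
apply: (@le_trans _ _ ((`|M| + 1) * (`|M| + 1)^-1)); last by rewrite divff// gt_eqF.
apply: ler_pM; rewrite ?enorm_ge0//; last exact: ltW.
by apply: le_trans xM _; apply: le_trans (ler_norm _) _; rewrite lerDl.
Qed.

Lemma polar_in_K0 A : in_K0 A -> in_K0 (polar A).
Proof.
move=> [kA cA iA]; have /compact_enormP[_ [M AM]] := kA.
by split; [exact: polar_compact|exact: polar_convex|exact: polar_interior AM].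
Qed.

End ConvexSets.

(** * Normal vectors of regular bodies *)

Ltac vring := by apply/rowP => ?; rewrite !mxE; ring.

Lemma natSinv_small (R : realType) (c : R) : 0 < c -> exists n, n.+1%:R^-1 < c.
Proof. by move=> c0; have [N _ HN] := near_infty_natSinv_lt (PosNum c0); exists N; apply: HN => /=. Qed.

Section Body.
Context {R : realType} {d : nat}.
Local Notation V := 'rV[R]_d.
Implicit Types (x y z u v w : V) (A B K : set V).

(** The nearest point in polar form: foot, unit outer normal and distance. The last clause bounds
    the distance by that to any known point of [A], which is how [s] is estimated later. *)
Lemma outer_proj A z : compact A -> convex_set A -> A !=set0 -> ~ A z ->
  exists p u (s : R), [/\ A p, enorm u = 1, normal_cone A p u & [/\ 0 < s, z = p + s *: u
    & forall a, A a -> s <= enorm (z - a)]].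
Proof.
move=> kA cA A0 Az; have [p Ap pP] := proj_exists z kA cA A0.
have zp0 : z - p != 0 by rewrite subr_eq0; apply: contra_notN Az => /eqP ->.
have np := enorm_gt0 zp0; have u1 := enorm_normalize zp0.
exists p, ((enorm (z - p))^-1 *: (z - p)), (enorm (z - p)); split => //.
  by move=> a Aa; rewrite dotZl pmulr_rle0 ?invr_gt0//; exact: pP.
split => //; first by rewrite scalerA divff ?gt_eqF// scale1r addrC subrK.
move=> a Aa; apply: le_trans (dot_unitl (z - a) u1).
have -> : z - a = (z - p) - (a - p) by rewrite opprB addrA subrK.
rewrite dotBr !dotZl.
rewrite -enorm_sqr expr2 mulrA mulVf ?gt_eqF// mul1r lerDl oppr_ge0.
by rewrite pmulr_rle0 ?invr_gt0//; exact: pP.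
Qed.

Lemma affdim_ge A (k : nat) (x0 : V) (X : 'M[R]_(k, d)) :
  A x0 -> (forall i : 'I_k, A (x0 + row i X)) -> row_free X -> (k <= affdim A)%N.
Proof.
move=> Ax0 AX fX; have kd : (k < d.+1)%N.
  by rewrite ltnS; move: (fX); rewrite /row_free => /eqP <-; exact: rank_leq_col.
by apply: (leq_bigmax_cond (Ordinal kd)); apply/asboolP; exists x0, X.
Qed.

Lemma affdim_le A (m : nat) : (forall (k : nat) (x0 : V) (X : 'M[R]_(k, d)),
  A x0 -> (forall i : 'I_k, A (x0 + row i X)) -> row_free X -> (k <= m)%N) ->
  (affdim A <= m)%N.
Proof.
by move=> H; apply/bigmax_leqP => k /asboolP[x0 [X [Ax0 AX fX]]]; exact: (H _ _ _ Ax0 AX fX).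
Qed.

Lemma affdim_interior A x : A° x -> affdim A = d.
Proof.
move=> /interior_enormP[e e0 Ae]; apply/eqP; rewrite eqn_leq; apply/andP; split.
  apply: affdim_le => k x0 X _ _; rewrite /row_free => /eqP <-; exact: rank_leq_col.
apply: (@affdim_ge _ d x ((e / 2)%:M)).
- by apply: Ae; rewrite subrr enorm0.
- move=> i; apply: Ae; rewrite addrAC subrr add0r.
  have -> : row i (e / 2)%:M = (e / 2) *: (delta_mx 0 i : V).
    by apply/rowP => j; rewrite !mxE eqxx/= mulr_natr eq_sym.
  rewrite enormZ ger0_norm; last by lra.
  suff -> : enorm (delta_mx 0 i : V) = 1 by lra.
  apply: unit_dot; rewrite /dot (bigD1 i)//= !mxE !eqxx mul1r big1 ?addr0//.
  by move=> j ji; rewrite !mxE (negPf ji) andbF mul0r.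
- by rewrite row_free_unit unitmxE det_scalar unitfE expf_neq0// gt_eqF// divr_gt0.
Qed.

Lemma normal_interior K y u : K° y -> normal_cone K y u -> u = 0.
Proof.
move=> /interior_enormP[e e0 Ke] nu; apply/eqP; apply: contraT => u0.
have := nu (y + (e / 2) *: ((enorm u)^-1 *: u)) _.
rewrite addrAC subrr add0r !dotZr -enorm_sqr => H.
have : e / 2 * ((enorm u)^-1 * enorm u ^+ 2) <= 0.
  apply: H; apply: Ke; rewrite addrAC subrr add0r enormZ enorm_normalize// mulr1.
  by rewrite ger0_norm; lra.
by rewrite leNgt !mulr_gt0// ?exprn_gt0 ?invr_gt0 ?enorm_gt0.
Qed.

(** The largest [t] with [x + t *: w] in [K] works: an interior point would allow a larger one. *)
Lemma exit_point K x w : compact K -> K x -> enorm w = 1 ->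
  exists2 t : R, 0 <= t & K (x + t *: w) /\ ~ K° (x + t *: w).
Proof.
move=> kK Kx w1; have /compact_enormP[clK [M KM]] := kK.
pose T := [set t : R | 0 <= t /\ K (x + t *: w)].
have tM t : T t -> t <= 2 * M.
  move=> [t0 Kt]; have := KM _ Kt; have := KM _ Kx => xM xtM.
  have : enorm (x + t *: w - x) <= 2 * M.
    by rewrite (le_trans (enormD _ _))// enormN; lra.
  by rewrite addrAC subrr add0r enormZ w1 mulr1 ger0_norm.
have cf : continuous (fun t : R => x + t *: w).
  apply: addV_continuous; first exact: cstV_continuous.
  by apply: scaleV_continuous; [exact: idV_continuous|exact: cstV_continuous].
have kT : compact T.
  apply: (subclosed_compact _ (@segment_compact R 0 (2 * M))).
    apply: closedI; first exact: closed_ge.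
    by apply: preimage_closed => // t _; exact: cf.
  by move=> t Tt /=; rewrite in_itv/= tM//; case: Tt => ->.
have T0 : T !=set0 by exists 0; split => //; rewrite scale0r addr0.
have [t /set_mem[t0 Kt] tmax] := compact_EVT_min T0 kT (continuous_subspaceT (@oppr_continuous R R)).
exists t => //; split => // /interior_enormP[e e0 Ke].
have /tmax : t + e / 2 \in T.
  apply/mem_set; split; first by rewrite addr_ge0// divr_ge0// ltW.
  apply: Ke; have -> : x + (t + e / 2) *: w - (x + t *: w) = (e / 2) *: w by vring.
  by rewrite enormZ w1 mulr1 ger0_norm; lra.
rewrite /=; lra.
Qed.

(** The counterpart of [exit_point] for a point outside [K]: the smallest admissible [t] gives the
    first contact of the backward ray with [K]. *)
Lemma entry_point K x w (t1 : R) : compact K -> ~ K x -> 0 <= t1 -> K (x - t1 *: w) ->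
  exists t : R, [/\ 0 < t, t <= t1, K (x - t *: w) & ~ K° (x - t *: w)].
Proof.
move=> kK Kx t10 Kt1; have /compact_enormP[clK _] := kK.
pose T := [set t : R | (0 <= t <= t1) /\ K (x - t *: w)].
have cf : continuous (fun t : R => x - t *: w).
  apply: subV_continuous; first exact: cstV_continuous.
  by apply: scaleV_continuous; [exact: idV_continuous|exact: cstV_continuous].
have kT : compact T.
  apply: (subclosed_compact _ (@segment_compact R 0 t1)).
    have -> : T = `[0, t1]%classic `&` (fun t : R => x - t *: w) @^-1` K.
      by apply/seteqP; split => t [] /=; rewrite in_itv/=.
    by apply: closedI; [exact: interval_closed|apply: preimage_closed => // t _; exact: cf].
  by move=> t [t01 _] /=; rewrite in_itv.
have T0 : T !=set0 by exists t1; split => //; rewrite t10 lexx.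
have [t /set_mem[/andP[t0 tt1] Kt] tmin] := compact_EVT_min T0 kT (continuous_subspaceT (@idV_continuous R)).
have tp : 0 < t.
  rewrite lt0r t0 andbT; apply: contra_notN Kx => /eqP tE.
  by rewrite tE scale0r subr0 in Kt.
exists t; split => // /interior_enormP[e e0 Ke].
pose s := Num.min t (e / (2 * (enorm w + 1))).
have w0 := enorm_ge0 w.
have s0 : 0 < s by rewrite lt_min tp divr_gt0//; lra.
have st : s <= t by rewrite ge_min lexx.
have se : s * enorm w < e.
  have : s * (2 * (enorm w + 1)) <= e by rewrite -ler_pdivlMr ?ge_min ?lexx ?orbT//; lra.
  nra.
have /tmin : t - s \in T.
  apply/mem_set; split; first by apply/andP; split; lra.
  apply: Ke; have -> : x - (t - s) *: w - (x - t *: w) = s *: w by vring.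
  by rewrite enormZ gtr0_norm.
lra.
Qed.

(** * Regular bodies: uniqueness and stability of normals *)

Section Regular.
Variables (K : set V).
Context (hK : in_K0 K) (hreg : regular_body K).

Lemma body_compact : compact K. Proof. by have [] := hK. Qed.
Lemma body_convex : convex_set K. Proof. by have [] := hK. Qed.
Lemma body_interior0 : K° 0. Proof. by have [] := hK. Qed.
Lemma body_mem0 : K 0. Proof. exact: interior_subset body_interior0. Qed.
Lemma body_neq0 : K !=set0. Proof. by exists 0; exact: body_mem0. Qed.
Lemma affdim_normal_cone y : K y -> ~ K° y -> affdim (normal_cone K y) = 1%N.
Proof. by move=> Ky Ki; apply: hreg; split => //; exact: subset_closure. Qed.

(** Regularity itself supplies the normal, without a separation theorem: a normal cone reduced to
    the origin would have affine dimension 0 instead of 1. *)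
Lemma normal_exists y : K y -> ~ K° y -> exists2 u, enorm u = 1 & normal_cone K y u.
Proof.
move=> Ky Ki.
have [u [u0 nu]] : exists u, u != 0 /\ normal_cone K y u.
  apply: contrapT => H.
  suff : (affdim (normal_cone K y) <= 0)%N by rewrite affdim_normal_cone.
  apply: affdim_le => -[//|k] x0 X nx0 nX fX; exfalso.
  have n0 v : normal_cone K y v -> v = 0.
    by move=> nv; apply: contrapT => /eqP v0; apply: H; exists v.
  have := nX ord0; rewrite (n0 _ nx0) add0r => /n0 rX.
  have /row_freeP[B XB] := fX.
  have : row ord0 X *m B = row ord0 (1%:M : 'M[R]_k.+1) by rewrite -row_mul XB.
  by rewrite rX mul0mx => /rowP/(_ ord0); rewrite !mxE eqxx => /eqP; rewrite eq_sym oner_eq0.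
exists ((enorm u)^-1 *: u); first exact: enorm_normalize.
by move=> k Kk; rewrite dotZl pmulr_rle0 ?invr_gt0 ?enorm_gt0//; exact: nu.
Qed.

(** Opposite normals would flatten [K], which has an interior point; other distinct unit normals are
    linearly independent, and together with the origin they make the normal cone two-dimensional. *)
Lemma normal_unique y u v : K y -> enorm u = 1 -> enorm v = 1 ->
  normal_cone K y u -> normal_cone K y v -> u = v.
Proof.
move=> Ky u1 v1 nu nv; apply: contrapT => /eqP uv.
have Ki : ~ K° y.
  by move=> /normal_interior/(_ nu) u0; move: u1; rewrite u0 enorm0 => /eqP; rewrite eq_sym oner_eq0.
have c1 : dot u v < 1.
  have := exprn_gt0 2 (enorm_gt0 (_ : u - v != 0)); rewrite subr_eq0 => /(_ uv).
  by rewrite enorm_sqrB//; lra.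
have cN1 : -1 < dot u v.
  have uNv : u + v != 0.
    apply/negP; rewrite addr_eq0 => /eqP uE.
    have /interior_enormP[e e0 Ke] := body_interior0.
    have Kv : K ((e / 2) *: v) by apply: Ke; rewrite subr0 enormZ v1 mulr1 ger0_norm; lra.
    have := nv _ Kv; have := nu _ body_mem0; rewrite uE !dotBr !dotNl dot0r dotZr dot_unit//; lra.
  have := exprn_gt0 2 (enorm_gt0 uNv).
  rewrite -[v in u + v]opprK enorm_sqrB ?enormN// dotNr; lra.
pose X : 'M[R]_(2, d) := \matrix_(i, j) (if i == ord0 then u 0 j else v 0 j).
have rX0 : row ord0 X = u by apply/rowP => j; rewrite !mxE.
have rX1 : row (lift ord0 ord0) X = v by apply/rowP => j; rewrite !mxE.
pose c := dot u v.
have c2 : 1 - c ^+ 2 != 0 by apply: lt0r_neq0; rewrite /c; nra.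
(* The basis dual to [u, v] in their span; its columns form the right inverse that certifies
   [row_free X]. *)
pose u' := (1 - c ^+ 2)^-1 *: (u - c *: v); pose v' := (1 - c ^+ 2)^-1 *: (v - c *: u).
have fX : row_free X.
  apply/row_freeP; exists (\matrix_(i, j) (if j == ord0 then u' 0 i else v' 0 i)).
  apply/matrixP => i j; rewrite !mxE.
  have -> : \sum_(k < d) X i k * (\matrix_(i, j) (if j == ord0 then u' 0 i else v' 0 i)) k j =
     dot (row i X) (if j == ord0 then u' else v').
    apply: eq_bigr => k _; rewrite [row i X 0 k]mxE; congr (_ * _).
    by rewrite [LHS]mxE; case: ifP.
  have [->|[->]] : i = ord0 \/ i = lift ord0 ord0.
    by case: i => [[|[|//]] ?]; [left|right]; apply: val_inj.
  - have [->|->] : j = ord0 \/ j = lift ord0 ord0.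
      by case: j => [[|[|//]] ?]; [left|right]; apply: val_inj.
    + by rewrite rX0 /= /u' dotZr dotBr dotZr dot_unit// -/c -expr2 mulVf.
    + by rewrite rX0 /= /v' dotZr dotBr dotZr dot_unit// -/c mulr1 subrr mulr0.
  - have [->|->] : j = ord0 \/ j = lift ord0 ord0.
      by case: j => [[|[|//]] ?]; [left|right]; apply: val_inj.
    + by rewrite rX1 /= /u' dotZr dotBr dotZr dot_unit// (dotC v u) -/c mulr1 subrr mulr0.
    + by rewrite rX1 /= /v' dotZr dotBr dotZr dot_unit// (dotC v u) -/c -expr2 mulVf.
suff : (2 <= affdim (normal_cone K y))%N by rewrite affdim_normal_cone.
apply: (@affdim_ge _ 2 0 X) => //; first by move=> k Kk; rewrite dot0l.
move=> i; rewrite add0r; have [->|->] : i = ord0 \/ i = lift ord0 ord0.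
  by case: i => [[|[|//]] ?]; [left|right]; apply: val_inj.
- by rewrite rX0.
- by rewrite rX1.
Qed.


Lemma norm_closed_sphere : closed [set u : V | enorm u = 1].
Proof.
apply: closed_eq_fun; last exact: cstV_continuous.
by apply: enorm_continuous; exact: idV_continuous.
Qed.

Lemma sphere_compact : compact [set u : V | enorm u = 1].
Proof.
apply/compact_enormP; split; first exact: norm_closed_sphere.
by exists 1 => x /= ->.
Qed.

(* Uniform continuity of the Gauss map. *)
Lemma gauss_uniform (e : R) : 0 < e -> exists2 s : R, 0 < s &
  forall y u v, K y -> enorm u = 1 -> normal_cone K y u -> enorm v = 1 ->
    (forall k, K k -> dot v (k - y) <= s) -> enorm (u - v) <= e.
Proof.
move=> e0; apply: contrapT => H.
pose S := [set u : V | enorm u = 1].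
(* Counterexamples for the tolerance [n.+1%:R^-1] form a decreasing sequence of compact sets. A
   common point has two distinct exact normals at the same [y], which [normal_unique] forbids. *)
pose F (n : nat) : set (V * (V * V)) := K `*` (S `*` S) `&`
  [set q | e <= enorm (q.2.1 - q.2.2)] `&`
  \bigcap_(k in K) [set q | dot q.2.1 (k - q.1) <= 0] `&`
  \bigcap_(k in K) [set q | dot q.2.2 (k - q.1) <= n.+1%:R^-1].
have c1 : continuous (fun q : V * (V * V) => q.1) by move=> q; exact: cvg_fst.
have c21 : continuous (fun q : V * (V * V) => q.2.1).
  by move=> q; apply: cvg_comp; [exact: cvg_snd|exact: cvg_fst].
have c22 : continuous (fun q : V * (V * V) => q.2.2).
  by move=> q; apply: cvg_comp; [exact: cvg_snd|exact: cvg_snd].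
have kP : compact (K `*` (S `*` S)).
  apply: compact_setX; first exact: body_compact.
  by apply: compact_setX; exact: sphere_compact.
have clF n : closed (F n).
  apply: closedI; first apply: closedI; first apply: closedI.
  - apply: compact_closed => //; exact: norm_hausdorff.
  - have cE := enorm_continuous (subV_continuous c21 c22).
    by apply: (@closed_le_fun _ _ (fun=> e) _ _ cE); exact: cstV_continuous.
  - apply: closed_bigI => k _.
    have ck : continuous (fun q : V * (V * V) => k - q.1).
      by apply: (@subV_continuous _ _ _ (fun=> k) _ _ c1); exact: cstV_continuous.
    by apply: (@closed_le_fun _ _ _ (fun=> 0) (dot_continuous c21 ck)); exact: cstV_continuous.
  - apply: closed_bigI => k _.
    have ck : continuous (fun q : V * (V * V) => k - q.1).
      by apply: (@subV_continuous _ _ _ (fun=> k) _ _ c1); exact: cstV_continuous.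
    by apply: (@closed_le_fun _ _ _ (fun=> _) (dot_continuous c22 ck)); exact: cstV_continuous.
have [[y [u v]] Hq] : exists q, forall n, F n q.
  apply: nested_compact => //.
  - by apply: (subclosed_compact (clF _) kP) => q [[[]]].
  - move=> n m nm q [? H1]; split => // k Kk; apply: le_trans (H1 k Kk) _.
    by rewrite lef_pV2 ?posrE// ler_nat ltnS.
  - move=> n; apply: contrapT => Fn; apply: H; exists n.+1%:R^-1 => // y u v Ky u1 nu v1 nv.
    rewrite leNgt; apply/negP => uv; apply: Fn; exists (y, (u, v)).
    by split => //; split => //; split => //=; exact: ltW.
have [[[[/= Ky [u1 v1]] uv] nu] _] := Hq 0%N.
move: uv; rewrite (@normal_unique y u v) ?subrr ?enorm0//; first by rewrite leNgt e0.
move=> k Kk; rewrite leNgt; apply/negP => c0.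
have [n nc] := natSinv_small c0.
by have [_ /(_ k Kk)/=] := Hq n; rewrite leNgt nc.
Qed.

(** Were [y + w] not interior, some boundary point within [2 * enorm w] of [y] would have a normal
    [u'] with [dot u' w] nonnegative. By [gauss_uniform] that normal is within [c / 2] of [u], which
    contradicts the inward inclination of [w]. *)
Lemma inner_cone (c : R) : 0 < c -> exists2 s : R, 0 < s &
  forall y u w, K y -> enorm u = 1 -> normal_cone K y u -> w != 0 ->
    enorm w <= s -> dot u w <= - c * enorm w -> K° (y + w).
Proof.
move=> c0; have [s s0 H] := gauss_uniform (divr_gt0 c0 (ltr0Sn R 1)).
exists (s / 2); first by rewrite divr_gt0.
move=> y u w Ky u1 nu w0 ws uw; apply: contrapT => Ki.
have wp := enorm_gt0 w0.
have [p [u' [Kp u'1 nu' pw pos]]] : exists p u', [/\ K p, enorm u' = 1, normal_cone K p u',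
    enorm (p - y) <= 2 * enorm w & 0 <= dot u' (y + w - p)].
  have [Kyw|nKyw] := pselect (K (y + w)).
    have [u' u'1 nu'] := normal_exists Kyw Ki.
    exists (y + w), u'; split => //; last by rewrite subrr dot0r.
    by rewrite addrAC subrr add0r; lra.
  have [p [u' [t [Kp u'1 nu' [t0 ywE tle]]]]] := outer_proj body_compact body_convex body_neq0 nKyw.
  exists p, u'; split => //; last by rewrite ywE addrAC subrr add0r dotZr dot_unit// mulr1 ltW.
  have tw : t <= enorm w by have := tle y Ky; rewrite addrAC subrr add0r.
  have -> : p - y = w - t *: u' by rewrite -[p](addrK (t *: u')) -ywE; vring.
  apply: le_trans (enormD _ _) _; rewrite enormN enormZ u'1 mulr1 gtr0_norm//; lra.
have u'u : enorm (u' - u) <= c / 2.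
  apply: (H _ _ _ Kp u'1 nu' u1) => k Kk.
  have -> : k - p = (k - y) + (y - p) by vring.
  rewrite dotDr; have := nu k Kk; have := dot_unitl (y - p) u1; rewrite enormB; lra.
have u'w : 0 <= dot u' w.
  have := nu' _ Ky; have -> : w = (y + w - p) - (y - p) by vring.
  rewrite [X in _ -> 0 <= X]dotBr; lra.
have : dot u' w <= dot u w + c / 2 * enorm w.
  rewrite -(subrK u u') dotDl addrC lerD2l.
  apply: le_trans (dot_le_enorm _ _) _; rewrite ler_wpM2r ?enorm_ge0//.
nra.
Qed.

End Regular.
End Body.

(** * Volume *)

Section VolumeTheory.
Context {R : realType} {d : nat}.
Local Notation V := 'rV[R]_d.
Implicit Types (a b x y z u v w : V) (A B K : set V).

Lemma box_vol_ge0 a b : (forall i, a 0 i <= b 0 i) -> 0 <= box_vol a b.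
Proof. by move=> ab; apply: prodr_ge0 => i _; rewrite subr_ge0. Qed.

Lemma volS A B : A `<=` B -> (vol A <= vol B)%E.
Proof.
move=> AB; apply: le_ereal_inf_tmp => _ [c [cab Bc] <-].
apply: ge_ereal_inf; eexists; last exact: lexx.
by exists c => //; split => //; exact: subset_trans Bc.
Qed.

Lemma vol_ge0 A : (0 <= vol A)%E.
Proof.
apply: le_ereal_inf_tmp => _ [c [cab Ac] <-].
by apply: nneseries_ge0 => k _ _; rewrite lee_fin box_vol_ge0.
Qed.

(** Coordinatewise monotone maps send boxes to boxes, hence coverings to coverings. Translations and
    dilations are the instances needed. *)
Lemma vol_le_map A B (f : V -> V) (k : R) : 0 < k ->
  (forall a b i, a 0 i <= b 0 i -> f a 0 i <= f b 0 i) ->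
  (forall a b, box_vol (f a) (f b) = k * box_vol a b) ->
  B `<=` f @` A -> (vol B <= k%:E * vol A)%E.
Proof.
move=> k0 fm fv BA; rewrite -lee_pdivrMl//.
apply: le_ereal_inf_tmp => _ [c [cab Ac] <-]; rewrite lee_pdivrMl//.
apply: ereal_inf_lbound.
exists (fun n => (f (c n).1, f (c n).2)).
  split=> [n i|y /BA[x /Ac[n _ xn] <-]]; first exact: fm.
  exists n => // i; have /andP[h1 h2] := xn i.
  by apply/andP; split; exact: fm.
rewrite -nneseriesZl//=; last by move=> n _; rewrite lee_fin box_vol_ge0.
by apply: eq_eseriesr => n _; rewrite fv EFinM.
Qed.

Definition translate (t : V) A : set V := [set x | A (x - t)].
Definition dilate (c : R) A : set V := [set x | A (c^-1 *: x)].

Lemma vol_translate t A : vol (translate t A) = vol A.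
Proof.
have H u B : (vol (translate u B) <= vol B)%E.
  rewrite -[leRHS]mul1e; apply: (vol_le_map (f := fun x => x + u)) => //.
  - by move=> a b i; rewrite !mxE lerD2r.
  - by move=> a b; rewrite mul1r; apply: eq_bigr => i _; rewrite !mxE; ring.
  - by move=> x Bx; exists (x - u) => //; rewrite subrK.
apply/eqP; rewrite eq_le H/=.
suff E : A = translate (- t) (translate t A) by rewrite {1}E; exact: H.
by apply/funext => x; rewrite /translate/= opprK addrK.
Qed.

Lemma vol_dilate (c : R) A : 0 < c -> vol (dilate c A) = ((c ^+ d)%:E * vol A)%E.
Proof.
have H k B : 0 < k -> (vol (dilate k B) <= (k ^+ d)%:E * vol B)%E.
  move=> k0; apply: (vol_le_map (f := fun x => k *: x)); first by rewrite exprn_gt0.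
  - by move=> a b i; rewrite !mxE ler_pM2l.
  - move=> a b; rewrite /box_vol -[in k ^+ d](card_ord d) -prodr_const -big_split/=.
    by apply: eq_bigr => i _; rewrite !mxE mulrBr.
  - by move=> x Bx; exists (k^-1 *: x) => //; rewrite scalerA divff ?scale1r ?gt_eqF.
move=> c0; apply/eqP; rewrite eq_le H//=.
rewrite -lee_pdivlMl ?exprn_gt0//.
suff E : A = dilate c^-1 (dilate c A) by rewrite {1}E -exprVn; apply: H; rewrite invr_gt0.
by apply/funext => x; rewrite /dilate/= invrK scalerA mulVf ?scale1r ?gt_eqF.
Qed.

Lemma vol_le_box A a b : (0 < d)%N -> (forall i, a 0 i <= b 0 i) ->
  A `<=` box a b -> (vol A <= (box_vol a b)%:E)%E.
Proof.
move=> d0 ab Aab; apply: ereal_inf_lbound.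
(* The covering is padded with degenerate boxes. Their volume is 0 because [0 < d]; in dimension 0
   an empty product would give 1. *)
exists (fun n : nat => if n == 0%N then (a, b) else (0, 0)).
  split=> [[|n] i //=|x Ax]; exists 0%N => //; exact: Aab.
rewrite nneseries_recl//=; last by case=> [|n] _; rewrite lee_fin box_vol_ge0//= => i.
rewrite eseries0 ?adde0// => -[//|n] _ _; congr EFin.
by rewrite /box_vol (bigD1 (Ordinal d0))//= subrr mul0r.
Qed.

Lemma vol_set0 : (0 < d)%N -> vol (@set0 V) = 0.
Proof.
move=> d0; apply/eqP; rewrite eq_le vol_ge0 andbT.
apply: le_trans (vol_le_box d0 (fun=> lexx _) (@sub0set _ (box 0 0))) _.
by rewrite lee_fin /box_vol (bigD1 (Ordinal d0))//= subrr mul0r.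
Qed.

Lemma vol_fin A (M : R) : (0 < d)%N -> (forall x, A x -> enorm x <= M) ->
  vol A \is a fin_num.
Proof.
move=> d0 AM; rewrite ge0_fin_numE ?vol_ge0//.
apply: (@le_lt_trans _ _ ((box_vol (const_mx (- `|M|)) (const_mx `|M|))%:E)); last exact: ltry.
apply: vol_le_box => // [i|x /AM xM i]; rewrite !mxE; first by rewrite ge0_cp.
by rewrite -ler_norml (le_trans (coord_le_enorm _ _))// (le_trans xM)// ler_norm.
Qed.

Lemma open_measurable_rV A : open A -> measurable (A : set (borel_rV R d)).
Proof. exact: sub_sigma_algebra. Qed.

Lemma closed_measurable_rV A : closed A -> measurable (A : set (borel_rV R d)).
Proof.
by move=> cA; rewrite -[A]setCK; apply: measurableC; apply: open_measurable_rV; exact: closed_openC.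
Qed.

Lemma compact_measurable_rV A : compact A -> measurable (A : set (borel_rV R d)).
Proof. by move=> /compact_enormP[cA _]; exact: closed_measurable_rV. Qed.

Lemma continuous_measurable_rV (f : V -> V) : continuous f ->
  measurable_fun setT (f : borel_rV R d -> borel_rV R d).
Proof.
move=> cf; apply: (@measurability _ _ (borel_rV R d) (borel_rV R d) setT f (@open V)) => //.
move=> _ [B oB <-]; rewrite setTI; apply: open_measurable_rV.
by apply: open_comp => // x _; exact: cf.
Qed.


Lemma body_scale K (M : R) : in_K0 K -> exists2 c : R, 0 < c &
  forall x, enorm x <= M -> K (c *: x).
Proof.
move=> [_ _ /interior_enormP[e e0 Ke]].
have M0 : 0 < `|M| + 1 by rewrite ltr_wpDl.
exists (e / (2 * (`|M| + 1))); first by rewrite divr_gt0 ?mulr_gt0.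
move=> x xM; apply: Ke; rewrite subr0 enormZ gtr0_norm ?divr_gt0 ?mulr_gt0//.
have : enorm x <= `|M| + 1 by apply: le_trans xM _; rewrite ler_wpDr// ler_norm.
rewrite mulrAC ltr_pdivrMr ?mulr_gt0// => H.
have := enorm_ge0 x; nra.
Qed.

(** * Volume as a measure, through the law of a uniform point *)

Section Measure.
Context {dO : measure_display} {O : measurableType dO} (P : probability O R).
Context (K : set V) (hd : (0 < d)%N) (hK : in_K0 K).
Context (X : O -> borel_rV R d) (mX : measurable_fun setT X) (uX : uniform_on P K X).

(** Division by 0 returns 0, so a vanishing volume would give the uniform law total mass 0. *)
Lemma vol_body_gt0 : 0 < fine (vol K).
Proof.
rewrite lt0r fine_ge0 ?vol_ge0// andbT; apply/eqP => K0.
have := uX measurableT; rewrite K0 invr0 mulr0 preimage_setT probability_setT => /eqP.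
by rewrite eqe oner_eq0.
Qed.

(* On a dilated copy of [K] the volume is a multiple of the law of the dilated uniform point. *)
Lemma vol_measure (M : R) : exists mu : {measure set (borel_rV R d) -> \bar R},
  forall A : set (borel_rV R d), measurable A -> (forall x, A x -> enorm x <= M) ->
    vol A = mu A.
Proof.
have [c c0 cK] := body_scale M hK.
pose f : borel_rV R d -> borel_rV R d := fun x : V => c^-1 *: x.
have mf : measurable_fun setT f.
  apply: continuous_measurable_rV; apply: scaleV_continuous; [exact: cstV_continuous|exact: idV_continuous].
have mfX : measurable_fun setT (f \o X) by exact: measurableT_comp.
(* The first factor undoes the dilation by [c], the second the normalisation of the uniform law. *)
have k0 : 0 <= (c ^+ d)^-1 * fine (vol K) by rewrite mulr_ge0 ?invr_ge0 ?exprn_ge0 ?fine_ge0 ?vol_ge0// ltW.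
have mfX' : f \o X \in mfun by apply/mem_set.
exists (mscale (NngNum k0) (distribution P (mfun_Sub mfX'))).
move=> A mA AM /=.
have -> : mscale (NngNum k0) (distribution P (mfun_Sub mfX')) A =
  (((c ^+ d)^-1 * fine (vol K))%:E * P (X @^-1` (dilate c A)))%E by [].
have mcA : measurable (dilate c A : set (borel_rV R d)).
  by rewrite -[X in measurable X](setTI (f @^-1` A)); exact: mf.
rewrite uX// setIidr; last first.
  move=> x /= /AM /cK; rewrite scalerA divff ?gt_eqF// scale1r//.
rewrite vol_dilate// fineM ?(vol_fin hd AM)//= EFinM.
have vK := vol_body_gt0.
rewrite -{1}(fineK (vol_fin hd AM)) -!EFinM; congr EFin.
by field; rewrite !gt_eqF// exprn_gt0.
Qed.


(** The class on which [vol] is finite and, by [vol_measure], additive; the measure provided there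
    depends on the bound. *)
Definition bborel A := measurable (A : set (borel_rV R d)) /\
  exists M : R, forall x, A x -> enorm x <= M.

Lemma bborelU A B : bborel A -> bborel B -> bborel (A `|` B).
Proof.
move=> [mA [M AM]] [mB [N BN]]; split; first exact: measurableU.
by exists (Num.max M N) => x [/AM|/BN] h; rewrite le_max h ?orbT.
Qed.

Lemma bborelS A B : bborel B -> measurable (A : set (borel_rV R d)) -> A `<=` B -> bborel A.
Proof. by move=> [mB [N BN]] mA AB; split => //; exists N => x /AB /BN. Qed.

Lemma bborel_compact A : compact A -> bborel A.
Proof.
by move=> kA; split; [exact: compact_measurable_rV|have /compact_enormP[] := kA].
Qed.

Lemma bborelD A B : bborel A -> bborel B -> bborel (A `\` B).
Proof. by move=> bA [mB _]; apply: (bborelS bA) => [|x []//]; apply: measurableD => //; case: bA. Qed.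

Lemma bborel_fin A : bborel A -> vol A \is a fin_num.
Proof. by move=> [_ [M AM]]; exact: vol_fin AM. Qed.

Definition rvol A : R := fine (vol A).

Lemma rvolK A : bborel A -> (rvol A)%:E = vol A.
Proof. by move=> /bborel_fin/fineK. Qed.

Lemma rvol_ge0 A : 0 <= rvol A.
Proof. by rewrite fine_ge0// vol_ge0. Qed.

Lemma rvolS A B : bborel B -> A `<=` B -> rvol A <= rvol B.
Proof.
move=> bB AB; apply: fine_le; last exact: volS.
- by have [_ [M BM]] := bB; apply: (vol_fin (M := M) hd) => x /AB/BM.
- exact: bborel_fin.
Qed.

Lemma rvolU A B : bborel A -> bborel B -> A `&` B = set0 ->
  rvol (A `|` B) = rvol A + rvol B.
Proof.
move=> bA bB AB0; have [mAB [M ABM]] := bborelU bA bB.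
have [mu muE] := vol_measure M.
apply: EFin_inj; rewrite EFinD !rvolK//; last exact: bborelU.
rewrite !muE//; [|by case: bB|by move=> x Bx; apply: ABM; right|by case: bA|by move=> x Bx; apply: ABM; left].
by apply: measureU => //; [case: bA|case: bB].
Qed.

Lemma rvolU_le A B : bborel A -> bborel B -> rvol (A `|` B) <= rvol A + rvol B.
Proof.
move=> bA bB; have -> : A `|` B = A `|` (B `\` A).
  apply/seteqP; split => x [|]; try by left.
    by have [|nAx] := pselect (A x); [left|right].
  by case; right.
rewrite rvolU//; [|exact: bborelD|by apply/seteqP; split => x //= [? []]].
by rewrite lerD2l; apply: rvolS => // x [].
Qed.

Lemma rvol_bigU (I : finType) (F : I -> set V) (s : seq I) :
  (forall i, bborel (F i)) ->
  bborel (\big[setU/set0]_(i <- s) F i) /\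
  rvol (\big[setU/set0]_(i <- s) F i) <= \sum_(i <- s) rvol (F i).
Proof.
move=> bF; elim: s => [|i s [IH1 IH2]].
  rewrite !big_nil; split; last by rewrite /rvol vol_set0.
  by split => //; exists 0.
rewrite !big_cons; split; first exact: bborelU.
by apply: le_trans (rvolU_le (bF i) IH1) _; rewrite lerD2l.
Qed.

Lemma rvol_cvg (F : nat -> set V) : (forall n, bborel (F n)) ->
  (forall n m, (n <= m)%N -> F m `<=` F n) ->
  rvol (F n) @[n --> \oo] --> rvol (\bigcap_n F n).
Proof.
move=> bF decF; have [m0 [M F0M]] := bF 0%N.
have [mu muE] := vol_measure M.
have FM n x : F n x -> enorm x <= M by move=> /(decF _ _ (leq0n n)); exact: F0M.
have mF n : measurable (F n : set (borel_rV R d)) by case: (bF n).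
have mI : measurable (\bigcap_n F n : set (borel_rV R d)) by exact: bigcap_measurable.
have bI : bborel (\bigcap_n F n) by apply: (bborelS (bF 0%N)) => // x; exact.
suff : vol \o F @ \oo --> (rvol (\bigcap_n F n))%:E by move=> /fine_cvg.
rewrite rvolK//.
have -> : vol (\bigcap_n F n) = mu (\bigcap_n F n) by apply: muE => // x /(_ 0%N I); exact: F0M.
have -> : vol \o F = mu \o F by apply/funext => n /=; apply: muE => // x; exact: FM.
apply: nonincreasing_cvg_mu => //.
- by rewrite -muE// -ge0_fin_numE ?vol_ge0//; exact: bborel_fin.
- by move=> n m nm; apply/subsetPset; exact: decF.
Qed.

Lemma rvol_translate t A : rvol (translate t A) = rvol A.
Proof. by rewrite /rvol vol_translate. Qed.

Lemma bborel_translate t A : bborel A -> bborel (translate t A).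
Proof.
move=> [mA [M AM]]; split.
  rewrite -[X in measurable X](setTI ((fun x : V => x - t) @^-1` A)).
  apply: (continuous_measurable_rV _ measurableT mA).
  by apply: subV_continuous; [exact: idV_continuous|exact: cstV_continuous].
exists (M + enorm t) => x /AM xM.
by rewrite -(subrK t x) (le_trans (enormD _ _))// lerD2r.
Qed.

Lemma prob_rvol A : measurable (A : set (borel_rV R d)) -> A `<=` K ->
  P (X @^-1` A) = (rvol A / rvol K)%:E.
Proof. by move=> mA AK; rewrite uX// setIidr. Qed.

(** For [c < 1] the dilate of [K] by [c] lies in the interior, so the boundary has volume at most
    [(1 - c ^+ d) * rvol K]; let [c] tend to 1. *)
Lemma rvol_boundary : rvol (K `\` K°) = 0.
Proof.
have [kK cK /interior_enormP[r r0 Kr]] := hK.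
have bK := bborel_compact kK.
have mint : measurable (K° : set (borel_rV R d)).
  by apply: open_measurable_rV; exact: open_interior.
have bd : bborel (K `\` K°).
  by apply: (bborelS bK) => [|x []//]; apply: measurableD => //; case: bK.
have H (c : R) : 0 < c < 1 -> rvol (K `\` K°) <= (1 - c ^+ d) * rvol K.
  move=> /andP[c0 c1].
  have sub x : dilate c K x -> K° x.
    move=> Kx; apply/interior_enormP; exists ((1 - c) * r); first by rewrite mulr_gt0// subr_gt0.
    move=> y yx; have -> : y = c *: (c^-1 *: x) + (1 - c) *: ((1 - c)^-1 *: (y - x)).
      by rewrite !scalerA !divff ?gt_eqF// ?subr_gt0// !scale1r addrC subrK.
    move/convex_setP: cK; apply => //; last by rewrite !ltW.
    apply: Kr; rewrite subr0 enormZ gtr0_norm ?invr_gt0 ?subr_gt0//.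
    by rewrite mulrC ltr_pdivrMr ?subr_gt0// mulrC.
  have bc : bborel (dilate c K).
    apply: (bborelS bK) => [|x /sub/interior_subset//].
    rewrite -[X in measurable X](setTI ((fun x : V => c^-1 *: x) @^-1` K)).
    apply: continuous_measurable_rV => //; last by case: bK.
    by apply: scaleV_continuous; [exact: cstV_continuous|exact: idV_continuous].
  have : rvol (K `\` K°) + rvol (dilate c K) <= rvol K.
    rewrite -rvolU//; last by apply/seteqP; split => x //= [[_ nx] /sub].
    by apply: rvolS => // x [[]//|/sub/interior_subset].
  rewrite {2}/rvol vol_dilate// fineM ?bborel_fin//=; rewrite -/(rvol K); lra.
apply/eqP; rewrite eq_le rvol_ge0 andbT.
have vK : 0 < rvol K := vol_body_gt0.
apply/ler_addgt0Pr => e e0; rewrite add0r.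
(* Bernoulli's inequality, which turns the bound [H] into one linear in [1 - c]. *)
have bern (c : R) n : 0 < c < 1 -> 1 - c ^+ n <= n%:R * (1 - c).
  move=> /andP[c0 c1]; elim: n => [|n IH]; first by rewrite expr0 subrr mul0r.
  have := exprn_ile1 n (ltW c0) (ltW c1); have := exprn_ge0 n (ltW c0).
  rewrite exprS -natr1; nra.
pose D := 2 * (d%:R * rvol K + e + 1).
have dv : 0 <= d%:R * rvol K by rewrite mulr_ge0// ltW.
have D0 : 0 < D by rewrite /D; lra.
pose t := e / D.
have t0 : 0 < t by rewrite divr_gt0.
have t1 : t < 1 by rewrite ltr_pdivrMr// mul1r /D; lra.
have c01 : 0 < 1 - t < 1 by apply/andP; split; lra.
apply: le_trans (H _ c01) _.
apply: (@le_trans _ _ (d%:R * t * rvol K)).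
  by rewrite ler_pM2r// (le_trans (bern _ d c01))// opprB addrC subrK.
have : t * D = e by rewrite divfK// gt_eqF.
rewrite /D; nra.
Qed.

End Measure.
End VolumeTheory.

(** * Oblique strips along the boundary *)

(** Nonnegativity makes an additive function monotone. Enclosing [n%:R * s] between consecutive
    integers yields [n%:R * |f s - s * f 1| <= f 1] for every [n], so the difference vanishes. *)
Lemma additive_linear (R : realType) (f : R -> R) :
  (forall s, 0 <= s -> 0 <= f s) ->
  (forall s t, 0 <= s -> 0 <= t -> f (s + t) = f s + f t) ->
  forall s, 0 <= s -> f s = s * f 1.
Proof.
move=> f0 fD s s0.
have fmono a b : 0 <= a -> a <= b -> f a <= f b.
  by move=> a0 ab; rewrite -(subrKC a b) fD ?subr_ge0// lerDl f0// subr_ge0.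
have fM n t : 0 <= t -> f (n%:R * t) = n%:R * f t.
  move=> t0; elim: n => [|n IH].
    by rewrite !mul0r; have := fD 0 0 (lexx _) (lexx _); rewrite addr0; lra.
  by rewrite -natr1 !mulrDl !mul1r fD ?mulr_ge0// IH.
have H n : n%:R * `|f s - s * f 1| <= f 1.
  rewrite -[n%:R]ger0_norm// -normrM mulrBr.
  have ns0 : 0 <= n%:R * s by rewrite mulr_ge0.
  have /andP[m1 m2] := truncn_itv ns0.
  set m := Num.trunc _ in m1 m2.
  have h1 : m%:R * f 1 <= n%:R * f s by rewrite -!fM// mulr1 fmono.
  have h2 : n%:R * f s <= m.+1%:R * f 1 by rewrite -!fM// mulr1 fmono// ltW.
  have f1 : 0 <= f 1 by exact: f0.
  rewrite -natr1 in m2 h2; rewrite ler_norml mulrA; nra.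
apply/eqP; rewrite -subr_eq0 -normr_le0 leNgt; apply/negP => c0.
have := H (Num.trunc (f 1 / `|f s - s * f 1|)).+1.
rewrite leNgt -ltr_pdivrMr//.
by have /andP[_ ->] := truncn_itv (divr_ge0 (f0 1 ler01) (ltW c0)).
Qed.

Section Strips.
Context {R : realType} {d : nat}.
Local Notation V := 'rV[R]_d.
Implicit Types (x y z u v w : V) (A B X : set V) (a b t : R).
Variables (K : set V).
Context (hd : (0 < d)%N) (hK : in_K0 K) (hreg : regular_body K).

(** An oblique version of [local_parallel_set]: all boundary points are displaced in the same
    direction [w], so layers of equal thickness are translates of one another. The half-open range
    makes consecutive strips disjoint. *)
Definition strip w X a b : set V :=
  [set x | exists y u t, [/\ K y, X u, normal_cone K y u, enorm u = 1 &
    a < t <= b /\ x = y + t *: w]].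

Definition cstrip w X a b : set V :=
  [set x | exists y u t, [/\ K y, X u, normal_cone K y u, enorm u = 1 &
    a <= t <= b /\ x = y + t *: w]].

Definition transverse w X (c : R) := forall u, X u -> enorm u = 1 -> c <= dot u w.

(** Two feet of the same point differ by a multiple of [w]. The normal inequality at one foot gives
    that multiple one sign, the inequality at the other foot the opposite sign. *)
Lemma strip_inj w X c y u t y' u' t' : 0 < c -> transverse w X c ->
  K y -> X u -> normal_cone K y u -> enorm u = 1 ->
  K y' -> X u' -> normal_cone K y' u' -> enorm u' = 1 ->
  y + t *: w = y' + t' *: w -> y = y' /\ t = t'.
Proof.
move=> c0 tX Ky Xu nu u1 Ky' Xu' nu' u'1 E.
have D : y - y' = (t' - t) *: w.
  by rewrite scalerBl -(addrK (t *: w) y) E; vring.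
have h1 : (t' - t) * dot u w >= 0.
  by have := nu _ Ky'; rewrite -opprB D dotNr dotZr oppr_le0.
have h2 : (t' - t) * dot u' w <= 0.
  by have := nu' _ Ky; rewrite D dotZr.
have p1 := lt_le_trans c0 (tX _ Xu u1); have p2 := lt_le_trans c0 (tX _ Xu' u'1).
rewrite pmulr_lge0// in h1; rewrite pmulr_lle0// in h2.
have tt : t = t' by lra.
by split => //; move: E; rewrite tt => /addIr.
Qed.

Definition normal_pairs X : set (V * V) :=
  [set q | [/\ K q.1, X q.2, normal_cone K q.1 q.2 & enorm q.2 = 1]].

Lemma normal_pairs_compact X : compact X -> compact (normal_pairs X).
Proof.
move=> kX.
have c1 : continuous (fun q : V * V => q.1) by move=> q; exact: cvg_fst.
have c2 : continuous (fun q : V * V => q.2) by move=> q; exact: cvg_snd.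
have kP : compact (K `*` X) by apply: compact_setX => //; exact: body_compact.
apply: (subclosed_compact _ kP); last by move=> q [].
have -> : normal_pairs X = K `*` X `&` [set q | enorm q.2 = 1] `&`
    \bigcap_(k in K) [set q | dot q.2 (k - q.1) <= 0].
  apply/seteqP; split => q; first by case=> ? ? n1 ?; split => // k Kk; exact: n1.
  by move=> [[[? ?] ?] n1]; split => // k Kk; exact: n1.
apply: closedI; first apply: closedI.
- by apply: compact_closed => //; exact: norm_hausdorff.
- have cE := enorm_continuous c2.
  by apply: (@closed_eq_fun _ _ _ (fun=> 1) cE); exact: cstV_continuous.
- apply: closed_bigI => k _.
  have ck : continuous (fun q : V * V => k - q.1).
    by apply: (@subV_continuous _ _ _ (fun=> k) _ _ c1); exact: cstV_continuous.
  by apply: (@closed_le_fun _ _ _ (fun=> 0) (dot_continuous c2 ck)); exact: cstV_continuous.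
Qed.

Lemma cstrip_compact w X a b : compact X -> compact (cstrip w X a b).
Proof.
move=> kX.
have -> : cstrip w X a b = (fun q : V * V * R => q.1.1 + q.2 *: w) @`
    (normal_pairs X `*` `[a, b]%classic).
  apply/seteqP; split => x.
    move=> [y [u [t [Ky Xu nu u1 [tab ->]]]]]; exists ((y, u), t); last by [].
    by split; [exact: And4|rewrite /= in_itv].
  move=> [[[y u] t] [[/= Ky Xu nu u1]]]; rewrite in_itv/= => tab <-.
  by exists y, u, t.
apply: continuous_compact; last first.
  by apply: compact_setX; [exact: normal_pairs_compact|exact: segment_compact].
apply: continuous_subspaceT; apply: addV_continuous.
  by move=> q; apply: cvg_comp; [exact: cvg_fst|exact: cvg_fst].
by apply: scaleV_continuous; [move=> q; exact: cvg_snd|exact: cstV_continuous].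
Qed.

(** By [strip_inj] the half-open strip is the difference of the compact closed strip and its bottom
    layer. *)
Lemma strip_bborel w X c a b : 0 < c -> transverse w X c -> compact X ->
  bborel (strip w X a b).
Proof.
move=> c0 tX kX.
have -> : strip w X a b = cstrip w X a b `\` cstrip w X a a.
  apply/seteqP; split => x.
    move=> [y [u [t [Ky Xu nu u1 [/andP[at_ tb] ->]]]]]; split.
      by exists y, u, t; split => //; rewrite ltW.
    move=> [y' [u' [t' [Ky' Xu' nu' u'1 [/andP[h1 h2] E]]]]].
    have [_ tt] := strip_inj c0 tX Ky Xu nu u1 Ky' Xu' nu' u'1 E; lra.
  move=> [[y [u [t [Ky Xu nu u1 [/andP[at_ tb] E]]]]] nx].
  exists y, u, t; split => //; split => //; rewrite tb andbT lt_neqAle at_ andbT.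
  by apply/eqP => ta; apply: nx; exists y, u, t; split => //; split => //; rewrite -ta lexx.
by apply: bborelD; apply/bborel_compact/cstrip_compact.
Qed.

Lemma strip_shift w X a b h : strip w X (a + h) (b + h) = translate (h *: w) (strip w X a b).
Proof.
apply/seteqP; split => x [y [u [t [Ky Xu nu u1 [/andP[h1 h2] E]]]]].
  exists y, u, (t - h); split => //; split; first by apply/andP; split; lra.
  by rewrite E; vring.
exists y, u, (t + h); split => //; split; first by apply/andP; split; lra.
by rewrite -(subrK (h *: w) x) E; vring.
Qed.

Lemma strip_mono w X Y a b a' b' : X `<=` Y -> a' <= a -> b <= b' ->
  strip w X a b `<=` strip w Y a' b'.
Proof.
move=> XY aa bb x [y [u [t [Ky Xu nu u1 [/andP[h1 h2] E]]]]].
exists y, u, t; split => //; [exact: XY|split => //; apply/andP; split; lra].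
Qed.

Section Vol.
Context {dO : measure_display} {O : measurableType dO} (P : probability O R).
Context (xi : O -> borel_rV R d) (mxi : measurable_fun setT xi) (uxi : uniform_on P K xi).

(** For transverse unit [w], the area of the boundary part with normals in [X] after projection
    along [w], that is, the integral of [dot u w] over [X] against the surface area measure. *)
Definition carea w X : R := rvol (strip w X 0 1).

(** Translation invariance and disjointness of consecutive strips make the volume additive in the
    thickness, so [additive_linear] applies. Exactness, not mere asymptotics, is the benefit of
    tilting. *)
Lemma rvol_strip w X c a b : 0 < c -> transverse w X c -> compact X -> a <= b ->
  rvol (strip w X a b) = (b - a) * carea w X.
Proof.
move=> c0 tX kX ab.
have bS a' b' : bborel (strip w X a' b') by exact: (strip_bborel _ _ c0 tX kX).
have shift a' b' h : rvol (strip w X (a' + h) (b' + h)) = rvol (strip w X a' b').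
  by rewrite strip_shift rvol_translate.
rewrite -[a in strip _ _ a _]add0r -{1}(subrK a b) shift.
apply: (additive_linear (f := fun s => rvol (strip w X 0 s))); last by rewrite subr_ge0.
  by move=> s _; exact: rvol_ge0.
move=> s t s0 t0; rewrite -(shift 0 t s) add0r [t + s]addrC -(rvolU hd hK mxi uxi)//.
  congr rvol; apply/seteqP; split => x.
    move=> [y [u [r [Ky Xu nu u1 [/andP[h1 h2] E]]]]].
    have [rs|rs] := leP r s; [left|right]; exists y, u, r; split => //; split => //.
      by rewrite h1.
    by rewrite rs.
  case=> -[y [u [r [Ky Xu nu u1 [/andP[h1 h2] E]]]]]; exists y, u, r; split => //; split => //;
  apply/andP; split; lra.
apply/seteqP; split => // x [].
move=> [y [u [r [Ky Xu nu u1 [/andP[h1 h2] ->]]]]].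
move=> [y' [u' [r' [Ky' Xu' nu' u'1 [/andP[h1' h2'] E]]]]].
have [_ tt] := strip_inj c0 tX Ky Xu nu u1 Ky' Xu' nu' u'1 E; lra.
Qed.

Lemma carea_ge0 w X : 0 <= carea w X. Proof. exact: rvol_ge0. Qed.

(** Continuity from above of volume. The intersection of the strips is again a strip because the
    foot is the same for all [n] by [strip_inj], and the normal at that foot is unique. *)
Lemma carea_cvg w (X : nat -> set V) c : 0 < c -> transverse w (X 0%N) c ->
  (forall n, compact (X n)) -> (forall n m, (n <= m)%N -> X m `<=` X n) ->
  carea w (X n) @[n --> \oo] --> carea w (\bigcap_n X n).
Proof.
move=> c0 tX kX decX.
have tXn n : transverse w (X n) c by move=> u /(decX _ _ (leq0n n)); exact: tX.
have -> : carea w (\bigcap_n X n) = rvol (\bigcap_n strip w (X n) 0 1).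
  congr rvol; apply/seteqP; split => x.
    by move=> [y [u [t [Ky Xu nu u1 E]]]] n _; exists y, u, t; split => //; exact: Xu.
  move=> H; have [y [u [t [Ky Xu nu u1 [t01 E]]]]] := H 0%N I.
  exists y, u, t; split => // n _.
  have [y' [u' [t' [Ky' Xu' nu' u'1 [t'01 E']]]]] := H n I.
  have X0u' : X 0%N u' by exact: (decX _ _ (leq0n n)).
  have [yy tt] := strip_inj c0 tX Ky Xu nu u1 Ky' X0u' nu' u'1 (etrans (esym E) E').
  by rewrite (normal_unique hK hreg Ky u1 u'1 nu)//; rewrite yy.
apply: (rvol_cvg hd hK mxi uxi) => [n|n m nm].
  exact: (strip_bborel _ _ c0 (tXn n) (kX n)).
by apply: strip_mono => //; exact: decX.
Qed.

End Vol.
End Strips.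

(** * Surface area measure *)

Section SurfaceArea.
Context {R : realType} {d : nat}.
Local Notation V := 'rV[R]_d.
Implicit Types (x y z u v w : V) (A B X : set V) (a b c t : R).

Definition sphere : set V := [set u | enorm u = 1].

Lemma parallel_compact X (e : R) : compact X -> compact (parallel_set X e).
Proof.
move=> kX.
have -> : parallel_set X e = (fun q : V * V => q.1 + q.2) @` (X `*` [set z | enorm z <= e]).
  apply/seteqP; split => x.
    by move=> [y Xy xy]; exists (y, x - y) => //=; rewrite addrC subrK.
  move=> [[y z] [/= Xy ze] <-]; exists y => //.
  by rewrite addrAC subrr add0r.
apply: continuous_compact.
  apply: continuous_subspaceT; apply: addV_continuous => q; [exact: cvg_fst|exact: cvg_snd].
apply: compact_setX => //; apply/compact_enormP; split; last by exists e.
have cE := enorm_continuous (@idV_continuous V).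
by apply: (@closed_le_fun _ _ _ (fun=> e) cE); exact: cstV_continuous.
Qed.

Lemma parallelS X e e' : e <= e' -> parallel_set X e `<=` parallel_set X e'.
Proof. by move=> ee x [y Xy xy]; exists y => //; exact: le_trans ee. Qed.

Definition shrinking X (e : R) (n : nat) : set V := parallel_set X (e / n.+1%:R).

Lemma shrinking_dec X e n m : 0 < e -> (n <= m)%N -> shrinking X e m `<=` shrinking X e n.
Proof.
move=> e0 nm; apply: parallelS.
by rewrite ler_pM2l// lef_pV2 ?posrE// ler_nat.
Qed.

Lemma bigcap_shrinking X e : 0 < e -> closed X -> \bigcap_n shrinking X e n = X.
Proof.
move=> e0 cX; apply/seteqP; split => x; last first.
  by move=> Xx n _; exists x => //; rewrite subrr enorm0 divr_ge0// ltW.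
move=> H; move/closed_enormP: cX; apply => e' e'0.
have [n nc] := natSinv_small (divr_gt0 e'0 e0).
have [y Xy xy] := H n I; exists y => //; apply: le_trans xy _.
by rewrite mulrC -ler_pdivlMr// ltW.
Qed.

Lemma transverse_parallel w X c e : enorm w = 1 -> X `<=` sphere -> transverse w X c ->
  transverse w (parallel_set X e) (c - e).
Proof.
move=> w1 Xs tX u [v Xv uv] u1.
have := tX v Xv (Xs _ Xv); have := dot_unitr (v - u) w1; rewrite enormB dotBl; lra.
Qed.

Section Body.
Variables (K : set V).
Context (hd : (0 < d)%N) (hK : in_K0 K) (hreg : regular_body K).
Context {dO : measure_display} {O : measurableType dO} (P : probability O R).
Context (xi : O -> borel_rV R d) (mxi : measurable_fun setT xi) (uxi : uniform_on P K xi).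
Context (S : {finite_measure set (borel_rV R d) -> \bar R}) (hS : is_surface_area_measure K S).

Lemma S_fin A : measurable (A : set (borel_rV R d)) -> S A \is a fin_num.
Proof. by move=> mA; exact: fin_num_measure. Qed.

Lemma S_shrinking X e : 0 < e -> compact X -> S (shrinking X e n) @[n --> \oo] --> S X.
Proof.
move=> e0 kX; have /compact_enormP[cX _] := kX.
rewrite -[in X in _ --> X](bigcap_shrinking e0 cX).
have mX n : measurable (shrinking X e n : set (borel_rV R d)).
  by apply: compact_measurable_rV; exact: parallel_compact.
apply: nonincreasing_cvg_mu => //.
- by rewrite -ge0_fin_numE//; exact: S_fin.
- by rewrite bigcap_shrinking//; exact: closed_measurable_rV.
- by move=> n m nm; apply/subsetPset; exact: shrinking_dec.
Qed.

(** Only unit normals enter [local_parallel_set], so every set in the defining limit is empty. *)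
Lemma S_off_sphere A : measurable (A : set (borel_rV R d)) -> A `&` sphere = set0 -> S A = 0.
Proof.
move=> mA A0; apply/eqP; rewrite eq_le measure_ge0 andbT.
apply: (cvge_to_le (hS mA)).
apply: nearW => e; have -> : local_parallel_set K e A = set0.
  apply/seteqP; split => // x [y [u [s [Ky Au nu u1 _]]]].
  by have : (A `&` sphere) u by []; rewrite A0.
by rewrite vol_set0// mule0.
Qed.

(** The metric projection of a strip point is no farther than its oblique foot, since [w] is a unit
    vector. The normal at the projection may differ from that at the foot; both points being close,
    [gauss_uniform] puts it in the [e]-neighbourhood of [X]. *)
Lemma strip_sub_local_parallel w X c e : 0 < c -> enorm w = 1 -> transverse w X c -> 0 < e ->
  exists2 s, 0 < s & forall t, t <= s ->
    strip K w X 0 t `<=` local_parallel_set K t (parallel_set X e).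
Proof.
move=> c0 w1 tX e0; have [s s0 H] := gauss_uniform hK hreg e0.
exists (s / 2); first by rewrite divr_gt0.
move=> t ts x [y [u [r [Ky Xu nu u1 [/andP[r0 rt] xE]]]]].
have uw := lt_le_trans c0 (tX _ Xu u1).
have nKx : ~ K x.
  by move=> /nu; rewrite xE addrAC subrr add0r dotZr leNgt mulr_gt0.
have [p [u' [q [Kp u'1 nu' [q0 xE' qle]]]]] :=
  outer_proj (body_compact hK) (body_convex hK) (body_neq0 hK) nKx.
have qr : q <= r.
  by have := qle _ Ky; rewrite xE addrAC subrr add0r enormZ w1 mulr1 gtr0_norm.
exists p, u', q; split => //; last first.
  by split => //; rewrite q0; exact: le_trans qr rt.
exists u => //; apply: (H p) => // k Kk.
have -> : k - p = (k - y) + (q *: u' - r *: w).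
  by rewrite -(addrK (q *: u') p) -xE' xE; vring.
rewrite dotDr; have := nu k Kk.
have := dot_unitl (q *: u' - r *: w) u1; have := enormD (q *: u') (- (r *: w)).
rewrite enormN !enormZ u'1 w1 !mulr1 !gtr0_norm//; lra.
Qed.

(** From a point at distance [r] from [K], going back by [k * r] along [w] overshoots into [K]
    because [k * c] exceeds 1. The first contact on the way is the oblique foot. *)
Lemma local_parallel_sub_strip w X c (k e : R) : 0 < c -> enorm w = 1 -> transverse w X c ->
  1 < k * c -> 0 < e -> exists2 s, 0 < s & forall t, t <= s ->
    local_parallel_set K t X `<=` strip K w (parallel_set X e) 0 (k * t).
Proof.
move=> c0 w1 tX kc e0; have k0 : 0 < k by rewrite -(pmulr_lgt0 _ c0); lra.
(* The displacement [r *: u - (k * r) *: w] descends against [u] by at least [(k * c - 1) * r] and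
   has norm at most [(1 + k) * r]; the quotient is the inclination required by [inner_cone]. *)
pose c' := (k * c - 1) / (1 + k).
have c'0 : 0 < c' by rewrite divr_gt0//; lra.
have [s s0 cone] := inner_cone hK hreg c'0.
have [s' s'0 gauss] := gauss_uniform hK hreg e0.
exists (Num.min s s' / (1 + k)); first by rewrite divr_gt0 ?lt_min ?s0//; lra.
move=> t; rewrite ler_pdivlMr; last by lra.
rewrite le_min => /andP[ts ts'] x [y [u [r [Ky Xu nu u1 [/andP[r0 rt] xE]]]]].
have nKx : ~ K x.
  by move=> /nu; rewrite xE addrAC subrr add0r dotZr dot_unit// mulr1 leNgt r0.
have uw := tX _ Xu u1.
pose v := r *: u - (k * r) *: w.
have kr0 : 0 < k * r by rewrite mulr_gt0.
have uv : dot u v <= - c' * (r * (1 + k)).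
  have c'k : c' * (1 + k) = k * c - 1 by rewrite divfK// gt_eqF//; lra.
  rewrite /v dotBr !dotZr dot_unit// mulr1 mulNr [r * _]mulrC mulrA c'k; nra.
have vr : enorm v <= r * (1 + k).
  apply: le_trans (enormD _ _) _; rewrite enormN !enormZ u1 w1 !mulr1 !gtr0_norm//; lra.
have Kv : K (x - (k * r) *: w).
  have -> : x - (k * r) *: w = y + v by rewrite xE /v addrA.
  apply: interior_subset; apply: (cone y u v Ky u1 nu).
  - apply/eqP => v0; move: uv; rewrite v0 dot0r; have : 0 < c' * (r * (1 + k)) by apply: mulr_gt0 => //; apply: mulr_gt0 => //; lra.
    lra.
  - by apply: le_trans vr _; apply: le_trans ts; rewrite ler_pM2r//; lra.
  - apply: le_trans uv _; rewrite !mulNr lerN2 ler_pM2l//.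
have [q [q0 qk Kq nKq]] := entry_point (body_compact hK) nKx (ltW kr0) Kv.
have [u' u'1 nu'] := normal_exists hreg Kq nKq.
exists (x - q *: w), u', q; split => //; last first.
  split; last by rewrite subrK.
  by rewrite q0/= (le_trans qk)// ler_pM2l.
exists u => //; apply: (gauss _ _ _ Kq) => // z Kz.
have -> : z - (x - q *: w) = (z - y) + (q *: w - r *: u) by rewrite xE; vring.
rewrite dotDr; have := nu z Kz.
have := dot_unitl (q *: w - r *: u) u1; have := enormD (q *: w) (- (r *: u)).
rewrite enormN !enormZ u1 w1 !mulr1 !gtr0_norm//; nra.
Qed.


Lemma inv_mul_vol e A B (r : R) : 0 < e -> bborel B -> A `<=` B -> rvol B = e * r ->
  (e^-1%:E * vol A <= r%:E)%E.
Proof.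
move=> e0 bB AB Br; rewrite lee_pdivrMl// -EFinM -Br (rvolK hd bB).
exact: volS.
Qed.

Lemma mul_inv_vol e A B (r : R) : 0 < e -> bborel B -> B `<=` A -> rvol B = e * r ->
  (r%:E <= e^-1%:E * vol A)%E.
Proof.
move=> e0 bB AB Br; rewrite lee_pdivlMl// -EFinM -Br (rvolK hd bB).
exact: volS.
Qed.

(** Thin strips lie in local parallel sets over slightly enlarged normals. The thickness tends to 0
    first, for a fixed enlargement; the enlargement is removed afterwards by continuity of [S]. *)
Lemma carea_le_surface w X c : 0 < c -> enorm w = 1 -> transverse w X c -> compact X ->
  ((carea K w X)%:E <= S X)%E.
Proof.
move=> c0 w1 tX kX.
apply: (cvge_to_ge (S_shrinking ltr01 kX)); apply: nearW => n.
have mX : measurable (shrinking X 1 n : set (borel_rV R d)).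
  by apply: compact_measurable_rV; exact: parallel_compact.
apply: (cvge_to_ge (hS mX)).
have n0 : 0 < 1 / n.+1%:R :> R by rewrite divr_gt0.
have [s s0 H] := strip_sub_local_parallel c0 w1 tX n0.
near=> e.
have e0 : 0 < e by near: e; exact: nbhs_right_gt.
apply: (mul_inv_vol e0 (strip_bborel hK _ _ c0 tX kX)).
  by apply: H; near: e; exact: nbhs_right_le.
by rewrite (rvol_strip hd hK mxi uxi c0 tX kX (ltW e0)) subr0.
Unshelve. all: by end_near. Qed.

(** The converse comparison. Here the enlargement falls on the strip, so [carea_cvg] removes it;
    keeping half of the transversality constant makes the enlarged sets transverse as well. *)
Lemma surface_le_carea w X c k : 0 < c -> enorm w = 1 -> transverse w X c -> compact X ->
  X `<=` sphere -> 1 < k * c -> (S X <= (k * carea K w X)%:E)%E.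
Proof.
move=> c0 w1 tX kX Xs kc.
have k0 : 0 < k by rewrite -(pmulr_lgt0 _ c0); lra.
have e0 : 0 < c / 2 by rewrite divr_gt0.
have mX : measurable (X : set (borel_rV R d)) by exact: compact_measurable_rV.
have tX0 : transverse w (shrinking X (c / 2) 0) (c / 2).
  rewrite /shrinking divr1 (_ : c / 2 = c - c / 2) //; last by lra.
  by rewrite {1}(_ : c - c / 2 = c / 2); [exact: transverse_parallel|lra].
have tXn n : transverse w (shrinking X (c / 2) n) (c / 2).
  by move=> u /(shrinking_dec e0 (leq0n n)); exact: tX0.
have kXn n : compact (shrinking X (c / 2) n) by exact: parallel_compact.
have := carea_cvg hd hK hreg mxi uxi e0 tX0 kXn (fun n m => @shrinking_dec X _ n m e0).
rewrite bigcap_shrinking//; last by have /compact_enormP[] := kX.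
move=> cc; rewrite -(fineK (S_fin mX)) lee_fin.
have kcc : k * carea K w (shrinking X (c / 2) n) @[n --> \oo] --> k * carea K w X.
  by apply: cvgM => //; exact: cvg_cst.
apply: (cvgr_to_ge kcc); apply: nearW => n.
rewrite -lee_fin fineK ?S_fin//; apply: (cvge_to_le (hS mX)).
have en0 : 0 < c / 2 / n.+1%:R by rewrite divr_gt0.
have [s s0 H] := local_parallel_sub_strip c0 w1 tX kc en0.
near=> e.
have e'0 : 0 < e by near: e; exact: nbhs_right_gt.
apply: (inv_mul_vol e'0 (strip_bborel hK _ _ e0 (tXn n) (kXn n))).
  by apply: H; near: e; exact: nbhs_right_le.
rewrite (rvol_strip hd hK mxi uxi e0 (tXn n) (kXn n)) ?subr0; last by rewrite mulr_ge0// ltW.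
by rewrite mulrCA mulrA.
Unshelve. all: by end_near. Qed.

(* If [S] missed the hemisphere, translating [K] step by step off itself along [v] would
   sweep too little volume. *)
Lemma surface_hemisphere v : enorm v = 1 -> (0 < S [set u | (0 < dot u v)%R])%E.
Proof.
move=> v1.
have mH : measurable ([set u | 0 < dot u v] : set (borel_rV R d)).
  have -> : [set u | 0 < dot u v] = ~` [set u | dot u v <= 0].
    by apply/seteqP; split => u /=; [move=> h; apply/negP; rewrite -ltNge|move/negP; rewrite -ltNge].
  apply: measurableC; apply: closed_measurable_rV.
  by apply: closed_le_fun; [apply: dot_continuous|]; [exact: idV_continuous|exact: cstV_continuous|exact: cstV_continuous].
have /compact_enormP[_ [M KM]] := body_compact hK.
have M0 : 0 <= M by have := KM _ (body_mem0 hK); rewrite enorm0.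
have bK := bborel_compact (body_compact hK).
have vK : 0 < rvol K := vol_body_gt0 uxi.
pose f e (j : nat) := translate ((j%:R * e) *: v) K.
have bf e j : bborel (f e j) by exact: bborel_translate.
(* A translated point that left [K] has a nearest point whose normal makes an acute angle with [v],
   at distance at most the step [e]. *)
have sub e : 0 < e -> f e 1%N `\` K `<=` local_parallel_set K e [set u | 0 < dot u v].
  move=> e0 x []; rewrite /f/translate/= mul1r => Kx nKx.
  have [p [u [s [Kp u1 nu [s0 xE sle]]]]] :=
    outer_proj (body_compact hK) (body_convex hK) (body_neq0 hK) nKx.
  have E : x - e *: v - p = s *: u - e *: v by rewrite xE; vring.
  have := nu _ Kx; rewrite E.
  rewrite dotBr !dotZr dot_unit// mulr1 => sev.
  exists p, u, s; split => //.
    by rewrite /= -(pmulr_rgt0 _ e0); lra.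
  split => //; rewrite s0/=; have := sle _ Kx.
  by rewrite opprB addrCA subrr addr0 enormZ v1 mulr1 gtr0_norm.
have main e : 0 < e -> e <= 1 -> (rvol K / (2 * M + 2)) * e <= rvol (f e 1%N `\` K).
  move=> e0 e1.
  have step n : rvol (f e n `\` K) <= n%:R * rvol (f e 1%N `\` K).
    elim: n => [|n IH].
      rewrite mul0r /f mul0r scale0r (_ : _ `\` _ = set0) ?/rvol ?vol_set0//.
      by apply/seteqP; split => // x [] /=; rewrite /translate/= subr0.
    have S1 : f e n.+1 `\` K `<=` (f e n.+1 `\` f e n) `|` (f e n `\` K).
      by move=> x [h1 h2]; have [h|h] := pselect (f e n x); [right|left].
    apply: le_trans (rvolS hd (bborelU (bborelD (bf _ _) (bf _ _)) (bborelD (bf _ _) bK)) S1) _.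
    apply: le_trans (rvolU_le hd hK mxi uxi (bborelD (bf _ _) (bf _ _)) (bborelD (bf _ _) bK)) _.
    have -> : f e n.+1 `\` f e n = translate ((n%:R * e) *: v) (f e 1%N `\` K).
      apply/seteqP; split => x; rewrite /f /translate/= mul1r -natr1 mulrDl mul1r scalerDl.
        by rewrite opprD addrA.
      by rewrite opprD addrA.
    by rewrite rvol_translate -natr1 mulrDl mul1r addrC lerD2r.
  (* After [N] steps the displacement exceeds the diameter bound [2 * M], so the translate is
     disjoint from [K] and the steps have swept at least the whole volume of [K]; since [e <= 1],
     [N%:R * e] stays below [2 * M + 2]. *)
  pose N := (Num.trunc ((2 * M + 1) / e)).+1.
  have /andP[N1 N2] : (Num.trunc ((2 * M + 1) / e))%:R <= (2 * M + 1) / e < N%:R.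
    by apply: truncn_itv; rewrite divr_ge0 ?ltW//; lra.
  have Ne : 2 * M + 1 < N%:R * e by rewrite -ltr_pdivrMr.
  have := step N.
  have -> : f e N `\` K = f e N.
    apply/seteqP; split => x; first by case.
    move=> h; split => // Kx.
    have H1 := KM _ h; have H2 := KM _ Kx.
    have : enorm ((N%:R * e) *: v) <= 2 * M.
      have -> : (N%:R * e) *: v = x - (x - (N%:R * e) *: v) by rewrite opprB addrCA subrr addr0.
      by apply: le_trans (enormD _ _) _; rewrite enormN; lra.
    rewrite enormZ v1 mulr1 ger0_norm; [lra|by rewrite mulr_ge0// ltW].
  rewrite rvol_translate => H.
  have Ne2 : N%:R * e <= 2 * M + 2.
    by rewrite /N -natr1 mulrDl mul1r; rewrite ler_pdivlMr// in N1; lra.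
  have r0 := rvol_ge0 (f e 1%N `\` K).
  rewrite mulrAC ler_pdivrMr; last by lra.
  nra.
apply: (@lt_le_trans _ _ ((rvol K / (2 * M + 2))%:E)).
  by rewrite lte_fin divr_gt0//; lra.
apply: (cvge_to_ge (hS mH)).
near=> e.
have e0 : 0 < e by near: e; exact: nbhs_right_gt.
rewrite lee_pdivlMl// -EFinM mulrC.
apply: (@le_trans _ _ (rvol (f e 1%N `\` K))%:E).
  by rewrite lee_fin; apply: main => //; near: e; exact: nbhs_right_le.
rewrite (rvolK hd (bborelD (bf _ _) bK)); apply: volS; exact: sub.
Unshelve. all: by end_near. Qed.

End Body.
End SurfaceArea.

(** * Angular cells *)

Lemma measure_mono (dT : measure_display) (T : measurableType dT) (R : realType)
    (mu : {measure set T -> \bar R}) (A B : set T) :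
  measurable A -> measurable B -> A `<=` B -> (mu A <= mu B)%E.
Proof. by move=> mA mB AB; apply: le_measure => //; exact: mem_set. Qed.

Lemma measure_bigU_le (dT : measure_display) (T : measurableType dT) (R : realType)
    (mu : {measure set T -> \bar R}) (I : Type) (s : seq I) (Q : pred I) (F : I -> set T) :
  (forall i, measurable (F i)) ->
  measurable (\big[setU/set0]_(i <- s | Q i) F i) /\
  (mu (\big[setU/set0]_(i <- s | Q i) F i) <= \sum_(i <- s | Q i) mu (F i))%E.
Proof.
move=> mF; elim: s => [|i s [IH1 IH2]]; first by rewrite !big_nil measure0.
rewrite !big_cons; case: (Q i) => //; split; first exact: measurableU.
by apply: (le_trans (@measureU2 _ _ _ mu _ _ (mF i) IH1)); rewrite leeD2l.
Qed.

Lemma bigsetUP (T : Type) (I : finType) (F : I -> set T) x :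
  (\big[setU/set0]_(i : I) F i) x <-> exists i, F i x.
Proof.
split; last by move=> [i Fi]; rewrite (bigD1 i)//=; left.
elim/big_ind: _ => [[]|A B IA IB [/IA|/IB]|i _ Fi]//.
by exists i.
Qed.

Section Angular.
Context {R : realType} {d : nat}.
Local Notation V := 'rV[R]_d.
Implicit Types (u v w : V).
Context (S : {finite_measure set (borel_rV R d) -> \bar R}) (S_sphere : S (~` sphere) = 0).

Lemma enormB_continuous w : continuous (fun u : V => enorm (u - w)).
Proof.
apply: enorm_continuous.
by apply: (@subV_continuous _ _ _ id (fun=> w) (@idV_continuous V)); exact: cstV_continuous.
Qed.

Lemma closed_enormB_ge w (a : R) : closed [set u : V | a <= enorm (u - w)].
Proof. by apply: closed_le_fun; [exact: cstV_continuous|exact: enormB_continuous]. Qed.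

Lemma closed_enormB_le w (a : R) : closed [set u : V | enorm (u - w) <= a].
Proof. by apply: closed_le_fun; [exact: enormB_continuous|exact: cstV_continuous]. Qed.

Lemma closed_shell w (a b : R) : closed [set u : V | a <= enorm (u - w) <= b].
Proof.
have -> : [set u : V | a <= enorm (u - w) <= b] =
    [set u | a <= enorm (u - w)] `&` [set u | enorm (u - w) <= b].
  by apply/seteqP; split => u /= => [/andP[]|[-> ->]].
by apply: closedI; [exact: closed_enormB_ge|exact: closed_enormB_le].
Qed.

Lemma sphere_net (r : R) : 0 < r -> exists q (w : 'I_q -> V),
  (forall b, enorm (w b) = 1) /\ forall u, enorm u = 1 -> exists b, enorm (u - w b) < r.
Proof.
move=> r0; have := @sphere_compact R d; rewrite compact_cover.
move=> /(_ V [set u | enorm u = 1] (fun w => [set u | enorm (u - w) < r])).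
case.
- move=> w _.
  have -> : [set u | enorm (u - w) < r] = ~` [set u | r <= enorm (u - w)].
    by apply/seteqP; split => u /=; [move=> h; apply/negP; rewrite -ltNge|move/negP; rewrite -ltNge].
  by apply: closed_openC; exact: closed_enormB_ge.
- by move=> u u1; exists u => //=; rewrite subrr enorm0.
- move=> D0 Dsub cov; pose D : seq V := finmap.enum_fset D0.
  exists (size D), (fun b => nth 0 D b); split.
    by move=> b; have /Dsub := mem_nth 0 (ltn_ord b); rewrite inE.
  move=> u /cov[w /= wD uw].
  have wi : (index w D < size D)%N by rewrite index_mem.
  by exists (Ordinal wi) => /=; rewrite nth_index.
Qed.

(* Pigeonhole over disjoint shells. *)
Lemma thin_shells q (w : 'I_q -> V) (r e : R) : 0 < r -> 0 < e ->
  exists r' eta : R, [/\ r <= r', r' + eta <= 2 * r, 0 < eta &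
    \sum_(b < q) fine (S [set u | r' <= enorm (u - w b) <= r' + eta]) <= e].
Proof.
move=> r0 e0; pose s := fine (S setT).
have s0 : 0 <= s by rewrite fine_ge0.
pose N := (Num.trunc (q%:R * s / e)).+1.
have Nq : q%:R * s < N%:R * e.
  rewrite -ltr_pdivrMr//.
  by have /andP[] := @truncn_itv _ (q%:R * s / e) (divr_ge0 (mulr_ge0 (ler0n _ _) s0) (ltW e0)).
pose h := r / N%:R; have h0 : 0 < h by rewrite divr_gt0.
pose F b (l : nat) := [set u : V | r + l%:R * h <= enorm (u - w b) < r + l.+1%:R * h].
have mF b l : measurable (F b l : set (borel_rV R d)).
  have -> : F b l = [set u | r + l%:R * h <= enorm (u - w b)] `\` [set u | r + l.+1%:R * h <= enorm (u - w b)].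
    apply/seteqP; split => u /=; first by move=> /andP[-> H]; split => //; apply/negP; rewrite -ltNge.
    by move=> [h1 /negP]; rewrite -ltNge => h2; apply/andP.
  by apply: measurableD; apply: closed_measurable_rV; exact: closed_enormB_ge.
have tF b : trivIset setT (F b).
  apply/trivIsetP => i j _ _ ij; apply/seteqP; split => // u [/andP[h1 h2] /andP[h3 h4]].
  have lt1 : (i%:R * h < j.+1%:R * h) by rewrite -(ltrD2l r); exact: le_lt_trans h4.
  have lt2 : (j%:R * h < i.+1%:R * h) by rewrite -(ltrD2l r); exact: le_lt_trans h2.
  rewrite !ltr_pM2r// !ltr_nat !ltnS in lt1 lt2.
  by move: ij; rewrite eqn_leq lt1 lt2.
have sumF b : \sum_(l < N) fine (S (F b l)) <= s.
  rewrite -lee_fin -sumEFin (eq_bigr (fun l : 'I_N => S (F b l))); last first.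
    by move=> l _; rewrite fineK// fin_num_measure.
  rewrite -(@measure_bigsetU _ _ _ S (F b) (mF b) (tF b) N) /s fineK ?fin_num_measure//.
  by apply: measure_mono => //; exact: bigsetU_measurable.
have [l Hl] : exists l : 'I_N, \sum_(b < q) fine (S (F b l)) <= e.
  apply: contrapT => H.
  have H' (l : 'I_N) : e <= \sum_(b < q) fine (S (F b l)).
    by rewrite leNgt; apply/negP => Hl; apply: H; exists l; exact: ltW.
  have : N%:R * e <= \sum_(l < N) \sum_(b < q) fine (S (F b l)).
    rewrite (le_trans _ (ler_sum _ (fun l _ => H' l)))// sumr_const card_ord.
    by rewrite -[e *+ _]mulr_natl.
  rewrite exchange_big/=.
  have : \sum_(b < q) \sum_(l < N) fine (S (F b l)) <= q%:R * s.
    rewrite (le_trans (ler_sum _ (fun b _ => sumF b)))// sumr_const card_ord.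
    by rewrite -[s *+ _]mulr_natl.
  lra.
(* Half the width places the closed shell inside the half-open one selected by the pigeonhole
   argument. *)
exists (r + l%:R * h), (h / 2); split.
- by rewrite lerDl mulr_ge0// ltW.
- have : l.+1%:R * h <= r.
    rewrite /h mulrA ler_pdivrMr// mulrC ler_pM2l// ler_nat; exact: ltn_ord.
  rewrite -natr1 mulrDl mul1r; lra.
- by rewrite divr_gt0.
- apply: le_trans Hl; apply: ler_sum => b _.
  have mC : measurable ([set u | r + l%:R * h <= enorm (u - w b) <= r + l%:R * h + h / 2] : set (borel_rV R d)).
    by apply: closed_measurable_rV; exact: closed_shell.
  apply: fine_le; [exact: fin_num_measure|exact: fin_num_measure|].
  apply: measure_mono => //.
  move=> u /= /andP[h1 h2]; apply/andP; split => //; apply: (le_lt_trans h2); have l1 : l.+1%:R = l%:R + 1 :> R by rewrite natr1.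
  rewrite l1; lra.
Qed.

(** A direction is assigned to the first ball of a net that contains it, with a neighbourhood of the
    ball's boundary removed. The gap [dl] ensures that a direction known only up to an error [dl] is
    either still in the right cell or in a margin [G] of small mass. *)
Lemma angular_cells (rho eps : R) : 0 < rho -> 0 < eps ->
  exists q (w : 'I_q -> V) (B G : 'I_q -> set V) (dl : R), [/\ 0 < dl,
    forall b, enorm (w b) = 1,
    forall b, [/\ compact (B b), B b `<=` sphere, forall u, B b u -> enorm (u - w b) <= rho &
      forall c v u, b != c -> B b u -> B c v -> dl < enorm (u - v)],
    forall b, [/\ compact (G b), G b `<=` sphere & forall u, G b u -> enorm (u - w b) <= rho] &
    [/\ \sum_(b < q) fine (S (G b)) <= eps,
        fine (S (~` \big[setU/set0]_(b < q) B b)) <= eps &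
        forall u, enorm u = 1 -> exists b, enorm (u - w b) <= rho /\
          forall v, enorm v = 1 -> enorm (v - u) <= dl -> B b v \/ G b v]].
Proof.
move=> rho0 eps0.
have r0 : 0 < rho / 2 by rewrite divr_gt0.
have [q [w [w1 cov]]] := sphere_net r0.
(* Each of the [q] sets [G b] may contain the same part of the margins, so the tolerance is shared
   among them. *)
have e'0 : 0 < eps / (q%:R + 1) by rewrite divr_gt0// ltr_wpDl.
have [r [eta [rr r2 eta0 Hsum]]] := thin_shells w r0 e'0.
(* Cells stop at radius [rm - dl] and stay outside [rm + dl] of all earlier centres. Both radii are
   interior to the thin shell with room [dl], so displacements by [dl] cannot cross it. *)
pose rm := r + eta / 2; pose dl := eta / 4.
pose M b := [set u | r <= enorm (u - w b) <= r + eta].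
pose B (b : 'I_q) := sphere `&` [set u | enorm (u - w b) <= rm - dl] `&`
  \bigcap_(c in [set c : 'I_q | (c < b)%N]) [set u | rm + dl <= enorm (u - w c)].
pose MM := \big[setU/set0]_(b < q) (sphere `&` M b).
pose G (b : 'I_q) := MM `&` [set u | enorm (u - w b) <= rho].
have cM b : closed (M b) by exact: closed_shell.
have cMM : closed MM.
  rewrite /MM; elim/big_ind: _ => //; first exact: closed0.
    by move=> *; exact: closedU.
  by move=> b _; apply: closedI => //; exact: norm_closed_sphere.
have sMM : fine (S MM) <= eps / (q%:R + 1).
  apply: le_trans Hsum; rewrite /MM.
  have mSM b : measurable (sphere `&` M b : set (borel_rV R d)).
    by apply: closed_measurable_rV; apply: closedI => //; exact: norm_closed_sphere.
  rewrite -lee_fin -sumEFin fineK; last by rewrite fin_num_measure//; exact: closed_measurable_rV.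
  apply: (@le_trans _ _ (\sum_(b < q) S (sphere `&` M b))%E).
    by have [] := measure_bigU_le S (index_enum 'I_q) xpredT mSM.
  have mM b : measurable (M b : set (borel_rV R d)) by apply: closed_measurable_rV; exact: cM.
  apply: lee_sum => b _; rewrite fineK; last exact: (fin_num_measure S _ (mM b)).
  apply: (measure_mono S (mSM b) (mM b)) => u [_ Mu]; exact: Mu.
have cB b : closed (B b).
  apply: closedI; first by apply: closedI; [exact: norm_closed_sphere|exact: closed_enormB_le].
  by apply: closed_bigI => c _; exact: closed_enormB_ge.
have ksub (A : set V) : closed A -> A `<=` sphere -> compact A.
  by move=> cA As; apply: (subclosed_compact cA (@sphere_compact R d)).
have MMs : MM `<=` sphere by move=> u /bigsetUP[b []].
(* trichotomy: each direction is in the first cell whose ball contains it, or in a margin *)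
have tri u v b : enorm u = 1 -> enorm v = 1 -> enorm (v - u) <= dl ->
    enorm (u - w b) < rm + dl -> (forall c : 'I_q, (c < b)%N -> rm + dl <= enorm (u - w c)) ->
    B b v \/ MM v.
  move=> u1 v1 vu ub uc.
  have [h|h] := leP (enorm (v - w b)) (rm - dl); last first.
    right; apply/bigsetUP; exists b; split => //; apply/andP.
    have := enorm_dist v u (w b); rewrite /rm /dl in h ub vu *; split; lra.
  have [[c cb hc]|nh] := pselect (exists2 c : 'I_q, (c < b)%N & enorm (v - w c) < rm + dl).
    right; apply/bigsetUP; exists c; split => //; apply/andP.
    have := enorm_dist u v (w c); rewrite [enorm (u - v)]enormB.
    have := uc c cb; rewrite /rm /dl in hc vu *; split; lra.
  left; split; first by split.
  by move=> c /= cb; rewrite leNgt; apply/negP => hc; apply: nh; exists c.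
have first u : enorm u = 1 -> exists b : 'I_q, enorm (u - w b) < rm + dl /\
    forall c : 'I_q, (c < b)%N -> rm + dl <= enorm (u - w c).
  move=> u1; have [b0 ub0] := cov u u1.
  have ub0' : enorm (u - w b0) < rm + dl by rewrite /rm /dl; lra.
  case: (@arg_minnP _ b0 (fun b => enorm (u - w b) < rm + dl) (fun b => b : nat) ub0').
  move=> b ub bmin; exists b; split => // c cb; rewrite leNgt; apply/negP => /bmin.
  by rewrite leqNgt cb.
exists q, w, B, G, dl; split => //.
- by rewrite divr_gt0.
- move=> b; split => //.
  + by apply: ksub => // u [[]].
  + by move=> u [[]].
  + by move=> u [[_ /= ub] _]; apply: le_trans ub _; rewrite /rm /dl; lra.
  + move=> c v u bc Bu Bv.
    have dl0 : 0 < dl by rewrite divr_gt0.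
    wlog cb : b c u v bc Bu Bv / (c < b)%N.
      move=> H; case: (ltngtP c b) => [cb|cb|cb]; first exact: (H b c).
        by rewrite enormB; apply: (H c b) => //; rewrite eq_sym.
      by move: bc; rewrite (ord_inj cb) eqxx.
    have [_ /(_ c cb)/= h1] := Bu; have [[_ /= h2] _] := Bv.
    have := enorm_dist u v (w c); lra.
- move=> b; split.
  + by apply: ksub => [|u [/MMs]//]; apply: closedI => //; exact: closed_enormB_le.
  + by move=> u [/MMs].
  + by move=> u [].
- split.
  + apply: (@le_trans _ _ (\sum_(b < q) (eps / (q%:R + 1)))).
      apply: ler_sum => b _; apply: le_trans sMM.
      have mMM : measurable (MM : set (borel_rV R d)) by exact: closed_measurable_rV.
      have mGb : measurable (G b : set (borel_rV R d)).
        by apply: closed_measurable_rV; apply: closedI => //; exact: closed_enormB_le.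
      apply: fine_le; [exact: fin_num_measure|exact: fin_num_measure|].
      by apply: measure_mono => // u [].
    rewrite sumr_const card_ord -[_ *+ q]mulr_natl mulrA ler_pdivrMr ?ltr_wpDl//.
    by rewrite mulrDr mulr1 mulrC lerDl ltW.
  + have ee : eps / (q%:R + 1) <= eps.
      by rewrite ler_pdivrMr ?ltr_wpDl// mulrDr mulr1 lerDr mulr_ge0// ltW.
    have mMM : measurable (MM : set (borel_rV R d)) by exact: closed_measurable_rV.
    have msp : measurable (~` sphere : set (borel_rV R d)).
      by apply: measurableC; apply: closed_measurable_rV; exact: norm_closed_sphere.
    have mB : measurable (~` \big[setU/set0]_(b < q) B b : set (borel_rV R d)).
      by apply: measurableC; apply: bigsetU_measurable => b _; exact: closed_measurable_rV.
    apply: le_trans (le_trans sMM ee).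
    apply: fine_le; [exact: fin_num_measure|exact: fin_num_measure|].
    apply: (@le_trans _ _ (S (~` sphere `|` MM))); last first.
      apply: (le_trans (@measureU2 _ _ _ S _ _ msp mMM)).
      by rewrite [X in (X + _)%E](_ : _ = 0%E) ?add0e; last exact: S_sphere.
    apply: measure_mono => //; first exact: measurableU.
    move=> u nB; have [u1|] := pselect (sphere u); [right|by left].
    have [b [ub uc]] := first u u1.
    have uu : enorm (u - u) <= dl by rewrite subrr enorm0 divr_ge0// ltW.
    have [Bu|//] := tri u u b u1 u1 uu ub uc.
    by exfalso; apply: nB; apply/bigsetUP; exists b.
  + move=> u u1; have [b [ub uc]] := first u u1; exists b; split.
      by apply: (le_trans (ltW ub)); rewrite /rm /dl; lra.
    move=> v v1 vu; have [|Mv] := tri u v b u1 v1 vu ub uc; [by left|right; split => //=].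
    have := enorm_dist v u (w b); rewrite /rm /dl in ub vu *; lra.
Qed.
End Angular.

(** * Polars of translates *)

Section ScaledPolar.
Context {R : realType} {d : nat}.
Local Notation V := 'rV[R]_d.
Implicit Types (x y z u v w : V).
Variables (K : set V).

Definition spol (n : nat) x : set V :=
  [set n%:R^-1 *: y | y in polar [set y - x | y in K]].

Definition seg (z : V) : set V := [set s *: z | s in `[0, 1]%classic].

Definition hclose (A B : set V) (e : R) := A `<=` parallel_set B e /\ B `<=` parallel_set A e.

(** For [z = (t, u)], the far end of the segment polar to the half-space with normal [u] at distance
    [t]. *)
Definition tip (z : R * V) : V := z.1^-1 *: z.2.

Lemma spolP n x z : (0 < n)%N ->
  spol n x z <-> forall k, K k -> n%:R * dot (k - x) z <= 1.
Proof.
move=> n0; have n0' : (n%:R : R) != 0 by rewrite pnatr_eq0 -lt0n.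
split.
  move=> [y py <-] k Kk; rewrite dotZr mulrA divff// mul1r.
  by apply: py; exists k.
move=> H; exists (n%:R *: z); last by rewrite scalerA mulVf// scale1r.
by move=> _ [k Kk <-]; rewrite dotZr; exact: H.
Qed.

(** Seen from [y - t *: w], the support of [K] in direction [u] is [t * dot w u], hence at most
    [t]. *)
Lemma seg_sub_spol n y u w (t c : R) : (0 < n)%N -> 0 < t -> enorm u = 1 -> enorm w = 1 ->
  normal_cone K y u -> 0 <= c <= 1 -> spol n (y - t *: w) (c *: ((n%:R * t)^-1 *: u)).
Proof.
move=> n0 t0 u1 w1 nu /andP[c0 c1]; apply/spolP => // k Kk.
have n0' : 0 < (n%:R : R) by rewrite ltr0n.
rewrite !dotZr mulrCA [n%:R * (_ * _)]mulrA.
have -> : n%:R * (n%:R * t)^-1 = t^-1 by field; rewrite !gt_eqF.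
have H : t^-1 * dot (k - (y - t *: w)) u <= 1.
  rewrite mulrC ler_pdivrMr// mul1r.
  have -> : k - (y - t *: w) = (k - y) + t *: w by vring.
  rewrite dotC dotDr dotZr; have := nu k Kk; have := dot_unitl w u1; rewrite w1.
  nra.
by apply: le_trans (ler_wpM2l c0 H) _; rewrite mulr1.
Qed.

Lemma spol_near_segment n y u w z (t r e s : R) : (0 < n)%N -> 0 < t -> K y ->
  enorm u = 1 -> enorm w = 1 -> normal_cone K y u -> enorm (u - w) <= r -> 0 < r -> r <= 4^-1 ->
  (forall v, enorm v = 1 -> (forall k, K k -> dot v (k - y) <= s) -> enorm (u - v) <= r) ->
  0 < e -> (n%:R * e)^-1 + t <= s -> spol n (y - t *: w) z -> e < enorm z ->
  exists2 c, 0 <= c <= 1 & enorm (z - c *: ((n%:R * t)^-1 *: u)) <= 3 * r / (n%:R * t).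
Proof.
move=> n0 t0 Ky u1 w1 nu uw r0 r4 gauss e0 es /spolP - /(_ n0) Hz ez.
have n0' : 0 < (n%:R : R) by rewrite ltr0n.
have z0 : 0 < enorm z by exact: lt_trans ez.
have zn0 : z != 0 by apply: contra_ltN z0 => /eqP ->; rewrite enorm0.
pose v := (enorm z)^-1 *: z.
have v1 : enorm v = 1 by exact: enorm_normalize.
have zE : z = enorm z *: v by rewrite scalerA divff ?scale1r// gt_eqF.
have Hv k : K k -> n%:R * enorm z * dot v (k - (y - t *: w)) <= 1.
  by move=> Kk; have := Hz k Kk; rewrite {1}zE dotZr mulrA dotC.
have ut : enorm (u - v) <= r.
  apply: gauss => // k Kk; apply: le_trans es.
  have -> : k - y = (k - (y - t *: w)) - t *: w by vring.
  rewrite dotBr dotZr; apply: lerD; last first.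
    have := dot_normr v w; rewrite v1 w1 mulr1 ler_norml => /andP[h _]; nra.
  apply: (@le_trans _ _ (n%:R * enorm z)^-1).
    by rewrite -[leRHS]mul1r ler_pdivlMr ?mulr_gt0// mulrC; exact: Hv.
  by rewrite lef_pV2 ?posrE ?mulr_gt0// ler_pM2l// ltW.
have wv : enorm (w - v) <= 2 * r.
  have := enorm_dist w u v; rewrite [enorm (w - u)]enormB; lra.
(* For unit vectors the inner product is 1 minus half the squared distance, and the distance is at
   most [2 * r]. *)
have dwv : 1 - 2 * r ^+ 2 <= dot w v.
  have := enorm_sqrB w1 v1; have := enorm_ge0 (w - v); nra.
pose t' := n%:R * t; have t'0 : 0 < t' by rewrite mulr_gt0.
pose a := enorm z * t'.
have a0 : 0 < a by rewrite mulr_gt0.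
have adot : a * dot w v <= 1.
  have := Hv y Ky; have -> : y - (y - t *: w) = t *: w by vring.
  by rewrite dotZr [dot v w]dotC /a /t' => h; apply: le_trans h; rewrite le_eqVlt; apply/orP; left; apply/eqP; ring.
have r2 : r ^+ 2 <= 16^-1 by rewrite expr2; nra.
have d78 : 7 / 8 <= dot w v by lra.
have a87 : a * 7 <= 8.
  have : a * (7 / 8) <= a * dot w v by rewrite ler_pM2l.
  lra.
have a1r : a - 1 <= r.
  have h1 : a * (1 - 2 * r ^+ 2) <= 1 by apply: le_trans adot; rewrite ler_pM2l.
  have h2 : a * r <= 8 / 7 * r by rewrite ler_pM2r//; lra.
  have h3 : a * r * r <= 8 / 7 * r * 4^-1.
    by apply: ler_pM => //; rewrite ?mulr_ge0// ltW.
  have h4 : a * (1 - 2 * r ^+ 2) = a - 2 * (a * r * r) by ring.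
  lra.
(* [a] is the length of [z] in units of the segment. It may exceed 1 by at most [r], and is then cut
   back to the tip. *)
exists (Num.min a 1); first by rewrite le_min ltW//= ler01 ge_min lexx orbT.
set c := Num.min a 1.
have ac : `|a - c| <= r.
  rewrite /c; have [h|h] := leP a 1; first by rewrite subrr normr0 ltW.
  by rewrite ger0_norm// subr_ge0 ltW.
have -> : z - c *: (t'^-1 *: u) = t'^-1 *: (a *: (v - u) + (a - c) *: u).
  have zE2 : z = t'^-1 *: (a *: v) by rewrite scalerA mulrC /a mulfK ?gt_eqF.
  by rewrite {1}zE2; vring.
rewrite enormZ gtr0_norm ?invr_gt0// mulrC ler_pM2r ?invr_gt0//.
apply: le_trans (enormD _ _) _; rewrite !enormZ u1 mulr1 gtr0_norm//.
rewrite enormB; have : a * enorm (u - v) <= 8 / 7 * r.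
  by apply: ler_pM => //; [exact: ltW|exact: enorm_ge0|lra].
lra.
Qed.

(** A long vector in the polar says that [K] extends less than [T / (2 n)] beyond [x] in its
    direction. As [w] has inner product at least 1/2 with that direction, the ray from [x] along [w]
    leaves [K] before [T / n]. *)
Lemma spol_far n x z (w : V) (T : R) : in_K0 K -> regular_body K -> (0 < n)%N -> 0 < T -> K x ->
  enorm w = 1 -> spol n x z -> 2 / T < enorm z ->
  enorm ((enorm z)^-1 *: z - w) <= 4^-1 ->
  exists y u t, [/\ K y, normal_cone K y u, enorm u = 1, x = y - t *: w & [/\ 0 <= t, n%:R * t < T &
    forall k, K k -> dot ((enorm z)^-1 *: z) (k - y) <= T / n%:R]].
Proof.
move=> hK hreg n0 T0 Kx w1 /spolP - /(_ n0) Hz zT vw.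
have n0' : 0 < (n%:R : R) by rewrite ltr0n.
have z0 : 0 < enorm z by apply: lt_trans zT; rewrite divr_gt0.
have zn0 : z != 0 by apply: contra_ltN z0 => /eqP ->; rewrite enorm0.
pose v := (enorm z)^-1 *: z.
have v1 : enorm v = 1 by exact: enorm_normalize.
have Hv k : K k -> n%:R * dot v (k - x) < T / 2.
  move=> Kk; rewrite /v dotZl mulrCA mulrC ltr_pdivrMr//.
  have := Hz k Kk; rewrite dotC => h; apply: le_lt_trans h _.
  by rewrite -ltr_pdivrMl ?divr_gt0// mulr1 invf_div.
have wv : 2^-1 <= dot w v.
  have := enorm_sqrB w1 v1; rewrite enormB in vw; have := enorm_ge0 (w - v); nra.
have [t t0 [Ky nKy]] := exit_point (body_compact hK) Kx w1.
have [u u1 nu] := normal_exists hreg Ky nKy.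
exists (x + t *: w), u, t; split => //; first by rewrite addrK.
have tT : n%:R * t < T.
  have := Hv _ Ky; rewrite addrAC subrr add0r dotZr [dot v w]dotC; nra.
split => // k Kk.
rewrite ler_pdivlMr// mulrC opprD addrA dotBr dotZr [dot v w]dotC mulrBr.
have := Hv k Kk; have : 0 <= n%:R * (t * dot w v) by rewrite !mulr_ge0//; lra.
lra.
Qed.

End ScaledPolar.

(** * Meshes of cells *)

Section Mesh.
Context {R : realType} {d : nat}.
Local Notation V := 'rV[R]_d.
Implicit Types (x y z u v w : V).

(** Time is cut into [mN] slabs of length [mh] starting at [mtlo], directions into the [mq] sets
    [mB]. [mrate e] is [n] times the probability that a uniform point falls in [mA n e], valid for
    [n] at least [mn0]. *)
Record mesh_data := MeshData {
  mN : nat;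
  mq : nat;
  mtlo : R;
  mh : R;
  mB : 'I_mq -> set V;
  mA : nat -> 'I_mN * 'I_mq -> set V;
  mX : nat -> set V;
  mrate : 'I_mN * 'I_mq -> R;
  mn0 : nat }.

Definition mtime (m : mesh_data) (a : nat) : R := mtlo m + a%:R * mh m.

Definition mcell (m : mesh_data) (e : 'I_(mN m) * 'I_(mq m)) : set (R * V) :=
  [set z | mtime m e.1 <= z.1 < mtime m e.1.+1 /\ mB e.2 z.2].

Variables (K : set V) (S : {finite_measure set (borel_rV R d) -> \bar R}).

Definition mlam (m : mesh_data) (e : 'I_(mN m) * 'I_(mq m)) : R :=
  mh m * fine (S (mB e.2)) / rvol K.

(* [mcell] are the cells of the limiting Poisson process, [mA n] the corresponding regions
   for a uniform point among [n], [mX n] the exceptional region. *)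
Record is_mesh (T eps : R) (m : mesh_data) : Prop := IsMesh {
  im_n0 : (0 < mn0 m)%N;
  im_tlo : 0 < mtlo m;
  im_h : 0 < mh m <= eps;
  im_T : T <= mtime m (mN m) <= T + 2;
  im_mB : forall b : 'I_(mq m), measurable (mB b : set (borel_rV R d));
  im_Bs : forall b : 'I_(mq m), mB b `<=` sphere;
  im_Bdiam : forall (b : 'I_(mq m)) u v, mB b u -> mB b v -> enorm (u - v) <= eps;
  im_Bdisj : forall (b c : 'I_(mq m)) u, mB b u -> mB c u -> b = c;
  im_tip : forall e p p', @mcell m e p -> @mcell m e p' -> enorm (tip p - tip p') <= eps;
  im_exc : (mtlo m * fine (S setT) +
     (T + 2) * fine (S (~` \big[setU/set0]_(b < mq m) mB b))) / rvol K <= eps;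
  im_rate0 : forall e, 0 <= @mrate m e;
  im_rate : forall e, @mrate m e <= mlam e;
  im_ratediff : \sum_e (mlam e - @mrate m e) <= eps;
  im_lamsq : \sum_e (@mlam m e) ^+ 2 <= eps;
  im_mA : forall n e, (mn0 m <= n)%N -> measurable (@mA m n e : set (borel_rV R d));
  im_Aint : forall n e, (mn0 m <= n)%N -> @mA m n e `<=` K°;
  im_Adisj : forall n e f x, (mn0 m <= n)%N -> @mA m n e x -> @mA m n f x -> e = f;
  im_Avol : forall n e, (mn0 m <= n)%N -> rvol (@mA m n e) / rvol K = @mrate m e / n%:R;
  im_mX : forall n, (mn0 m <= n)%N -> measurable (mX m n : set (borel_rV R d));
  im_Xint : forall n, (mn0 m <= n)%N -> mX m n `<=` K;
  im_Xvol : forall n, (mn0 m <= n)%N -> rvol (mX m n) / rvol K <= eps / n%:R;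
  im_rest : forall n x, (mn0 m <= n)%N -> K° x -> (forall e, ~ @mA m n e x) -> ~ mX m n x ->
    forall z, spol K n x z -> enorm z <= 2 / T;
  im_close : forall n e x p, (mn0 m <= n)%N -> @mA m n e x -> @mcell m e p ->
    hclose (spol K n x) (seg (tip p)) eps }.

Context (hd : (0 < d)%N) (hK : in_K0 K) (hreg : regular_body K).
Context (hS : is_surface_area_measure K S).
Context {dO : measure_display} {O : measurableType dO} (P : probability O R).
Context (xi : O -> borel_rV R d) (mxi : measurable_fun setT xi) (uxi : uniform_on P K xi).

Lemma tip_dist (tlo h r : R) (z z' : R * V) : 0 < tlo -> 0 <= r ->
  tlo <= z.1 -> tlo <= z'.1 -> `|z.1 - z'.1| <= h -> enorm z'.2 = 1 ->
  enorm (z.2 - z'.2) <= r -> enorm (tip z - tip z') <= r / tlo + h / tlo ^+ 2.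
Proof.
move=> tlo0 r0 h1 h2 hh u1 ur; rewrite /tip.
have t0 : 0 < z.1 by exact: lt_le_trans h1.
have t'0 : 0 < z'.1 by exact: lt_le_trans h2.
have -> : z.1^-1 *: z.2 - z'.1^-1 *: z'.2 = z.1^-1 *: (z.2 - z'.2) + (z.1^-1 - z'.1^-1) *: z'.2 by vring.
apply: le_trans (enormD _ _) _; rewrite !enormZ u1 mulr1; apply: lerD.
  rewrite ger0_norm; last by rewrite invr_ge0 ltW.
  rewrite mulrC; apply: ler_pM => //; first exact: enorm_ge0.
    by rewrite invr_ge0 ltW.
  by rewrite lef_pV2 ?posrE.
have -> : z.1^-1 - z'.1^-1 = (z'.1 - z.1) * (z.1 * z'.1)^-1.
  by field; rewrite !gt_eqF.
rewrite normrM (ger0_norm (x := _^-1)); last by rewrite invr_ge0 mulr_ge0// ltW.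
rewrite distrC; apply: ler_pM => //; first by rewrite invr_ge0 mulr_ge0// ltW.
rewrite lef_pV2 ?posrE ?mulr_gt0 ?exprn_gt0// expr2.
by apply: ler_pM => //; exact: ltW.
Qed.

Lemma surface_sphere : S (~` sphere) = 0.
Proof.
apply: (S_off_sphere hd hS); last by rewrite setICl.
by apply: measurableC; apply: closed_measurable_rV; exact: norm_closed_sphere.
Qed.

Lemma transverse_ball w (X : set V) (r : R) : enorm w = 1 ->
  (forall u, X u -> enorm (u - w) <= r) -> transverse w X (1 - r ^+ 2 / 2).
Proof.
move=> w1 Xr u Xu u1; have := Xr u Xu; have := enorm_sqrB u1 w1; have := enorm_ge0 (u - w).
move=> h0 h1 h2; have : enorm (u - w) ^+ 2 <= r ^+ 2 by rewrite !expr2 ler_pM.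
lra.
Qed.

End Mesh.

(** A time [tau] corresponds to depth [tau / n] below the boundary, measured along the centre [w b]
    of the angular cell. The region of a cell is a strip, so its volume is exactly proportional to
    [h / n], and the only loss against the Poisson intensity is the cosine factor. *)
Lemma mesh_exists (R : realType) (d : nat) (K : set 'rV[R]_d)
    (S : {finite_measure set (borel_rV R d) -> \bar R})
    (hd : (0 < d)%N) (hK : in_K0 K) (hreg : regular_body K) (hS : is_surface_area_measure K S)
    (dO : measure_display) (O : measurableType dO) (P : probability O R)
    (xi : O -> borel_rV R d) (mxi : measurable_fun setT xi) (uxi : uniform_on P K xi)
    (T eps : R) : 0 < T -> 0 < eps -> exists m, is_mesh K S T eps m.
Proof.
pose V := 'rV[R]_d.
move=> T0 eps0.
have surface_sphere := surface_sphere hd hS.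
set s := fine (S setT); have s0 : 0 <= s by rewrite fine_ge0.
set vK := rvol K; have vK0 : 0 < vK := vol_body_gt0 uxi.
pose D := (T + 2) * (s + 1).
have D0 : 0 < D by rewrite mulr_gt0//; lra.
(* Times before [tlo] are given up because tips blow up there; their mass is at most half of the
   tolerance. *)
pose tlo : R := Num.min 1 (eps * vK / (2 * D)).
have ev0 : 0 < eps * vK by exact: mulr_gt0.
have tlo0 : 0 < tlo by rewrite lt_min ltr01 divr_gt0//; exact: mulr_gt0.
have tlo1 : tlo <= 1 by rewrite ge_min lexx.
have tloD : tlo * D <= eps * vK / 2.
  have : tlo * (2 * D) <= eps * vK by rewrite -ler_pdivlMr; [rewrite ge_min lexx orbT|exact: mulr_gt0].
  lra.
pose ea := eps * vK / (4 * D); have ea0 : 0 < ea by rewrite divr_gt0//; exact: mulr_gt0.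
(* The three bounds serve, in order, [spol_near_segment], the accuracy of tips of norm up to
   [1 / tlo], and the total defect of the rates. *)
pose r : R := Num.min 4^-1 (Num.min (tlo * eps / 10) (eps * vK / D)).
have r0 : 0 < r.
  rewrite !lt_min invr_gt0 ltr0n/=; apply/andP; split; last exact: divr_gt0.
  by apply: divr_gt0 => //; exact: mulr_gt0.
have r4 : r <= 4^-1 by rewrite ge_min lexx.
have rtlo : r * 10 <= tlo * eps by rewrite -ler_pdivlMr// !ge_min lexx orbT.
have rD : r * D <= eps * vK by rewrite -ler_pdivlMr// !ge_min lexx !orbT.
(* The bound 1 keeps the horizon below [T + 2], the third controls tips, whose dependence on time
   has slope up to [1 / tlo ^+ 2], and the last the sum of squared intensities, that is, multiple
   occupancy. *)
pose h : R := Num.min 1 (Num.min eps (Num.min (tlo ^+ 2 * eps / 4) (eps * vK ^+ 2 / (D * (s + 1))))).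
have Ds0 : 0 < D * (s + 1) by apply: mulr_gt0 => //; lra.
have h0 : 0 < h.
  rewrite !lt_min ltr01 eps0/=; apply/andP; split; apply: divr_gt0 => //;
  by apply: mulr_gt0 => //; exact: exprn_gt0.
have h1 : h <= 1 by rewrite ge_min lexx.
have heps : h <= eps by rewrite !ge_min lexx orbT.
have htlo : h * 4 <= tlo ^+ 2 * eps by rewrite -ler_pdivlMr// !ge_min lexx !orbT.
have hD : h * (D * (s + 1)) <= eps * vK ^+ 2.
  by rewrite -ler_pdivlMr// !ge_min lexx !orbT.
pose N := (Num.trunc (T / h)).+1.
have [N1 N2] : T < N%:R * h /\ N%:R * h <= T + h.
  have /andP[n1 n2] := @truncn_itv _ (T / h) (ltW (divr_gt0 T0 h0)).
  rewrite -ltr_pdivrMr//; split => //.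
  by rewrite ler_pdivlMr// in n1; rewrite /N -natr1 mulrDl mul1r lerD2r.
have DE : D = (T + 2) * (s + 1) by [].
have eaD : D * ea = eps * vK / 4 by rewrite /ea; field; rewrite gt_eqF.
have sE Z : Z = setT -> fine (S Z) = s by move=> ->.
have vKE Z : Z = K -> rvol Z = vK by move=> ->.
clearbody D tlo ea r h N s vK.
have [q [w [B [G [dl [dl0 w1 BP GP [SG SB cov]]]]]]] := angular_cells surface_sphere r0 ea0.
have [s1 s10 gauss1] := gauss_uniform hK hreg r0.
have dl20 : 0 < dl / 2 by rewrite divr_gt0.
have [s2 s20 gauss2] := gauss_uniform hK hreg dl20.
have half0 : 0 < 2^-1 :> R by rewrite invr_gt0.
have [s3 s30 cone] := inner_cone hK hreg half0.
(* With [C / n] below all geometric thresholds, two displacements of depth [(T + 2) / n] and the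
   slack [1 / (n * eps)] from a polar vector longer than [eps] are simultaneously harmless. *)
pose C := 2 * (T + 2) + eps^-1.
have C0 : 0 < C by rewrite addr_gt0 ?invr_gt0 ?mulr_gt0//; lra.
pose sm := Num.min s1 (Num.min s2 s3).
have sm0 : 0 < sm by rewrite !lt_min s10 s20 s30.
pose n0 := (Num.trunc (C / sm)).+1.
have nP n : (n0 <= n)%N -> [/\ (0 < n)%N, 0 < n%:R :> R & C / n%:R <= sm].
  move=> nn; have n00 : (0 < n)%N by exact: leq_trans nn.
  split => //; first by rewrite ltr0n.
  rewrite ler_pdivrMr ?ltr0n// mulrC -ler_pdivrMr//.
  have /andP[_ k2] := @truncn_itv _ (C / sm) (ltW (divr_gt0 C0 sm0)).
  by apply: le_trans (ltW k2) _; rewrite ler_nat.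
have CE : C = 2 * (T + 2) + eps^-1 by [].
have sms : [/\ sm <= s1, sm <= s2 & sm <= s3] by rewrite /sm !ge_min !lexx !orbT.
have [sm1 sm2 sm3] := sms.
have n00 : (0 < n0)%N by [].
clearbody C sm n0.
pose c := 1 - r ^+ 2 / 2.
have r2 : r ^+ 2 <= r / 4 by rewrite expr2; clear -r0 r4; nra.
have c78 : 7 / 8 <= c by rewrite /c; clear -r2 r4; lra.
have c0 : 0 < c by clear -c78; lra.
have cE : c = 1 - r ^+ 2 / 2 by [].
have kB b : compact (B b) by have [] := BP b.
have Bs b : B b `<=` sphere by have [] := BP b.
have Bw b u : B b u -> enorm (u - w b) <= r by have [_ _ + _] := BP b; apply.
have kG b : compact (G b) by have [] := GP b.
have Gw b u : G b u -> enorm (u - w b) <= r by have [_ _] := GP b; apply.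
have tB b : transverse (w b) (B b) c by exact: (transverse_ball (w1 b) (Bw b)).
have tG b : transverse (w b) (G b) c by exact: (transverse_ball (w1 b) (Gw b)).
pose ca b := carea K (w b) (B b); pose cg b := carea K (w b) (G b).
have mB b : measurable (B b : set (borel_rV R d)) by exact: compact_measurable_rV.
have mG b : measurable (G b : set (borel_rV R d)) by exact: compact_measurable_rV.
have fS (Z : set (borel_rV R d)) : measurable Z -> (fine (S Z))%:E = S Z by move=> mZ; rewrite fineK// fin_num_measure.
have caS b : ca b <= fine (S (B b)).
  rewrite -lee_fin (fS _ (mB b)).
  exact: (carea_le_surface hd hK hreg mxi uxi hS c0 (w1 b) (tB b) (kB b)).
have cgS b : cg b <= fine (S (G b)).
  rewrite -lee_fin (fS _ (mG b)).
  exact: (carea_le_surface hd hK hreg mxi uxi hS c0 (w1 b) (tG b) (kG b)).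
have ca0 b : 0 <= ca b by exact: carea_ge0.
have cg0 b : 0 <= cg b by exact: carea_ge0.
have SB0 b : 0 <= fine (S (B b)) by rewrite fine_ge0.
(* The factor is admissible because [(1 + r) * (1 - r ^+ 2 / 2)] exceeds 1 for [0 < r <= 1/4]. *)
have Sca b : fine (S (B b)) <= (1 + r) * ca b.
  rewrite -lee_fin (fS _ (mB b)).
  apply: (surface_le_carea hd hK hreg mxi uxi hS c0 (w1 b) (tB b) (kB b) (Bs b)).
  by rewrite cE; clear -r2 r0 r4; nra.
have caE b : carea K (w b) (B b) = ca b by [].
have cgE b : carea K (w b) (G b) = cg b by [].
clearbody ca cg.
have [sB sBE] : exists sB : 'I_q -> R, forall b, fine (S (B b)) = sB b by eexists.
have [sG sGE] : exists sG : 'I_q -> R, forall b, fine (S (G b)) = sG b by eexists.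
have [sC sCE] : exists sC : R, forall Z, Z = (~` \big[setU/set0]_(b < q) B b) -> fine (S Z) = sC by eexists => Z ->; reflexivity.
rewrite (sCE _ erefl) in SB; rewrite (eq_bigr _ (fun b _ => sGE b)) in SG.
have caS' b : ca b <= sB b by rewrite -sBE.
have cgS' b : cg b <= sG b by rewrite -sGE.
have SB0' b : 0 <= sB b by rewrite -sBE.
have sG0 b : 0 <= sG b by rewrite -sGE fine_ge0.
have sC0 : 0 <= sC by rewrite -(sCE _ erefl) fine_ge0.
have Sca' b : sB b <= (1 + r) * ca b by rewrite -sBE.
move: caS cgS SB0 Sca => _ _ _ _.
have Bdisj b b' u : B b u -> B b' u -> b = b'.
  move=> Bu B'u; apply: contrapT => /eqP bb; have [_ _ _ /(_ b' u u bb Bu B'u)] := BP b.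
  by rewrite subrr enorm0 ltNge ltW.
have sumSB : \sum_(b < q) sB b <= s.
  rewrite -(eq_bigr _ (fun b _ => sBE b)).
  rewrite -lee_fin -sumEFin (eq_bigr (fun b => S (B b))); last by move=> b _; exact: fS.
  rewrite -(sE _ erefl) fS//.
  have tB' : trivIset setT B.
    apply/trivIsetP => b b' _ _ bb; apply/seteqP; split => // u [h2 h3].
    by move: bb; rewrite (Bdisj b b' u h2 h3) eqxx.
  have mUB : measurable (\big[setU/set0]_(b < q) B b : set (borel_rV R d)) by exact: bigsetU_measurable.
  by rewrite -(measure_semi_additive_ord S mB tB' mUB); exact: measure_mono.
have [mt mtE] : exists mt : nat -> R, forall a, mt a = tlo + a%:R * h by eexists.
have mtS a : mt a.+1 = mt a + h by rewrite !mtE -natr1 mulrDl mul1r addrA.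
have mt0 a : tlo <= mt a by rewrite mtE lerDl mulr_ge0// ltW.
have mtmono a a' : (a <= a')%N -> mt a <= mt a' by move=> aa; rewrite !mtE lerD2l ler_pM2r// ler_nat.
have mtT : T <= mt N <= T + 2 by apply/andP; rewrite !mtE; clear -N1 N2 tlo0 tlo1 h1; split; lra.
have mtT2 (a : 'I_N) : mt a.+1 <= T + 2 by case/andP: mtT => _; apply: le_trans; exact: mtmono.
(* The strip parameter counts outward displacement, so depths enter with a minus sign and the order
   of the two times is reversed. *)
pose A (n : nat) (e : 'I_N * 'I_q) : set V :=
  strip K (w e.2) (B e.2) (- (mt e.1.+1 / n%:R)) (- (mt e.1 / n%:R)).
have AP n e x : (0 < n%:R :> R) -> A n e x -> exists y u t, [/\ K y, B e.2 u, normal_cone K y u, enorm u = 1 &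
    [/\ x = y - t *: w e.2, mt e.1 <= n%:R * t, n%:R * t < mt e.1.+1 & 0 < t]].
  move=> n0' [y [u [t [Ky Bu nu u1 [/andP[h2 h3] ->]]]]].
  exists y, u, (- t); split => //.
  have h4 : mt e.1 <= n%:R * - t by rewrite mulrC -ler_pdivrMr//; clear -h2 h3; lra.
  split => //; first by rewrite scaleNr opprK.
    by rewrite mulrC -ltr_pdivlMr//; clear -h2 h3; lra.
  by rewrite -(pmulr_rgt0 _ n0'); apply: lt_le_trans h4; exact: lt_le_trans (mt0 _).
(* Points to be excluded: those under a margin of directions, and those so close to the boundary
   that their time is below [tlo]. *)
pose X (n : nat) : set V := K `&` ((\big[setU/set0]_(b < q) strip K (w b) (G b) (- (mt N / n%:R)) 0)
  `|` (\big[setU/set0]_(b < q) strip K (w b) (B b) (- (tlo / n%:R)) 0)).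
have bsG n b : bborel (strip K (w b) (G b) (- (mt N / n%:R)) 0) by exact: (strip_bborel hK _ _ c0 (tG b) (kG b)).
have bsB n b : bborel (strip K (w b) (B b) (- (tlo / n%:R)) 0) by exact: (strip_bborel hK _ _ c0 (tB b) (kB b)).
exists (MeshData tlo h B A X (fun e => h * ca e.2 / vK) n0); split => /=.
- by [].
- exact: tlo0.
- by rewrite h0.
- by rewrite /mtime/= -mtE.
- exact: mB.
- exact: Bs.
- move=> b u v Bu Bv; have := enorm_dist u (w b) v; rewrite [enorm (w b - v)]enormB.
  have := Bw b u Bu; have := Bw b v Bv; have : tlo * eps <= eps by rewrite ger_pMl.
  clear -rtlo r0; lra.
- exact: Bdisj.
- move=> e p p' [/andP[h2 h3] Bp] [/andP[h4 h5] Bp'].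
  have h2' : mt e.1 <= p.1 by rewrite mtE.
  have h4' : mt e.1 <= p'.1 by rewrite mtE.
  have h3' : p.1 < mt e.1.+1 by rewrite mtE.
  have h5' : p'.1 < mt e.1.+1 by rewrite mtE.
  have m0 := mt0 e.1; have mS := mtS e.1.
  apply: le_trans (tip_dist (h := h) (r := 2 * r) tlo0 _ _ _ _ (Bs _ _ Bp') _) _.
  + by clear -r0; lra.
  + by clear -h2' m0; lra.
  + by clear -h4' m0; lra.
  + by rewrite ler_norml; apply/andP; clear -h2' h3' h4' h5' mS; split; lra.
  + have := enorm_dist p.2 (w e.2) p'.2; rewrite [enorm (w e.2 - _)]enormB.
    have := Bw _ _ Bp; have := Bw _ _ Bp'; clear; lra.
  + have i1 : 2 * r / tlo <= eps / 5 by rewrite ler_pdivrMr//; clear -rtlo; lra.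
    have i2 : h / tlo ^+ 2 <= eps / 4 by rewrite ler_pdivrMr ?exprn_gt0//; clear -htlo; lra.
    clear -i1 i2 eps0; lra.
- rewrite (vKE _ erefl) (sE _ erefl) (sCE _ erefl) ler_pdivrMr//.
  have i1 : tlo * s <= tlo * D by rewrite ler_pM2l// DE; clear -T0 s0 sumSB; nra.
  have i2 : (T + 2) * sC <= D * ea.
    apply: ler_pM => //; first by clear -T0; lra.
    by rewrite DE; clear -T0 s0; nra.
  clear -i1 i2 eaD tloD eps0 vK0 ev0; lra.
- by move=> e; rewrite divr_ge0 ?mulr_ge0// ltW.
- by move=> e; rewrite /mlam/= (vKE _ erefl) ?sBE ler_pM2r ?invr_gt0// ler_pM2l.
- apply: (@le_trans _ _ (\sum_(e : 'I_N * 'I_q) h / vK * (r * sB e.2))).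
    apply: ler_sum => e _; rewrite /mlam/= (vKE _ erefl) ?sBE -mulrBl -mulrBr [h / vK * _]mulrAC.
    rewrite ler_pM2r ?invr_gt0// ler_pM2l//.
    have := Sca' e.2; have := caS' e.2; clear -r0; nra.
  rewrite -(pair_bigA _ (fun (a : 'I_N) b => h / vK * (r * sB b)))/=.
  rewrite sumr_const card_ord -mulr_sumr -mulr_sumr -[_ *+ N]mulr_natl.
  have -> : N%:R * (h / vK * (r * \sum_(b < q) sB b)) =
    (N%:R * h) * r * (\sum_(b < q) sB b) / vK by ring.
  rewrite ler_pdivrMr//; apply: le_trans rD; rewrite DE mulrA mulrC.
  have n1 : N%:R * h * r <= (T + 2) * r by rewrite ler_pM2r//; clear -N2 h1; lra.
  have n2 : 0 <= N%:R * h * r by rewrite mulr_ge0 ?mulr_ge0// ltW.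
  have n3 : 0 <= \sum_(b < q) sB b by exact: sumr_ge0.
  rewrite [r * _]mulrC mulrC; apply: ler_pM => //; clear -sumSB; lra.
- apply: (@le_trans _ _ (\sum_(e : 'I_N * 'I_q) (h / vK) ^+ 2 * (s * sB e.2))).
    apply: ler_sum => e _; rewrite /mlam/= (vKE _ erefl) ?sBE.
    have -> : h * sB e.2 / vK = h / vK * sB e.2 by ring.
    rewrite exprMn ler_pM2l ?exprn_gt0 ?divr_gt0// expr2 ler_wpM2r//.
    by apply: le_trans sumSB; rewrite (bigD1 e.2)//= lerDl sumr_ge0.
  rewrite -(pair_bigA _ (fun (a : 'I_N) b => (h / vK) ^+ 2 * (s * sB b)))/=.
  rewrite sumr_const card_ord -mulr_sumr -mulr_sumr -[_ *+ N]mulr_natl.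
  have -> : N%:R * ((h / vK) ^+ 2 * (s * \sum_(b < q) sB b)) =
    h * ((N%:R * h) * (s * (\sum_(b < q) sB b))) / vK ^+ 2.
    by field; rewrite gt_eqF.
  rewrite ler_pdivrMr ?exprn_gt0//; apply: le_trans hD; rewrite ler_pM2l// DE -[leRHS]mulrA.
  have n3 : 0 <= \sum_(b < q) sB b by exact: sumr_ge0.
  have Nh0 : 0 <= N%:R * h by rewrite mulr_ge0// ltW.
  apply: ler_pM => //; [exact: mulr_ge0|clear -N2 h1; lra|].
  by apply: ler_pM => //; clear -sumSB s0; lra.
- by move=> n e _; have [] := strip_bborel hK (- (mt e.1.+1 / n%:R)) (- (mt e.1 / n%:R)) c0 (tB e.2) (kB e.2).
- move=> n e nn x; have [n1 n2 n3] := nP n nn.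
  move=> /(AP n e x n2)[y [u [t [Ky Bu nu u1 [-> h2 h3 t0]]]]].
  apply: (cone y u) => //.
  + by rewrite oppr_eq0 scaler_eq0 negb_or gt_eqF//=; apply: contra_eqN (w1 e.2) => /eqP ->; rewrite enorm0 eq_sym oner_eq0.
  + rewrite enormN enormZ w1 mulr1 gtr0_norm//.
    have : t <= C / n%:R.
      rewrite ler_pdivlMr// mulrC; have := mtT2 e.1; have : 0 < eps^-1 by rewrite invr_gt0.
      rewrite CE; clear -h3 T0; lra.
    by move=> h4; exact: le_trans h4 (le_trans n3 _).
  + rewrite dotNr dotZr enormN enormZ w1 mulr1 gtr0_norm//.
    have := tB e.2 u Bu u1; clear -c78 t0; nra.
- move=> n e f x nn; have [n1 n2 n3] := nP n nn.
  move=> /(AP n e x n2)[y [u [t [Ky Bu nu u1 [xE h2 h3 t0]]]]].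
  move=> /(AP n f x n2)[y' [u' [t' [Ky' Bu' nu' u'1 [xE' h2' h3' t'0]]]]].
  have tC t0' : n%:R * t0' < T + 2 -> t0' <= (T + 2) / n%:R.
    by move=> hh; rewrite ler_pdivlMr// mulrC ltW.
  have ttC := tC t (lt_le_trans h3 (mtT2 e.1)).
  have tt'C := tC t' (lt_le_trans h3' (mtT2 f.1)).
  have ef : e.2 = f.2.
    apply: contrapT => /eqP ef; have [_ _ _ /(_ f.2 u' u ef Bu Bu')] := BP e.2.
    suff : enorm (u - u') <= dl / 2 by clear -dl0; lra.
    apply: (gauss2 y) => // k Kk.
    have -> : k - y = (k - y') + (t' *: w f.2 - t *: w e.2).
      by rewrite -(subrK (t *: w e.2) y) -xE xE'; vring.
    rewrite dotDr; have := nu' k Kk.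
    have := dot_unitl (t' *: w f.2 - t *: w e.2) u'1.
    have := enormD (t' *: w f.2) (- (t *: w e.2)); rewrite enormN !enormZ !w1 !mulr1 !gtr0_norm//.
    have : C / n%:R <= s2 by exact: le_trans n3 _.
    have -> : C / n%:R = (T + 2) / n%:R + (T + 2) / n%:R + eps^-1 / n%:R by rewrite CE; ring.
    have : 0 <= eps^-1 / n%:R by rewrite divr_ge0 ?invr_ge0// ltW.
    clear -ttC tt'C; lra.
  have Bu'e : B e.2 u' by rewrite ef.
  have E : y + (- t) *: w e.2 = y' + (- t') *: w e.2 by rewrite !scaleNr -xE xE' ef.
  have [_ /oppr_inj tt] := strip_inj c0 (tB e.2) Ky Bu nu u1 Ky' Bu'e nu' u'1 E.
  rewrite tt in h2 h3.
  have lt1 : (e.1 < f.1.+1)%N by rewrite ltnNge; apply/negP => /mtmono; clear -h2 h3 h2' h3'; lra.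
  have lt2 : (f.1 < e.1.+1)%N by rewrite ltnNge; apply/negP => /mtmono; clear -h2 h3 h2' h3'; lra.
  have ef1 : e.1 = f.1 by apply: ord_inj; apply/eqP; rewrite eqn_leq -ltnS lt1 -ltnS lt2.
  by rewrite [e]surjective_pairing [f]surjective_pairing ef1 ef.
- move=> n e nn; have [n1 n2 n3] := nP n nn.
  rewrite (rvol_strip hd hK mxi uxi c0 (tB e.2) (kB e.2)).
    by rewrite caE mtS (vKE _ erefl); field; rewrite !gt_eqF.
  by rewrite lerN2 ler_pM2r ?invr_gt0// mtS lerDl ltW.
- move=> n _; apply: measurableI; first by have [] := bborel_compact (body_compact hK).
  apply: measurableU; apply: bigsetU_measurable => b _; [by case: (bsG n b)|by case: (bsB n b)].
- by move=> n _ x [].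
- move=> n nn; have [n1 n2 n3] := nP n nn.
  have [bG vG] := rvol_bigU hd hK mxi uxi (index_enum 'I_q) (bsG n).
  have [bB vB] := rvol_bigU hd hK mxi uxi (index_enum 'I_q) (bsB n).
  rewrite (vKE _ erefl) ler_pdivrMr//.
  apply: le_trans (rvolS hd (bborelU bG bB) (@subIsetr _ _ _)) _.
  apply: le_trans (rvolU_le hd hK mxi uxi bG bB) _.
  apply: le_trans (lerD vG vB) _.
  apply: (@le_trans _ _ (\sum_(b < q) (T + 2) / n%:R * sG b +
     \sum_(b < q) tlo / n%:R * sB b)).
    apply: lerD; apply: ler_sum => b _.
      rewrite (rvol_strip hd hK mxi uxi c0 (tG b) (kG b)); last first.
        by rewrite oppr_le0 divr_ge0// ltW// (lt_le_trans tlo0 (mt0 _)).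
      rewrite sub0r opprK; apply: ler_pM.
      + by rewrite divr_ge0// ltW// (lt_le_trans tlo0 (mt0 _)).
      + by rewrite cgE.
      + by rewrite ler_pM2r ?invr_gt0//; case/andP: mtT.
      + by rewrite cgE; exact: cgS'.
    rewrite (rvol_strip hd hK mxi uxi c0 (tB b) (kB b)); last first.
      by rewrite oppr_le0 divr_ge0// ltW.
    by rewrite caE sub0r opprK ler_pM2l ?divr_gt0//; exact: caS'.
  rewrite -!mulr_sumr.
  have -> : (T + 2) / n%:R * (\sum_(b < q) sG b) + tlo / n%:R * (\sum_(b < q) sB b) =
    ((T + 2) * (\sum_(b < q) sG b) + tlo * (\sum_(b < q) sB b)) / n%:R by ring.
  rewrite mulrAC ler_pM2r ?invr_gt0//.
  have i1 : tlo * (\sum_(b < q) sB b) <= tlo * D by rewrite ler_pM2l// DE; clear -T0 s0 sumSB; nra.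
  have i2 : (T + 2) * (\sum_(b < q) sG b) <= D * ea.
    apply: ler_pM => //; [clear -T0; lra|by apply: sumr_ge0|].
    by rewrite DE; clear -T0 s0; nra.
  clear -i1 i2 eaD tloD ev0; lra.
- move=> n x nn Kx nA nX z sz; rewrite leNgt; apply/negP => zT.
  have [n1 n2 n3] := nP n nn.
  have z0 : z != 0.
    apply/eqP => z0; move: zT; rewrite z0 enorm0 ltNge => /negP; apply.
    by rewrite divr_ge0// ltW.
  have v1 := enorm_normalize z0.
  (* The cell is chosen from the direction of [z], before the foot of [x] is known. The slack [dl]
     of the covering then places the normal at the foot in [B b] or in its margin. *)
  have [b [vb Hb]] := cov _ v1.
  have [y [u [t [Ky nu u1 xE [t0 tT Hk]]]]] :=
    spol_far hK hreg n1 T0 (interior_subset Kx) (w1 b) sz zT (le_trans vb r4).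
  have uv : enorm (u - (enorm z)^-1 *: z) <= dl.
    apply: (@le_trans _ _ (dl / 2)); last by clear -dl0; lra.
    apply: (gauss2 y) => // k Kk; apply: le_trans (Hk k Kk) _.
    have : C / n%:R <= s2 by exact: le_trans n3 _.
    apply: le_trans; rewrite ler_pM2r ?invr_gt0// CE.
    have : 0 < eps^-1 by rewrite invr_gt0.
    clear -T0; lra.
  have [Bu|Gu] := Hb u u1 uv; last first.
    apply: nX; split; first exact: interior_subset.
    left; apply/bigsetUP; exists b, y, u, (- t); split => //; split; last by rewrite scaleNr.
    rewrite oppr_le0 t0 andbT ltrN2 ltr_pdivlMr// mulrC; apply: lt_le_trans tT _.
    by case/andP: mtT.
  have [tt|tt] := ltP (n%:R * t) tlo.
    apply: nX; split; first exact: interior_subset.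
    right; apply/bigsetUP; exists b, y, u, (- t); split => //; split; last by rewrite scaleNr.
    by rewrite oppr_le0 t0 andbT ltrN2 ltr_pdivlMr// mulrC.
  have tt0 : 0 <= (n%:R * t - tlo) / h by rewrite divr_ge0 ?subr_ge0// ltW.
  have /andP[k1 k2] := truncn_itv tt0.
  set a := Num.trunc _ in k1 k2.
  rewrite ler_pdivlMr// in k1; rewrite ltr_pdivrMr// in k2.
  have aN : (a < N)%N.
    rewrite -(ltr_nat R) -(ltr_pM2r h0); apply: le_lt_trans k1 _; clear -tT N1 tlo0; lra.
  apply: (nA (Ordinal aN, b)); exists y, u, (- t); split => //=; split; last by rewrite scaleNr.
  apply/andP; split.
    by rewrite ltrN2 ltr_pdivlMr// mulrC !mtE; clear -k1 k2; lra.
  by rewrite lerN2 ler_pdivrMr// mulrC !mtE; clear -k1 k2; lra.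
- move=> n e x p nn; have [n1 n2 n3] := nP n nn.
  move=> /(AP n e x n2)[y [u [t [Ky Bu nu u1 [-> h2 h3 t0]]]]] [/andP[h4 h5] Bp].
  have nt0 : 0 < n%:R * t by rewrite mulr_gt0.
  have nttlo : tlo <= n%:R * t by apply: le_trans h2; exact: mt0.
  have h4' : mt e.1 <= p.1 by rewrite mtE.
  have h5' : p.1 < mt e.1.+1 by rewrite mtE.
  have mS := mtS e.1; have m0 := mt0 e.1.
  have pt : enorm ((n%:R * t)^-1 *: u - tip p) <= 2 * r / tlo + h / tlo ^+ 2.
    apply: (tip_dist (h := h) (r := 2 * r) (z := (n%:R * t, u)) (z' := p) tlo0 _ nttlo _ _ (Bs _ _ Bp)).
    + by clear -r0; lra.
    + by clear -h4' m0; lra.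
    + by rewrite /= ler_norml; apply/andP; clear -h2 h3 h4' h5' mS; split; lra.
    + have := enorm_dist u (w e.2) p.2; rewrite [enorm (w e.2 - _)]enormB/=.
      have := Bw _ _ Bp; have := Bw _ _ Bu; clear; lra.
  have i1 : r / tlo <= eps / 10 by rewrite ler_pdivrMr//; clear -rtlo; lra.
  have i2 : h / tlo ^+ 2 <= eps / 4 by rewrite ler_pdivrMr ?exprn_gt0//; clear -htlo; lra.
  have i3 : 2 * r / tlo = 2 * (r / tlo) by ring.
  rewrite i3 in pt.
  split.
    move=> z sz; have [ze|ze] := leP (enorm z) eps.
      exists 0; last by rewrite subr0.
      by exists 0; [rewrite /= in_itv/= lexx ler01|rewrite scale0r].
    have es : (n%:R * eps)^-1 + t <= s1.
      have : C / n%:R <= s1 by exact: le_trans n3 _.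
      apply: le_trans; rewrite ler_pdivlMr// mulrDl invfM mulrAC mulVf ?gt_eqF// mul1r.
      by rewrite CE [t * _]mulrC; have := mtT2 e.1; clear -h3 T0; lra.
    have [c' c'01 zc] := spol_near_segment n1 t0 Ky u1 (w1 e.2) nu (Bw _ _ Bu) r0 r4
      (fun v => @gauss1 y u v Ky u1 nu) eps0 es sz ze.
    exists (c' *: tip p); first by exists c' => //=; rewrite in_itv.
    apply: le_trans (enorm_dist _ (c' *: ((n%:R * t)^-1 *: u)) _) _.
    rewrite -scalerBr enormZ ger0_norm; last by case/andP: c'01.
    have : 3 * r / (n%:R * t) <= 3 * r / tlo.
      by rewrite ler_pM2l ?mulr_gt0// lef_pV2 ?posrE.
    have -> : 3 * r / tlo = 3 * (r / tlo) by ring.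
    have : c' * enorm ((n%:R * t)^-1 *: u - tip p) <= 1 * enorm ((n%:R * t)^-1 *: u - tip p).
      by rewrite ler_wpM2r ?enorm_ge0//; case/andP: c'01.
    clear -zc pt i1 i2 eps0; lra.
  move=> _ [c' + <-]; rewrite /= in_itv/= => c'01.
  exists (c' *: ((n%:R * t)^-1 *: u)).
    exact: seg_sub_spol.
  rewrite -scalerBr enormZ ger0_norm; last by case/andP: c'01.
  rewrite enormB.
  have : c' * enorm ((n%:R * t)^-1 *: u - tip p) <= 1 * enorm ((n%:R * t)^-1 *: u - tip p).
    by rewrite ler_wpM2r ?enorm_ge0//; case/andP: c'01.
  have : 0 < r / tlo by rewrite divr_gt0.
  clear -pt i1 i2 eps0; lra.
Qed.

(** * Stability of recursive peeling *)

Section Stability.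
Context {R : realType} {d : nat}.
Local Notation V := 'rV[R]_d.
Implicit Types (x : nat -> V) (u v w y z : V).

(** Hypothesis and conclusion hold for all smaller positive values, so the minimum of finitely many
    thresholds works. *)
Lemma finite_uniform (T : choiceType) (F : set T) (Q : T -> R -> Prop) :
  finite_set F -> (forall k, F k -> exists2 e, 0 < e & forall e', 0 < e' -> e' <= e -> Q k e') ->
  exists2 e, 0 < e & forall k e', F k -> 0 < e' -> e' <= e -> Q k e'.
Proof.
move=> /finite_seqP[s ->]; elim: s => [|k s IH] H.
  by exists 1 => // k e' /=; rewrite in_nil.
have [e e0 He] : exists2 e, 0 < e & forall k e', [set` s] k -> 0 < e' -> e' <= e -> Q k e'.
  by apply: IH => j /= js; apply: H; rewrite /= inE js orbT.
have [e1 e10 He1] := H k (mem_head _ _).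
exists (Num.min e e1); first by rewrite lt_min e0.
move=> j e' /=; rewrite in_cons => /orP[/eqP ->|js] e'0; rewrite le_min => /andP[h1 h2].
  exact: He1.
exact: He.
Qed.

Lemma finite_argmax (T : choiceType) (F : set T) (f : T -> R) :
  finite_set F -> F !=set0 -> exists2 k, F k & forall j, F j -> f j <= f k.
Proof.
move=> /finite_seqP[s ->] [k0]; elim: s k0 => [k0 /=|k s IH k0 _]; first by rewrite in_nil.
case: s IH => [_|a s IH]; first by exists k => [|j] /=; rewrite inE// => /eqP ->.
have [k1 sk1 Hk1] := IH a (mem_head _ _).
have [h|h] := leP (f k1) (f k).
  exists k => [|j] /=; first exact: mem_head.
  by rewrite in_cons => /orP[/eqP ->//|js]; apply: le_trans h; exact: Hk1.
exists k1 => [|j] /=; first by rewrite in_cons orbC; apply/orP; left.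
by rewrite in_cons => /orP[/eqP ->|js]; [exact: ltW|exact: Hk1].
Qed.

Lemma open_halfspace_convex u (c : R) : convex_set [set y | dot u y < c].
Proof.
apply/convex_setP => y z t /= Hy Hz /andP[t0 t1]; rewrite !dotE.
have [->|tn0] := eqVneq t 0; first by rewrite mul0r add0r subr0 mul1r.
have t0' : 0 < t by rewrite lt_neqAle eq_sym tn0.
apply: (@lt_le_trans _ _ (t * c + (1 - t) * c)); last by rewrite -mulrDl subrKC mul1r.
by apply: ltr_leD; [rewrite ltr_pM2l|rewrite ler_wpM2l ?subr_ge0// ltW].
Qed.

Lemma seg_compact z : compact (seg z).
Proof.
apply: continuous_compact; last exact: segment_compact.
by apply: continuous_subspaceT; apply: scaleV_continuous; [exact: idV_continuous|exact: cstV_continuous].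
Qed.

Lemma segP z y : seg z y <-> exists2 s : R, 0 <= s <= 1 & y = s *: z.
Proof. by split=> [[s /=]|[s s01 ->]]; [rewrite in_itv/= => ? <-; exists s|exists s => //=; rewrite in_itv]. Qed.

Lemma seg0 z : seg z 0. Proof. by apply/segP; exists 0; rewrite ?lexx ?ler01// scale0r. Qed.
Lemma seg1 z : seg z z. Proof. by apply/segP; exists 1; rewrite ?lexx ?ler01// scale1r. Qed.

Lemma seg_convex z : convex_set (seg z).
Proof.
apply/convex_setP => _ _ t /segP[a /andP[a0 a1] ->] /segP[b /andP[b0 b1] ->] /andP[t0 t1].
apply/segP; exists (t * a + (1 - t) * b); last by rewrite !scalerA scalerDl.
apply/andP; split; first by rewrite addr_ge0// mulr_ge0// subr_ge0.
apply: (@le_trans _ _ (t * 1 + (1 - t) * 1)); last by rewrite !mulr1 subrKC.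
by apply: lerD; rewrite ler_wpM2l// subr_ge0.
Qed.

Lemma seg_min (A : set V) z : convex_set A -> A 0 -> A z -> seg z `<=` A.
Proof.
move=> /convex_setP cA A0 Az _ /segP[s s01 ->].
by have := cA z 0 s Az A0 s01; rewrite scaler0 addr0.
Qed.

Lemma seg_enorm z y : seg z y -> enorm y <= enorm z.
Proof.
move=> /segP[s /andP[s0 s1] ->]; rewrite enormZ ger0_norm//.
by rewrite ler_piMl// enorm_ge0.
Qed.

Lemma closure_enormP (A : set V) y :
  closure A y <-> forall e, 0 < e -> exists2 z, A z & enorm (y - z) <= e.
Proof.
split; last exact: closure_enorm.
move=> cly e e0; have /cly[z [Az /= yz]] : nbhs y [set z | enorm (z - y) < e].
  by apply/nbhs_enormP; exists e.
by exists z => //; rewrite enormB ltW.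
Qed.

Lemma closure_convex (A : set V) : convex_set A -> convex_set (closure A).
Proof.
move=> /convex_setP cA; apply/convex_setP => y z t /closure_enormP Hy /closure_enormP Hz t01.
apply/closure_enormP => e e0; have [y' Ay' yy'] := Hy e e0; have [z' Az' zz'] := Hz e e0.
exists (t *: y' + (1 - t) *: z'); first exact: cA.
have -> : t *: y + (1 - t) *: z - (t *: y' + (1 - t) *: z') =
  t *: (y - y') + (1 - t) *: (z - z') by vring.
case/andP: t01 => t0 t1.
apply: le_trans (enormD _ _) _; rewrite !enormZ !ger0_norm ?subr_ge0//.
nra.
Qed.

Section Family.
Context {I : Type}.
Implicit Types (M : I -> set V) (J : set I).

Lemma family_sub M J i : J i -> M i `<=` family_hull M J.
Proof. by move=> Ji y My; apply: chull_sub; exists i. Qed.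

Lemma family_hullS M J J' : J `<=` J' -> family_hull M J `<=` family_hull M J'.
Proof. by move=> JJ; apply: chullS => y [i Ji My]; exists i => //; exact: JJ. Qed.

Lemma family_hull_min M J (A : set V) : convex_set A -> (forall i, J i -> M i `<=` A) ->
  family_hull M J `<=` A.
Proof. by move=> cA H; apply: chull_min => // y [i Ji My]; exact: (H i). Qed.

Lemma criticalP M J i : critical M J i <-> J i /\ ~ (M i `<=` family_hull M (J `\ i)).
Proof.
split=> [[Ji H]|[Ji H]]; split => //.
  move=> Mi; apply: H; apply/seteqP; split; last by apply: family_hullS => j [].
  apply: family_hull_min; first exact: chull_convex.
  move=> j Jj; have [->//|ji] := pselect (j = i).
  exact: (@family_sub M (J `\ i) j).
by move=> E; apply: H; rewrite -E; exact: family_sub.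
Qed.

End Family.

Lemma family_hull_compact (I : choiceType) (M : I -> set V) (J : set I) :
  finite_set J -> J !=set0 -> (forall i, J i -> [/\ compact (M i), convex_set (M i) & M i 0]) ->
  compact (family_hull M J).
Proof.
move=> fJ J0 H; apply: compact_chull_finite => // i Ji.
by have [? ? ?] := H i Ji; split => //; exists 0.
Qed.

(* [good_gen] is general position: a tip in a hull spanned by finitely many other tips lies
   strictly below the level 1 of its gauge. *)
Record good x : Prop := Good {
  good_fin : forall e : R, 0 < e -> finite_set [set k | e < enorm (x k)];
  good_span : forall J : set nat, finite_set (~` J) -> exists F (r : R),
    [/\ finite_set F, F `<=` J, F !=set0, 0 < r &
        forall y, enorm y <= r -> family_hull (seg \o x) F y];
  good_gen : forall k F (r : R), finite_set F -> 0 < r ->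
    (forall y, enorm y <= r -> family_hull (seg \o x) F y) ->
    ~ F k -> family_hull (seg \o x) F (x k) ->
    exists2 s : R, 0 <= s < 1 & exists2 c, family_hull (seg \o x) F c & x k = s *: c;
  good_inj : injective x;
  good_neq0 : forall k, x k != 0 }.

Section Good.
Variables (x : nat -> V).
Context (gx : good x).
Local Notation L := (seg \o x).

Lemma good_family k : [/\ compact (L k), convex_set (L k) & L k 0].
Proof. by split; [exact: seg_compact|exact: seg_convex|exact: seg0]. Qed.

(** Finitely many tips span a ball of radius [r], which absorbs every segment of length at most [r];
    only finitely many are longer. *)
Lemma good_hull_finite (J : set nat) : finite_set (~` J) -> exists F (r : R),
  [/\ finite_set F, F `<=` J, F !=set0, 0 < r & (forall y, enorm y <= r -> family_hull L F y) /\
      family_hull L J = family_hull L F].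
Proof.
move=> cJ; have [F [r [fF FJ F0 r0 Fr]]] := good_span gx cJ.
exists (F `|` (J `&` [set k | r < enorm (x k)])), r; split => //.
- by rewrite finite_setU; split => //; apply: sub_finite_set (good_fin gx r0) => k [].
- by move=> k [/FJ|[]].
- by have [k Fk] := F0; exists k; left.
split; first by move=> y /Fr; apply: family_hullS => k; left.
apply/seteqP; split; last by apply: family_hullS => k [/FJ|[]].
apply: family_hull_min; first exact: chull_convex.
move=> k Jk; have [h|h] := leP (enorm (x k)) r.
  apply: seg_min; [exact: chull_convex| |].
    by apply: (family_hullS _ (Fr 0 _)); [left|rewrite enorm0 ltW].
  by apply: (family_hullS _ (Fr (x k) h)); left.
by apply: family_sub; right.
Qed.

Lemma good_hull_compact J : finite_set (~` J) -> compact (family_hull L J).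
Proof.
move=> /good_hull_finite[F [r [fF FJ F0 r0 [_ ->]]]].
by apply: family_hull_compact => // k _; exact: good_family.
Qed.

Lemma critical_good J k : critical L J k <-> J k /\ ~ family_hull L (J `\ k) (x k).
Proof.
rewrite criticalP; split=> -[Jk H]; split => //.
  (* Without another index the hull is empty and contains no tip; otherwise it contains the origin,
     and a segment lies in it as soon as its tip does. *)
  move=> Hk; apply: H; have [[j jk]|nj] := pselect (exists j, (J `\ k) j); last first.
    exfalso; apply: (Hk set0); split; first by apply/convex_setP.
    by move=> y [j jk _]; apply: nj; exists j.
  apply: seg_min => //; first exact: chull_convex.
  by apply: (family_sub jk); exact: seg0.
by move=> Hk; apply: H; apply: Hk; exact: seg1.
Qed.


(** A tip inside a ball spanned by other members is redundant, so each peeling step removes only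
    finitely many segments and index sets remain cofinite. *)
Lemma critical_cofinite (J : set nat) : finite_set (~` J) ->
  finite_set (critical L J) /\ finite_set (~` (J `\` critical L J)).
Proof.
move=> cJ; have fc : finite_set (critical L J).
  have [F [r [fF FJ F0 r0 [Fr _]]]] := good_hull_finite cJ.
  have fU : finite_set (F `|` [set k | r < enorm (x k)]).
    by rewrite finite_setU; split => //; exact: (good_fin gx r0).
  apply: sub_finite_set fU => k /critical_good[Jk Hk].
  have [Fk|nFk] := pselect (F k); [by left|right => /=].
  rewrite ltNge; apply/negP => xr; apply: Hk; apply: (family_hullS _ (Fr _ xr)).
  by move=> j Fj; split; [exact: FJ|move=> /= jk; apply: nFk; rewrite -jk].
split => //; rewrite setCD finite_setU; split => //.
Qed.

(** A tip of maximal norm is critical: all other tips have strictly smaller inner product with it,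
    being distinct and not longer. Hence the recursion on the limit never stops. *)
Lemma critical_nonempty (J : set nat) : finite_set (~` J) -> critical L J !=set0.
Proof.
move=> cJ; have [F [r [fF FJ [j0 Fj0] r0 _]]] := good_span gx cJ.
have xj0 : 0 < enorm (x j0) by apply: enorm_gt0; exact: good_neq0.
have fG : finite_set (J `&` [set k | enorm (x j0) / 2 < enorm (x k)]).
  apply: sub_finite_set (good_fin gx (divr_gt0 xj0 (ltr0Sn R 1))) => k [_] /=.
  by [].
have Gj0 : (J `&` [set k | enorm (x j0) / 2 < enorm (x k)]) j0.
  by split; [exact: FJ|rewrite /=; lra].
have [k [Jk xk] kmax] := finite_argmax (fun k => enorm (x k)) fG (ex_intro _ _ Gj0).
exists k; apply/critical_good; split => //.
have cH := @open_halfspace_convex (x k) (dot (x k) (x k)).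
move=> H; suff : dot (x k) (x k) < dot (x k) (x k) by rewrite ltxx.
have xk0 : 0 < enorm (x k) by apply: enorm_gt0; exact: good_neq0.
move: H; apply: (@family_hull_min _ L (J `\ k) _ cH) => j [Jj jk].
apply: seg_min => //=; first by rewrite dot0r -enorm_sqr exprn_gt0.
have xjk : enorm (x j) <= enorm (x k).
  have [h|h] := ltP (enorm (x j0) / 2) (enorm (x j)); last by move: xk => /=; lra.
  have : (J `&` [set k | enorm (x j0) / 2 < enorm (x k)]) j by split.
  exact: kmax.
have : 0 < dot (x k - x j) (x k - x j).
  rewrite -enorm_sqr exprn_gt0//; apply: enorm_gt0; rewrite subr_eq0.
  by apply/eqP => /(good_inj gx) E; apply: jk.
rewrite !dotE (dotC (x j) (x k)) -(enorm_sqr (x j)) -(enorm_sqr (x k)) !expr2.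
have : enorm (x j) * enorm (x j) <= enorm (x k) * enorm (x k).
  by apply: ler_pM; rewrite ?enorm_ge0.
lra.
Qed.

(** Criticality is made quantitative: a critical tip has positive distance from the compact hull of
    the others, and by [good_gen] a redundant one is surrounded by the hull of finitely many others.
    Only finitely many tips need an individual threshold; short ones are inside a fixed ball. *)
Lemma good_thresholds (J : set nat) : finite_set (~` J) -> exists2 e0 : R, 0 < e0 &
  forall e, 0 < e -> e <= e0 ->
  [/\ forall k, critical L J k -> ~ parallel_set (family_hull L (J `\ k)) (2 * e) (x k),
      forall k, J k -> ~ critical L J k -> exists F, [/\ finite_set F, F !=set0, F `<=` J `\ k,
        forall f, F f -> e < enorm (x f) &
        parallel_set (seg (x k)) (3 * e) `<=` family_hull L F] &
      exists F, [/\ finite_set F, F !=set0, F `<=` J, forall f, F f -> e < enorm (x f) &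
        forall y, enorm y <= 4 * e -> family_hull L F y]].
Proof.
move=> cJ; have [F [r [fF FJ F0 r0 [Fr _]]]] := good_hull_finite cJ.
have pos G : finite_set G -> exists2 e0 : R, 0 < e0 & forall f e, G f -> 0 < e -> e <= e0 ->
    e < enorm (x f).
  move=> fG; apply: (finite_uniform (Q := fun f e => e < enorm (x f)) fG) => f _.
  have xf0 : 0 < enorm (x f) by apply: enorm_gt0; exact: good_neq0.
  by exists (enorm (x f) / 2); [lra|move=> e' _ h; lra].
have [eF eF0 HF] := pos F fF.
(* Tips of norm at most [R0] lie in the ball spanned by [F] and are shorter than every tip of [F],
   so [F] itself witnesses their redundancy. *)
pose R0 := Num.min (r / 4) eF.
have R00 : 0 < R0 by rewrite lt_min eF0 andbT; lra.
have R0r : R0 <= r / 4 by rewrite ge_min lexx.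
have R0F f : F f -> R0 < enorm (x f) by move=> Ff; apply: HF => //; rewrite ge_min lexx orbT.
clearbody R0.
pose G := J `&` [set k | R0 < enorm (x k)].
have fG : finite_set G by apply: sub_finite_set (good_fin gx R00) => k [].
pose Q k e := (critical L J k -> ~ parallel_set (family_hull L (J `\ k)) (2 * e) (x k)) /\
   (~ critical L J k -> exists F, [/\ finite_set F, F !=set0, F `<=` J `\ k,
        forall f, F f -> e < enorm (x f) &
        parallel_set (seg (x k)) (3 * e) `<=` family_hull L F]).
have [e1 e10 H1] : exists2 e1 : R, 0 < e1 & forall k e, G k -> 0 < e -> e <= e1 -> Q k e.
  apply: (finite_uniform (Q := Q) fG) => k [Jk xk].
  have cJk : finite_set (~` (J `\ k)).
    by rewrite setCD finite_setU; split => //; exact: finite_set1.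
  have [ck|nck] := pselect (critical L J k).
    have := (critical_good J k).1 ck => -[_ nHk].
    have /closed_enormP clH : closed (family_hull L (J `\ k)).
      by have /compact_enormP[] := good_hull_compact cJk.
    have [e [e0 He]] : exists e, 0 < e /\ forall y, family_hull L (J `\ k) y -> e < enorm (x k - y).
      apply: contrapT => H; apply: nHk; apply: clH => e e0; apply: contrapT => H2; apply: H.
      exists e; split => // y Hy; rewrite ltNge; apply/negP => xy; apply: H2.
      by exists y.
    exists (e / 2); first lra.
    move=> e' e'0 e'e; split => // _ [y Hy xy].
    have := He y Hy; lra.
  have [F' [r' [fF' FJ' F0' r'0 [Fr' HE]]]] := good_hull_finite cJk.
  have Hk : family_hull L F' (x k).
    by rewrite -HE; apply: contrapT => nH; apply: nck; apply/critical_good.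
  have nF'k : ~ F' k by move=> /FJ'[_]; apply.
  have [s /andP[s0 s1] [c Hc xE]] := good_gen gx fF' r'0 Fr' nF'k Hk.
  have [e' e'0 He'] := pos F' fF'.
  (* Since [x k = s *: c], mixing a point of the segment towards [c] with weight [s] and the ball of
     radius [r'] with weight [1 - s] leaves a ball of radius [r' * (1 - s)], which must contain one
     of radius [3 * e]. *)
  exists (Num.min e' (r' * (1 - s) / 3)).
    by rewrite lt_min e'0/= divr_gt0// mulr_gt0// subr_gt0.
  move=> e e0; rewrite le_min => /andP[ee' er']; split => // _.
  exists F'; split => //; first by move=> f Ff; apply: He'.
  move=> y [z /segP[t /andP[t0 t1] ->] yz].
  have /convex_setP cF' : convex_set (family_hull L F') by exact: chull_convex.
  have s1' : 1 - s != 0 by rewrite subr_eq0 eq_sym lt_eqF.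
  have -> : y = s *: (t *: c) + (1 - s) *: ((1 - s)^-1 *: (y - t *: x k)).
    by rewrite (scalerA (1 - s)) mulfV// scale1r xE !scalerA (mulrC s t) addrC subrK.
  apply: (cF' _ _ _); last by rewrite s0 ltW.
    have := cF' c 0 t Hc (Fr' 0 _); rewrite scaler0 addr0; apply; last by rewrite t0.
    by rewrite enorm0 ltW.
  apply: Fr'; rewrite enormZ normfV gtr0_norm ?subr_gt0//.
  by rewrite mulrC ler_pdivrMr ?subr_gt0//; apply: le_trans yz _; lra.
exists (Num.min e1 (R0 / 2)); first by rewrite lt_min e10/=; lra.
move=> e e0; rewrite le_min => /andP[ee1 eR0].
have H0 : forall f, F f -> e < enorm (x f) by move=> f /R0F; lra.
split.
- move=> k ck; have [h|h] := ltP R0 (enorm (x k)).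
    by have [] := H1 k e (conj ck.1 h) e0 ee1; move=> /(_ ck).
  have := (critical_good J k).1 ck => -[Jk nH]; exfalso; apply: nH.
  apply: (family_hullS _ (Fr (x k) _)); last lra.
  by move=> j Fj; split; [exact: FJ|move=> /= jk; have := R0F j Fj; rewrite jk; lra].
- move=> k Jk nck; have [h|h] := ltP R0 (enorm (x k)).
    by have [_] := H1 k e (conj Jk h) e0 ee1; move=> /(_ nck).
  exists F; split => //.
    by move=> j Fj; split; [exact: FJ|move=> /= jk; have := R0F j Fj; rewrite jk; lra].
  move=> y [z /seg_enorm zx yz]; apply: Fr.
  have := enormD (y - z) z; rewrite subrK; lra.
- by exists F; split => // y h; apply: Fr; lra.
Qed.

End Good.

(** [Rm] is a partial bijection; members left over on either side are within [e] of the origin. A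
    finite sample can thus be compared with the infinite family of segments. *)
Record matching (I : choiceType) (M : I -> set V) (x : nat -> V) (Rm : I -> nat -> Prop) (e : R)
    : Prop := Matching {
  mt_body : forall i, [/\ compact (M i), convex_set (M i) & M i 0];
  mt_fun : forall i k k', Rm i k -> Rm i k' -> k = k';
  mt_inj : forall i i' k, Rm i k -> Rm i' k -> i = i';
  mt_close : forall i k, Rm i k -> hclose (M i) (seg (x k)) e;
  mt_left : forall i y, (forall k, ~ Rm i k) -> M i y -> enorm y <= e;
  mt_right : forall k, (forall i, ~ Rm i k) -> enorm (x k) <= e }.

(** The invariant of the recursion: matched members survive together, and unmatched ones, being
    small, are never removed. *)
Definition corr (I : Type) (Rm : I -> nat -> Prop) (JM : set I) (J : set nat) :=
  [/\ forall i k, Rm i k -> (JM i <-> J k),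
      forall i, (forall k, ~ Rm i k) -> JM i &
      forall k, (forall i, ~ Rm i k) -> J k].

(** * One peeling step under a matching *)

Section Step.
Variables (x : nat -> V) (I : choiceType) (M : I -> set V) (Rm : I -> nat -> Prop) (e : R).
Context (gx : good x) (e0 : 0 < e) (mt : matching M x Rm e).
Local Notation L := (seg \o x).

Lemma matching_sub JM J : corr Rm JM J -> J !=set0 ->
  family_hull M JM `<=` parallel_set (family_hull L J) e.
Proof.
move=> [c1 c2 c3] [j0 Jj0]; apply: family_hull_min.
  exact/parallel_convex/chull_convex.
move=> i Ji y My; have [[k Rik]|nk] := pselect (exists k, Rm i k).
  have [/(_ _ My)[z Lz yz] _] := mt_close mt Rik.
  by exists z => //; apply: (family_sub (M := L) ((c1 _ _ Rik).1 Ji)).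
exists 0; first by apply: (family_sub (M := L) Jj0); exact: seg0.
by rewrite subr0; apply: (mt_left mt (i := i)) => // k Rik; apply: nk; exists k.
Qed.

(** Tips longer than [e] must be matched. Their partners span a hull [e]-close to that of [F], and
    [cball_parallel] turns a ball of radius [2 * e] in one hull into its centre in the other. *)
Lemma matching_transfer JM J F : corr Rm JM J -> finite_set F -> F !=set0 -> F `<=` J ->
  (forall f, F f -> e < enorm (x f)) ->
  exists FM, [/\ FM `<=` JM, (forall i, FM i -> exists2 f, F f & Rm i f) &
    forall z, (forall y, enorm (y - z) <= 2 * e -> family_hull L F y) -> family_hull M FM z].
Proof.
move=> [c1 c2 c3] fF [f0 Ff0] FJ xF.
have Fm f : F f -> exists i, Rm i f.
  move=> Ff; apply: contrapT => nf; have := xF f Ff.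
  by rewrite ltNge (mt_right mt)// => i Rif; apply: nf; exists i.
pose FM := [set i | exists2 f, F f & Rm i f].
exists FM; split => //.
  by move=> i [f Ff Rif]; apply/(c1 _ _ Rif); exact: FJ.
have [i0 Ri0] := Fm f0 Ff0.
have fFM : finite_set FM.
  have /choice[g Hg] : forall f, exists i, F f -> Rm i f.
    by move=> f; have [/Fm[i]|nF] := pselect (F f); [exists i|exists i0].
  apply: sub_finite_set (finite_image g fF) => i [f Ff Rif]; exists f => //.
  exact: (mt_inj mt (Hg f Ff) Rif).
have FM0 : FM i0 by exists f0.
move=> z Hz; apply: (@cball_parallel _ _ (family_hull L F) _ z (2 * e) e).
- by apply: family_hull_compact => //; [exists i0|move=> i _; exact: (mt_body mt i)].
- exact: chull_convex.
- by exists 0; apply: (family_sub FM0); have [] := mt_body mt i0.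
- exact: ltW.
- by rewrite ltr_pMl// ltr1n.
- exact: Hz.
apply: chull_parallel => y [f Ff Ly]; have [i Rif] := Fm f Ff.
have [_ /(_ _ Ly)[w Mw yw]] := mt_close mt Rif.
by exists w => //; exists i => //; exists f.
Qed.

(** The margins [2 * e], [3 * e] and [4 * e] pay for the distance between matched members, the
    distance between the two hulls and the erosion in [matching_transfer], so both recursions
    declare the same matched members critical. *)
Lemma matching_step JM J (hJ : finite_set (~` J)) : corr Rm JM J ->
  [/\ forall k, critical L J k -> ~ parallel_set (family_hull L (J `\ k)) (2 * e) (x k),
      forall k, J k -> ~ critical L J k -> exists F, [/\ finite_set F, F !=set0, F `<=` J `\ k,
        forall f, F f -> e < enorm (x f) &
        parallel_set (seg (x k)) (3 * e) `<=` family_hull L F] &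
      exists F, [/\ finite_set F, F !=set0, F `<=` J, forall f, F f -> e < enorm (x f) &
        forall y, enorm y <= 4 * e -> family_hull L F y]] ->
  [/\ corr Rm (JM `\` critical M JM) (J `\` critical L J),
      hclose (family_hull M JM) (family_hull L J) e,
      forall y, enorm y <= e -> family_hull M JM y &
      critical M JM !=set0].
Proof.
have h0 := e0; move=> cJ [tc tn [F [fF F0 FJ xF Fb]]].
have J0 : J !=set0 by case: F0 => f /FJ; exists f.
have [FM [FMJ FMF FMH]] := matching_transfer cJ fF F0 FJ xF.
(* Of the radius [4 * e], half covers the size of the member and half is lost in the transfer. *)
have small i : (forall y, M i y -> enorm y <= 2 * e) -> M i `<=` family_hull M FM.
  move=> Mi y My; apply: FMH => z zy; apply: Fb.
  by have := enormD (z - y) y; have := Mi y My; rewrite subrK; lra.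
have [c1 c2 c3] := cJ.
have ceq i k : Rm i k -> JM i -> (critical M JM i <-> critical L J k).
  move=> Rik Ji; have Jk := (c1 _ _ Rik).1 Ji; split; last first.
    move=> ck; apply/criticalP; split => // Mi.
    (* If [M i] were redundant, the tip would be [e]-close to a point of [M i], which is [e]-close
       to the hull of the other segments; the margin [2 * e] excludes this. *)
    apply: (tc k ck).
    have [_ /(_ _ (@seg1 _))[y My xy]] := mt_close mt Rik.
    have : parallel_set (family_hull L (J `\ k)) e y.
      apply: (@matching_sub (JM `\ i) (J `\ k)); last exact: Mi.
        split.
        - move=> i' k' Rik'; split=> -[h1 h2]; split; first exact/(c1 _ _ Rik').
          + by move=> /= E; apply: h2; rewrite /= E in Rik'; exact: (mt_inj mt Rik' Rik).
          + exact/(c1 _ _ Rik').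
          + by move=> /= E; apply: h2; rewrite /= E in Rik'; exact: (mt_fun mt Rik' Rik).
        - by move=> i' ni'; split; [exact: c2|move=> /= E; apply: (ni' k); rewrite E].
        - by move=> k' nk'; split; [exact: c3|move=> /= E; apply: (nk' i); rewrite E].
      (* [J] cannot consist of [k] alone: removing [k] leaves a cofinite set, which by
         [critical_nonempty] has a member. *)
      apply: contrapT => nJ.
      have nJk : forall j, J j -> j = k.
        by move=> j Jj; apply: contrapT => jk; apply: nJ; exists j.
      have cJk : finite_set (~` (J `\ k)).
        by rewrite setCD finite_setU; split => //; exact: finite_set1.
      have [j [[Jj jk] _]] := critical_nonempty gx cJk.
      by apply: jk; exact: nJk.
    move=> [z Hz yz]; exists z => //.
    by have := enorm_dist (x k) y z; lra.
  move=> /criticalP[_ nMi]; apply: contrapT => nck; apply: nMi.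
  (* A point of [M i] is [e]-close to the segment, so the ball of radius [2 * e] around it stays in
     the [3 * e]-neighbourhood covered by [F']. *)
  have [F' [fF' F0' FJ' xF' Fb']] := tn k Jk nck.
  have [FM' [FMJ' FMF' FMH']] := @matching_transfer JM J F' cJ fF' F0' (fun f h => (FJ' f h).1) xF'.
  move=> y My; have : family_hull M FM' y.
    apply: FMH' => z zy; apply: Fb'.
    have [/(_ _ My)[w Lw yw] _] := mt_close mt Rik.
    by exists w => //; have := enorm_dist z y w; lra.
  apply: family_hullS => i' Fi'; split; first exact: FMJ'.
  move=> /= E; have [f Ff Rif] := FMF' i' Fi'; have [_ fk] := FJ' f Ff; apply: fk => /=.
  by rewrite E in Rif; exact: (mt_fun mt Rif Rik).
split.
- split.
  + move=> i k Rik; split=> -[h1 h2].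
      split; first exact/(c1 _ _ Rik).
      by move=> ck; apply: h2; apply/(ceq _ _ Rik).
    have Ji := (c1 _ _ Rik).2 h1; split => // ci.
    by apply: h2; apply/(ceq _ _ Rik).
  + move=> i ni; split; first exact: c2.
    move=> /criticalP[_]; apply.
    have hi : forall y, M i y -> enorm y <= 2 * e.
      by move=> y My; have := mt_left mt ni My; lra.
    apply: (subset_trans (small i hi)).
    apply: family_hullS => j FMj; split; first exact: FMJ.
    by move=> /= E; have [f _ Rif] := FMF j FMj; apply: (ni f); rewrite -E.
  + move=> k nk; split; first exact: c3.
    move=> /critical_good[_]; apply.
    have xk := mt_right mt nk.
    apply: (family_hullS _ (Fb (x k) _)); last lra.
    move=> f Ff; split; first exact: FJ.
    by move=> /= E; have := xF f Ff; rewrite E; lra.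
- split; first exact: matching_sub.
  have H0 : family_hull M JM 0.
    apply: (family_hullS FMJ); apply: FMH => y; rewrite subr0 => h; apply: Fb; lra.
  apply: family_hull_min; first exact/parallel_convex/chull_convex.
  move=> k Jk y Ly; have [[i Rik]|ni] := pselect (exists i, Rm i k).
    have [_ /(_ _ Ly)[z Mz yz]] := mt_close mt Rik.
    by exists z => //; apply: (family_sub (M := M) ((c1 _ _ Rik).2 Jk)).
  exists 0 => //; rewrite subr0; apply: le_trans (seg_enorm Ly) _.
  by apply: (mt_right mt) => i Rik; apply: ni; exists i.
- move=> y ye; apply: (family_hullS FMJ); apply: FMH => z zy; apply: Fb.
  by have := enormD (z - y) y; rewrite subrK; lra.
- have [k ck] := critical_nonempty gx hJ.
  have Jk := ck.1; have nck := ((critical_good _ _ _).1 ck).2.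
  have [[i Rik]|ni] := pselect (exists i, Rm i k).
    by exists i; apply/(ceq _ _ Rik) => //; apply/(c1 _ _ Rik).
  exfalso; apply: nck.
  have xk : enorm (x k) <= e by apply: (mt_right mt) => i Rik; apply: ni; exists i.
  apply: (family_hullS _ (Fb (x k) _)); last lra.
  move=> f Ff; split; first exact: FJ.
  by move=> /= E; have := xF f Ff; rewrite E; lra.
Qed.

End Step.

Lemma good_peel_cofinite x r : good x -> finite_set (~` peel_index (seg \o x) r).
Proof.
move=> gx; rewrite /peel_index; elim: (r.-1) => [|n IH] /=; first by rewrite setCT.
by have [] := critical_cofinite gx IH.
Qed.

Lemma matching_iter x (m : nat) : good x -> exists2 e0 : R, 0 < e0 &
  forall e, 0 < e -> e <= e0 -> forall (I : choiceType) (M : I -> set V) Rm, matching M x Rm e ->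
  forall n, (n < m)%N ->
    [/\ corr Rm (peel_index M n.+2) (peel_index (seg \o x) n.+2),
      hclose (family_hull M (peel_index M n.+1)) (family_hull (seg \o x) (peel_index (seg \o x) n.+1)) e,
      forall y, enorm y <= e -> family_hull M (peel_index M n.+1) y &
      critical M (peel_index M n.+1) !=set0].
Proof.
move=> gx; elim: m => [|m [e1 e10 IH]]; first by exists 1.
have hJ := good_peel_cofinite m.+1 gx.
have [e2 e20 H2] := good_thresholds gx hJ.
exists (Num.min e1 e2); first by rewrite lt_min e10.
move=> e e0; rewrite le_min => /andP[ee1 ee2] I M Rm mt n.
rewrite ltnS leq_eqVlt => /orP[/eqP ->|]; last exact: (IH e e0 ee1 I M Rm mt).
apply: (matching_step gx e0 mt hJ _ (H2 e e0 ee2)).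
(* At the first step both index sets are full, so the correspondence is trivial; later it is the
   first conclusion of the preceding step. *)
case: m {hJ H2} IH => [|m] IH; first by split.
by have [] := IH e e0 ee1 I M Rm mt m (ltnSn m).
Qed.

(** The depth is an infimum of integers, none of which is at most [m]; hence it is at least
    [m.+1]. *)
Lemma peel_depth_gt (I : Type) (M : I -> set V) (m : nat) :
  (forall r, (0 < r <= m)%N -> ~ peel_stops M r) -> ((m%:R)%:E < peel_depth M)%E.
Proof.
move=> H; apply: (@lt_le_trans _ _ ((m.+1)%:R)%:E); first by rewrite lte_fin ltr_nat.
apply: le_ereal_inf_tmp => _ [r [r0 sr] <-]; rewrite lee_fin ler_nat ltnNge.
by apply/negP => rm; apply: (H r) => //; rewrite r0.
Qed.

(** A matching says nothing about distinctness of the [M i], so admissibility is assumed separately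
    for definedness. The hull of [M] need not be closed; passing to the closure doubles the error,
    whence [e / 2]. *)
Lemma matching_peel (hd : (0 < d)%N) x (m : nat) (e : R) : good x -> 0 < e ->
  exists2 e0 : R, 0 < e0 & forall h, 0 < h -> h <= e0 ->
  forall (I : choiceType) (M : I -> set V) Rm, matching M x Rm h ->
    (peel_admissible M -> forall r, (0 < r <= m)%N -> peel_defined M r) /\
    forall r, (0 < r <= m)%N ->
      in_K0 (peel M r) /\ hclose (peel M r) (peel (seg \o x) r) e.
Proof.
move=> gx e0; have [e1 e10 H1] := matching_iter m gx.
exists (Num.min e1 (e / 2)); first by rewrite lt_min e10/= divr_gt0.
move=> h h0; rewrite le_min => /andP[he1 he] I M Rm mt.
have H r : (0 < r <= m)%N -> [/\ hclose (family_hull M (peel_index M r)) (family_hull (seg \o x) (peel_index (seg \o x) r)) h,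
      (family_hull M (peel_index M r))° 0 & critical M (peel_index M r) !=set0].
  case: r => // r; rewrite andTb => rm; have [_ a b c] := H1 h h0 he1 I M Rm mt r rm.
  split => //; apply/interior_enormP; exists h => // y; rewrite subr0 => yh.
  by apply: b; exact: ltW.
split.
  move=> Ma r /andP[r0 rm]; split => //; apply: peel_depth_gt => s /andP[s0 sr].
  have [_ i0 [k ck]] := H s (introT andP (conj s0 (leq_trans sr rm))).
  have i1 : (family_hull M setT)° 0.
    by apply: interiorS i0; exact: family_hullS.
  move=> [|E]; last by move: ck; rewrite E.
  by rewrite (affdim_interior i0) (affdim_interior i1) ltnn.
move=> r rm; have [[hc1 hc2] i0 _] := H r rm.
have kL : compact (family_hull (seg \o x) (peel_index (seg \o x) r)).
  by apply: (good_hull_compact gx); exact: good_peel_cofinite.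
have /compact_enormP[clL [N HN]] := kL.
split.
  split.
  - apply/compact_enormP; split; first exact: closed_closure.
    exists (N + h + 1) => y /closure_enormP/(_ 1 ltr01)[z /hc1[w /HN wN zw] yz].
    have := enormD (y - w) w; have := enorm_dist y z w; rewrite subrK; lra.
  - exact/closure_convex/chull_convex.
  - exact: (interiorS (@subset_closure _ _)).
rewrite /peel -((closure_id _).1 clL); split.
  move=> y /closure_enormP/(_ h h0)[z /hc1[w Lw zw] yz]; exists w => //.
  by have := enorm_dist y z w; lra.
move=> y /hc2[z Mz yz]; exists z; first exact: subset_closure.
lra.
Qed.

Lemma good_matching x (e : R) : 0 < e -> matching (seg \o x) x eq e.
Proof.
move=> e0; split.
- by move=> i; split; [exact: seg_compact|exact: seg_convex|exact: seg0].
- by move=> i k k' <-.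
- by move=> i i' k -> ->.
- by move=> i _ <-; split => y Hy; exists y => //; rewrite subrr enorm0 ltW.
- by move=> i y /(_ i).
- by move=> k /(_ k).
Qed.

Lemma seg_inj : injective (@seg R d).
Proof.
move=> y z E; have /segP[s /andP[s0 s1] yE] : seg z y by rewrite -E; exact: seg1.
have /segP[t /andP[t0 t1] zE] : seg y z by rewrite E; exact: seg1.
have [sE|s1'] := eqVneq s 1; first by rewrite yE sE scale1r.
suff : enorm z = 0 by move=> /enorm_eq0 z0; rewrite yE z0 scaler0.
have : enorm z <= s * enorm z.
  rewrite {1}zE yE scalerA enormZ ger0_norm ?mulr_ge0//.
  by rewrite ler_wpM2r ?enorm_ge0// ler_piMl.
have [z0|z0] := eqVneq (enorm z) 0; first by [].
rewrite leNgt gtr_pMl ?lt_neqAle ?s1' ?s1//.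
by rewrite eq_sym z0 enorm_ge0.
Qed.

Lemma good_admissible (hd : (0 < d)%N) x : good x -> peel_admissible (seg \o x).
Proof.
move=> gx; have c0 : finite_set (~` (setT : set nat)) by rewrite setCT.
split.
- by move=> i j /seg_inj/(good_inj gx).
- by move=> i; split; [exact: seg_compact|exact: seg_convex].
- exact: (good_hull_compact gx).
- have [F [r [_ _ _ r0 Hr]]] := good_span gx c0.
  rewrite (@affdim_interior _ _ _ 0)//; apply/interior_enormP; exists r => // y.
  by rewrite subr0 => /ltW/Hr; exact: family_hullS.
Qed.

(** The stability statement applied to the family matched with itself. *)
Lemma good_peel (hd : (0 < d)%N) x r : good x -> (0 < r)%N ->
  peel_defined (seg \o x) r /\ in_K0 (peel (seg \o x) r).
Proof.
move=> gx r0; have [e0 e00 H] := matching_peel hd r gx ltr01.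
have [H1 H2] := H e0 e00 (lexx _) _ _ _ (good_matching x e00).
have rr : (0 < r <= r)%N by rewrite r0 leqnn.
split; last by have [] := H2 r rr.
exact: H1 (good_admissible hd gx) _ rr.
Qed.

End Stability.

(** * Convergence of bodies *)

Section HausdorffSpace.
Context {R : realType} {d : nat}.
Local Notation V := 'rV[R]_d.
Implicit Types (A B C : body0 R d).

Lemma hausdorff_le A B (e : R) : 0 <= e -> hclose A B e -> hausdorff_dist A B <= e.
Proof.
move=> e0 [AB BA]; apply: ge_inf; last by split.
by have [] := hausdorff_radii_inf A B.
Qed.

Lemma hausdorff_lt A B (e : R) : hausdorff_dist A B < e -> hclose A B e.
Proof.
move=> ABe; have e0 : 0 < e - hausdorff_dist A B by rewrite subr_gt0.
have [r [r0 AB BA] re] := inf_adherent e0 (hausdorff_radii_inf A B).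
have {}re : r <= e by apply: ltW; rewrite addrC subrK in re.
by split=> y /[dup] _ => [/AB|/BA][z Bz yz]; exists z => //; apply: le_trans yz re.
Qed.

(** Polarity is Lipschitz with constant [r^-2] on sets containing the ball of radius [r], since
    polars then lie in the ball of radius [r^-1]. *)
Lemma polar_hclose (A B : set V) (r e : R) : 0 < r -> 0 <= e ->
  (forall y, enorm y <= r -> A y) -> (forall y, enorm y <= r -> B y) ->
  hclose A B e -> hclose (polar A) (polar B) (e / r ^+ 2).
Proof.
move=> r0 e0; suff main (A' B' : set V) : (forall y, enorm y <= r -> A' y) -> A' `<=` parallel_set B' e ->
    (forall y, enorm y <= r -> B' y) -> polar B' `<=` parallel_set (polar A') (e / r ^+ 2).
  by move=> Ar Br [AB BA]; split; exact: main.
move=> Ar AB Br y By.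
have yr : enorm y <= r^-1.
  have [->|y0] := eqVneq (enorm y) 0; first by rewrite invr_ge0 ltW.
  have y0' : 0 < enorm y by rewrite lt_neqAle eq_sym y0 enorm_ge0.
  have By' : B' ((r / enorm y) *: y).
    by apply: Br; rewrite enormZ ger0_norm ?divr_ge0 ?enorm_ge0 ?(ltW r0)// divfK.
  have := By _ By'; rewrite dotZl -enorm_sqr.
  by rewrite expr2 mulrA divfK// -ler_pdivlMl// mulr1.
(* A point at distance [e] from [B] has inner product at most [1 + e / r] with [y], so this
   contraction of [y] lands in the other polar. *)
pose c := (1 + e / r)^-1.
have c0 : 0 < 1 + e / r by rewrite ltr_pwDl// divr_ge0// ltW.
exists (c *: y).
  move=> x /AB[z Bz xz]; rewrite dotZr /c mulrC ler_pdivrMr// mul1r.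
  have -> : x = z + (x - z) by rewrite addrC subrK.
  rewrite dotDl; apply: lerD; first exact: By.
  apply: le_trans (dot_le_enorm _ _) _; apply: ler_pM; rewrite ?enorm_ge0//.
rewrite -{1}(scale1r y) -scalerBl enormZ.
have -> : 1 - c = (e / r) * c 
  by rewrite -[e / r](addKr 1) (addrC (-1)) mulrBl mul1r /c mulfV// gt_eqF.
rewrite ger0_norm; last by rewrite mulr_ge0 ?divr_ge0 ?invr_ge0 ?(ltW r0) ?(ltW c0).
have -> : e / r ^+ 2 = (e / r) * 1 * r^-1 by field; rewrite gt_eqF.
apply: ler_pM; rewrite ?enorm_ge0 ?mulr_ge0 ?invr_ge0 ?divr_ge0 ?(ltW r0) ?(ltW c0)//.
  by apply: ler_wpM2l; rewrite ?divr_ge0 ?(ltW r0)// invf_le1// lerDl divr_ge0// ltW.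
Qed.

(** Otherwise a sequence outside [U] would converge to [y] in every coordinate, hence in the product
    topology. *)
Lemma ptws_open_near (m : nat) (U : set {ptws 'I_m -> body0 R d}) y : open U -> U y ->
  exists2 e : R, 0 < e & forall z : 'I_m -> body0 R d, (forall r, hausdorff_dist (y r) (z r) < e) -> U z.
Proof.
move=> oU Uy; apply: contrapT => H.
have /choice[z Hz] : forall n : nat, exists z : 'I_m -> body0 R d,
    (forall r, hausdorff_dist (y r) (z r) < n.+1%:R^-1) /\ ~ U z.
  move=> n; apply: contrapT => Hn; apply: H; exists n.+1%:R^-1 => // z Hz.
  by apply: contrapT => Uz; apply: Hn; exists z.
have zy : z n @[n --> \oo] --> (y : {ptws 'I_m -> body0 R d}).
  apply/cvg_sup => i.
  rewrite cvg_image; last by rewrite eqEsubset; split=> v // _; exists (cst v).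
  move=> W nW; exists (@^~ i @^-1` W); last first.
    by rewrite eqEsubset; split => [j [? + <-//]|j Wj]; exists (fun _ => j).
  move: nW => /nbhs_ballP[e /= e0 eW].
  have [N HN] := natSinv_small e0.
  exists N => // n /= Nn; apply: eW; rewrite ballEmdist /=.
  apply: lt_le_trans ((Hz n).1 i) _; apply: le_trans (ltW HN).
  by rewrite lef_pV2 ?posrE// ler_nat ltnS.
have /zy[N _ HN] : nbhs (y : {ptws 'I_m -> body0 R d}) U by exact: open_nbhs_nbhs.
exact: (Hz N).2 (HN N (leqnn N)).
Qed.

Lemma ptws_continuous_near (m : nat) (f : {ptws 'I_m -> body0 R d} -> R) y (e : R) :
  continuous f -> 0 < e ->
  exists2 h : R, 0 < h & forall z : 'I_m -> body0 R d, (forall r, hausdorff_dist (y r) (z r) < h) ->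
    `|f y - f z| < e.
Proof.
move=> cf e0; apply: (@ptws_open_near m (f @^-1` ball (f y) e)).
  by apply: open_comp; [move=> z _; exact: cf|exact: ball_open].
exact: ballxx.
Qed.

(** The approximations take values through finite codes, so preimages of arbitrary sets under them
    are measurable; no topological property of the inner sets [Uk] is required. *)
Lemma limit_measurable (m : nat) (dT : measure_display) (T : measurableType dT)
    (Yj : nat -> T -> 'I_m -> body0 R d) (Y : T -> {ptws 'I_m -> body0 R d}) :
  (forall j (U : set ('I_m -> body0 R d)), measurable (Yj j @^-1` U)) ->
  (forall w e, 0 < e -> exists N, forall j, (N <= j)%N -> forall r, hausdorff_dist (Yj j w r) (Y w r) < e) ->
  forall U, open U -> measurable (Y @^-1` U).
Proof.
move=> mY cY U oU.
pose Uk (k : nat) := [set y : 'I_m -> body0 R d | forall z : 'I_m -> body0 R d,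
  (forall r, hausdorff_dist (y r) (z r) < k.+1%:R^-1) -> U z].
have -> : Y @^-1` U = \bigcup_k \bigcup_N \bigcap_(j in [set j | (N <= j)%N]) (Yj j @^-1` Uk k).
  apply/seteqP; split=> w /=.
    move=> /(ptws_open_near oU)[e e0 He].
    have [k Hk] := natSinv_small (divr_gt0 e0 (ltr0Sn R 1)).
    have [N HN] := cY w (e / 2) (divr_gt0 e0 (ltr0Sn R 1)).
    exists k => //; exists N => // j /= Nj z Hz; apply: He => r.
    apply: (le_lt_trans (hausdorff_dist_triangle (Yj j w r) _ _)).
    rewrite hausdorff_dist_sym (splitr e); apply: ltrD; first exact: HN.
    exact: lt_trans (Hz r) Hk.
  move=> [k _ [N _ H]].
  have [N' HN'] := cY w (k.+1%:R^-1) (ltac:(by rewrite invr_gt0)).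
  exact: (H (maxn N N') (leq_maxl _ _)) (HN' (maxn N N') (leq_maxr _ _)).
apply: bigcupT_measurable => k; apply: bigcupT_measurable => N.
by apply: bigcap_measurable => //; exists N => /=.
Qed.

(** The parameter [g] is the identity for peelings and polarity for wrappings, so that one argument
    serves both halves of the theorem. *)
Definition hcont (g : body0 R d -> body0 R d) := forall A (e : R), 0 < e ->
  exists2 h : R, 0 < h & forall B, hausdorff_dist A B < h -> hausdorff_dist (g A) (g B) < e.

Definition polar_body A : body0 R d := Body0 (polar_in_K0 (body0P A)).

Lemma id_hcont : hcont id.
Proof. by move=> A e e0; exists e. Qed.

Lemma polar_hcont : hcont polar_body.
Proof.
move=> A e e0; have [kA cA /interior_enormP[r r0 Ar]] := body0P A.
(* The first bound guarantees that every [B] within [h] still contains the ball of radius [r / 4];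
   the second then makes the Lipschitz estimate smaller than [e]. *)
pose h := Num.min (r / 4) (e * (r / 4) ^+ 2 / 2).
have r4 : 0 < r / 4 by lra.
have h0 : 0 < h by rewrite lt_min r4/= divr_gt0// mulr_gt0// exprn_gt0.
have h1 : h <= r / 4 by rewrite ge_min lexx.
have h2 : h <= e * (r / 4) ^+ 2 / 2 by rewrite ge_min lexx orbT.
exists h => // B ABh; have ABc := hausdorff_lt ABh.
have [kB cB _] := body0P B.
apply: (@le_lt_trans _ _ (h / (r / 4) ^+ 2)).
  apply: hausdorff_le; first by rewrite divr_ge0 ?sqr_ge0// ltW.
  apply: polar_hclose => //; first exact: ltW.
    by move=> y yr; apply: Ar; rewrite subr0; lra.
  move=> y yr; apply: (@cball_parallel _ _ A _ y (r / 2) h) => //.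
  - by exists 0; exact: body0_0.
  - exact: ltW.
  - by lra.
  - by move=> z zy; apply: Ar; rewrite subr0; have := enormD (z - y) y; rewrite subrK; lra.
  - by have [] := ABc.
rewrite ltr_pdivrMr ?exprn_gt0//; apply: le_lt_trans h2 _.
have : 0 < e * (r / 4) ^+ 2 by rewrite mulr_gt0// exprn_gt0.
lra.
Qed.

(** The default [B0] is returned without applying [g], in accordance with [wrap_body0], whose
    default is not polarised. *)
Definition peelval (g : body0 R d -> body0 R d) B0 (I : Type) (M : I -> set V) (r : nat) : body0 R d :=
  match pselect (peel_defined M r /\ in_K0 (peel M r)) with
  | left h => g (Body0 (proj2 h))
  | right _ => B0
  end.

Lemma peelvalE g B0 (I : Type) (M : I -> set V) r (h : in_K0 (peel M r)) : peel_defined M r ->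
  peelval g B0 M r = g (Body0 h).
Proof.
by move=> dM; rewrite /peelval; case: pselect => [[h1 h2]|[]//]; congr g; exact: body0_inj.
Qed.

(** The two sides test membership in the space of bodies at different places, for the polar and for
    the peeling; the third hypothesis reconciles them. *)
Lemma wrap_val B0 (I : Type) (L M : I -> set V) r : (forall i, in_frakK0 (L i)) ->
  (forall i, polar (L i) = M i) -> (peel_defined M r -> in_K0 (peel M r)) ->
  wrap_body0 B0 L r = peelval polar_body B0 M r.
Proof.
move=> hL LM hM; have {LM}LM : polar \o L = M by apply/funext.
rewrite /wrap_body0 /body0_or /peelval /wrap_defined LM.
case: pselect => [[[h1 h2] h3]|H]; case: pselect => [[h4 h5]|H'] //.
- by apply: body0_inj; rewrite /= /Defs.wrap LM.
- by exfalso; apply: H'; split => //; exact: hM.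
- by exfalso; apply: H; split => //; rewrite /Defs.wrap LM; exact: polar_in_K0.
Qed.

Lemma peelval_stable (hd : (0 < d)%N) g (hg : hcont g) B0 x (m : nat) (e : R) : good x -> 0 < e ->
  exists2 e0 : R, 0 < e0 & forall h, 0 < h -> h <= e0 ->
  forall (I : choiceType) (M : I -> set V) Rm, matching M x Rm h -> peel_admissible M ->
  forall r : 'I_m, hausdorff_dist (peelval g B0 M r.+1) (peelval g B0 (seg \o x) r.+1) < e.
Proof.
move=> gx e0.
pose A (r : 'I_m) := Body0 (good_peel hd gx (ltn0Sn r)).2.
have [h0 h00 Hh] : exists2 h0 : R, 0 < h0 & forall (r : 'I_m) h, setT r -> 0 < h -> h <= h0 ->
    forall B, hausdorff_dist (A r) B <= h -> hausdorff_dist (g (A r)) (g B) < e.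
  have := @finite_uniform R 'I_m setT (fun r h => forall B, hausdorff_dist (A r) B <= h ->
    hausdorff_dist (g (A r)) (g B) < e) finite_finset; apply => r _.
  have [h h0 Hh] := hg (A r) e e0; exists (h / 2); first lra.
  move=> h' h'0 h'h B AB; apply: Hh; lra.
have [e1 e10 H1] := matching_peel hd m gx h00.
exists e1 => // h hh he I M Rm mt Ma r.
have [H2 H3] := H1 h hh he I M Rm mt.
have rm : (0 < r.+1 <= m)%N by rewrite ltn_ord.
have [inM hc] := H3 r.+1 rm.
rewrite (peelvalE _ _ inM) ?(peelvalE _ _ (good_peel hd gx (ltn0Sn r)).2); last 2 first.
- exact: (good_peel hd gx _).1.
- exact: H2.
rewrite hausdorff_dist_sym; apply: (Hh r h0) => //.
by rewrite hausdorff_dist_sym; apply: hausdorff_le => //; exact: ltW.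
Qed.

End HausdorffSpace.

(** * Integrals of functions equal almost everywhere, without measurability *)

Section AlmostEverywhere.
Import HBNNSimple.
Context {R : realType} {dT : measure_display} {T : measurableType dT} (P : {measure set T -> \bar R}).

(** The integral is a supremum over simple functions below. Such a function below [f], cut off on
    the null set, lies below [g] and keeps its integral; measurability of [f] and [g] does not
    enter. *)
Lemma ae_eq_ge0_integral (f g : T -> \bar R) : (forall x, 0 <= f x)%E -> (forall x, 0 <= g x)%E ->
  {ae P, forall x, f x = g x} -> (\int[P]_x f x = \int[P]_x g x)%E.
Proof.
suff H f' g' : (forall x, 0 <= f' x)%E -> (forall x, 0 <= g' x)%E ->
    {ae P, forall x, f' x = g' x} -> (\int[P]_x f' x <= \int[P]_x g' x)%E.
  move=> f0 g0 fg; apply/eqP; rewrite eq_le; apply/andP; split; apply: H => //.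
  by apply: filterS fg => x.
move=> f0 g0 [N [mN PN0 fgN]].
rewrite !ge0_integralTE//; apply: ub_ereal_sup => _ [h hf <-].
pose h' := mul_nnsfun h (indic_nnsfun R (measurableC mN)).
set E := ereal_sup _; have h'E : (sintegral P h' <= E)%E.
  apply: ereal_sup_ubound; exists h' => //= x; have [Nx|nNx] := pselect (N x).
    by rewrite /measurable_realfun.mindic indicE memNset ?mulr0//=; apply.
  rewrite /measurable_realfun.mindic indicE mem_set// mulr1; have -> : g' x = f' x; last exact: hf.
  by apply/esym; apply: contrapT => neq; apply: nNx; apply: fgN.
apply: le_trans h'E.
rewrite -!integralT_nnsfun le_eqVlt; apply/orP; left; apply/eqP.
apply: ae_eq_integral => //.
- exact/measurable_realfun.measurable_EFinP.
- exact/measurable_realfun.measurable_EFinP.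
exists N; split => // x /= H; apply: contrapT => nNx; apply: H => _.
by rewrite /measurable_realfun.mindic indicE mem_set// mulr1.
Qed.

Lemma ae_eq_integralT (f g : T -> \bar R) :
  {ae P, forall x, f x = g x} -> (\int[P]_x f x = \int[P]_x g x)%E.
Proof.
move=> fg; rewrite integralE (integralE _ _ g); congr (_ - _)%E;
  by apply: ae_eq_ge0_integral => //; apply: filterS fg => x /= fgx;
  rewrite ?funeposE ?funenegE fgx.
Qed.

End AlmostEverywhere.

(** * Admissibility of the two families *)

Section Families.
Context {R : realType} {d : nat}.
Local Notation V := 'rV[R]_d.
Implicit Types (K : set V) (x y z u v : V).

Lemma translate_in_K0 K n x : (0 < n)%N -> in_K0 K -> K° x ->
  in_K0 [set (n%:R : R) *: (y - x) | y in K].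
Proof.
move=> n0 [kK /convex_setP cK iK] /interior_enormP[e e0 He].
have n0' : 0 < (n%:R : R) by rewrite ltr0n.
split.
- apply: continuous_compact => //; apply: continuous_subspaceT.
  apply: scaleV_continuous; first exact: cstV_continuous.
  by apply: subV_continuous; [exact: idV_continuous|exact: cstV_continuous].
- apply/convex_setP => _ _ t [y Ky <-] [z Kz <-] t01.
  by exists (t *: y + (1 - t) *: z); [exact: cK|vring].
- apply/interior_enormP; exists (n%:R * e); first exact: mulr_gt0.
  move=> y; rewrite subr0 => ye; exists (x + n%:R^-1 *: y).
    apply: He; rewrite addrC addKr enormZ normfV ger0_norm ?ler0n//.
    by rewrite ltr_pdivrMl.
  by rewrite addrC addKr scalerA mulfV ?gt_eqF// scale1r.
Qed.

Lemma polar_translate K n x : (0 < n)%N ->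
  polar [set (n%:R : R) *: (y - x) | y in K] = spol K n x.
Proof.
move=> n0; apply/seteqP; split=> z.
  by move=> pz; apply/spolP => // k Kk; rewrite -dotZl; apply: pz; exists k.
by move=> /(spolP _ _ _ n0) H _ [k Kk <-]; rewrite dotZl; exact: H.
Qed.

Lemma spol_in_K0 K n x : (0 < n)%N -> in_K0 K -> K° x -> in_K0 (spol K n x).
Proof.
by move=> n0 hK Kx; rewrite -polar_translate//; apply: polar_in_K0; exact: translate_in_K0.
Qed.

(** The polar determines the support value of the translate in the direction [v = x - x']; the
    supports of the two translates differ there by [dot v v]. *)
Lemma spol_inj K n x x' : (0 < n)%N -> in_K0 K -> K° x -> spol K n x = spol K n x' -> x = x'.
Proof.
move=> n0 hK /interior_enormP[e e0 He] xx'; apply/eqP; rewrite -subr_eq0; apply/negPn/negP => v0.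
set v := x - x' in v0.
have n0' : 0 < (n%:R : R) by rewrite ltr0n.
have [y /set_mem Ky ymax] : exists2 y, y \in K & forall z, z \in K -> dot z v <= dot y v.
  apply: EVT_max_rV; [exact: body_neq0|by have [] := hK|].
  apply: continuous_subspaceT.
  by apply: dot_continuous; [exact: idV_continuous|exact: cstV_continuous].
have v0' : 0 < enorm v by apply: enorm_gt0.
have c0 : 0 < dot (y - x) v.
  have : K (x + (e / 2 / enorm v) *: v).
    apply: He; rewrite addrC addKr enormZ ger0_norm ?divfK ?gt_eqF//; first lra.
    by rewrite !divr_ge0 ?enorm_ge0// ltW.
  move=> /mem_set/ymax; rewrite dotDl dotZl dotBl -enorm_sqr => h.
  have : 0 < e / 2 / enorm v * enorm v ^+ 2 by rewrite mulr_gt0 ?exprn_gt0 ?divr_gt0.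
  lra.
have : spol K n x ((n%:R * dot (y - x) v)^-1 *: v).
  apply/spolP => // k Kk; rewrite dotZr mulrCA mulrC ler_pdivrMr ?mulr_gt0// mul1r.
  by rewrite ler_pM2l// !dotBl lerD2r; apply: ymax; exact: mem_set.
rewrite xx' => /(spolP _ _ _ n0)/(_ _ Ky).
rewrite dotZr mulrCA mulrC ler_pdivrMr ?mulr_gt0// mul1r ler_pM2l// !dotBl.
have : 0 < dot v v by rewrite -enorm_sqr exprn_gt0.
by rewrite {1}/v dotBl; lra.
Qed.

(** An empty index set has empty hull, whose [affdim] is 0 by convention and so below the initial
    dimension; the procedure would have stopped. *)
Lemma peel_index_nonempty (I : Type) (M : I -> set V) r : peel_defined M r -> peel_index M r !=set0.
Proof.
move=> [[_ _ _ a0] r0 dr]; apply: contrapT => /set0P/negP/negPn/eqP E.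
have : peel_stops M r.
  left; rewrite E; apply: leq_ltn_trans a0; apply: affdim_le => k x0 X H _ _; exfalso.
  by apply: (H set0); split; [apply/convex_setP|move=> y [i []]].
move=> sr; move: dr; rewrite ltNge => /negP; apply.
by apply: ereal_inf_lbound; exists r.
Qed.

Lemma prelimit_in_K0 K n (y : nat -> V) r : in_K0 K -> (forall i : 'I_n, K° (y i)) ->
  peel_defined (@scaled_polar_family R d K y n) r -> in_K0 (peel (@scaled_polar_family R d K y n) r).
Proof.
move=> hK Ky /peel_index_nonempty[i0 Ji0].
have n0 : (0 < n)%N by exact: leq_ltn_trans (ltn_ord i0).
have kH : compact (family_hull (@scaled_polar_family R d K y n) (peel_index (@scaled_polar_family R d K y n) r)).
  apply: family_hull_compact; [exact: finite_finset|by exists i0|move=> i _].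
  by have [? ? ?] := spol_in_K0 n0 hK (Ky i); split => //; exact: interior_subset.
have /compact_enormP[clH _] := kH.
rewrite /peel -((closure_id _).1 clH); split => //; first exact: chull_convex.
have [_ _] := spol_in_K0 n0 hK (Ky i0); apply: interiorS.
exact: (family_sub (M := @scaled_polar_family R d K y n)).
Qed.

Lemma prelimit_admissible K n (y : nat -> V) : (0 < d)%N -> in_K0 K -> (0 < n)%N ->
  (forall i : 'I_n, K° (y i)) -> (forall i j : 'I_n, y i = y j -> i = j) ->
  peel_admissible (@scaled_polar_family R d K y n).
Proof.
move=> hd hK n0 Ky yinj.
have Mi i := spol_in_K0 n0 hK (Ky i).
split.
- by move=> i j /(spol_inj n0 hK (Ky i))/yinj.
- by move=> i; have [] := Mi i.
- apply: family_hull_compact; [exact: finite_finset|by exists (Ordinal n0)|move=> i _].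
  by have [? ? ?] := Mi i; split => //; exact: interior_subset.
- rewrite (@affdim_interior _ _ _ 0)//.
  have [_ _] := Mi (Ordinal n0); apply: interiorS.
  exact: (family_sub (M := @scaled_polar_family R d K y n)).
Qed.

Lemma prelimit_wrap K n (y : nat -> V) B0 r : in_K0 K -> (forall i : 'I_n, K° (y i)) ->
  wrap_body0 B0 (@scaled_translate_family R d K y n) r =
  peelval (@polar_body R d) B0 (@scaled_polar_family R d K y n) r.
Proof.
move=> hK Ky; apply: wrap_val.
- move=> i; have n0 : (0 < n)%N by exact: leq_ltn_trans (ltn_ord i).
  have [k1 k2 k3] := translate_in_K0 n0 hK (Ky i); split => //.
  by have /compact_enormP[] := k1.
- move=> i; have n0 : (0 < n)%N by exact: leq_ltn_trans (ltn_ord i).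
  exact: polar_translate.
- exact: prelimit_in_K0.
Qed.

(** The half-space contains the whole hyperplane orthogonal to [u] and the whole ray opposite to
    [u], which forces polar vectors to be nonnegative multiples of [u]. *)
Lemma polar_halfspace u (t : R) : 0 < t -> enorm u = 1 ->
  polar [set x | dot x u <= t] = seg (t^-1 *: u).
Proof.
move=> t0 u1; have uu : dot u u = 1 by rewrite -enorm_sqr u1 expr1n.
apply/seteqP; split=> [z pz|z /segP[s /andP[s0 s1] ->]]; last first.
  move=> x /= xu; rewrite !dotZr.
  apply: (@le_trans _ _ (s * 1)); last by rewrite mulr1.
  by apply: ler_wpM2l => //; rewrite mulrC ler_pdivrMr// mul1r.
set c := dot z u.
have w0 : z = c *: u.
  apply/eqP; rewrite -subr_eq0; apply/negPn/negP => w0.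
  set w := z - c *: u in w0.
  have wu : dot w u = 0 by rewrite /w dotBl dotZl uu mulr1 /c subrr.
  have w0' : 0 < dot w w by rewrite -enorm_sqr exprn_gt0// enorm_gt0.
  have := pz ((2 / dot w w) *: w); rewrite /= dotZl wu mulr0 => /(_ (ltW t0)).
  have -> : z = w + c *: u by rewrite /w subrK.
  rewrite dotZl dotDr dotZr wu mulr0 addr0 divfK ?gt_eqF//; lra.
have c0 : 0 <= c.
  rewrite leNgt; apply/negP => c0.
  have := pz ((2 / c) *: u); rewrite /= w0 !dotZl dotZr uu !mulr1 divfK ?lt_eqF// => H.
  have : 2 / c < 0 by rewrite pmulr_rlt0// invr_lt0.
  by move=> h; have := H _; lra.
have c1 : c * t <= 1.
  have := pz (t *: u); rewrite /= w0 !dotZl dotZr uu !mulr1 => /(_ (lexx _)).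
  by rewrite mulrC.
apply/segP; exists (c * t); first by rewrite mulr_ge0// ltW.
by rewrite w0 scalerA mulfK ?gt_eqF.
Qed.

Lemma halfspace_in_frakK0 u (t : R) : 0 < t -> enorm u = 1 -> in_frakK0 [set x : V | dot x u <= t].
Proof.
move=> t0 u1; split.
- apply: (@closed_le_fun _ _ (fun x : V => dot x u) (fun=> t)); last by move=> ?; exact: cst_continuous.
  by apply: dot_continuous; [exact: idV_continuous|exact: cstV_continuous].
- have -> : [set x : V | dot x u <= t] = [set x | dot u x <= t].
    by apply/seteqP; split=> x /=; rewrite dotC.
  exact: halfspace_convex.
- apply/interior_enormP; exists t => // y; rewrite subr0 => yt /=.
  by have := dot_unitr y u1; lra.
Qed.

Lemma limit_wrap (p : nat -> R * V) B0 r : (0 < d)%N -> (forall i, 0 < (p i).1 /\ enorm (p i).2 = 1) ->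
  good (tip \o p) -> wrap_body0 B0 (halfspace_family p) r.+1 = peelval (@polar_body R d) B0 (segment_family p) r.+1.
Proof.
move=> hd hp gx; apply: wrap_val.
- by move=> i; have [t0 u1] := hp i; exact: halfspace_in_frakK0.
- by move=> i; have [t0 u1] := hp i; exact: polar_halfspace.
- by move=> _; exact: (good_peel hd gx (ltn0Sn r)).2.
Qed.

End Families.

(** * Poisson points in a mesh *)

Section Products.
Context {R : realType}.
Implicit Types (I : finType).

(** The Weierstrass product inequality, by induction on the number of factors. *)
Lemma prod_one_minus_ge (I : Type) (s : seq I) (f : I -> R) : (forall i, 0 <= f i <= 1) ->
  1 - \sum_(i <- s) f i <= \prod_(i <- s) (1 - f i).
Proof.
move=> f01; elim: s => [|i s IH]; first by rewrite !big_nil subr0.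
rewrite !big_cons; have /andP[h0 h1] := f01 i.
have s0 : 0 <= \sum_(j <- s) f j by apply: sumr_ge0 => j _; have /andP[] := f01 j.
have p1 : \prod_(j <- s) (1 - f j) <= 1.
  apply: (@le_trans _ _ (\prod_(j <- s) 1)); last by rewrite big1.
  apply: ler_prod => j _; have /andP[a b] := f01 j.
  by rewrite subr_ge0 b/= lerBlDr lerDl.
move: (f i) (\sum_(j <- s) f j) (\prod_(j <- s) (1 - f j)) h0 h1 s0 p1 IH {f01} => a b c *.
nra.
Qed.

Lemma sum_prod_sets I (f g : I -> R) :
  \sum_(C : {set I}) \prod_i (if i \in C then f i else g i) = \prod_i (f i + g i).
Proof. by rewrite bigA_distr; apply: eq_bigl => C. Qed.

(** The right side is the probability that independent Poisson counts are all at most 1; each factor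
    is at least [1 - l i ^+ 2]. *)
Lemma sum_exp_weight I (l : I -> R) (eps : R) : (forall i, 0 <= l i) -> \sum_i l i ^+ 2 <= eps ->
  eps <= 1 -> 1 - eps <= \prod_i (expR (- l i) * l i + expR (- l i)).
Proof.
move=> l0 leps eps1; apply: (@le_trans _ _ (1 - \sum_i l i ^+ 2)); first by rewrite lerB.
have l1 i : l i ^+ 2 <= 1.
  apply: le_trans eps1; apply: le_trans leps; rewrite (bigD1 i)//= lerDl.
  by apply: sumr_ge0 => j _; exact: sqr_ge0.
apply: le_trans (prod_one_minus_ge _ _) _; first by move=> i; rewrite sqr_ge0 l1.
apply: ler_prod => i _; rewrite subr_ge0 l1/=.
have -> : expR (- l i) * l i + expR (- l i) = expR (- l i) * (1 + l i) by ring.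
have -> : 1 - l i ^+ 2 = (1 - l i) * (1 + l i) by ring.
apply: ler_wpM2r; first by rewrite addr_ge0.
by have := expR_ge1Dx (- l i).
Qed.

(** The Poisson weight of a pattern may exceed its sample counterpart, but the excess summed over
    all patterns is of order [eps], however many cells there are. *)
Lemma sum_weight_diff I (l r : I -> R) (eps : R) : (forall i, 0 <= r i) -> (forall i, r i <= l i) ->
  \sum_i (l i - r i) <= eps -> 0 <= eps <= 1 ->
  exists dC : {set I} -> R, [/\ forall C, 0 <= dC C,
    forall C : {set I}, \prod_i (if i \in C then expR (- l i) * l i else expR (- l i)) -
      expR (- (\sum_i r i + eps)) * \prod_i (if i \in C then r i else 1) <= dC C &
    \sum_C dC C <= 2 * eps].
Proof.
move=> r0 rl Hd /andP[eps0 eps1].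
pose pl (C : {set I}) := \prod_i (if i \in C then l i else 1).
pose pr (C : {set I}) := \prod_i (if i \in C then r i else 1).
have l0 i : 0 <= l i by exact: le_trans (rl i).
have prpl (C : {set I}) : 0 <= pr C <= pl C.
  apply/andP; split; first by apply: prodr_ge0 => i _; case: ifP.
  by apply: ler_prod => i _; case: ifP => _; rewrite ?r0 ?rl ?ler01 ?lexx.
set L := \sum_i l i.
have eL (C : {set I}) : \prod_i (if i \in C then expR (- l i) * l i else expR (- l i)) = expR (- L) * pl C.
  rewrite /L -sumrN expR_sum -big_split/=; apply: eq_bigr => i _.
  by case: ifP => _; rewrite ?mulr1.
have LL : \prod_i (l i + 1) * expR (- L) <= 1.
  rewrite expRN -ler_pdivlMr ?invr_gt0 ?expR_gt0// mul1r invrK /L expR_sum.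
  by apply: ler_prod => i _; rewrite addr_ge0//= addrC expR_ge1Dx.
have E0 := expR_ge0 (- L).
(* The first term pays for replacing the intensities in the product, the second for the factor
   [expR (- eps)] in the exponential. *)
exists (fun C => expR (- L) * (pl C - pr C) + eps * (expR (- L) * pl C)); split.
- move=> C; have /andP[h1 h2] := prpl C.
  by rewrite addr_ge0// ?mulr_ge0 ?subr_ge0//; exact: le_trans h2.
- move=> C; rewrite eL -/(pr C); have /andP[h1 h2] := prpl C.
  have h3 : expR (- L) * (1 - eps) <= expR (- (\sum_i r i + eps)).
    have : \sum_i r i <= L by apply: ler_sum.
    move=> rL; apply: (@le_trans _ _ (expR (- L) * expR (- eps))).
      by apply: ler_wpM2l => //; exact: expR_ge1Dx.
    by rewrite -expRD ler_expR; lra.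
  have h4 : expR (- L) * (1 - eps) * pr C <= expR (- (\sum_i r i + eps)) * pr C.
    exact: ler_wpM2r.
  have h5 : expR (- L) * eps * pr C <= expR (- L) * eps * pl C.
    by apply: ler_wpM2l => //; exact: mulr_ge0.
  lra.
- rewrite big_split/= -!mulr_sumr sumrB !sum_prod_sets.
  have h1 : (1 - eps) * \prod_i (l i + 1) <= \prod_i (r i + 1).
    apply: (@le_trans _ _ ((1 - \sum_i (l i - r i)) * \prod_i (l i + 1))).
      apply: ler_wpM2r; last by rewrite lerB.
      by apply: prodr_ge0 => i _; exact: addr_ge0.
    have d1 i : 0 <= l i - r i <= 1.
      rewrite subr_ge0 rl/=; apply: le_trans eps1; apply: le_trans Hd.
      by rewrite (bigD1 i)//= lerDl; apply: sumr_ge0 => j _; rewrite subr_ge0.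
    apply: (@le_trans _ _ (\prod_i (1 - (l i - r i)) * \prod_i (l i + 1))).
      apply: ler_wpM2r; first by apply: prodr_ge0 => i _; exact: addr_ge0.
      exact: prod_one_minus_ge.
    rewrite -big_split/=; apply: ler_prod => i _; have /andP[a b] := d1 i.
    rewrite mulr_ge0 ?subr_ge0 ?addr_ge0//=; have := mulr_ge0 a (l0 i); lra.
  move: (\prod_i (l i + 1)) (\prod_i (r i + 1)) h1 LL => A B h1 LL.
  have h2 : expR (- L) * ((1 - eps) * A) <= expR (- L) * B by exact: ler_wpM2l.
  nra.
Qed.

End Products.

Section FiniteUnion.
Context {dT : measure_display} {T : measurableType dT} {R : realType} (mu : {measure set T -> \bar R}).

Lemma measure_bigcup_fin (I : finType) (F : I -> set T) : (forall i, measurable (F i)) ->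
  (forall i j w, F i w -> F j w -> i = j) -> mu (\bigcup_i F i) = (\sum_i mu (F i))%E.
Proof.
move=> mF dF; rewrite measure_fin_bigcup//.
- have -> : [set: I] = [set` index_enum I].
    by apply/seteqP; split=> i //= _; rewrite mem_index_enum.
  by rewrite -fsbig_seq ?index_enum_uniq.
- exact: finite_finset.
- by move=> i j _ _ [w [Fi Fj]]; exact: dF Fi Fj.
Qed.

Lemma measurable_bigcup_fin (I : finType) (F : I -> set T) : (forall i, measurable (F i)) ->
  measurable (\bigcup_i F i).
Proof. by move=> mF; apply: fin_bigcup_measurable => //; exact: finite_finset. Qed.

End FiniteUnion.

Section Poisson.
Context {R : realType} {d : nat}.
Local Notation V := 'rV[R]_d.
Local Notation ST := (measurableTypeR R * borel_rV R d)%type.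
Context {dO : measure_display} {O : measurableType dO} (Q : probability O R).
Variables (K : set V) (S : {finite_measure set (borel_rV R d) -> \bar R}).
Variable (p : nat -> O -> ST).
Context (p_dom : forall i w, 0 < (p i w).1 /\ enorm (p i w).2 = 1).
Context (p_poisson : poisson_process Q (hyperplane_intensity K S) p).
Local Notation mu := (hyperplane_intensity K S).

Lemma point_count_ge (A : set ST) w i : A (p i w) -> (1%:E <= point_count p A w)%E.
Proof.
move=> Ai; apply: le_trans (@nneseries_lim_ge _ (fun i => (\1_A (p i w))%:E) xpredT 0 i.+1 _); last first.
  by move=> n _ _; rewrite lee_fin.
rewrite big_nat_recr//= indicE mem_set// leeDr//.
by apply: sume_ge0 => j _; rewrite lee_fin.
Qed.

Lemma point_count_ge2 (A : set ST) w i j : A (p i w) -> A (p j w) -> i != j ->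
  (2%:E <= point_count p A w)%E.
Proof.
wlog ij : i j / (i < j)%N.
  move=> H Ai Aj /[dup] ij; rewrite neq_ltn => /orP[h|h]; first exact: (H i j).
  by apply: (H j i) => //; rewrite eq_sym.
move=> Ai Aj _.
apply: le_trans (@nneseries_lim_ge _ (fun i => (\1_A (p i w))%:E) xpredT 0 j.+1 _); last first.
  by move=> n _ _; rewrite lee_fin.
have a1 k : A (p k w) -> (\1_A (p k w))%:E = 1%:E :> \bar R by move=> Ak; rewrite indicE mem_set.
rewrite big_nat_recr//= a1//.
have -> : 2%:E = (1 + 1)%E :> \bar R by rewrite -EFinD.
apply: leeD2r; rewrite (big_cat_nat (n := i.+1))//=.
rewrite big_nat_recr//= a1// -addeA; apply: le_trans (leeDr _ _).
  by apply: leeDl; apply: sume_ge0 => k _; rewrite lee_fin.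
by apply: sume_ge0 => k _; rewrite lee_fin.
Qed.

Lemma point_count0 (A : set ST) w : point_count p A w = 0 -> forall i, ~ A (p i w).
Proof. by move=> c0 i /point_count_ge; rewrite c0 lee_fin ler10. Qed.

Lemma point_count0P (A : set ST) w : (forall i, ~ A (p i w)) -> point_count p A w = 0.
Proof. by move=> H; apply: eseries0 => i _ _; rewrite indicE memNset//. Qed.

(** Counts run over indices, so a count of 1 also excludes a repeated point; this is the source of
    distinctness of the tips. *)
Lemma point_count1 (A : set ST) w : point_count p A w = 1%:E ->
  (exists i, A (p i w)) /\ forall i j, A (p i w) -> A (p j w) -> i = j.
Proof.
move=> c1; split.
  apply: contrapT => H; have := point_count0P (A := A) (w := w) (fun i Ai => H (ex_intro _ i Ai)).
  by rewrite c1 => -[] /eqP; rewrite oner_eq0.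
move=> i j Ai Aj; apply/eqP/negPn/negP => /(point_count_ge2 Ai Aj).
by rewrite c1 lee_fin; apply/negP; rewrite -ltNge ltr1n.
Qed.

Lemma point_count_measurable (A : set ST) : measurable A -> measurable_fun setT (point_count p A : O -> \bar R).
Proof.
move=> mA; apply: ge0_emeasurable_sum => [i w _ _|i _]; first by rewrite lee_fin.
have [mp _] := p_poisson.
apply/measurable_EFinP; have -> : (fun w => \1_A (p i w)) = \1_(p i @^-1` A) :> (O -> R) by [].
by apply: measurable_indic; rewrite -[X in measurable X]setTI; exact: (mp i).
Qed.

Lemma count_event_measurable (A : set ST) (c : \bar R) : measurable A ->
  measurable [set w | point_count p A w = c].
Proof.
move=> mA; rewrite -[X in measurable X]setTI.
by have := point_count_measurable mA measurableT (emeasurable_set1 c).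
Qed.

Lemma poisson_fin (F : finType) (A : F -> set ST) (n : F -> nat) :
  (forall f, measurable (A f)) -> (forall f, (mu (A f) < +oo)%E) -> trivIset setT A ->
  Q [set w | forall f, point_count p (A f) w = ((n f)%:R)%:E] =
    (\prod_f poisson_weight (fine (mu (A f))) (n f))%:E.
Proof.
move=> mA fA tA; have [_ H] := p_poisson.
have {}H := H #|F| (A \o enum_val) (n \o enum_val) (fun j => mA _) (fun j => fA _) _.
have -> : [set w | forall f, point_count p (A f) w = ((n f)%:R)%:E] =
  [set w | forall j : 'I_#|F|, point_count p ((A \o enum_val) j) w = (((n \o enum_val) j)%:R)%:E].
  apply/seteqP; split=> w /= Hw; first by move=> j; exact: Hw.
  by move=> f; rewrite -(enum_rankK f); exact: Hw.
rewrite H; last by move=> i j _ _ ij; apply: enum_val_inj; exact: tA ij.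
by congr EFin; rewrite [RHS](reindex _ (onW_bij _ (enum_val_bij F))).
Qed.

Lemma mu_rect (a b : R) (B : set (borel_rV R d)) : measurable B -> 0 <= a -> a <= b ->
  mu ([set t | a <= t < b] `*` B) = ((b - a) * fine (S B) / rvol K)%:E.
Proof.
move=> mB a0 ab; rewrite /hyperplane_intensity.
have H (D : set R) : measurable D -> lebesgue_measure D = (b - a)%:E ->
    ((rvol K)^-1%:E * (lebesgue_measure \x S)%E (D `*` B))%E = ((b - a) * fine (S B) / rvol K)%:E.
  move=> mD leb; rewrite product_measure1E//.
  have fS : S B \is a fin_num by exact: fin_num_measure.
  rewrite [X in (_ * (X * _))%E]leb -[X in (_ * (_ * X))%E](fineK fS).
  by rewrite !muleA -!EFinM /rvol; congr EFin; ring.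
have leb x : lebesgue_measure [set` Interval (BSide x a) (BLeft b)] = (b - a)%:E.
  rewrite lebesgue_measure_itv/= lte_fin; case: ltP => // ba.
  by have -> : b = a by [apply/eqP; rewrite eq_le ba]; rewrite subrr.
(* The intensity lives on positive times, so a slab starting at 0 becomes an open interval, of the
   same length. *)
have [a0'|a00] := eqVneq a 0; last first.
  have -> : ([set t | a <= t < b] `*` B) `&` [set x : ST | 0 < x.1] = `[a, b[%classic `*` B.
    apply/seteqP; split=> [[t u] /= [[h1 h2] _]|[t u] /=]; rewrite in_itv/=; first by split.
    move=> [/andP[h1 h2] h3]; split; first by rewrite h1.
    by apply: lt_le_trans h1; rewrite lt_neqAle eq_sym a00.
  exact: H.
have -> : ([set t | a <= t < b] `*` B) `&` [set x : ST | 0 < x.1] = `]a, b[%classic `*` B.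
  rewrite a0'; apply/seteqP; split=> [[t u] /= [[/andP[_ h1] h2] h3]|[t u] /=]; rewrite in_itv/=.
    by rewrite h3.
  by move=> [/andP[h1 h2] h3]; rewrite (ltW h1).
exact: H.
Qed.

Lemma rect_measurable (a b : R) (B : set (borel_rV R d)) : measurable B ->
  measurable ([set t | a <= t < b] `*` B : set ST).
Proof.
move=> mB; apply: measurableX => //.
have -> : [set t | a <= t < b] = `[a, b[%classic by apply/seteqP; split=> t /=; rewrite in_itv.
exact: measurable_itv.
Qed.

End Poisson.

Section MeshEvents.
Context {R : realType} {d : nat}.
Local Notation V := 'rV[R]_d.
Local Notation ST := (measurableTypeR R * borel_rV R d)%type.
Context {dO : measure_display} {O : measurableType dO} (Q : probability O R).
Variables (K : set V) (S : {finite_measure set (borel_rV R d) -> \bar R}).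
Variable (p : nat -> O -> ST).
Context (p_dom : forall i w, 0 < (p i w).1 /\ enorm (p i w).2 = 1).
Context (p_poisson : poisson_process Q (hyperplane_intensity K S) p).
Local Notation mu := (hyperplane_intensity K S).
Variables (T eps : R) (m : @mesh_data R d).
Context (eps1 : eps <= 1) (hm : is_mesh K S T eps m).
Local Notation cell := ('I_(mN m) * 'I_(mq m))%type.
Local Notation lam := (@mlam R d K S m).

Definition mrest : set V := ~` \big[setU/set0]_(b < mq m) mB b.

(* Together with the cells these cover [0 < t < mtime m (mN m)]. *)
Definition mexc (b : bool) : set ST :=
  if b then [set t | 0 <= t < mtlo m] `*` setT
  else [set t | mtlo m <= t < mtime m (mN m)] `*` mrest.

Definition limit_event (C : {set cell}) : set O :=
  [set w | (forall e : cell, point_count p (mcell e : set ST) w = ((nat_of_bool (e \in C))%:R)%:E) /\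
           forall b, point_count p (mexc b) w = 0].

Lemma mtime_le a b : (a <= b)%N -> mtime m a <= mtime m b.
Proof.
move=> ab; have /andP[h0 _] := im_h hm.
by rewrite /mtime lerD2l ler_wpM2r ?ler_nat// ltW.
Qed.

Lemma mtime_ge a : mtlo m <= mtime m a.
Proof. by have := mtime_le (leq0n a); rewrite {1}/mtime mul0r addr0. Qed.

Lemma mtime_inj t (a b : nat) : mtime m a <= t < mtime m a.+1 -> mtime m b <= t < mtime m b.+1 -> a = b.
Proof.
move=> /andP[h1 h2] /andP[h3 h4]; apply/eqP; rewrite eqn_leq; apply/andP; split; rewrite leqNgt; apply/negP => h.
  by have := mtime_le h; lra.
by have := mtime_le h; lra.
Qed.

Lemma mcell_inj (e f : cell) z : mcell e z -> mcell f z -> e = f.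
Proof.
case: e => a b; case: f => a' b' /= [h1 h2] [h3 h4]; congr (_, _).
  by apply: val_inj; exact: mtime_inj h1 h3.
exact: im_Bdisj hm _ _ _ h2 h4.
Qed.

Lemma mcell_measurable (e : cell) : measurable (mcell e : set ST).
Proof. exact: rect_measurable (im_mB hm e.2). Qed.

Lemma mrest_measurable : measurable (mrest : set (borel_rV R d)).
Proof. by apply: measurableC; apply: bigsetU_measurable => b _; exact: im_mB hm b. Qed.

Lemma mexc_measurable b : measurable (mexc b).
Proof. by case: b; apply: rect_measurable => //; exact: mrest_measurable. Qed.

Lemma mu_cell (e : cell) : mu (mcell e : set ST) = (lam e)%:E.
Proof.
have tlo0 := im_tlo hm; have := mtime_ge e.1; have := mtime_le (leqnSn e.1) => h1 h2.
rewrite (mu_rect _ _ (im_mB hm e.2))//; last by lra.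
congr EFin; rewrite /mlam; congr (_ * _ / _); rewrite /mtime.
by have -> : e.1.+1%:R = e.1%:R + 1 :> R; [rewrite natr1|ring].
Qed.

Lemma mu_mexc : mu (mexc true) = (mtlo m * fine (S setT) / rvol K)%:E /\
  mu (mexc false) = ((mtime m (mN m) - mtlo m) * fine (S (mrest : set (borel_rV R d))) / rvol K)%:E.
Proof.
have tlo0 := im_tlo hm; split; rewrite mu_rect ?subr0//; [exact: ltW|exact: mrest_measurable|exact: ltW|exact: mtime_ge].
Qed.

Lemma exc_mass_le : 0 <= \sum_b fine (mu (mexc b)) <= eps.
Proof.
have [E1 E2] := mu_mexc; rewrite big_bool/= E1 E2/=.
have tlo0 := im_tlo hm; have h1 := mtime_ge (mN m); have /andP[_ h2] := im_T hm.
have rK : 0 <= (rvol K)^-1 by rewrite invr_ge0 rvol_ge0.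
have S1 : 0 <= fine (S setT) by apply: fine_ge0.
have S2 : 0 <= fine (S (mrest : set (borel_rV R d))) by apply: fine_ge0.
apply/andP; split.
  by rewrite addr_ge0// mulr_ge0// mulr_ge0// ?subr_ge0// ltW.
apply: le_trans (im_exc hm); rewrite -mulrDl ler_wpM2r// lerD2l ler_wpM2r//.
by apply: le_trans h2; rewrite lerBlDr lerDl ltW.
Qed.

Lemma lam_ge0 (e : cell) : 0 <= lam e.
Proof. exact: le_trans (im_rate0 hm e) (im_rate hm e). Qed.

Definition exc_weight : R := \prod_b expR (- fine (mu (mexc b))).
Definition cell_weight (C : {set cell}) : R :=
  \prod_e (if e \in C then expR (- lam e) * lam e else expR (- lam e)).
(** The limit in [n] of the lower bound for the probability that a sample shows the pattern [C]; the
    extra [eps] in the exponent stands for the exceptional region [mX]. *)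
Definition sample_weight (C : {set cell}) : R :=
  expR (- (\sum_e @mrate R d m e + eps)) * \prod_e (if e \in C then @mrate R d m e else 1).

Lemma exc_weight_itv : 1 - eps <= exc_weight <= 1.
Proof.
have /andP[h1 h2] := exc_mass_le; rewrite /exc_weight -expR_sum sumrN; apply/andP; split.
  by have := expR_ge1Dx (- \sum_b fine (mu (mexc b))); lra.
by rewrite -expR0 ler_expR; lra.
Qed.

Lemma cell_weight_ge0 C : 0 <= cell_weight C.
Proof. apply: prodr_ge0 => e _; case: ifP => _; last exact: expR_ge0.
by apply: mulr_ge0; [exact: expR_ge0|exact: lam_ge0]. Qed.

(** Cells and exceptional sets as a single disjoint family, so that their joint law is one instance
    of [poisson_fin]. *)
Definition event_family (f : bool + cell) : set ST :=
  match f with inl b => mexc b | inr e => mcell e end.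

Lemma event_family_triv : trivIset setT event_family.
Proof.
have tlo (e : cell) (z : R * V) : mcell e z -> mtlo m <= z.1.
  by move=> [/andP[h _] _]; apply: le_trans h; exact: mtime_ge.
move=> [b|e] [b'|e'] _ _ [z [/=]].
- by case: b; case: b' => //= -[h1 h2] [h3 h4]; exfalso; move: h1 h3 => /=; lra.
- case: b => /= -[h1 h2] h3; exfalso.
    by have := tlo _ _ h3; move: h1 => /=; lra.
  by apply: h2; case: h3 => _ Bz; apply/bigsetUP; exists e'.2.
- case: b' => /= h3 [h1 h2]; exfalso.
    by have := tlo _ _ h3; move: h1 => /=; lra.
  by apply: h2; case: h3 => _ Bz; apply/bigsetUP; exists e.2.
- by move=> h1 h2; congr inr; exact: mcell_inj h1 h2.
Qed.

Lemma prob_limit_event C : Q (limit_event C) = (exc_weight * cell_weight C)%:E.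
Proof.
pose n (f : bool + cell) := match f with inl b => 0%N | inr e => nat_of_bool (e \in C) end.
have -> : limit_event C = [set w | forall f, point_count p (event_family f) w = ((n f)%:R)%:E].
  apply/seteqP; split=> w /=; first by move=> [h1 h2] [b|e] /=; [exact: h2|exact: h1].
  by move=> H; split=> [e|b]; [exact: (H (inr e))|exact: (H (inl b))].
rewrite (poisson_fin p_poisson).
- rewrite big_sumType/=; congr (_ * _)%:E; apply: eq_bigr => f _; rewrite /poisson_weight/=.
    by rewrite expr0 mulr1 fact0 divr1.
  rewrite mu_cell/=; case: ifP => _ /=; rewrite ?expr0 ?mulr1 ?expr1 ?fact0 divr1//.
- by move=> [b|e] /=; [exact: mexc_measurable|exact: mcell_measurable].
- move=> [b|e] /=; last by rewrite mu_cell ltry.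
  by have [E1 E2] := mu_mexc; case: b; rewrite ?E1 ?E2 ltry.
- exact: event_family_triv.
Qed.

Lemma limit_event_measurable C : measurable (limit_event C).
Proof.
have -> : limit_event C =
    (\bigcap_(e : cell) [set w | point_count p (mcell e : set ST) w = ((nat_of_bool (e \in C))%:R)%:E]) `&`
    (\bigcap_b [set w | point_count p (mexc b) w = 0]).
  apply/seteqP; split=> w /= [h1 h2]; split; [by move=> e _; exact: h1|by move=> b _; exact: h2|..].
    by move=> e; exact: h1.
  by move=> b; exact: h2.
apply: measurableI; apply: fin_bigcap_measurable; try exact: finite_finset.
  by move=> e _; apply: (count_event_measurable p_poisson); exact: mcell_measurable.
by move=> b _; apply: (count_event_measurable p_poisson); exact: mexc_measurable.
Qed.

Lemma limit_event_disj C C' w : limit_event C w -> limit_event C' w -> C = C'.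
Proof.
move=> [h1 _] [h2 _]; apply/setP => e; have := h1 e; rewrite h2 => -[] /eqP.
by rewrite eqr_nat; case: (e \in C); case: (e \in C').
Qed.

(** One [eps] is lost to points in the exceptional sets and one to cells with several points. *)
Lemma limit_events_large : ((1 - 2 * eps)%:E <= Q (\bigcup_C limit_event C))%E.
Proof.
rewrite measure_bigcup_fin; [|exact: limit_event_measurable|exact: limit_event_disj].
rewrite (eq_bigr (fun C => (exc_weight * cell_weight C)%:E)); last by move=> C _; exact: prob_limit_event.
rewrite sumEFin lee_fin -mulr_sumr /cell_weight sum_prod_sets.
have /andP[h1 _] := exc_weight_itv.
have h2 := sum_exp_weight lam_ge0 (im_lamsq hm) eps1.
have /andP[_ h3] := im_h hm.
apply: (@le_trans _ _ ((1 - eps) * (1 - eps))); first by have := sqr_ge0 eps; lra.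
by apply: ler_pM; rewrite ?subr_ge0.
Qed.

Lemma eps_ge0 : 0 <= eps.
Proof. by have /andP[h1 h2] := im_h hm; lra. Qed.

Lemma limit_event_weights : exists dC : {set cell} -> R, [/\ forall C, 0 <= dC C,
    forall C, fine (Q (limit_event C)) <= sample_weight C + dC C & \sum_C dC C <= 2 * eps].
Proof.
have [|dC [h1 h2 h3]] := sum_weight_diff (im_rate0 hm) (im_rate hm) (im_ratediff hm) (eps := eps).
  by rewrite eps1 eps_ge0.
exists dC; split => // C; rewrite prob_limit_event/=.
have /andP[_ h4] := exc_weight_itv.
apply: (@le_trans _ _ (cell_weight C)); first by rewrite ler_piMl ?cell_weight_ge0.
by have := h2 C; rewrite -/(cell_weight C) -/(sample_weight C); lra.
Qed.

Lemma limit_event_cell C w (e : cell) : limit_event C w -> e \in C ->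
  (exists i, mcell e (p i w)) /\ forall i j, mcell e (p i w) -> mcell e (p j w) -> i = j.
Proof. by move=> [h _] eC; apply: (point_count1 (A := mcell e : set ST)); rewrite h eC. Qed.

Lemma limit_event_early C w i : limit_event C w -> (p i w).1 < mtime m (mN m) ->
  exists2 e : cell, e \in C & mcell e (p i w).
Proof.
move=> [h1 h2] tT; have [t0 _] := p_dom i w.
have [tlo|tlo] := ltP (p i w).1 (mtlo m).
  by exfalso; apply: (point_count0 (h2 true) (i := i)); split => //=; rewrite ltW.
have [Br|] := pselect (mrest (p i w).2).
  by exfalso; apply: (point_count0 (h2 false) (i := i)); split => //=; rewrite tlo.
move=> /contrapT/bigsetUP[b Bb].
have [a at1] : exists a : 'I_(mN m), mtime m a <= (p i w).1 < mtime m a.+1.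
  have /andP[h0 _] := im_h hm.
  pose k := Num.trunc (((p i w).1 - mtlo m) / mh m).
  have /andP[k1 k2] : k%:R <= ((p i w).1 - mtlo m) / mh m < k.+1%:R.
    by apply: truncn_itv; rewrite divr_ge0 ?subr_ge0// ltW.
  have {}k1 : mtime m k <= (p i w).1 by move: k1; rewrite ler_pdivlMr// /mtime; lra.
  have {}k2 : (p i w).1 < mtime m k.+1 by move: k2; rewrite ltr_pdivrMr// /mtime; lra.
  have kN : (k < mN m)%N by rewrite ltnNge; apply/negP => /mtime_le; lra.
  by exists (Ordinal kN); rewrite /= k1 k2.
exists (a, b) => //; apply/negPn/negP => nC.
by have := h1 (a, b); rewrite (negbTE nC) => /point_count0/(_ i); apply.
Qed.

End MeshEvents.

(** * Almost sure properties of the limit *)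

Arguments limit_event {R d dO O} p m C _ : rename.

Lemma negligible_small (R : realType) (dT : measure_display) (T : measurableType dT)
    (mu : {measure set T -> \bar R}) (A : set T) :
  (forall e : R, 0 < e -> exists B, [/\ measurable B, A `<=` B & (mu B <= e%:E)%E]) ->
  mu.-negligible A.
Proof.
move=> H; have /choice[B HB] : forall n : nat, exists B,
    [/\ measurable B, A `<=` B & (mu B <= (n.+1%:R^-1)%:E)%E].
  by move=> n; apply: H; rewrite invr_gt0.
exists (\bigcap_n B n); split.
- by apply: bigcapT_measurable => n; have [] := HB n.
- apply/eqP; rewrite eq_le measure_ge0 andbT; apply/lee_addgt0Pr => e e0; rewrite add0e.
  have [n ne] := natSinv_small e0; have [mB _ Bn] := HB n.
  apply: (@le_trans _ _ (mu (B n))).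
    apply: measure_mono => //; first by apply: bigcapT_measurable => k; have [] := HB k.
    by move=> w; apply.
  by apply: le_trans Bn _; rewrite lee_fin ltW.
- by move=> w Aw n _; have [_ AB _] := HB n; exact: AB.
Qed.

(** The selected slabs lie between a first and a last one, whose starting times differ by at most
    [W]; the additional [h] is the length of the last slab. *)
Lemma sum_window (R : realType) (N : nat) (A : pred 'I_N) (h W : R) : 0 <= h -> 0 <= W ->
  (forall a b : 'I_N, A a -> A b -> (a%:R - b%:R) * h <= W) -> \sum_(a | A a) h <= W + h.
Proof.
move=> h0 W0 H; have [a0 Aa0|A0] := pickP A; last by rewrite big_pred0// addr_ge0.
have [lo Alo Hlo] : exists2 lo, A lo & forall b, A b -> (lo <= b)%N.
  by case: (arg_minnP (fun a : 'I_N => (a : nat)) Aa0) => lo h1 h2; exists lo.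
have [hi Ahi Hhi] : exists2 hi, A hi & forall b, A b -> (b <= hi)%N.
  by case: (arg_maxnP (fun a : 'I_N => (a : nat)) Aa0) => hi h1 h2; exists hi.
have lohi : (lo <= hi)%N by exact: Hlo.
rewrite sumr_const.
have cA : (#|A| <= (hi - lo).+1)%N.
  rewrite cardE -(size_map (@nat_of_ord N)) -(size_iota lo (hi - lo).+1).
  apply: uniq_leq_size; first by rewrite map_inj_uniq ?enum_uniq//; exact: ord_inj.
  move=> x /mapP[a]; rewrite mem_enum => Aa ->; rewrite mem_iota Hlo//=.
  by rewrite addnS ltnS subnKC// Hhi.
apply: (@le_trans _ _ (h *+ (hi - lo).+1)); first by rewrite -!(mulr_natl h) ler_wpM2r ?ler_nat.
rewrite mulrSr lerD2r -mulr_natl natrB//; exact: H.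
Qed.

Section AlmostSure.
Context {R : realType} {d : nat}.
Local Notation V := 'rV[R]_d.
Local Notation ST := (measurableTypeR R * borel_rV R d)%type.
Context {dO : measure_display} {O : measurableType dO} (Q : probability O R).
Variables (K : set V) (S : {finite_measure set (borel_rV R d) -> \bar R}).
Variable (p : nat -> O -> ST).
Context (volK : 0 < rvol K).
Context (p_dom : forall i w, 0 < (p i w).1 /\ enorm (p i w).2 = 1).
Context (p_poisson : poisson_process Q (hyperplane_intensity K S) p).
Local Notation mu := (hyperplane_intensity K S).

Lemma tip_enorm i w : enorm (tip (p i w)) = (p i w).1^-1.
Proof.
have [t0 u1] := p_dom i w.
by rewrite /tip enormZ u1 mulr1 normfV gtr0_norm.
Qed.

Lemma tip_inj w i j : tip (p i w) = tip (p j w) -> p i w = p j w.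
Proof.
move=> E; have [t0 _] := p_dom i w; have [t0' _] := p_dom j w.
have tt : (p i w).1 = (p j w).1 by apply: invr_inj; rewrite -!tip_enorm E.
move: E; rewrite /tip tt => /(scalerI _) E.
case: (p i w) (p j w) tt E t0 t0' => [t u] [t' u'] /= -> E _ t0'.
by rewrite E// invr_eq0 gt_eqF.
Qed.

(** The time range after [k0] has infinite mass over [U]: a window of length [n] is empty with
    probability [expR (- (n%:R * s))], which is made smaller than any [e]. *)
Lemma late_direction (U : set (borel_rV R d)) (k0 : nat) : measurable U -> (0 < S U)%E ->
  {ae Q, forall w, exists2 i, k0%:R <= (p i w).1 & U (p i w).2}.
Proof.
move=> mU SU; apply: negligible_small => e e0.
have SU' : 0 < fine (S U) by rewrite fine_gt0// SU ltey_eq fin_num_measure.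
pose s := fine (S U) / rvol K; have s0 : 0 < s by exact: divr_gt0.
pose n := (Num.trunc (e^-1 / s)).+1.
have ne : e^-1 <= n%:R * s.
  have /andP[_ h] := truncn_itv (divr_ge0 (ltW (ltac:(by rewrite invr_gt0) : 0 < e^-1)) (ltW s0)).
  by rewrite -ler_pdivrMr// ltW.
pose A : set ST := [set t | k0%:R <= t < k0%:R + n%:R] `*` U.
have mA : measurable A by exact: rect_measurable.
have muA : mu A = (n%:R * s)%:E.
  rewrite mu_rect ?ler0n ?lerDl ?ler0n//; congr EFin; rewrite /s; ring.
exists [set w | point_count p A w = 0]; split.
- exact: count_event_measurable p_poisson _ _ mA.
- move=> w /= H; apply: point_count0P => i [/andP[h1 h2] h3]; apply: H.
  by exists i.
have := poisson_fin p_poisson (F := unit) (A := fun=> A) (fun=> 0%N) (fun=> mA).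
have -> : [set w | forall f : unit, point_count p A w = (0%:R)%:E] = [set w | point_count p A w = 0].
  by apply/seteqP; split=> w /=; [move=> /(_ tt)|move=> -> _].
have fA : unit -> (mu A < +oo)%E by move=> _; rewrite muA ltry.
have tA : trivIset [set: unit] (fun=> A) by move=> [] [] _ _ _.
move=> H; apply: (@eq_ind_r _ _ (fun x => (x <= e%:E)%E) _ _ (H fA tA)).
rewrite lee_fin (big_pred1 tt); last by case.
rewrite /poisson_weight muA/= expr0 mulr1 fact0 divr1 expRN.
rewrite -[leRHS]invrK lef_pV2 ?posrE ?invr_gt0 ?expR_gt0//.
by apply: (le_trans ne); apply: le_trans (expR_ge1Dx _); rewrite lerDr.
Qed.

(** A point outside the hull is separated from it in some direction, in which at least one tip
    reaches [rho / t1]. *)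
Lemma ball_hull w (F : set nat) (rho t1 : R) : finite_set F -> F !=set0 -> 0 < rho -> 0 < t1 ->
  (forall v, enorm v = 1 -> exists i, [/\ F i, (p i w).1 <= t1 & rho <= dot (p i w).2 v]) ->
  forall z, enorm z <= rho / t1 -> family_hull (seg \o (fun i => tip (p i w))) F z.
Proof.
move=> fF F0 rho0 t10 HF z zr; apply: contrapT => nz.
have kH : compact (family_hull (seg \o (fun i => tip (p i w))) F).
  apply: family_hull_compact => // i _.
  by split; [exact: seg_compact|exact: seg_convex|exact: seg0].
have H0 : family_hull (seg \o (fun i => tip (p i w))) F !=set0.
  have [i Fi] := F0; exists 0; apply: (family_sub (M := seg \o (fun i => tip (p i w))) Fi).
  exact: seg0.
have [q [u [s [Hq u1 nu [s0 zE _]]]]] := outer_proj kH (@chull_convex _ _ _) H0 nz.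
have [i [Fi ti iu]] := HF u u1; have [t0 _] := p_dom i w.
have Hi : family_hull (seg \o (fun i => tip (p i w))) F (tip (p i w)).
  by apply: (family_sub (M := seg \o (fun i => tip (p i w))) Fi); exact: seg1.
have := nu _ Hi; rewrite dotC dotBl /tip dotZl.
have h1 : dot z u = dot q u + s by rewrite zE dotDl dotZl -enorm_sqr u1 expr1n mulr1.
have h2 := dot_unitr z u1.
have h3 : rho / t1 <= (p i w).1^-1 * dot (p i w).2 u.
  rewrite mulrC; apply: ler_pM => //; rewrite ?invr_ge0 ?(ltW rho0) ?(ltW t10)//.
  by rewrite lef_pV2 ?posrE.
lra.
Qed.


Context (hpos : forall v : V, enorm v = 1 -> (0 < S [set u | (0 < dot u v)%R])%E).

Lemma dot_ge_measurable (v : V) (c : R) : measurable ([set u | c <= dot u v] : set (borel_rV R d)).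
Proof.
apply: closed_measurable_rV; apply: (@closed_le_fun _ _ (fun=> c) (fun u : V => dot u v)).
  by move=> ?; exact: cst_continuous.
by apply: dot_continuous; [exact: idV_continuous|exact: cstV_continuous].
Qed.

(** Compactness of the sphere turns positivity of every open hemisphere into finitely many sets of
    positive mass such that any choice of one unit direction from each surrounds the origin with a
    uniform margin. *)
Lemma direction_sets : exists q (U : 'I_q -> set V) (rho : R), [/\ 0 < rho,
  forall b, measurable (U b : set (borel_rV R d)), forall b, (0 < S (U b : set (borel_rV R d)))%E &
  forall v, enorm v = 1 -> exists b, forall u, U b u -> enorm u = 1 -> rho <= dot u v].
Proof.
have hmar (v : V) : enorm v = 1 -> exists2 c : R, 0 < c & (0 < S [set u | (c <= dot u v)%R])%E.
  move=> v1; apply: contrapT => H; have := hpos v1.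
  have -> : [set u : V | 0 < dot u v] = \bigcup_n [set u | n.+1%:R^-1 <= dot u v].
    apply/seteqP; split=> u /=; last first.
      by move=> [n _ /= h]; apply: lt_le_trans h; rewrite invr_gt0.
    by move=> /natSinv_small[n h]; exists n => //=; exact: ltW.
  (* If all these caps were null, so would be their union, the open hemisphere. *)
  have S0 n : S [set u | n.+1%:R^-1 <= dot u v] = 0%E.
    apply/eqP; rewrite eq_le measure_ge0 andbT leNgt; apply/negP => h; apply: H.
    by exists n.+1%:R^-1 => //; rewrite invr_gt0.
  have mU : measurable (\bigcup_n [set u | n.+1%:R^-1 <= dot u v] : set (borel_rV R d)).
    by apply: bigcupT_measurable => n; exact: dot_ge_measurable.
  have /(negligibleP _ mU) -> : S.-negligible (\bigcup_n [set u | n.+1%:R^-1 <= dot u v] : set (borel_rV R d)).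
    apply: negligible_bigcup => n; exists [set u | n.+1%:R^-1 <= dot u v]; split => //; last exact: S0.
    exact: dot_ge_measurable.
  by rewrite ltxx.
have /choice[c Hc] : forall v : V, exists c : R, 0 < c /\
    (enorm v = 1 -> (0 < S [set u | (c <= dot u v)%R])%E).
  move=> v; have [/hmar[c c0 h]|nv] := pselect (enorm v = 1); first by exists c.
  by exists 1.
have := @sphere_compact R d; rewrite compact_cover.
move=> /(_ V [set u | enorm u = 1] (fun w => [set u | enorm (u - w) < c w / 2])); case.
- move=> w _.
  have -> : [set u | enorm (u - w) < c w / 2] = ~` [set u | c w / 2 <= enorm (u - w)].
    by apply/seteqP; split => u /=; [move=> h; apply/negP; rewrite -ltNge|move/negP; rewrite -ltNge].
  by apply: closed_openC; exact: closed_enormB_ge.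
- by move=> u u1; exists u => //=; rewrite subrr enorm0 divr_gt0//; have [] := Hc u.
- move=> D0 Dsub cov; pose D : seq V := finmap.enum_fset D0.
  have [rho rho0 Hrho] : exists2 rho : R, 0 < rho & forall (b : 'I_(size D)) e, setT b -> 0 < e ->
      e <= rho -> e <= c (nth 0 D b) / 2.
    have := @finite_uniform R 'I_(size D) setT (fun b e => e <= c (nth 0 D b) / 2) finite_finset.
    apply => b _; exists (c (nth 0 D b) / 2) => //.
    by rewrite divr_gt0//; have [] := Hc (nth 0 D b).
  exists (size D), (fun b => [set u | c (nth 0 D b) <= dot u (nth 0 D b)]), rho; split => //.
  + by move=> b; exact: dot_ge_measurable.
  + by move=> b; have [_] := Hc (nth 0 D b); apply; have /Dsub := mem_nth 0 (ltn_ord b); rewrite inE.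
  + move=> v /cov[w /= wD vw]; have wi : (index w D < size D)%N by rewrite index_mem.
    exists (Ordinal wi) => u /=; have := Hrho (Ordinal wi) rho I rho0 (lexx _).
    rewrite /= nth_index// => h uw u1.
    have -> : v = w + (v - w) by rewrite addrC subrK.
    rewrite dotDr; have := dot_unitl (- (v - w)) u1; rewrite enormN dotNr; lra.
Qed.

(** Every direction set contains points later than any given time. Later than all the finitely many
    excluded points, they have indices in [J], and one point per set spans a ball by [ball_hull]. *)
Lemma cofinite_span : {ae Q, forall w, forall J : set nat, finite_set (~` J) ->
  exists F (r : R), [/\ finite_set F, F `<=` J, F !=set0, 0 < r &
    forall y, enorm y <= r -> family_hull (seg \o (fun i => tip (p i w))) F y]}.
Proof.
have [q [U [rho [rho0 mU SU HU]]]] := direction_sets.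
have : {ae Q, forall w, forall b k0, exists2 i, k0%:R <= (p i w).1 & U b (p i w).2}.
  have H : forall k0 : nat, {ae Q, forall w, forall b, exists2 i, k0%:R <= (p i w).1 & U b (p i w).2}.
    move=> k0; apply: filter_forall => b; exact: late_direction.
  by have := ae_foralln H; apply: filterS => w Hw b k0; exact: Hw.
apply: filterS => w Hw J cJ.
have [k0 Hk0] : exists k0 : nat, forall i, (~` J) i -> (p i w).1 < k0%:R.
  have [[j0 Jj0]|E] := pselect (~` J !=set0); last by exists 0%N => i Ji; exfalso; apply: E; exists i.
  have [j _ Hj] := finite_argmax (fun i => (p i w).1) cJ (ex_intro _ _ Jj0).
  have [t0 _] := p_dom j w.
  have /andP[_ h] := truncn_itv (ltW t0).
  by exists (Num.trunc (p j w).1).+1 => i /Hj h'; exact: le_lt_trans h.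
have /choice[g Hg] : forall b, exists i, k0%:R <= (p i w).1 /\ U b (p i w).2.
  by move=> b; have [i h1 h2] := Hw b k0; exists i.
have gJ b : J (g b).
  by apply: contrapT => /Hk0; rewrite ltNge; have [-> _] := Hg b.
have [t1 t10 Ht1] : exists2 t1 : R, 0 < t1 & forall b, (p (g b) w).1 <= t1.
  exists (1 + \sum_b (p (g b) w).1).
    by rewrite ltr_pwDl// sumr_ge0// => b _; have [h _] := p_dom (g b) w; exact: ltW.
  move=> b; rewrite (bigD1 b)//= addrCA lerDl addr_ge0// sumr_ge0// => b' _.
  by have [h _] := p_dom (g b') w; exact: ltW.
have [v1|v1] := pselect (exists v : V, enorm v = 1); last first.
  exfalso; have [_ u1] := p_dom 0%N w; apply: v1; by exists (p 0%N w).2.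
exists (range g), (rho / t1); split.
- by apply: finite_image; exact: finite_finset.
- by move=> _ [b _ <-].
- by have [v /HU[b _]] := v1; exists (g b), b.
- exact: divr_gt0.
apply: ball_hull => //.
- by apply: finite_image; exact: finite_finset.
- by have [v /HU[b _]] := v1; exists (g b), b.
- move=> v /HU[b Hb]; exists (g b); split; [by exists b|exact: Ht1|apply: Hb].
    by have [] := Hg b.
  by have [] := p_dom (g b) w.
Qed.


(** * Critical positions occupy thin time windows *)

Section Window.
Variables (T eps r : R) (m : @mesh_data R d) (hm : is_mesh K S T eps m).
Context (r0 : 0 < r) (eps1 : eps <= 1) (T0 : 0 < T).
Local Notation cell := ('I_(mN m) * 'I_(mq m))%type.
Local Notation hull q D := (family_hull (seg \o (fun e : cell => tip (q e))) D).

(* The tips in the cells of [D] span a hull with a gauge; [z] sits on its unit level. *)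
Definition critical_position (D : set cell) (q : cell -> R * V) (z : R * V) :=
  [/\ forall e, D e -> mcell e (q e), forall y, enorm y <= r -> hull q D y,
      hull q D (tip z) & ~ exists2 s : R, 0 <= s < 1 & exists2 c, hull q D c & tip z = s *: c].

(** Two choices of points in the cells of [D] give hulls within [eps], both containing the ball of
    radius [r]. Their gauges in directions of one angular cell are therefore close, and so are the
    times at which a tip sits on level 1. *)
Lemma critical_window D q q' (z z' : R * V) (e e' : cell) : e.2 = e'.2 ->
  mcell e z -> mcell e' z' -> critical_position D q z -> critical_position D q' z' ->
  z.1 - z'.1 <= eps * (T + 3) / r.
Proof.
move=> ee' ez ez' [Dq qr qz nz] [Dq' qr' qz' nz'].
have tlo0 := im_tlo hm; have eps0 := eps_ge0 hm.
have [/andP[z1 _] z2] := ez; have [/andP[z'1 z'3] z'2] := ez'.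
have t0 : 0 < z.1 by apply: lt_le_trans (lt_le_trans tlo0 (mtime_ge hm _)) z1.
have t'0 : 0 < z'.1 by apply: lt_le_trans (lt_le_trans tlo0 (mtime_ge hm _)) z'1.
have t'T : z'.1 <= T + 2.
  have /andP[_ h] := im_T hm; apply: le_trans h; apply: ltW; apply: (lt_le_trans z'3).
  by apply: (mtime_le hm); exact: ltn_ord.
have [c0 Hc0 zc0] : parallel_set (hull q D) eps (tip z').
  move: qz'; apply: chull_parallel => y [f Df /segP[s /andP[s0 s1] ->]].
  exists (s *: tip (q f)); first by exists f => //; apply/segP; exists s; rewrite ?s0.
  rewrite -scalerBr enormZ ger0_norm//; apply: le_trans (ler_piMl (enorm_ge0 _) s1) _.
  exact: im_tip hm _ _ _ (Dq' f Df) (Dq f Df).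
have uu : enorm (z.2 - z'.2) <= eps.
  by apply: (im_Bdiam hm (b := e.2)) => //; rewrite ee'.
(* The error of the tip, [eps] from the hull and [eps / z'.1] from the direction, fits into [dl]
   times the ball of radius [r]; hence the point lies in [1 + dl] times the hull. *)
pose dl := (eps + eps / z'.1) / r.
have dl0 : 0 <= dl by rewrite divr_ge0 ?(ltW r0)// addr_ge0// divr_ge0// ltW.
pose w := z'.1^-1 *: z.2 - c0.
have hw : enorm w <= dl * r.
  rewrite /dl divfK ?gt_eqF// /w.
  have -> : z'.1^-1 *: z.2 - c0 = (tip z' - c0) + z'.1^-1 *: (z.2 - z'.2) by rewrite /tip; vring.
  apply: le_trans (enormD _ _) _; apply: lerD => //.
  rewrite enormZ gtr0_norm ?invr_gt0// mulrC ler_wpM2r// invr_ge0 ltW//.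
have [c Hc cE] : exists2 c, hull q D c & z'.1^-1 *: z.2 = (1 + dl) *: c.
  have [dl00|dln] := eqVneq dl 0.
    exists c0 => //; rewrite dl00 addr0 scale1r; apply/eqP; rewrite -subr_eq0 -/w.
    by apply/eqP/enorm_eq0/eqP; rewrite eq_le enorm_ge0 andbT; move: hw; rewrite dl00 mul0r.
  have dlp : 0 < dl by rewrite lt_neqAle eq_sym dln.
  have d1 : 0 < 1 + dl by rewrite ltr_pwDl.
  have Hw : hull q D (dl^-1 *: w).
    by apply: qr; rewrite enormZ gtr0_norm ?invr_gt0// ler_pdivrMl.
  exists ((1 + dl)^-1 *: c0 + (1 - (1 + dl)^-1) *: (dl^-1 *: w)).
    have /convex_setP cv : convex_set (hull q D) by exact: chull_convex.
    apply: (cv _ _ _ Hc0 Hw); rewrite invr_ge0 (ltW d1) invf_le1//; lra.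
  rewrite scalerDr !scalerA mulfV ?gt_eqF// scale1r.
  have -> : (1 + dl) * (1 - (1 + dl)^-1) * dl^-1 = 1.
    by rewrite mulrBr mulr1 mulfV ?gt_eqF// addrAC subrr add0r mulfV.
  by rewrite scale1r /w addrC subrK.
have key : z.1 <= z'.1 * (1 + dl).
  rewrite leNgt; apply/negP => lt; apply: nz; exists (z'.1 * (1 + dl) / z.1).
    by rewrite ltr_pdivrMr// mul1r lt andbT divr_ge0 ?(ltW t0)// mulr_ge0 ?(ltW t'0)// addr_ge0.
  exists c => //; have -> : tip z = (z'.1 / z.1) *: (z'.1^-1 *: z.2).
    by rewrite /tip scalerA mulrAC mulfV ?gt_eqF// mul1r.
  by rewrite cE scalerA mulrAC.
have -> : eps * (T + 3) / r = eps * ((T + 2) + 1) / r by congr (_ * _ / _); ring.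
have dlE : z'.1 * dl = eps * (z'.1 + 1) / r.
  by rewrite /dl; field; rewrite !gt_eqF.
have : eps * (z'.1 + 1) / r <= eps * ((T + 2) + 1) / r.
  by rewrite ler_wpM2r ?invr_ge0 ?(ltW r0)// ler_wpM2l// lerD2r.
rewrite -dlE; lra.
Qed.

(** A property of the mesh alone, so that occupancy of its cells can be estimated through Poisson
    counts. *)
Definition bad_pair (D : {set cell}) (e : cell) :=
  e \notin D /\ exists q z, mcell e z /\ critical_position [set` D] q z.

Definition occupied (D : {set cell}) : set O :=
  [set w | forall e : cell, e \in D -> point_count p (mcell e : set ST) w = 1%:E].

Lemma occupied_measurable D : measurable (occupied D).
Proof.
have -> : occupied D = \bigcap_(e in [set` D]) [set w | point_count p (mcell e : set ST) w = 1%:E].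
  by apply/seteqP; split=> w H e /=; exact: H.
apply: fin_bigcap_measurable; first exact: finite_finset.
by move=> e _; apply: (count_event_measurable p_poisson); exact: mcell_measurable hm _.
Qed.

(** Cells outside [D] are replaced by the empty set, whose count is 0 with certainty; the
    exponential factors are bounded by 1. *)
Lemma prob_occupied D : (Q (occupied D) <= (\prod_(e in D) @mlam R d K S m e)%:E)%E.
Proof.
pose A (e : cell) : set ST := if e \in D then mcell e : set ST else set0.
have mu0 : mu set0 = 0%E by rewrite /hyperplane_intensity set0I measure0 mule0.
have -> : occupied D = [set w | forall e, point_count p (A e) w = ((nat_of_bool (e \in D))%:R)%:E].
  apply/seteqP; split=> w /= H e; last by move=> eD; have := H e; rewrite /A eD.
  rewrite /A; case: ifP => [eD|_]; first exact: H.
  have nz i : ~ (set0 : set ST) (p i w) by [].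
  exact: (point_count0P nz).
rewrite (poisson_fin p_poisson).
- rewrite lee_fin [leRHS]big_mkcond/=; apply: ler_prod => e _.
  rewrite /A /poisson_weight; case: ifP => _.
    rewrite (mu_cell hm)/= expr1 divr1; have l0 := lam_ge0 hm e.
    rewrite mulr_ge0 ?expR_ge0//= ler_piMl//.
    by rewrite -expR0 ler_expR oppr_le0.
  by rewrite mu0/= oppr0 expR0 expr0 fact0 divr1 mulr1 ler01 lexx.
- by move=> e; rewrite /A; case: ifP => _ //; exact: mcell_measurable hm _.
- by move=> e; rewrite /A; case: ifP => _; rewrite ?(mu_cell hm) ?mu0 ltry.
- move=> e f _ _ [z [/=]]; rewrite /A; case: ifP => // _ h1; case: ifP => // _ h2.
  exact: mcell_inj hm _ _ _ h1 h2.
Qed.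

Lemma direction_mass : \sum_(b < mq m) fine (S (mB b : set (borel_rV R d))) <= fine (S setT).
Proof.
have mB' b : measurable (mB b : set (borel_rV R d)) := im_mB hm b.
rewrite -lee_fin fineK ?fin_num_measure// -sumEFin.
rewrite (eq_bigr (fun b => S (mB b : set (borel_rV R d)))); last first.
  by move=> b _; rewrite fineK// fin_num_measure.
rewrite -(measure_bigcup_fin S mB' (im_Bdisj hm)).
by apply: measure_mono => //; exact: measurable_bigcup_fin.
Qed.

(** Within one angular cell the bad slabs lie in a window of length [eps * (T + 3) / r + eps] by
    [critical_window]; summing over directions gives a bound proportional to the total mass of
    [S]. *)
Lemma bad_pair_mass D (hb : pred cell) : (forall e, hb e -> bad_pair D e) ->
  \sum_(e | hb e) @mlam R d K S m e <= (eps * (T + 3) / r + 2 * eps) * (fine (S setT) / rvol K).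
Proof.
move=> Hb; have /andP[h0 heps] := im_h hm; have eps0 := eps_ge0 hm.
have W0 : 0 <= eps * (T + 3) / r + eps.
  by rewrite addr_ge0// divr_ge0 ?(ltW r0)// mulr_ge0// addr_ge0// ltW.
rewrite (eq_bigl (fun e : cell => xpredT e.1 && hb (e.1, e.2))); last by case.
rewrite -(pair_big_dep xpredT (fun a b => hb (a, b)) (fun a b => mh m * fine (S (mB b : set (borel_rV R d))) / rvol K))/=.
rewrite (exchange_big_dep xpredT)//=.
have Sb b : 0 <= fine (S (mB b : set (borel_rV R d))) / rvol K by rewrite divr_ge0 ?rvol_ge0// fine_ge0.
apply: (@le_trans _ _ (\sum_(b < mq m) (eps * (T + 3) / r + 2 * eps) * (fine (S (mB b : set (borel_rV R d))) / rvol K))).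
  apply: ler_sum => b _.
  have -> : \sum_(a < mN m | hb (a, b)) mh m * fine (S (mB b : set (borel_rV R d))) / rvol K =
      (\sum_(a < mN m | hb (a, b)) mh m) * (fine (S (mB b : set (borel_rV R d))) / rvol K).
    by rewrite mulr_suml; apply: eq_bigr => a _; rewrite mulrA.
  apply: ler_wpM2r => //.
  apply: le_trans (sum_window (W := eps * (T + 3) / r + eps) (ltW h0) W0 _) _; last by lra.
  move=> a a' /Hb[_ [q [z [ez cz]]]] /Hb[_ [q' [z' [ez' cz']]]].
  have := critical_window (erefl : (a, b).2 = (a', b).2) ez ez' cz cz'.
  have [/andP[z1 z3] z2] := ez; have [/andP[z'1 z'3] z'2] := ez'.
  move: z3 z'1; rewrite /mtime/= => z3 z'1.
  have E : a.+1%:R = a%:R + 1 :> R by rewrite natr1.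
  have [_ z4] := andP (introT andP (conj z1 z3)).
  move: z1 z'3; rewrite /mtime/= => z1 z'3.
  have E' : a'.+1%:R = a'%:R + 1 :> R by rewrite natr1.
  rewrite E' in z'3; lra.
rewrite -mulr_sumr -mulr_suml ler_wpM2l ?ler_wpM2r ?invr_ge0 ?rvol_ge0 ?direction_mass//.
by rewrite addr_ge0// ?mulr_ge0// ?invr_ge0 ?(ltW r0)// addr_ge0// ltW.
Qed.

End Window.


(** Failure of [good_gen], restricted to times before [T] and a fixed inner radius, so that a finite
    mesh can detect it. *)
Definition degenerate (T r : R) (w : O) := exists k F, [/\ finite_set F, ~ F k,
  (p k w).1 < T /\ (forall f, F f -> (p f w).1 < T),
  (forall y, enorm y <= r -> family_hull (seg \o (fun i => tip (p i w))) F y) /\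
    family_hull (seg \o (fun i => tip (p i w))) F (tip (p k w)) &
  ~ exists2 s : R, 0 <= s < 1 & exists2 c, family_hull (seg \o (fun i => tip (p i w))) F c &
      tip (p k w) = s *: c].

Lemma degenerate_mesh (T eps r : R) m (hm : is_mesh K S T eps m) C w :
  limit_event p m C w -> degenerate T r w ->
  exists (D : {set 'I_(mN m) * 'I_(mq m)}) e, bad_pair r D e /\ occupied (e |: D) w.
Proof.
move=> wC [k [F [fF nFk [kT FT] [Fr Hk] nk]]]; have /andP[TN _] := im_T hm.
have early i : (p i w).1 < T -> exists2 e, e \in C & mcell e (p i w).
  by move=> iT; apply: (limit_event_early p_dom hm wC); exact: lt_le_trans TN.
have [ek ekC ekk] := early k kT.
have /choice[cl Hcl] : forall f, exists e, F f -> e \in C /\ mcell e (p f w).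
  move=> f; have [/FT/early[e h1 h2]|nf] := pselect (F f); first by exists e.
  by exists ek.
pose D : {set 'I_(mN m) * 'I_(mq m)} := [set e | `[< exists2 f, F f & cl f = e >]]%SET.
have DP e : e \in D <-> exists2 f, F f & cl f = e.
  by rewrite inE; split=> [/asboolP|] // H; apply/asboolP.
have same f f' e : mcell e (p f w) -> mcell e (p f' w) -> e \in C -> f = f'.
  by move=> h1 h2 eC; have [_] := limit_event_cell wC eC; apply.
have /choice[rep Hrep] : forall e, exists f, e \in D -> F f /\ cl f = e.
  move=> e; have [/DP[f h1 h2]|nD] := pselect (e \in D); first by exists f.
  by exists k.
(* On a resolved configuration a cell holds at most one point, so cells can replace indices without
   changing the hull. *)
have hullE : family_hull (seg \o (fun e => tip (p (rep e) w))) [set` D] =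
    family_hull (seg \o (fun i => tip (p i w))) F.
  rewrite /family_hull; congr (chull _); apply/seteqP; split=> y.
    by move=> [e eD ye]; have [h1 h2] := Hrep e eD; exists (rep e).
  move=> [f Ff yf]; have eD : cl f \in D by apply/DP; exists f.
  exists (cl f) => //=; have [h1 h2] := Hrep _ eD.
  have [c1 c2] := Hcl f Ff; have [c3 c4] := Hcl _ h1; rewrite h2 in c4.
  by rewrite (same _ _ _ c4 c2 c1).
exists D, ek; split; last first.
  move=> e; rewrite in_setU1 => /orP[/eqP ->|/DP[f Ff <-]]; case: (wC) => H _; rewrite H ?ekC//.
  by have [-> _] := Hcl f Ff.
split.
  apply/negP => /DP[f Ff ef]; have [c1 c2] := Hcl f Ff; rewrite ef in c2.
  by apply: nFk; rewrite -(same _ _ _ c2 ekk ekC).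
exists (fun e => p (rep e) w), (p k w); split => //; split; rewrite ?hullE//.
by move=> e eD; have [h1 h2] := Hrep e eD; have [_ c2] := Hcl _ h1; rewrite h2 in c2.
Qed.

Let sigma := fine (S setT) / rvol K.

(** A union bound over the exponentially many pairs: since [e] is not in [D] the bounds factorise,
    and summing the products over all [D] gives at most the exponential of the total intensity,
    which does not depend on the mesh. *)
Lemma bad_pairs_mass (T eps r : R) m (hm : is_mesh K S T eps m) : 0 < r -> eps <= 1 -> 0 < T ->
  exists B, [/\ measurable B, forall w (D : {set 'I_(mN m) * 'I_(mq m)}) e, bad_pair r D e -> occupied (e |: D) w -> B w &
    (Q B <= (((eps * (T + 3) / r + 2 * eps) * sigma) * expR ((T + 2) * sigma))%:E)%E].
Proof.
move=> r0 eps1 T0; pose hb (x : {set 'I_(mN m) * 'I_(mq m)} * ('I_(mN m) * 'I_(mq m))) := `[< bad_pair r x.1 x.2 >].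
have [mbad leB] := measure_bigU_le Q (index_enum _) hb (fun x => occupied_measurable hm (x.2 |: x.1)).
exists (\big[setU/set0]_(x | hb x) occupied (x.2 |: x.1)); split => //.
  move=> w D e bDe oDe; rewrite (bigD1 (D, e))/=; first by left.
  exact/asboolP.
apply: le_trans leB _.
have /andP[h0 heps] := im_h hm; have eps0 := eps_ge0 hm.
have lam0 := lam_ge0 hm.
have sg0 : 0 <= sigma by rewrite divr_ge0 ?rvol_ge0// fine_ge0.
pose W := (eps * (T + 3) / r + 2 * eps) * sigma.
have W0 : 0 <= W.
  by rewrite mulr_ge0// addr_ge0// ?mulr_ge0// ?invr_ge0 ?(ltW r0)// addr_ge0// ltW.
apply: (@le_trans _ _ (\sum_(x | hb x) (\prod_(e in x.2 |: x.1) @mlam R d K S m e)%:E)%E).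
  by apply: lee_sum => x _; exact: (prob_occupied hm).
rewrite sumEFin lee_fin.
rewrite (eq_bigr (fun x : {set 'I_(mN m) * 'I_(mq m)} * ('I_(mN m) * 'I_(mq m)) => @mlam R d K S m x.2 * \prod_(e in x.1) @mlam R d K S m e)); last first.
  by move=> x /asboolP[nx _]; rewrite big_setU1.
rewrite (eq_bigl (fun x : {set 'I_(mN m) * 'I_(mq m)} * ('I_(mN m) * 'I_(mq m)) => xpredT x.1 && hb (x.1, x.2))); last by case.
rewrite -(pair_big_dep xpredT (fun D e => hb (D, e)) (fun D e => @mlam R d K S m e * \prod_(e' in D) @mlam R d K S m e'))/=.
apply: (@le_trans _ _ (\sum_(D : {set 'I_(mN m) * 'I_(mq m)}) W * \prod_(e' in D) @mlam R d K S m e')).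
  apply: ler_sum => D _; rewrite -mulr_suml; apply: ler_wpM2r; first by apply: prodr_ge0.
  have hD e : hb (D, e) -> bad_pair r D e by move=> /asboolP.
  exact: (bad_pair_mass hm r0 T0 hD).
rewrite -mulr_sumr; apply: ler_wpM2l => //.
under eq_bigr do rewrite big_mkcond/=.
rewrite sum_prod_sets; apply: (@le_trans _ _ (expR (\sum_e @mlam R d K S m e))).
  by rewrite expR_sum; apply: ler_prod => e _; rewrite addr_ge0//= addrC expR_ge1Dx.
rewrite ler_expR -(pair_bigA _ (fun a b => mh m * fine (S (mB b : set (borel_rV R d))) / rvol K))/=.
rewrite sumr_const card_ord -mulr_suml -mulr_sumr -[leLHS]mulr_natl.
have hN : (mN m)%:R * mh m <= T + 2.
  by have /andP[_] := im_T hm; have := im_tlo hm; rewrite /mtime; lra.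
have := direction_mass hm; rewrite /sigma => hS.
have S0 : 0 <= \sum_(b < mq m) fine (S (mB b : set (borel_rV R d))) by apply: sumr_ge0 => b _; exact: fine_ge0.
rewrite 2!mulrA [leRHS]mulrA; apply: ler_wpM2r; first by rewrite invr_ge0 rvol_ge0.
by apply: ler_pM => //; rewrite mulr_ge0// ltW.
Qed.

Context (mesh_ex : forall T eps : R, 0 < T -> 0 < eps -> exists m : @mesh_data R d, is_mesh K S T eps m).

Lemma not_degenerate_ae (T r : R) : 0 < T -> 0 < r -> {ae Q, forall w, ~ degenerate T r w}.
Proof.
move=> T0 r0; apply: negligible_small => e e0.
have sg0 : 0 <= sigma by rewrite divr_ge0 ?rvol_ge0// fine_ge0.
(* The 2 accounts for unresolved configurations, the rest is the factor of [eps] in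
   [bad_pairs_mass]. *)
pose c := 2 + ((T + 3) / r + 2) * sigma * expR ((T + 2) * sigma).
have c0 : 0 < c.
  rewrite ltr_pwDl// mulr_ge0 ?expR_ge0// mulr_ge0// addr_ge0// divr_ge0 ?(ltW r0)// addr_ge0// ltW//.
pose eps := Num.min 1 (e / c).
have eps0 : 0 < eps by rewrite lt_min ltr01 divr_gt0.
have eps1 : eps <= 1 by rewrite ge_min lexx.
have epse : eps * c <= e by rewrite -ler_pdivlMr// ge_min lexx orbT.
have [m hm] := mesh_ex T0 eps0.
have [B [mB HB leB]] := bad_pairs_mass hm r0 eps1 T0.
have mU : measurable (\bigcup_C limit_event p m C).
  by apply: measurable_bigcup_fin => C; exact: (limit_event_measurable p_poisson hm).
exists (~` (\bigcup_C limit_event p m C) `|` B); split.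
- by apply: measurableU => //; exact: measurableC.
- move=> w /= /contrapT dw; have [[C _ wC]|nC] := pselect ((\bigcup_C limit_event p m C) w); last by left.
  by right; have [D [e' [b1 b2]]] := degenerate_mesh hm wC dw; exact: HB b1 b2.
have := measureU2 Q (measurableC mU) mB; move=> h2; apply: (le_trans h2) => {h2}.
have h1 := limit_events_large p_poisson eps1 hm.
have fU : Q (\bigcup_C limit_event p m C) \is a fin_num by exact: fin_num_measure.
have h3 : (Q (~` (\bigcup_C limit_event p m C)) <= (2 * eps)%:E)%E.
  rewrite probability_setC// -(fineK fU) -EFinB lee_fin.
  by move: h1; rewrite -(fineK fU) lee_fin; lra.
apply: (le_trans (leeD h3 leB)).
rewrite -EFinD lee_fin; apply: le_trans epse; rewrite le_eqVlt; apply/orP; left; apply/eqP.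
by rewrite /c; ring.
Qed.

Lemma mesh_sequence : exists M : nat -> @mesh_data R d, forall j,
  is_mesh K S (j.+1%:R) ((2 ^+ j.+1)^-1) (M j).
Proof.
have H (j : nat) : exists m : @mesh_data R d, is_mesh K S (j.+1%:R) ((2 ^+ j.+1)^-1) m.
  by apply: mesh_ex; rewrite ?invr_gt0 ?exprn_gt0.
by have [M hM] := choice H; exists M.
Qed.

Lemma half_pow_le1 j : (2 ^+ j)^-1 <= 1 :> R.
Proof. by rewrite invf_le1 ?exprn_gt0// exprn_ege1// ler1n. Qed.

(** The first Borel-Cantelli lemma, with unresolved probabilities at most [2 / 2 ^+ j.+1]. *)
Lemma eventually_resolved (M : nat -> @mesh_data R d) :
  (forall j, is_mesh K S (j.+1%:R) ((2 ^+ j.+1)^-1) (M j)) ->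
  {ae Q, forall w, exists J, forall j, (J <= j)%N -> exists C, limit_event p (M j) C w}.
Proof.
move=> hM; pose F j := ~` (\bigcup_C limit_event p (M j) C).
have mU j : measurable (\bigcup_C limit_event p (M j) C).
  by apply: measurable_bigcup_fin => C; exact: (limit_event_measurable p_poisson (hM j)).
have mF j : measurable (F j) by exact: measurableC.
have QF j : (Q (F j) <= ((2 : R) / 2 ^+ j.+1)%:E)%E.
  have h1 := limit_events_large p_poisson (half_pow_le1 _) (hM j).
  have fU : Q (\bigcup_C limit_event p (M j) C) \is a fin_num by exact: fin_num_measure.
  rewrite probability_setC// -(fineK fU) -EFinB lee_fin.
  by move: h1; rewrite -(fineK fU) lee_fin; lra.
exists (lim_sup_set F); split.
- by apply: bigcapT_measurable => n; apply: bigcup_measurable => j _; exact: mF.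
- apply: lim_sup_set_cvg0 => //.
  apply: (@le_lt_trans _ _ (2%:E : \bar R)); last exact: ltry.
  apply: le_trans (epsilon_trick0 _ _); last by [].
  apply: lee_nneseries => [j _ _|j _]; first exact: measure_ge0.
  by have := QF j; rewrite natrX.
- move=> w /= H n _; apply: contrapT => H2; apply: H; exists n => j nj.
  apply: contrapT => H3; apply: H2; exists j => // -[C _ wC].
  by apply: H3; exists C.
Qed.

Lemma good_ae : {ae Q, forall w, good (fun i => tip (p i w))}.
Proof.
have [M hM] := mesh_sequence.
have H1 := eventually_resolved hM.
have H2 : {ae Q, forall w, forall k : nat, ~ degenerate k.+1%:R (k.+1%:R^-1) w}.
  by apply: ae_foralln => k; apply: not_degenerate_ae; rewrite ?invr_gt0.
have H3 := cofinite_span.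
apply: filterS3 H1 H2 H3 => w [J HJ] nd span.
(* A resolving mesh with a late horizon shows that only finitely many points come before [T], at
   most one in each cell. *)
have early (T : R) : exists j C, limit_event p (M j) C w /\ T < mtime (M j) (mN (M j)).
  pose j := maxn J (Num.trunc `|T|).
  have [C wC] := HJ j (leq_maxl _ _); exists j, C; split => //.
  have /andP[h _] := im_T (hM j); apply: lt_le_trans h.
  have /andP[_ h] := truncn_itv (normr_ge0 T).
  apply: (le_lt_trans (ler_norm T)); apply: (lt_le_trans h).
  by rewrite ler_nat ltnS leq_maxr.
split.
- move=> e e0; have [j [C [wC Te]]] := early e^-1.
  have /choice[g Hg] : forall c, exists i, c \in C -> mcell c (p i w).
    move=> c; have [/(limit_event_cell wC)[[i ci] _]|nc] := pselect (c \in C); first by exists i.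
    by exists 0%N.
  apply: sub_finite_set (finite_image g (finite_finset (X := setT))) => k /= ek.
  have [t0 _] := p_dom k w.
  have [|c cC ck] := limit_event_early p_dom (hM j) wC (i := k).
    apply: lt_trans Te; rewrite (tip_enorm k w) in ek.
    by rewrite -[ltLHS]invrK ltf_pV2 ?posrE// invr_gt0.
  by exists c => //; have [_] := limit_event_cell wC cC; apply => //; exact: Hg.
- exact: span.
- move=> k F r fF r0 Fr nFk Hk; apply: contrapT => ns.
  have [t1 Ht1] : exists t1 : R, forall f, (F `|` [set k]) f -> (p f w).1 <= t1.
    have [|k1 _ Hk1] := finite_argmax (fun f => (p f w).1) (_ : finite_set (F `|` [set k])) (ex_intro _ k (or_intror erefl)).
      by rewrite finite_setU; split => //; exact: finite_set1.
    by exists (p k1 w).1.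
  (* One integer bounds both the times and the inverse radius, so countably many null sets exclude
     every degeneracy. *)
  pose n := (Num.trunc `|t1| + Num.trunc r^-1)%N.
  have n1 : t1 < n.+1%:R.
    have /andP[_ h] := truncn_itv (normr_ge0 t1).
    apply: (le_lt_trans (ler_norm t1)); apply: (lt_le_trans h).
    by rewrite ler_nat ltnS leq_addr.
  have n2 : n.+1%:R^-1 <= r.
    have ri : 0 <= r^-1 by rewrite invr_ge0 ltW.
    have /andP[_ h] := truncn_itv ri.
    rewrite -[leRHS]invrK lef_pV2 ?posrE ?invr_gt0//; apply: ltW; apply: (lt_le_trans h).
    by rewrite ler_nat ltnS leq_addl.
  apply: (nd n); exists k, F; split => //.
    split; first by apply: le_lt_trans n1; apply: Ht1; right.
    by move=> f Ff; apply: le_lt_trans n1; apply: Ht1; left.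
  by split => // y yn; apply: Fr; exact: le_trans n2.
- move=> k l /tip_inj E; have [j [C [wC Te]]] := early (p k w).1.
  have [c cC ck] := limit_event_early p_dom (hM j) wC Te.
  by have [_] := limit_event_cell wC cC; apply => //; rewrite -E.
- move=> k; apply/eqP => E; have := tip_enorm k w; rewrite E enorm0 => /esym/eqP.
  by have [t0 _] := p_dom k w; rewrite invr_eq0 gt_eqF.
Qed.

End AlmostSure.

(** * Sample points in a mesh *)

Section Asymptotics.
Context {R : realType}.

(** For [0 <= y <= 1/2] one has [1 - y >= expR (- (y + 2 * y ^+ 2))]; take [y = x / n] and raise to
    the power [n]. *)
Lemma one_minus_pow_ge (x : R) (n : nat) : 0 <= x -> 2 * x <= n%:R -> (0 < n)%N ->
  expR (- x) * (1 - 2 * x ^+ 2 / n%:R) <= (1 - x / n%:R) ^+ n.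
Proof.
move=> x0 xn n0; have n0' : 0 < (n%:R : R) by rewrite ltr0n.
pose y := x / n%:R; have y0 : 0 <= y by rewrite divr_ge0// ltW.
have y2 : y <= 2^-1 by rewrite /y ler_pdivrMr//; lra.
have H : expR (- (y + 2 * y ^+ 2)) <= 1 - y.
  have y1 : 0 < 1 - y by lra.
  rewrite expRN -[leRHS]invrK lef_pV2 ?posrE ?invr_gt0 ?expR_gt0//.
  apply: le_trans (expR_ge1Dx _); rewrite -[leLHS]mul1r ler_pdivrMr//.
  have : y * (1 - 2 * y) * y >= 0 by rewrite !mulr_ge0//; lra.
  lra.
apply: (@le_trans _ _ (expR (- (y + 2 * y ^+ 2)) ^+ n)); last first.
  have y1 : 0 <= 1 - y by lra.
  by apply: lerXn2r => //; rewrite nnegrE ?expR_ge0.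
rewrite -expRM_natl.
have -> : n%:R * - (y + 2 * y ^+ 2) = - x + - (2 * x ^+ 2 / n%:R) by rewrite /y; field; rewrite gt_eqF.
by rewrite expRD ler_wpM2l ?expR_ge0// expR_ge1Dx.
Qed.

(** The ratio is the product of [1 - i / n] over [i < k]; each of the [k] factors loses at most
    [k / n]. *)
Lemma ffact_ratio_ge (n k : nat) : (k <= n)%N -> (0 < n)%N ->
  1 - (k * k)%:R / n%:R <= (n ^_ k)%:R / n%:R ^+ k :> R.
Proof.
move=> kn n0; have n0' : 0 < (n%:R : R) by rewrite ltr0n.
have -> : (n ^_ k)%:R / n%:R ^+ k = \prod_(i < k) (1 - i%:R / n%:R) :> R.
  have E : (n%:R^-1) ^+ k = \prod_(i < k) n%:R^-1 :> R by rewrite prodr_const card_ord.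
  rewrite ffact_prod natr_prod -exprVn E -big_split/=.
  apply: eq_bigr => i _; rewrite natrB; last by apply: leq_trans kn; exact: ltnW.
  by rewrite mulrBl mulfV ?gt_eqF.
apply: le_trans (prod_one_minus_ge _ _); last first.
  move=> i; rewrite divr_ge0//= ler_pdivrMr// mul1r ler_nat.
  by apply: leq_trans kn; exact: ltnW.
rewrite lerB// natrM; apply: (@le_trans _ _ (\sum_(i < k) k%:R / n%:R)).
  by apply: ler_sum => i _; rewrite ler_wpM2r ?invr_ge0 ?(ltW n0')// ler_nat ltnW.
by rewrite sumr_const card_ord -[leLHS]mulr_natl mulrA.
Qed.

End Asymptotics.

Section SampleEvents.
Context {R : realType} {d : nat} (hd : (0 < d)%N).
Local Notation V := 'rV[R]_d.
Context {dO : measure_display} {O : measurableType dO} (P : probability O R).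
Variables (K : set V) (hK : in_K0 K) (S : {finite_measure set (borel_rV R d) -> \bar R}).
Variable (xi : nat -> O -> borel_rV R d).
Context (xi_meas : forall i, measurable_fun setT (xi i)).
Context (xi_unif : forall i, uniform_on P K (xi i)).
Context (xi_indep : independent_seq P xi).
Variables (T eps : R) (m : @mesh_data R d).
Context (hm : is_mesh K S T eps m).
Local Notation cell := ('I_(mN m) * 'I_(mq m))%type.
Local Notation rate := (@mrate R d m).

Section FixedSize.
Variables (n : nat) (hn : (mn0 m <= n)%N).

Definition sample_rest : set V := K° `\` (\big[setU/set0]_(e : cell) mA n e `|` mX m n).

Lemma mA_measurable (e : cell) : measurable (mA n e : set (borel_rV R d)).
Proof. exact: (im_mA hm e hn). Qed.

Lemma interior_measurable : measurable (K° : set (borel_rV R d)).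
Proof. by apply: open_measurable_rV; exact: open_interior. Qed.

Lemma sample_rest_measurable : measurable (sample_rest : set (borel_rV R d)).
Proof.
apply: measurableD; first exact: interior_measurable.
apply: measurableU; last exact: (im_mX hm hn).
by apply: bigsetU_measurable => e _; exact: mA_measurable.
Qed.

Lemma prob_mA i (e : cell) : P (xi i @^-1` mA n e) = (rate e / n%:R)%:E.
Proof.
rewrite (prob_rvol (xi_unif i) (mA_measurable e)); last first.
  by move=> x /(im_Aint hm hn); exact: interior_subset.
by rewrite (im_Avol hm e hn).
Qed.

Definition rest_prob : R := rvol sample_rest / rvol K.

Lemma prob_rest i : P (xi i @^-1` sample_rest) = rest_prob%:E.
Proof.
apply: (prob_rvol (xi_unif i) sample_rest_measurable).
by move=> x [/interior_subset].
Qed.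

Lemma bborel_sub (A : set V) : measurable (A : set (borel_rV R d)) -> A `<=` K -> bborel A.
Proof.
by move=> mA0 AK; apply: (bborelS (B := K)) => //; apply: bborel_compact; have [] := hK.
Qed.

Let volK : 0 < rvol K := vol_body_gt0 (xi_unif 0).

(** [K] is covered by its null boundary, the rest, the regions [mA] and the exceptional region, so
    subadditivity of volume suffices. *)
Lemma rest_prob_itv : 1 - (\sum_e rate e + eps) / n%:R <= rest_prob <= 1.
Proof.
have bK : bborel K by apply: bborel_compact; have [] := hK.
have bR : bborel sample_rest.
  by apply: bborel_sub; [exact: sample_rest_measurable|move=> x [/interior_subset]].
apply/andP; split; last first.
  by rewrite /rest_prob ler_pdivrMr// mul1r; apply: rvolS => // x [/interior_subset].
have AK (e : cell) : mA n e `<=` K by move=> x /(im_Aint hm hn); exact: interior_subset.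
have bA (e : cell) : bborel (mA n e) by apply: bborel_sub => //; exact: mA_measurable.
have bX : bborel (mX m n).
  by apply: bborel_sub; [exact: (im_mX hm hn)|exact: (im_Xint hm hn)].
have [bU leU] := rvol_bigU hd hK (xi_meas 0) (xi_unif 0) (index_enum cell) bA.
have bKK : bborel (K `\` K°).
  by apply: bborel_sub => [|x []//]; apply: measurableD; [by have [] := bK|exact: interior_measurable].
have b1 : bborel (\big[setU/set0]_(e : cell) mA n e `|` mX m n) by exact: bborelU.
have b2 := bborelU bR b1; have b3 := bborelU bKK b2.
have h1 : rvol K <= rvol (K `\` K°) + (rvol sample_rest + (rvol (\big[setU/set0]_(e : cell) mA n e) + rvol (mX m n))).
  apply: (@le_trans _ _ (rvol ((K `\` K°) `|` (sample_rest `|` (\big[setU/set0]_(e : cell) mA n e `|` mX m n))))).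
    apply: rvolS => // x Kx; have [iK|nK] := pselect (K° x); last by left.
    right; have [|] := pselect ((\big[setU/set0]_(e : cell) mA n e `|` mX m n) x); first by right.
    by left.
  apply: le_trans (rvolU_le hd hK (xi_meas 0) (xi_unif 0) bKK b2) _; rewrite lerD2l.
  apply: le_trans (rvolU_le hd hK (xi_meas 0) (xi_unif 0) bR b1) _; rewrite lerD2l.
  exact: (rvolU_le hd hK (xi_meas 0) (xi_unif 0)).
move: h1; rewrite (rvol_boundary hd hK (xi_meas 0) (xi_unif 0)) add0r => h1.
have h2 := im_Xvol hm hn.
have h3 : \sum_(e : cell) rvol (mA n e) = (\sum_e rate e) / n%:R * rvol K.
  rewrite (eq_bigr (fun e => rate e / n%:R * rvol K)); first by rewrite -!mulr_suml.
  by move=> e _; rewrite -(im_Avol hm e hn) divfK ?gt_eqF.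
rewrite /rest_prob ler_pdivlMr//.
move: h2; rewrite ler_pdivrMr// => h2.
rewrite mulrBl mul1r (mulrDl _ _ (n%:R^-1)) mulrDl.
have : rvol (\big[setU/set0]_(e : cell) mA n e) <= (\sum_e rate e) / n%:R * rvol K.
  by rewrite -h3.
lra.
Qed.

Section Assignment.
Variables (C : {set cell}) (s : {ffun 'I_#|C| -> 'I_n}).

(* The set prescribed for the [i]-th point when [s] tells which points realise the cells of [C]. *)
Definition prescribed (i : nat) : set V :=
  match [pick j | (s j : nat) == i] with Some j => mA n (enum_val j) | None => sample_rest end.

Definition assigned : set O := \bigcap_(i in [set` iota 0 n]) (xi i @^-1` prescribed i).

Lemma prescribed_measurable i : measurable (prescribed i : set (borel_rV R d)).
Proof.
by rewrite /prescribed; case: pickP => [j _|_]; [exact: mA_measurable|exact: sample_rest_measurable].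
Qed.

Lemma preimage_measurable i (A : set V) : measurable (A : set (borel_rV R d)) -> measurable (xi i @^-1` A).
Proof. by move=> mA0; rewrite -[X in measurable X]setTI; exact: (xi_meas i). Qed.

Lemma assigned_measurable : measurable assigned.
Proof.
apply: fin_bigcap_measurable; first exact: finite_seq.
by move=> i _; apply: preimage_measurable; exact: prescribed_measurable.
Qed.

Context (sinj : injective s).

Lemma assignedP w : assigned w <->
  (forall j, mA n (enum_val j) (xi (s j) w)) /\
  (forall i : 'I_n, (forall j, s j != i) -> sample_rest (xi i w)).
Proof.
split=> [H|[H1 H2] i].
  have H' (i : 'I_n) : prescribed i (xi i w) by apply: (H i); rewrite /= mem_iota ltn_ord.
  split=> [j|i Hi]; have := H' _.
    move=> /(_ (s j)); rewrite /prescribed; case: pickP => [j' /eqP/ord_inj/sinj -> //|/(_ j)].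
    by rewrite eqxx.
  move=> /(_ i); rewrite /prescribed; case: pickP => // j /eqP/ord_inj E.
  by have := Hi j; rewrite E eqxx.
rewrite /= mem_iota add0n => /andP[_ ilt]; rewrite /prescribed; case: pickP => [j /eqP <-//|Hi].
by apply: (H2 (Ordinal ilt)) => j; apply/negP => /eqP E; have := Hi j; rewrite E eqxx.
Qed.

Lemma prob_assigned_ge : 0 <= rest_prob ->
  ((\prod_(e in C) (rate e / n%:R) * rest_prob ^+ n)%:E <= P assigned)%E.
Proof.
move=> q0; rewrite (xi_indep (iota_uniq 0 n)); last exact: prescribed_measurable.
have /andP[_ q1] := rest_prob_itv.
pose b i : R := match [pick j | (s j : nat) == i] with Some j => rate (enum_val j) / n%:R | None => rest_prob end.
rewrite (eq_bigr (fun i => (b i)%:E)); last first.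
  by move=> i _; rewrite /prescribed /b; case: pickP => [j _|_]; [exact: prob_mA|exact: prob_rest].
rewrite prodEFin lee_fin.
have -> : \prod_(i <- iota 0 n) b i = \prod_(i < n) b i.
  by rewrite -(big_mkord xpredT b) /index_iota subn0.
pose D := [set s j | j in 'I_#|C|]%SET.
have DP (i : 'I_n) : (i \in D) = [exists j, s j == i].
  by apply/imsetP/existsP => [[j _ ->]|[j /eqP <-]]; exists j.
have bD j : b (s j) = rate (enum_val j) / n%:R.
  rewrite /b; case: pickP => [j' /eqP/ord_inj/sinj -> //|/(_ j)].
  by rewrite eqxx.
have bnD i : i \notin D -> b i = rest_prob.
  rewrite DP => /existsPn H; rewrite /b; case: pickP => // j /eqP/ord_inj E.
  by have := H j; rewrite E eqxx.
have -> : \prod_(e in C) (rate e / n%:R) = \prod_(i in D) b i.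
  rewrite big_imset/=; last by move=> j j' _ _; exact: sinj.
  by rewrite big_enum_val; apply: eq_bigr => j _; rewrite bD.
have r0 e : 0 <= rate e := im_rate0 hm e.
have bD0 i : i \in D -> 0 <= b i by move=> /imsetP[j _ ->]; rewrite bD divr_ge0.
rewrite [leRHS](bigID [in D])/=; apply: ler_wpM2l; first by apply: prodr_ge0.
rewrite (eq_bigr (fun=> rest_prob)); last by move=> i; exact: bnD.
(* The exact exponent is the number of remaining points; enlarging it to [n] only lowers the bound,
   since [rest_prob] is at most 1. *)
rewrite prodr_const; apply: ler_wiXn2l => //.
by rewrite -[leqRHS]card_ord max_card.
Qed.

End Assignment.

Definition sample_event (C : {set cell}) : set O :=
  \bigcup_(s : {s : {ffun 'I_#|C| -> 'I_n} | injectiveb s}) assigned (\val s).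

Lemma sample_event_measurable C : measurable (sample_event C).
Proof. by apply: measurable_bigcup_fin => s; exact: assigned_measurable. Qed.

Lemma sample_eventP C w : sample_event C w ->
  [/\ forall e, e \in C -> exists i : 'I_n, mA n e (xi i w),
      forall (e : cell) (i i' : 'I_n), mA n e (xi i w) -> mA n e (xi i' w) -> i = i' &
      forall i : 'I_n, sample_rest (xi i w) \/ exists2 e, e \in C & mA n e (xi i w)].
Proof.
move=> [[s /injectiveP sinj] _ /= /(assignedP sinj)[H1 H2]].
have dj (e : cell) i : mA n e (xi i w) -> ~ sample_rest (xi i w).
  by move=> h1 [_]; apply; left; apply/bigsetUP; exists e.
have H3 (i : 'I_n) : (exists j, s j = i) \/ sample_rest (xi i w).
  have [[j sj]|nj] := pselect (exists j, s j = i); [by left; exists j|right].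
  by apply: H2 => j; apply/eqP => E; apply: nj; exists j.
split.
- by move=> e eC; exists (s (enum_rank_in eC e)); have := H1 (enum_rank_in eC e); rewrite enum_rankK_in.
- move=> e i i' h1 h2.
  have [[j sj]|r1] := H3 i; last by case: (dj _ _ h1).
  have [[j' sj']|r2] := H3 i'; last by case: (dj _ _ h2).
  have E1 : enum_val j = e by apply: (im_Adisj hm hn (x := xi i w)) => //; rewrite -sj; exact: H1.
  have E2 : enum_val j' = e by apply: (im_Adisj hm hn (x := xi i' w)) => //; rewrite -sj'; exact: H1.
  by rewrite -sj -sj'; congr (s _); apply: enum_val_inj; rewrite E1 E2.
- move=> i; have [[j <-]|r1] := H3 i; [right|by left].
  by exists (enum_val j); [exact: enum_valP|exact: H1].
Qed.

Lemma sample_event_disj C C' w : sample_event C w -> sample_event C' w -> C = C'.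
Proof.
move=> /sample_eventP[a1 _ a3] /sample_eventP[b1 _ b3].
have dj (e : cell) i : mA n e (xi i w) -> ~ sample_rest (xi i w).
  by move=> h1 [_]; apply; left; apply/bigsetUP; exists e.
apply/setP => e; apply/idP/idP => [/a1|/b1] [i Ai]; [have := b3 i|have := a3 i];
  move=> [/(dj e i Ai)//|[e' eC Ai']]; by rewrite (im_Adisj hm hn Ai Ai').
Qed.

(** Different injective assignments give disjoint events, because the point in each region is
    unique; their number is the falling factorial. *)
Lemma prob_sample_event_ge (C : {set cell}) : 0 <= rest_prob ->
  (((n ^_ #|C|)%:R / n%:R ^+ #|C| * \prod_(e in C) rate e * rest_prob ^+ n)%:E <= P (sample_event C))%E.
Proof.
move=> q0; rewrite measure_bigcup_fin.
- apply: (@le_trans _ _ (\sum_(s : {s : {ffun 'I_#|C| -> 'I_n} | injectiveb s}) (\prod_(e in C) (rate e / n%:R) * rest_prob ^+ n)%:E)%E); last first.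
    by apply: lee_sum => s _; apply: prob_assigned_ge => //; exact/injectiveP/(valP s).
  rewrite sumEFin lee_fin sumr_const card_sig.
  have -> : #|[pred s : {ffun 'I_#|C| -> 'I_n} | injectiveb s]| = (n ^_ #|C|)%N.
    by rewrite -[in RHS](card_ord n) -[X in (_ ^_ X)%N](card_ord #|C|) -card_inj_ffuns cardsE.
  rewrite -[leRHS]mulr_natl big_split/= prodr_const exprVn le_eqVlt; apply/orP; left; apply/eqP.
  by ring.
- by move=> s; exact: assigned_measurable.
- move=> [s hs] [s' hs'] w /= h1 h2; apply: val_inj => /=; apply/ffunP => j.
  have := sample_eventP (ex_intro2 _ _ (exist _ s hs) I h1 : sample_event C w) => -[_ uq _].
  have [a1 _] := (assignedP (injectiveP _ hs) w).1 h1.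
  have [b1 _] := (assignedP (injectiveP _ hs') w).1 h2.
  exact: uq (a1 j) (b1 j).
Qed.

End FixedSize.

Lemma sample_event_limit (C : {set cell}) (dl : R) : 0 < dl -> exists N, forall n, (N <= n)%N ->
  (mn0 m <= n)%N -> ((sample_weight eps C - dl)%:E <= P (sample_event n C))%E.
Proof.
move=> dl0; have eps0 := eps_ge0 hm.
have r0 (e : cell) : 0 <= rate e := im_rate0 hm e.
set x := \sum_e rate e + eps.
have x0 : 0 <= x by rewrite addr_ge0// sumr_ge0.
pose k := #|C|; pose w := \prod_(e in C) rate e.
have w0 : 0 <= w by apply: prodr_ge0.
have wE : sample_weight eps C = expR (- x) * w by rewrite /sample_weight -/x /w [in RHS]big_mkcond.
(* The sum of the error numerators of [ffact_ratio_ge] and [one_minus_pow_ge]; the relative error is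
   at most [c / n]. *)
pose c := (k * k)%:R + 2 * x ^+ 2 : R.
have c0 : 0 <= c by rewrite addr_ge0// mulr_ge0// sqr_ge0.
exists (k + Num.trunc (2 * x) + Num.trunc (expR (- x) * w * c / dl) + Num.trunc c + 1)%N => n Nn hn.
have big (y : R) : 0 <= y -> (Num.trunc y < n)%N -> y <= n%:R.
  move=> y0 yn; have /andP[_ h] := truncn_itv y0; apply: ltW; apply: (lt_le_trans h).
  by rewrite ler_nat.
have n1 : 2 * x <= n%:R.
  by apply: big; [exact: mulr_ge0|apply: leq_trans Nn; rewrite addn1 ltnS; do 2 apply: leq_trans (leq_addr _ _); exact: leq_addl].
have n2 : expR (- x) * w * c / dl <= n%:R.
  apply: big; first by rewrite divr_ge0 ?(ltW dl0)// mulr_ge0// mulr_ge0// expR_ge0.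
  apply: leq_trans Nn; rewrite addn1 ltnS; apply: leq_trans (leq_addr _ _); exact: leq_addl.
have n3 : c <= n%:R by apply: big => //; apply: leq_trans Nn; rewrite addn1 ltnS leq_addl.
have kn : (k <= n)%N by apply: leq_trans Nn; do 3 apply: leq_trans (leq_addr _ _); exact: leq_addr.
have n0 : (0 < n)%N by exact: leq_trans (im_n0 hm) hn.
have n0' : 0 < (n%:R : R) by rewrite ltr0n.
have /andP[q1 q2] := rest_prob_itv hn.
have xn : 0 <= 1 - x / n%:R by rewrite subr_ge0 ler_pdivrMr// mul1r; lra.
apply: le_trans (prob_sample_event_ge hn C _); last exact: le_trans q1.
rewrite lee_fin wE -/k -/w.
have h1 := ffact_ratio_ge (R := R) kn n0.
have h2 := one_minus_pow_ge x0 n1 n0.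
have h3 : (1 - x / n%:R) ^+ n <= rest_prob n ^+ n by apply: lerXn2r => //; rewrite nnegrE//; exact: le_trans q1.
have E0 := expR_ge0 (- x).
set A : R := (k * k)%:R / n%:R in h1; set B : R := 2 * x ^+ 2 / n%:R in h2.
have A0 : 0 <= A by rewrite divr_ge0// ltW.
have B0 : 0 <= B by rewrite divr_ge0 ?(ltW n0')// mulr_ge0// sqr_ge0.
have AB : A + B = c / n%:R by rewrite /A /B -mulrDl.
have AB1 : A + B <= 1 by rewrite AB ler_pdivrMr// mul1r.
have small : expR (- x) * w * (A + B) <= dl.
  by rewrite AB mulrA ler_pdivrMr// (mulrC dl) -ler_pdivrMr.
apply: (@le_trans _ _ ((1 - A) * w * (expR (- x) * (1 - B)))).
  have : 0 <= expR (- x) * w * (A * B) by rewrite !mulr_ge0.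
  lra.
apply: ler_pM.
- by rewrite mulr_ge0// subr_ge0; lra.
- by rewrite mulr_ge0// subr_ge0; lra.
- exact: ler_wpM2r.
- exact: le_trans h3.
Qed.

End SampleEvents.

(** * Measurability of the sample peelings *)

Section Approximation.
Context {R : realType} {d : nat}.
Local Notation V := 'rV[R]_d.
Context {dO : measure_display} {O : measurableType dO} (P : probability O R).

Lemma discrete_preimage (C : finType) (Om : set O) (c : O -> C) (T : Type) (G : C -> T) (b : T) (U : set T) :
  measurable Om -> (forall v, measurable (Om `&` [set w | c w = v])) ->
  measurable [set w | U (if pselect (Om w) then G (c w) else b)].
Proof.
move=> mOm mc; have -> : [set w | U (if pselect (Om w) then G (c w) else b)] =
    (\bigcup_(v in [set v | U (G v)]) (Om `&` [set w | c w = v])) `|` (~` Om `&` [set w | U b]).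
  apply/seteqP; split=> w /=.
    by case: pselect => [Ow|nOw] h; [left; exists (c w)|right].
  by case=> [[v /= Uv [Ow cv]]|[nOw Ub]]; case: pselect => //; rewrite cv.
apply: measurableU; first by apply: fin_bigcup_measurable => //; exact: finite_finset.
apply: measurableI; first exact: measurableC.
by have [Ub|nUb] := pselect (U b); [have -> : [set _ : O | U b] = setT by apply/seteqP; split
  |have -> : [set _ : O | U b] = set0 by apply/seteqP; split].
Qed.

(** For each code value the value of [X] at some outcome with that code is chosen, whatever the
    measurability of [X]. *)
Lemma representatives (C : Type) (Om : set O) (c : O -> C) (T : Type) (X : O -> T) (b : T) :
  exists G : C -> T, forall w, Om w -> exists w', [/\ Om w', c w' = c w & G (c w) = X w'].
Proof.
have H (v : C) : exists t : T, forall w, Om w -> c w = v -> exists w', [/\ Om w', c w' = v & t = X w'].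
  have [[w0 [Ow0 cw0]]|nw] := pselect (exists w, Om w /\ c w = v).
    by exists (X w0) => w Ow cw; exists w0.
  by exists b => w Ow cw; exfalso; apply: nw; exists w.
have [G HG] := choice H.
by exists G => w Ow; exact: (HG (c w) w Ow erefl).
Qed.

(** If finer and finer measurable finite codes determine [X] up to small errors, [X] is a pointwise
    limit of functions of the codes. This avoids studying the peeling map on a space of families. *)
Lemma random_element_approx (k : nat) (Om : set O) (X : O -> {ptws 'I_k -> body0 R d}) (B0 : body0 R d)
    (C : nat -> finType) (c : forall j, O -> C j) :
  measurable Om -> {ae P, forall w, Om w} ->
  (forall j v, measurable (Om `&` [set w | c j w = v])) ->
  (forall w e, Om w -> 0 < e -> exists N, forall j, (N <= j)%N -> forall w', Om w' -> c j w' = c j w ->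
     forall r, hausdorff_dist (X w' r) (X w r) < e) ->
  random_element P X.
Proof.
move=> mOm aeOm mc H.
have [G HG] : exists G : forall j, C j -> 'I_k -> body0 R d, forall j w, Om w ->
    exists w', [/\ Om w', c j w' = c j w & G j (c j w) = X w'].
  exists (fun j => projT1 (cid (representatives Om (c j) (X : O -> 'I_k -> body0 R d) (cst B0)))) => j.
  exact: projT2 (cid (representatives Om (c j) (X : O -> 'I_k -> body0 R d) (cst B0))).
exists (fun w => if pselect (Om w) then X w else cst B0).
  apply: (@limit_measurable _ _ k _ _ (fun j w => if pselect (Om w) then G j (c j w) else cst B0)).
    by move=> j U; have := discrete_preimage (G j) (cst B0) U mOm (mc j).
  move=> w e e0; have [Ow|nOw] := pselect (Om w); last first.
    exists 0%N => j _ r; case: (pselect (Om w)) => [Ow|nO]; first by case: (nOw Ow).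
    by rewrite /= hausdorff_distxx.
  have [N HN] := H w e Ow e0; exists N => j Nj r; case: (pselect (Om w)) => // Ow'.
  by have [w' [Oww cw' E]] := HG j w Ow; rewrite /= E; exact: HN Nj w' Oww cw' r.
by apply: filterS aeOm => w Ow; case: (pselect (Om w)).
Qed.

End Approximation.

Section CompactNet.
Context {R : realType} {d : nat}.
Local Notation V := 'rV[R]_d.

Lemma compact_net (A : set V) (r : R) : compact A -> 0 < r -> exists q (w : 'I_q -> V),
  forall u, A u -> exists b, enorm (u - w b) <= r.
Proof.
move=> kA r0; have := kA; rewrite compact_cover => /(_ V A (fun w => [set u | enorm (u - w) < r])).
case.
- move=> w _.
  have -> : [set u : V | enorm (u - w) < r] = ~` [set u | r <= enorm (u - w)].
    by apply/seteqP; split => u /=; [move=> h; apply/negP; rewrite -ltNge|move/negP; rewrite -ltNge].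
  by apply: closed_openC; exact: closed_enormB_ge.
- by move=> u Au; exists u => //=; rewrite subrr enorm0.
- move=> D0 Dsub cov; pose D : seq V := finmap.enum_fset D0.
  exists (size D), (fun b => nth 0 D b) => u /cov[w /= wD uw].
  have wi : (index w D < size D)%N by rewrite index_mem.
  by exists (Ordinal wi) => /=; rewrite nth_index// ltW.
Qed.

End CompactNet.

(** * Samples in general position and their finite codes *)

Section Sample.
Context {R : realType} {d : nat} (hd : (0 < d)%N).
Local Notation V := 'rV[R]_d.
Context {dO : measure_display} {O : measurableType dO} (P : probability O R).
Variables (K : set V) (hK : in_K0 K).
Variable (xi : nat -> O -> borel_rV R d).
Context (xi_meas : forall i, measurable_fun setT (xi i)).
Context (xi_unif : forall i, uniform_on P K (xi i)).
Context (xi_indep : independent_seq P xi).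

Let volK : 0 < rvol K := vol_body_gt0 (xi_unif 0).

Lemma xi_preimage i (A : set V) : measurable (A : set (borel_rV R d)) -> measurable (xi i @^-1` A).
Proof. by move=> mA0; rewrite -[X in measurable X]setTI; exact: (xi_meas i). Qed.

Lemma ae_interior i : {ae P, forall w, K° (xi i w)}.
Proof.
have mI : measurable (K° : set (borel_rV R d)) by apply: open_measurable_rV; exact: open_interior.
have bK : bborel K by apply: bborel_compact; have [] := hK.
have bI : bborel K° by apply: (bborelS bK) => //; exact: interior_subset.
exists (~` (xi i @^-1` K°)); split; [by apply: measurableC; exact: xi_preimage| |by []].
rewrite probability_setC; last exact: xi_preimage.
rewrite (prob_rvol (xi_unif i) mI); last exact: interior_subset.
have -> : rvol K° = rvol K; last by rewrite mulfV ?gt_eqF// subee.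
apply/eqP; rewrite eq_le; apply/andP; split; first by apply: (rvolS hd) => //; exact: interior_subset.
have bD : bborel (K `\` K°) by exact: bborelD.
rewrite -[leRHS]add0r -(rvol_boundary hd hK (xi_meas i) (xi_unif i)).
apply: le_trans (rvolU_le hd hK (xi_meas i) (xi_unif i) bD bI).
apply: (rvolS hd); first exact: bborelU.
by move=> x Kx; have [|] := pselect (K° x); [right|left].
Qed.

Lemma slab_rvol (M a h : R) : (forall x, K x -> enorm x <= M) -> 0 <= h -> 0 <= M ->
  rvol (K `&` [set x | a <= x 0 (Ordinal hd) <= a + h]) <= h * (2 * M) ^+ d.-1.
Proof.
move=> KM h0 M0; set A := K `&` _.
pose lo : V := \row_i (if i == Ordinal hd then a else - M).
pose hi : V := \row_i (if i == Ordinal hd then a + h else M).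
have : (vol A <= (box_vol lo hi)%:E)%E.
  apply: vol_le_box => // [i|x [Kx /= xa] i]; rewrite !mxE.
    by case: eqP => _; [rewrite lerDl|rewrite ge0_cp].
  case: eqP => [->|_]; first exact: xa.
  by rewrite -ler_norml (le_trans (coord_le_enorm _ _))// KM.
have -> : box_vol lo hi = h * (2 * M) ^+ d.-1.
  rewrite /box_vol (bigD1 (Ordinal hd))//= !mxE eqxx addrAC subrr add0r; congr (_ * _).
  rewrite (eq_bigr (fun=> 2 * M)); last by move=> i ni; rewrite !mxE (negbTE ni); lra.
  by rewrite prodr_const cardC1 card_ord.
rewrite /rvol => Ale; have /fineK E : vol A \is a fin_num.
  by apply: (vol_fin hd (M := M)) => x [/KM].
by rewrite -lee_fin E.
Qed.

(** Coinciding points share one of [L] parallel slabs of equal width. Given the slab of the first,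
    independence bounds the probability for the second by a constant over [L]. *)
Lemma ae_distinct i j : i != j -> {ae P, forall w, xi i w <> xi j w}.
Proof.
move=> ij; apply: negligible_small => e e0.
have kK : compact K by have [] := hK.
have /compact_enormP[_ [M0 HM0]] := kK.
(* Strictly more than the radius of [K], so that half-open slabs reach every point. *)
pose M := `|M0| + 1; have M1 : 0 < M by rewrite ltr_wpDl.
have HM x : K x -> enorm x <= M.
  by move=> /HM0 h; apply: (le_trans h); apply: (le_trans (ler_norm _)); rewrite lerDl.
pose c := (2 * M) ^+ d / rvol K; have c0 : 0 <= c by rewrite divr_ge0 ?(ltW volK)// exprn_ge0// mulr_ge0// ltW.
pose L := (Num.trunc (c / e)).+1.
have L0 : 0 < (L%:R : R) by rewrite ltr0n.
have cL : c / L%:R <= e.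
  have /andP[_ h] := truncn_itv (divr_ge0 c0 (ltW e0)).
  by rewrite ler_pdivrMr// mulrC -ler_pdivrMr// ltW.
pose h := 2 * M / L%:R; have h0 : 0 < h by rewrite divr_gt0// mulr_gt0.
pose a (l : 'I_L) := - M + l%:R * h.
pose cl (l : 'I_L) : set V := K `&` [set x | a l <= x 0 (Ordinal hd) < a l + h].
have Lh : L%:R * h = 2 * M by rewrite /h mulrC divfK ?gt_eqF.
have cldisj l l' x : cl l x -> cl l' x -> l = l'.
  move=> [_ /= /andP[x1 x2]] [_ /= /andP[x3 x4]]; apply: ord_inj; apply/eqP; rewrite eqn_leq.
  apply/andP; split; rewrite leqNgt; apply/negP => lt.
    have : (l'.+1%:R : R) * h <= l%:R * h by rewrite ler_wpM2r ?(ltW h0)// ler_nat.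
    have -> : l'.+1%:R = l'%:R + 1 :> R by rewrite natr1.
    by move: x1 x4; rewrite /a; lra.
  have : (l.+1%:R : R) * h <= l'%:R * h by rewrite ler_wpM2r ?(ltW h0)// ler_nat.
  have -> : l.+1%:R = l%:R + 1 :> R by rewrite natr1.
  by move: x2 x3; rewrite /a; lra.
have clcov x : K x -> exists l, cl l x.
  move=> Kx; have : enorm x < M.
    by apply: le_lt_trans (HM0 x Kx) _; apply: le_lt_trans (ler_norm _) _; rewrite ltrDl.
  move=> xM; have := coord_le_enorm x (Ordinal hd); rewrite ler_norml => /andP[y1 y2].
  set y := x 0 (Ordinal hd) in y1 y2 *.
  have p0 : 0 <= (y + M) / h by rewrite divr_ge0 ?(ltW h0)//; lra.
  have /andP[t1 t2] := truncn_itv p0.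
  move: t1 t2; rewrite ler_pdivlMr// ltr_pdivrMr// => t1 t2.
  have tL : (Num.trunc ((y + M) / h) < L)%N.
    rewrite ltnNge; apply/negP => Lt.
    have : L%:R * h <= (Num.trunc ((y + M) / h))%:R * h by rewrite ler_wpM2r ?(ltW h0)// ler_nat.
    by rewrite Lh; lra.
  exists (Ordinal tL); split => //=; rewrite /a/= -/y.
  have E : (Num.trunc ((y + M) / h)).+1%:R = (Num.trunc ((y + M) / h))%:R + 1 :> R by rewrite natr1.
  by move: t2; rewrite E; lra.
have cf : continuous (fun x : V => x 0 (Ordinal hd)) by exact: coord_continuous.
have mcl l : measurable (cl l : set (borel_rV R d)).
  have -> : cl l = K `&` ([set x | a l <= x 0 (Ordinal hd)] `\` [set x | a l + h <= x 0 (Ordinal hd)]).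
    apply/seteqP; split=> x /= [Kx]; first by move=> /andP[-> x2]; split => //; split => //; apply/negP; rewrite -ltNge.
    by move=> [x1 /negP]; rewrite -ltNge => x2; split => //=; rewrite x1 x2.
  apply: measurableI; first exact: compact_measurable_rV.
  by apply: measurableD; apply: closed_measurable_rV;
    apply: (@closed_le_fun _ _ (fun=> _) (fun x : V => x 0 (Ordinal hd))) => //; move=> ?; exact: cst_continuous.
have Pcl l : (P (xi j @^-1` cl l) <= (c / L%:R)%:E)%E.
  rewrite (prob_rvol (xi_unif j) (mcl l)); last by move=> x [].
  rewrite lee_fin /c mulrAC ler_wpM2r ?invr_ge0 ?(ltW volK)//.
  apply: (@le_trans _ _ (h * (2 * M) ^+ d.-1)).
    apply: le_trans (slab_rvol (a l) HM (ltW h0) (ltW M1)); apply: (rvolS hd).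
      apply: (bborelS (B := K)); [exact: bborel_compact| |by move=> x []].
      apply: measurableI; first exact: compact_measurable_rV.
      rewrite [X in measurable X](_ : _ =
          [set x : V | a l <= x 0 (Ordinal hd)] `&` [set x | x 0 (Ordinal hd) <= a l + h]); last first.
        by apply/seteqP; split=> x /=; [move=> /andP[]|move=> [-> ->]].
      apply: measurableI; apply: closed_measurable_rV.
        by apply: (@closed_le_fun _ _ (fun=> _) (fun x : V => x 0 (Ordinal hd))) => //; move=> ?; exact: cst_continuous.
      by apply: (@closed_le_fun _ _ (fun x : V => x 0 (Ordinal hd)) (fun=> _)) => //; move=> ?; exact: cst_continuous.
    by move=> x [Kx /= /andP[x1 x2]]; split => //=; rewrite x1 ltW.
  by rewrite /h -[in leRHS](prednK hd) exprS mulrAC.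
have Pind l : P (xi i @^-1` cl l `&` xi j @^-1` cl l) = (P (xi i @^-1` cl l) * P (xi j @^-1` cl l))%E.
  have uij : uniq [:: i; j] by rewrite /= inE ij.
  have := xi_indep uij (A := fun=> cl l) (fun=> mcl l); rewrite big_cons big_seq1 => <-; congr (P _).
  apply/seteqP; split=> w /=; first by move=> [w1 w2] k /=; rewrite !inE => /orP[/eqP ->|/eqP ->].
  by move=> H; split; apply: (H _); rewrite /= !inE eqxx ?orbT.
have [N [mN PN HN]] := ae_interior i.
have mE l : measurable (xi i @^-1` cl l `&` xi j @^-1` cl l) by apply: measurableI; exact: xi_preimage.
have [mU leU] := measure_bigU_le P (index_enum _) xpredT mE.
exists (N `|` \big[setU/set0]_(l < L) (xi i @^-1` cl l `&` xi j @^-1` cl l)); split.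
- exact: measurableU.
- move=> w /= /contrapT E; have [/interior_subset/clcov[l cll]|nK] := pselect (K° (xi i w)); last by left; apply: HN.
  by right; apply/bigsetUP; exists l; split => //=; rewrite -E.
set B1 := \big[setU/set0]_(l < L) _ in mU leU *.
have h1 : (P (N `|` B1) <= P N + P B1)%E by exact: measureU2.
rewrite PN add0e in h1; apply: (le_trans h1).
apply: (le_trans leU); apply: (@le_trans _ _ (\sum_(l < L) P (xi i @^-1` cl l) * (c / L%:R)%:E)%E).
  apply: lee_sum => l _.
  have hl : (P (xi i @^-1` cl l `&` xi j @^-1` cl l) <= P (xi i @^-1` cl l) * (c / L%:R)%:E)%E.
    by rewrite Pind; apply: lee_wpmul2l => //; exact: measure_ge0.
  exact: hl.
rewrite -ge0_sume_distrl; last by move=> l _; exact: measure_ge0.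
rewrite -(measure_bigcup_fin P (fun l => xi_preimage i (mcl l))); last by move=> l l' w; exact: cldisj.
apply: (@le_trans _ _ (1 * (c / L%:R)%:E)%E); last by rewrite mul1e lee_fin.
apply: lee_wpmul2r; first by rewrite lee_fin divr_ge0// ltW.
by apply: probability_le1; apply: measurable_bigcup_fin => l; exact: xi_preimage.
Qed.


Lemma sample_position (n : nat) : exists Om : set O, [/\ measurable Om, {ae P, forall w, Om w},
  forall w (i : 'I_n), Om w -> K° (xi i w) & forall w (i j : 'I_n), Om w -> xi i w = xi j w -> i = j].
Proof.
have : {ae P, forall w, (forall i : 'I_n, K° (xi i w)) /\ forall i j : 'I_n, xi i w = xi j w -> i = j}.
  have H1 : {ae P, forall w, forall i : 'I_n, K° (xi i w)}.
    by apply: filter_forall => i; exact: ae_interior.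
  have H2 : {ae P, forall w, forall i j : 'I_n, xi i w = xi j w -> i = j}.
    apply: filter_forall => i; apply: filter_forall => j.
    have [->|ij] := eqVneq i j; first by apply: nearW.
    by apply: filterS (ae_distinct ij) => w.
  by apply: filterS2 H1 H2 => w.
move=> [N [mN PN HN]]; exists (~` N); split.
- exact: measurableC.
- by exists N; split => // w /= /contrapT.
- by move=> w i nNw; have [] : (forall i : 'I_n, K° (xi i w)) /\ forall i j : 'I_n, xi i w = xi j w -> i = j
    by apply: contrapT => H; apply: nNw; exact: HN.
- by move=> w i j nNw; have [_] : (forall i : 'I_n, K° (xi i w)) /\ forall i j : 'I_n, xi i w = xi j w -> i = j
    by [apply: contrapT => H; apply: nNw; exact: HN]; apply.
Qed.

Lemma body_nets : exists q (z : forall j : nat, 'I_(q j) -> V), forall j u, K u ->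
  exists b, enorm (u - z j b) <= j.+1%:R^-1.
Proof.
have kK : compact K by have [] := hK.
have H (j : nat) := compact_net kK (ltac:(by rewrite invr_gt0 ltr0n) : (0 : R) < j.+1%:R^-1).
by exists (fun j => projT1 (cid (H j))), (fun j => projT1 (cid (projT2 (cid (H j))))) => j u;
  exact: (projT2 (cid (projT2 (cid (H j))))).
Qed.

Section FixedSize.
Variables (n : nat) (Om : set O).
Context (mOm : measurable Om).
Context (OmK : forall w (i : 'I_n), Om w -> K° (xi i w)).
Context (Omd : forall w (i j : 'I_n), Om w -> xi i w = xi j w -> i = j).

Let fam w := @scaled_polar_family R d K (xi ^~ w) n.
Let hullc w (J : set 'I_n) := family_hull (fam w) J.

Lemma spol_near (x : V) (e : R) : (0 < n)%N -> K° x -> 0 < e -> exists2 dl : R, 0 < dl &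
  forall x', K° x' -> enorm (x - x') <= dl -> hclose (spol K n x) (spol K n x') e.
Proof.
move=> n0 /interior_enormP[r r0 Hr] e0; have n0' : 0 < (n%:R : R) by rewrite ltr0n.
have r4 : 0 < n%:R * (r / 4) by rewrite mulr_gt0// divr_gt0.
(* The first bound leaves both translates a common inner ball; the second is the Lipschitz constant
   of polarity on bodies containing it. *)
pose dl := Num.min (r / 2) (e * n%:R * (r / 4) ^+ 2).
have dl0 : 0 < dl by rewrite lt_min divr_gt0//= !mulr_gt0// exprn_gt0// divr_gt0.
exists dl => // x' Kx' xx'.
have dl1 : enorm (x - x') <= r / 2 by apply: le_trans xx' _; rewrite ge_min lexx.
have dl2 : enorm (x - x') <= e * n%:R * (r / 4) ^+ 2 by apply: le_trans xx' _; rewrite ge_min lexx orbT.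
have ball z : enorm (z - x) <= 3 * r / 4 -> K z by move=> h; apply: Hr; lra.
have trans (z : V) : enorm (z - x) <= r / 2 -> forall y, enorm y <= n%:R * (r / 4) ->
    [set (n%:R : R) *: (k - z) | k in K] y.
  move=> zx y yr; exists (z + n%:R^-1 *: y); last by rewrite addrC addKr scalerA mulfV ?gt_eqF// scale1r.
  apply: ball; have -> : z + n%:R^-1 *: y - x = (z - x) + n%:R^-1 *: y by vring.
  apply: le_trans (enormD _ _) _; rewrite enormZ gtr0_norm ?invr_gt0//.
  have : n%:R^-1 * enorm y <= r / 4 by rewrite ler_pdivrMl.
  lra.
rewrite -!polar_translate//.
have [h1 h2] : hclose (polar [set (n%:R : R) *: (k - x) | k in K]) (polar [set (n%:R : R) *: (k - x') | k in K])
    (n%:R * enorm (x - x') / (n%:R * (r / 4)) ^+ 2).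
  apply: polar_hclose => //.
  - by rewrite mulr_ge0// enorm_ge0.
  - by apply: trans; rewrite subrr enorm0 divr_ge0// ltW.
  - by apply: trans; rewrite enormB.
  - split=> _ [k Kk <-]; [exists (n%:R *: (k - x'))|exists (n%:R *: (k - x))]; try by exists k.
      have -> : n%:R *: (k - x) - n%:R *: (k - x') = - (n%:R *: (x - x')) by vring.
      by rewrite enormN enormZ gtr0_norm.
    have -> : n%:R *: (k - x') - n%:R *: (k - x) = n%:R *: (x - x') by vring.
    by rewrite enormZ gtr0_norm.
have le : n%:R * enorm (x - x') / (n%:R * (r / 4)) ^+ 2 <= e.
  rewrite ler_pdivrMr ?exprn_gt0//.
  have -> : e * (n%:R * (r / 4)) ^+ 2 = n%:R * (e * n%:R * (r / 4) ^+ 2) by ring.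
  by rewrite ler_pM2l.
by split=> y; [move=> /h1[z Hz yz]|move=> /h2[z Hz yz]]; exists z => //; exact: le_trans le.
Qed.

Lemma hull_near w (e : R) : Om w -> 0 < e -> exists2 dl : R, 0 < dl & forall w', Om w' ->
  (forall i : 'I_n, enorm (xi i w - xi i w') <= dl) -> forall J, hclose (hullc w J) (hullc w' J) e.
Proof.
move=> Ow e0.
have [dl dl0 Hdl] : exists2 dl : R, 0 < dl & forall (i : 'I_n) h, setT i -> 0 < h -> h <= dl ->
    forall x', K° x' -> enorm (xi i w - x') <= h -> hclose (spol K n (xi i w)) (spol K n x') e.
  have := @finite_uniform R 'I_n setT (fun i h => forall x', K° x' -> enorm (xi i w - x') <= h ->
    hclose (spol K n (xi i w)) (spol K n x') e) finite_finset.
  apply=> i _; have n0 : (0 < n)%N by exact: leq_ltn_trans (ltn_ord i).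
  have [dl dl0 H] := spol_near n0 (OmK i Ow) e0.
  by exists dl => // h _ hdl x' Kx' xx'; apply: H => //; exact: le_trans hdl.
exists dl => // w' Ow' ww' J.
have close i := Hdl i dl I dl0 (lexx _) (xi i w') (OmK i Ow') (ww' i).
split; apply: chull_parallel => y [i Ji yi].
  by have [/(_ _ yi)[z zi yz] _] := close i; exists z => //; exists i.
by have [_ /(_ _ yi)[z zi yz]] := close i; exists z => //; exists i.
Qed.

Lemma hull_closed w J : Om w -> closed (hullc w J).
Proof.
move=> Ow; have [[i0 Ji0]|J0] := pselect (J !=set0); last first.
  have -> : hullc w J = set0.
    by apply/seteqP; split => // y Hy; apply: (Hy set0); split; [apply/convex_setP|move=> z [i Ji]; case: J0; exists i].
  exact: closed0.
have n0 : (0 < n)%N by exact: leq_ltn_trans (ltn_ord i0).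
have /compact_enormP[] // : compact (hullc w J).
apply: family_hull_compact; [exact: finite_finset|by exists i0|move=> i _].
by have [? ? ?] := spol_in_K0 n0 hK (OmK i Ow); split => //; exact: interior_subset.
Qed.

Variables (q : nat -> nat) (z : forall j : nat, 'I_(q j) -> V).
Context (hz : forall j u, K u -> exists b, enorm (u - z (j := j) b) <= j.+1%:R^-1).

(** Finite measurable information that locates every sample point up to [2 / j.+1%:R]. *)
Definition grid_code j w : {ffun 'I_n * 'I_(q j) -> bool} :=
  [ffun x : 'I_n * 'I_(q j) => enorm (xi x.1 w - z (j := j) x.2) <= j.+1%:R^-1].

(** The recursion only compares hulls of subfamilies, so this table fixes all index sets exactly;
    the grid code alone could not, since equality of hulls is unstable. *)
Definition hull_table w : {set {set 'I_n} * {set 'I_n}} :=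
  finset (fun x : {set 'I_n} * {set 'I_n} => `[< hullc w [set` x.1] = hullc w [set` x.2] >]).

Lemma grid_code_measurable j v : measurable [set w | grid_code j w = v].
Proof.
have -> : [set w | grid_code j w = v] = \bigcap_(x : 'I_n * 'I_(q j))
    [set w | (enorm (xi x.1 w - z (j := j) x.2) <= j.+1%:R^-1) = v x].
  apply/seteqP; split=> w /=; first by move=> <- x _ /=; rewrite ffunE.
  by move=> H; apply/ffunP => x; rewrite ffunE; exact: H.
apply: fin_bigcap_measurable; first exact: finite_finset.
move=> x _; have mc : measurable (xi x.1 @^-1` [set u | enorm (u - z (j := j) x.2) <= j.+1%:R^-1]).
  by apply: xi_preimage; apply: closed_measurable_rV; exact: closed_enormB_le.
case: (v x); first exact: mc.
have -> : [set w | (enorm (xi x.1 w - z (j := j) x.2) <= j.+1%:R^-1) = false] =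
    ~` (xi x.1 @^-1` [set u | enorm (u - z (j := j) x.2) <= j.+1%:R^-1]).
  by apply/seteqP; split=> w /=; [move=> ->|move=> /negP/negbTE].
exact: measurableC.
Qed.

Lemma grid_code_near j w w' (i : 'I_n) : Om w -> grid_code j w' = grid_code j w ->
  enorm (xi i w - xi i w') <= 2 / j.+1%:R.
Proof.
move=> Ow /ffunP E; have [b hb] := hz j (interior_subset (OmK i Ow)).
have := E (i, b); rewrite !ffunE /= hb => hb'.
apply: le_trans (enorm_dist _ (z (j := j) b) _) _; rewrite (enormB (z b)).
by rewrite mulr_natl mulr2n lerD.
Qed.

Lemma grid_small (dl : R) : 0 < dl -> exists N, forall j, (N <= j)%N -> 2 / j.+1%:R <= dl.
Proof.
move=> dl0; have [N HN] := natSinv_small (divr_gt0 dl0 (ltr0Sn R 1)); exists N => j Nj.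
have : j.+1%:R^-1 <= N.+1%:R^-1 :> R by rewrite lef_pV2 ?posrE// ler_nat ltnS.
move: (N.+1%:R^-1) (j.+1%:R^-1) HN => a c; lra.
Qed.

(** Closed hulls are equal when they are close at every scale, and closeness at a given scale can be
    read off representatives of sufficiently fine grid codes. *)
Lemma hull_eq_measurable (J J' : set 'I_n) : measurable (Om `&` [set w | hullc w J = hullc w J']).
Proof.
pose X w := (hullc w J, hullc w J').
have [G HG] : exists G : forall j, {ffun 'I_n * 'I_(q j) -> bool} -> set V * set V, forall j w, Om w ->
    exists w', [/\ Om w', grid_code j w' = grid_code j w & G j (grid_code j w) = X w'].
  exists (fun j => projT1 (cid (representatives Om (grid_code j) X (set0, set0)))) => j.
  exact: projT2 (cid (representatives Om (grid_code j) X (set0, set0))).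
pose U (l : nat) := [set y : set V * set V | hclose y.1 y.2 l.+1%:R^-1].
have -> : Om `&` [set w | hullc w J = hullc w J'] = Om `&` \bigcap_(l : nat) \bigcup_(N : nat)
    \bigcap_(j in [set j | (N <= j)%N]) [set w | U l (if pselect (Om w) then G j (grid_code j w) else (set0, set0))].
  apply/seteqP; split=> w /= [Ow H]; split => //.
    move=> l _; have l0 : (0 : R) < l.+1%:R^-1 / 2 by rewrite divr_gt0// invr_gt0.
    have [dl dl0 Hdl] := hull_near Ow l0.
    have [N HN] := grid_small dl0; exists N => // j /= Nj.
    case: (pselect (Om w)) => // Ow' /=; have [w' [Oww cw' ->]] := HG j w Ow.
    have hh := Hdl w' Oww (fun i => le_trans (grid_code_near i Ow cw') (HN j Nj)).
    have [a1 a2] := hh J; have [b1 b2] := hh J'; rewrite H in a1 a2.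
    rewrite /U /X/= (splitr (l.+1%:R^-1)); split; apply: parallel_setD; [exact: a2|exact: b1|exact: b2|exact: a1].
  have main (A B : set 'I_n) : (forall e : R, 0 < e -> hullc w A `<=` parallel_set (hullc w B) e) -> hullc w A `<=` hullc w B.
    move=> HAB y Ay; have /closed_enormP cB := @hull_closed w B Ow.
    by apply: cB => e e0; have [x Bx yx] := HAB e e0 y Ay; exists x.
  have key (e : R) : 0 < e -> hclose (hullc w J) (hullc w J') e.
    move=> e0; have e3 : 0 < e / 3 by rewrite divr_gt0.
    have [l Hl] := natSinv_small e3; have [N _ HN] := H l I.
    have [dl dl0 Hdl] := hull_near Ow e3; have [N' HN'] := grid_small dl0.
    have := HN (maxn N N') (leq_maxl _ _) => /=; case: (pselect (Om w)) => // Ow' /=.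
    have [w' [Oww cw' ->]] := HG (maxn N N') w Ow.
    rewrite /U /X /= => -[u1 u2].
    have hh := Hdl w' Oww (fun i => le_trans (grid_code_near i Ow cw') (HN' _ (leq_maxr _ _))).
    have [a1 a2] := hh J; have [b1 b2] := hh J'.
    have le : e / 3 + (l.+1%:R^-1 + e / 3) <= e by move: (l.+1%:R^-1) Hl => c; lra.
    split=> y Hy.
      have [x Hx yx] := parallel_setD a1 (parallel_setD u1 b2) Hy.
      by exists x => //; exact: le_trans le.
    have [x Hx yx] := parallel_setD b1 (parallel_setD u2 a2) Hy.
    by exists x => //; exact: le_trans le.
  by apply/seteqP; split; apply: main => e /key[].
apply: measurableI => //; apply: bigcapT_measurable => l; apply: bigcupT_measurable => N.
apply: bigcap_measurable => [|j _]; first by exists N => /=.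
apply: discrete_preimage => // v; apply: measurableI => //; exact: grid_code_measurable.
Qed.

Lemma hull_table_measurable t : measurable (Om `&` [set w | hull_table w = t]).
Proof.
have -> : Om `&` [set w | hull_table w = t] = Om `&` \bigcap_(x : {set 'I_n} * {set 'I_n})
    (if x \in t then Om `&` [set w | hullc w [set` x.1] = hullc w [set` x.2]]
     else Om `\` (Om `&` [set w | hullc w [set` x.1] = hullc w [set` x.2]])).
  apply/seteqP; split=> w /= [Ow H]; split => //.
    move=> x _; rewrite -H inE; case: asboolP => hx; split => // -[_]; exact: hx.
  apply/setP => x; have := H x I; rewrite inE.
  by case: ifP => _ [_ h]; apply/asboolP => //; move=> h'; apply: h.
apply: measurableI => //; apply: fin_bigcap_measurable; first exact: finite_finset.
by move=> x _; case: ifP => _; [exact: hull_eq_measurable|apply: measurableD => //; exact: hull_eq_measurable].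
Qed.

Section SameTable.
Variables (w w' : O).
Context (Ow : Om w) (Ow' : Om w') (ww' : hull_table w = hull_table w').

Lemma table_hull (J J' : set 'I_n) : hullc w J = hullc w J' <-> hullc w' J = hullc w' J'.
Proof.
have toset (A : set 'I_n) : [set` finset (fun i : 'I_n => `[< A i >])] = A.
  by apply/seteqP; split=> i /=; rewrite inE => /asboolP.
pose x := (finset (fun i : 'I_n => `[< J i >]), finset (fun i : 'I_n => `[< J' i >])).
have : (x \in hull_table w) = (x \in hull_table w') by rewrite ww'.
rewrite !inE /x/= !toset => E; split=> h; apply/asboolP; first by rewrite -E; apply/asboolP.
by rewrite E; apply/asboolP.
Qed.

Lemma table_critical J : critical (fam w) J = critical (fam w') J.
Proof.
by apply/seteqP; split=> i [Ji H]; split => // E; apply: H; have [a b] := table_hull J (J `\ i); [exact: b|exact: a].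
Qed.

Lemma table_index r : peel_index (fam w) r = peel_index (fam w') r.
Proof. by rewrite /peel_index; elim: r.-1 => [//|l IH] /=; rewrite IH table_critical. Qed.

(** Each member already has interior, so the dimension test in [peel_stops] depends on emptiness of
    the index set only and is the same for outcomes with the same table. *)
Lemma sample_affdim v J : Om v -> affdim (hullc v J) = if `[< J !=set0 >] then d else affdim (set0 : set V).
Proof.
move=> Ov; case: asboolP => [[i0 Ji0]|J0].
  have n0 : (0 < n)%N by exact: leq_ltn_trans (ltn_ord i0).
  apply: (@affdim_interior _ _ _ 0); have [_ _] := spol_in_K0 n0 hK (OmK i0 Ov).
  by apply: interiorS; exact: (family_sub (M := fam v)).
congr affdim; apply/seteqP; split => // y Hy; apply: (Hy set0); split; first by apply/convex_setP.
by move=> u [i Ji]; case: J0; exists i.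
Qed.

Lemma table_defined r : peel_defined (fam w) r -> peel_defined (fam w') r.
Proof.
move=> /[dup] dw [_ r0 dr].
have stops s : peel_stops (fam w') s -> peel_stops (fam w) s.
  by rewrite /peel_stops -/(hullc w _) -/(hullc w' _) -/(hullc w setT) -/(hullc w' setT) !sample_affdim// table_index table_critical.
have [i0 _] : peel_index (fam w) r !=set0 by exact: peel_index_nonempty.
have n0 : (0 < n)%N by exact: leq_ltn_trans (ltn_ord i0).
split; [|exact: r0|].
  by apply: (prelimit_admissible hd hK n0); [move=> i; exact: OmK|move=> i j; exact: Omd].
apply: (lt_le_trans dr); apply: ereal_inf_le_tmp => _ [s [s0 ss] <-]; exists s => //; split => //.
exact: stops.
Qed.

End SameTable.

(** With equal tables the peelings are hulls over the same indices, and with equal grid codes these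
    hulls are close; the default value occurs on both sides at once. *)
Lemma sample_random_element g (hg : hcont g) B0 (k : nat) : {ae P, forall w, Om w} ->
  random_element P (fun w => (fun r : 'I_k => peelval g B0 (fam w) r.+1) : {ptws 'I_k -> body0 R d}).
Proof.
move=> aeOm.
apply: (@random_element_approx _ _ _ _ P k Om _ B0
  (fun j => ({set {set 'I_n} * {set 'I_n}} * {ffun 'I_n * 'I_(q j) -> bool})%type)
  (fun j w => (hull_table w, grid_code j w))) => //.
  move=> j [t v].
  have -> : Om `&` [set w | (hull_table w, grid_code j w) = (t, v)] =
      (Om `&` [set w | hull_table w = t]) `&` [set w | grid_code j w = v].
    by apply/seteqP; split=> w /=; [move=> [Ow [-> ->]]|move=> [[Ow ->] ->]].
  apply: measurableI; [exact: hull_table_measurable|exact: grid_code_measurable].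
move=> w e Ow e0.
have inK0 v r : Om v -> peel_defined (fam v) r -> in_K0 (peel (fam v) r).
  by move=> Ov; apply: prelimit_in_K0 => // i; exact: OmK.
have [h0 h00 Hh] : exists2 h0 : R, 0 < h0 & forall (r : 'I_k) h, setT r -> 0 < h -> h <= h0 ->
    forall (A : in_K0 (peel (fam w) r.+1)) B, hausdorff_dist (Body0 A) B <= h -> hausdorff_dist (g (Body0 A)) (g B) < e.
  have := @finite_uniform R 'I_k setT (fun r h => forall (A : in_K0 (peel (fam w) r.+1)) B,
    hausdorff_dist (Body0 A) B <= h -> hausdorff_dist (g (Body0 A)) (g B) < e) finite_finset.
  apply=> r _; have [A|nA] := pselect (in_K0 (peel (fam w) r.+1)); last by exists 1 => // h _ _ A; case: (nA A).
  have [h h0 Hh] := hg (Body0 A) e e0; exists (h / 2); first by rewrite divr_gt0.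
  move=> h' h'0 h'h A' B AB; rewrite (Prop_irrelevance A' A) in AB *; apply: Hh.
  by apply: le_lt_trans AB _; apply: le_lt_trans h'h _; lra.
have [dl dl0 Hdl] := hull_near Ow h00; have [N HN] := grid_small dl0.
exists N => j Nj w' Ow' [tt cc] r.
have hh := Hdl w' Ow' (fun i => le_trans (grid_code_near i Ow cc) (HN j Nj)).
have [dw|nd] := pselect (peel_defined (fam w) r.+1); last first.
  have nd' : ~ peel_defined (fam w') r.+1 by move=> /(table_defined Ow' Ow tt).
  have pv v : ~ peel_defined (fam v) r.+1 -> peelval g B0 (fam v) r.+1 = B0.
    by move=> nv; rewrite /peelval; case: pselect => [h|_]; [case: (nv h.1)|reflexivity].
  by rewrite (pv w nd) (pv w' nd') hausdorff_distxx.
have dw' := table_defined Ow Ow' (esym tt) dw.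
rewrite (peelvalE g B0 (inK0 w _ Ow dw))// (peelvalE g B0 (inK0 w' _ Ow' dw'))//.
rewrite hausdorff_dist_sym; apply: (Hh r h0) => //; apply: hausdorff_le; first exact: ltW.
rewrite /= /peel -/(hullc w _) -/(hullc w' _) (table_index tt r.+1).
rewrite -((closure_id _).1 (@hull_closed w _ Ow)) -((closure_id _).1 (@hull_closed w' _ Ow')).
exact: hh.
Qed.

End FixedSize.
End Sample.

(** * Convergence in distribution *)

Section Matchings.
Context {R : realType} {d : nat} (hd : (0 < d)%N).
Local Notation V := 'rV[R]_d.
Local Notation ST := (measurableTypeR R * borel_rV R d)%type.
Context {dO : measure_display} {O : measurableType dO}.
Context {dO' : measure_display} {O' : measurableType dO'}.
Variables (K : set V) (hK : in_K0 K) (S : {finite_measure set (borel_rV R d) -> \bar R}).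
Variable (xi : nat -> O -> borel_rV R d).
Variable (p : nat -> O' -> ST).
Context (p_dom : forall i w, 0 < (p i w).1 /\ enorm (p i w).2 = 1).
Variables (T eps h : R) (m : @mesh_data R d).
Context (hm : is_mesh K S T eps m) (T0 : 0 < T) (h1 : eps <= h) (h2 : 2 / T <= h).
Variable (C : {set 'I_(mN m) * 'I_(mq m)}).

Lemma hclose_le (A B : set V) (e f : R) : e <= f -> hclose A B e -> hclose A B f.
Proof.
by move=> ef [h3 h4]; split=> y; [move=> /h3[z Bz yz]|move=> /h4[z Bz yz]]; exists z => //; exact: le_trans ef.
Qed.

Lemma seg_hclose (y z : V) (e : R) : enorm (y - z) <= e -> hclose (seg y) (seg z) e.
Proof.
move=> yz; split=> _ /segP[s /andP[s0 s1] ->].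
  exists (s *: z); first by apply/segP; exists s; rewrite ?s0.
  by rewrite -scalerBr enormZ ger0_norm//; apply: le_trans yz; rewrite ler_piMl// enorm_ge0.
exists (s *: y); first by apply/segP; exists s; rewrite ?s0.
rewrite -scalerBr enormZ ger0_norm//; apply: le_trans yz.
by rewrite enormB ler_piMl// enorm_ge0.
Qed.

Lemma late_tip k w : (forall e, e \in C -> ~ mcell e (p k w)) -> limit_event p m C w -> enorm (tip (p k w)) <= h.
Proof.
move=> nk wC; have [t0 u1] := p_dom k w.
have late : mtime m (mN m) <= (p k w).1.
  by rewrite leNgt; apply/negP => /(limit_event_early p_dom hm wC)[e /nk].
rewrite (tip_enorm p_dom); apply: le_trans h2; have /andP[TN _] := im_T hm.
have Tt := le_trans TN late.
apply: (@le_trans _ _ T^-1); first by rewrite lef_pV2 ?posrE.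
by rewrite ler_pMl ?invr_gt0// ler1n.
Qed.

(** Sample point and Poisson point are matched when they belong to the same occupied cell. Unmatched
    sample points are small by [im_rest], unmatched Poisson points are late. *)
Lemma sample_matching n w w' : (mn0 m <= n)%N -> (forall i : 'I_n, K° (xi i w)) ->
  sample_event K xi n C w -> limit_event p m C w' ->
  matching (@scaled_polar_family R d K (xi ^~ w) n) (fun i => tip (p i w'))
    (fun i k => exists2 e, e \in C & mA n e (xi i w) /\ mcell e (p k w')) h.
Proof.
move=> hn Kxi wC w'C; have [s1 s2 s3] := sample_eventP hm hn wC.
have n0 : (0 < n)%N by exact: leq_trans (im_n0 hm) hn.
split.
- move=> i; have [k1 k2 k3] := spol_in_K0 n0 hK (Kxi i); split => //; exact: interior_subset k3.
- move=> i k k' [e eC [a1 a2]] [e' eC' [b1 b2]].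
  have E := im_Adisj hm hn a1 b1; rewrite -E in b2.
  by have [_ uq] := limit_event_cell w'C eC; exact: uq.
- move=> i i' k [e eC [a1 a2]] [e' eC' [b1 b2]].
  have E := mcell_inj hm a2 b2; rewrite -E in b1.
  exact: s2 a1 b1.
- by move=> i k [e eC [a1 a2]]; apply: (hclose_le h1); exact: (im_close hm hn a1 a2).
- move=> i y ni yi; have [ri|[e eC ei]] := s3 i; last first.
    by have [[k ek] _] := limit_event_cell w'C eC; exfalso; apply: (ni k); exists e.
  have [Ki nAX] := ri; apply: le_trans h2; apply: (im_rest hm hn Ki _ _ yi).
    by move=> e ei; apply: nAX; left; apply/bigsetUP; exists e.
  by move=> Xi; apply: nAX; right.
- move=> k nk; apply: (late_tip _ w'C) => e eC ek.
  by have [i ei] := s1 e eC; apply: (nk i); exists e.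
Qed.

(** Two limiting configurations with the same pattern are compared in order to see that patterns
    determine the limit approximately, hence its measurability. *)
Lemma limit_matching w w' : limit_event p m C w -> limit_event p m C w' ->
  matching (seg \o (fun i => tip (p i w))) (fun i => tip (p i w'))
    (fun i k => exists2 e, e \in C & mcell e (p i w) /\ mcell e (p k w')) h.
Proof.
move=> wC w'C; split.
- by move=> i; split; [exact: seg_compact|exact: seg_convex|exact: seg0].
- move=> i k k' [e eC [a1 a2]] [e' eC' [b1 b2]].
  have E := mcell_inj hm a1 b1; rewrite -E in b2.
  by have [_ uq] := limit_event_cell w'C eC; exact: uq.
- move=> i i' k [e eC [a1 a2]] [e' eC' [b1 b2]].
  have E := mcell_inj hm a2 b2; rewrite -E in b1.
  by have [_ uq] := limit_event_cell wC eC; exact: uq.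
- move=> i k [e eC [a1 a2]]; apply: (hclose_le h1); apply: seg_hclose.
  exact: im_tip hm _ _ _ a1 a2.
- move=> i y ni /seg_enorm yi; apply: (le_trans yi); apply: (late_tip _ wC) => e eC ei.
  by have [[k ek] _] := limit_event_cell w'C eC; apply: (ni k); exists e.
- move=> k nk; apply: (late_tip _ w'C) => e eC ek.
  by have [[i ei] _] := limit_event_cell wC eC; apply: (nk i); exists e.
Qed.

End Matchings.

Section LimitElement.
Context {R : realType} {d : nat} (hd : (0 < d)%N).
Local Notation V := 'rV[R]_d.
Local Notation ST := (measurableTypeR R * borel_rV R d)%type.
Context {dO : measure_display} {O : measurableType dO} (Q : probability O R).
Variables (K : set V) (S : {finite_measure set (borel_rV R d) -> \bar R}).
Variable (p : nat -> O -> ST).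
Context (p_dom : forall i w, 0 < (p i w).1 /\ enorm (p i w).2 = 1).
Context (p_poisson : poisson_process Q (hyperplane_intensity K S) p).
Variable (M : nat -> @mesh_data R d).
Context (hM : forall j, is_mesh K S (j.+1%:R) ((2 ^+ j.+1)^-1) (M j)).

Definition resolved w := exists J, forall j, (J <= j)%N -> exists C, limit_event p (M j) C w.

Lemma fine_mesh (e : R) : 0 < e -> exists N, forall j, (N <= j)%N ->
  (2 ^+ j.+1)^-1 <= e /\ 2 / j.+1%:R <= e.
Proof.
move=> e0; have [N HN] := natSinv_small (divr_gt0 e0 (ltr0Sn R 1)); exists N => j Nj.
have le1 : j.+1%:R^-1 <= e / 2 :> R.
  by apply: ltW; apply: le_lt_trans HN; rewrite lef_pV2 ?posrE// ler_nat ltnS.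
split; last by move: le1; rewrite ler_pdivlMr// mulrC.
have e2 : e / 2 <= e by rewrite ler_pdivrMr// ler_peMr ?(ltW e0)// ler1n.
apply: (@le_trans _ _ (j.+1%:R^-1)); last exact: le_trans e2.
rewrite lef_pV2 ?posrE ?exprn_gt0// -natrX ler_nat; exact: ltnW (ltn_expl _ _).
Qed.

Definition event_code j w : option {set 'I_(mN (M j)) * 'I_(mq (M j))} :=
  match pselect (exists C, limit_event p (M j) C w) with
  | left H => Some (projT1 (cid H)) | right _ => None end.

Lemma event_codeP j w C : event_code j w = Some C <-> limit_event p (M j) C w.
Proof.
rewrite /event_code; case: pselect => [H|nH]; last by split=> // wC; case: nH; exists C.
have hC := projT2 (cid H); split=> [[<-]//|wC].
by congr Some; exact: limit_event_disj hC wC.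
Qed.

Lemma event_code_measurable j v : measurable [set w | event_code j w = v].
Proof.
case: v => [C|].
  have -> : [set w | event_code j w = Some C] = limit_event p (M j) C.
    by apply/seteqP; split=> w /event_codeP.
  exact: (limit_event_measurable p_poisson (hM j)).
have -> : [set w | event_code j w = None] = ~` (\bigcup_C limit_event p (M j) C).
  apply/seteqP; split=> w /=; first by move=> wN [C _ /event_codeP]; rewrite wN.
  by move=> nw; case E : (event_code j w) => [C|//]; exfalso; apply: nw; exists C => //; exact/event_codeP.
apply: measurableC; apply: measurable_bigcup_fin => C.
exact: (limit_event_measurable p_poisson (hM j)).
Qed.

Lemma limit_random_element g (hg : hcont g) B0 (k : nat) (Om : set O) : measurable Om ->
  {ae Q, forall w, Om w} ->
  (forall w, Om w -> good (fun i => tip (p i w)) /\ resolved w) ->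
  random_element Q (fun w => (fun r : 'I_k => peelval g B0 (segment_family (p ^~ w)) r.+1) : {ptws 'I_k -> body0 R d}).
Proof.
move=> mOm aeOm HOm.
apply: (@random_element_approx _ _ _ _ Q k Om _ B0 _ event_code) => //.
  by move=> j v; apply: measurableI => //; exact: event_code_measurable.
move=> w e Ow e0; have [gw [J HJ]] := HOm w Ow.
have [e1 e10 H1] := peelval_stable hd hg B0 k gw e0.
have [N HN] := fine_mesh e10.
exists (maxn N J) => j; rewrite geq_max => /andP[Nj Jj] w' Ow' cc r.
have [C wC] := HJ j Jj; have w'C : limit_event p (M j) C w' by apply/event_codeP; rewrite cc; exact/event_codeP.
have [m1 m2] := HN j Nj; have [gw' _] := HOm w' Ow'.
have mt := limit_matching p_dom (hM j) (ltr0Sn R j) m1 m2 w'C wC.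
exact: (H1 e1 e10 (lexx _) _ _ _ mt (good_admissible hd gw') r).
Qed.

End LimitElement.

(** * Means of bounded functions and measurable modifications *)

Section Integrals.
Context {R : realType} {dO : measure_display} {O : measurableType dO} (P : probability O R).

Lemma bounded_integrable (f : O -> R) (M : R) : measurable_fun setT f -> (forall w, `|f w| <= M) ->
  P.-integrable setT (EFin \o f).
Proof.
move=> mf fM; apply: measurable_bounded_integrable => //.
  by have h : (P setT < +oo)%E by [rewrite probability_setT ltry]; exact: h.
exists M; split; first exact: num_real.
by move=> M' MM' w _ /=; apply: le_trans (fM w) (ltW MM').
Qed.

Definition mean (f : O -> R) : R := fine (\int[P]_w (f w)%:E)%E.

Lemma meanE (f : O -> R) (M : R) : measurable_fun setT f -> (forall w, `|f w| <= M) ->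
  (\int[P]_w (f w)%:E)%E = (mean f)%:E.
Proof.
by move=> mf fM; rewrite /mean fineK//; apply: integrable_fin_num => //; exact: bounded_integrable mf fM.
Qed.

Lemma mean_le (f g : O -> R) (M : R) : measurable_fun setT f -> (forall w, `|f w| <= M) ->
  measurable_fun setT g -> (forall w, `|g w| <= M) -> (forall w, f w <= g w) -> mean f <= mean g.
Proof.
move=> mf fM mg gM fg; rewrite -lee_fin -(meanE mf fM) -(meanE mg gM).
by apply: le_integral => //; [exact: bounded_integrable mf fM|exact: bounded_integrable mg gM|move=> w _; rewrite lee_fin].
Qed.

Lemma mean_shift (f : O -> R) (M a b : R) : measurable_fun setT f -> (forall w, `|f w| <= M) ->
  mean (fun w => a * f w + b) = a * mean f + b.
Proof.
move=> mf fM; have fi := bounded_integrable mf fM.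
rewrite /mean; under eq_integral do rewrite EFinD EFinM.
rewrite integralD//=; last 2 first.
- exact: integrableZl.
- by apply: finite_measure_integrable_cst.
rewrite integralZl// integral_cst// [X in (_ + _ * X)%E]probability_setT mule1.
by rewrite (meanE mf fM) -EFinM -EFinD.
Qed.

Lemma simple_mean (C : finType) (E : C -> set O) (a : C -> R) : (forall c, measurable (E c)) ->
  (forall c, 0 <= a c) ->
  measurable_fun setT (fun w => \sum_c a c * \1_(E c) w) /\
  mean (fun w => \sum_c a c * \1_(E c) w) = \sum_c a c * fine (P (E c)).
Proof.
move=> mE a0.
have mi c : measurable_fun setT (fun w => a c * \1_(E c) w : R).
  by apply: measurable_funM => //; exact: measurable_indic.
split; first by apply: measurable_sum => c.
rewrite /mean; under eq_integral do rewrite -sumEFin.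
rewrite ge0_integral_sum//; last 2 first.
- by move=> c; apply/measurable_EFinP.
- by move=> c w _; rewrite lee_fin mulr_ge0.
rewrite (eq_bigr (fun c => (a c * fine (P (E c)))%:E)); first by rewrite sumEFin.
move=> c _; under eq_integral do rewrite EFinM.
rewrite ge0_integralZl//; [|by apply/measurable_EFinP; exact: measurable_indic|by rewrite lee_fin].
by rewrite integral_indic// setIT EFinM fineK// fin_num_measure.
Qed.

Lemma bounded_modification (T : topologicalType) (X : O -> T) (f : T -> R) (C : R) :
  random_element P X -> continuous f -> (forall x, `|f x| <= C) ->
  exists F : O -> R, [/\ measurable_fun setT F, forall w, `|F w| <= C &
    {ae P, forall w, F w = f (X w)}].
Proof.
move=> [Y mY YE] cf fC; exists (f \o Y); split; [|by move=> w; exact: fC|by apply: filterS YE => w ->].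
apply: (measurability _ (RGenOpens.measurableE R)) => _ [_ [a [b ->] <-]].
rewrite setTI comp_preimage; apply: mY; apply: open_comp; last exact: interval_open.
by move=> x _; exact: cf.
Qed.

End Integrals.

Section Convergence.
Context {R : realType} {d : nat} (hd : (0 < d)%N).
Local Notation V := 'rV[R]_d.
Local Notation ST := (measurableTypeR R * borel_rV R d)%type.
Context {dO : measure_display} {O : measurableType dO} (P : probability O R).
Context {dO' : measure_display} {O' : measurableType dO'} (Q : probability O' R).
Variables (K : set V) (hK : in_K0 K) (S : {finite_measure set (borel_rV R d) -> \bar R}).
Variable (xi : nat -> O -> borel_rV R d).
Context (xi_meas : forall i, measurable_fun setT (xi i)).
Context (xi_unif : forall i, uniform_on P K (xi i)).
Context (xi_indep : independent_seq P xi).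
Variable (p : nat -> O' -> ST).
Context (p_dom : forall i w, 0 < (p i w).1 /\ enorm (p i w).2 = 1).
Context (p_poisson : poisson_process Q (hyperplane_intensity K S) p).
Variable (M : nat -> @mesh_data R d).
Context (hM : forall j, is_mesh K S (j.+1%:R) ((2 ^+ j.+1)^-1) (M j)).
Variables (Om : nat -> set O) (Oq : set O').
Context (OmK : forall n w (i : 'I_n), Om n w -> K° (xi i w)).
Context (Omd : forall n w (i j : 'I_n), Om n w -> xi i w = xi j w -> i = j).
Context (hOm : forall n, {ae P, forall w, Om n w}).
Context (mOq : measurable Oq) (hOq : {ae Q, forall w, Oq w}).
Context (Oqg : forall w, Oq w -> good (fun i => tip (p i w)) /\ resolved p M w).
Variables (g : body0 R d -> body0 R d) (hg : hcont g) (B0 : body0 R d) (k : nat).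

Local Notation Z := ({ptws 'I_k -> body0 R d}).
Let X n w : Z := (fun r : 'I_k => peelval g B0 (@scaled_polar_family R d K (xi ^~ w) n) r.+1).
Let Y w : Z := (fun r : 'I_k => peelval g B0 (segment_family (p ^~ w)) r.+1).

Section LowerBound.
Variables (f : Z -> R) (cf : continuous f) (B : R) (f0B : forall z, 0 <= f z <= B).
Variables (FX : nat -> O -> R) (FY : O' -> R).
Context (mFX : forall n, measurable_fun setT (FX n)) (mFY : measurable_fun setT FY).
Context (FXB : forall n w, 0 <= FX n w <= B) (FYB : forall w, 0 <= FY w <= B).
Context (FXE : forall n, {ae P, forall w, FX n w = f (X n w)}) (FYE : {ae Q, forall w, FY w = f (Y w)}).

(* [B] is included so that the infimum is not taken over the empty set, whose [inf] is 0. *)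
Let values j (C : {set 'I_(mN (M j)) * 'I_(mq (M j))}) : set R :=
  [set r | r = B \/ exists n w, [/\ (mn0 (M j) <= n)%N, Om n w, sample_event K xi n C w & r = f (X n w)]].
Let low j C := inf (@values j C).

Lemma low_itv j C : 0 <= @low j C <= B.
Proof.
have lb : lbound (values C) 0.
  by move=> r [->|[n [w [_ _ _ ->]]]]; [have /andP[h1 h2] := f0B (fun=> B0); exact: le_trans h2|have /andP[] := f0B (X n w)].
apply/andP; split; first by apply: lb_le_inf => //; exists B; left.
by apply: ge_inf; [exists 0|left].
Qed.

Lemma low_le j C n w : (mn0 (M j) <= n)%N -> Om n w -> sample_event K xi n C w -> @low j C <= f (X n w).
Proof.
move=> hn Ow wC; apply: ge_inf; last by right; exists n, w.
exists 0 => r [->|[n' [w' [_ _ _ ->]]]]; last by have /andP[] := f0B (X n' w').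
by have /andP[h1 h2] := f0B (X n w); exact: le_trans h2.
Qed.

(** All samples with the pattern of [w], whatever their size, are matched to [w] within the mesh
    error; once this is below the stability threshold of [w], their values of [f] are within [e] of
    the limit. *)
Lemma low_ge w (e : R) : Oq w -> 0 < e -> exists N, forall j, (N <= j)%N -> forall C,
  limit_event p (M j) C w -> f (Y w) - e <= @low j C.
Proof.
move=> Ow e0; have [gw _] := Oqg Ow.
have [h h0 Hh] := ptws_continuous_near (Y w) cf e0.
have [e1 e10 H1] := peelval_stable hd hg B0 k gw h0.
have [N HN] := fine_mesh e10; exists N => j Nj C wC; have [m1 m2] := HN j Nj.
apply: lb_le_inf; first by exists B; left.
move=> r [->|[n [w' [hn Ow' w'C ->]]]].
  by have /andP[_ h2] := f0B (Y w); lra.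
have n0 : (0 < n)%N by exact: leq_trans (im_n0 (hM j)) hn.
have mt := sample_matching hK p_dom (hM j) (ltr0Sn R j) m1 m2 hn (fun i => OmK i Ow') w'C wC.
have ad := @prelimit_admissible R d K n (xi ^~ w') hd hK n0 (fun i => OmK i Ow') (fun i i' => @Omd n w' i i' Ow').
have := Hh (X n w') _; rewrite ltr_norml => H.
have /andP[_] : - e < f (Y w) - f (X n w') < e.
  by apply: H => r'; rewrite hausdorff_dist_sym; exact: (H1 e1 e10 (lexx _) _ _ _ mt ad r').
lra.
Qed.

Let phi j w : R := \sum_(C : {set 'I_(mN (M j)) * 'I_(mq (M j))}) low C * \1_(limit_event p (M j) C) w.

Lemma phiE j w C : limit_event p (M j) C w -> phi j w = low C.
Proof.
move=> wC; rewrite /phi (bigD1 C)//= indicE mem_set// mulr1 big1 ?addr0// => C' CC'.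
rewrite indicE memNset ?mulr0// => wC'; move/eqP: CC'; apply; exact: limit_event_disj wC' wC.
Qed.

Lemma phi_itv j w : 0 <= phi j w <= B.
Proof.
have [[C wC]|nC] := pselect (exists C, limit_event p (M j) C w).
  by rewrite (phiE wC) low_itv.
rewrite /phi big1; last by move=> C _; rewrite indicE memNset ?mulr0// => wC; apply: nC; exists C.
by have /andP[h1 h2] := f0B (Y w); rewrite lexx (le_trans h1).
Qed.

Lemma phi_mean j : measurable_fun setT (phi j) /\
  mean Q (phi j) = \sum_C @low j C * fine (Q (limit_event p (M j) C)).
Proof.
apply: simple_mean; first by move=> C; exact: (limit_event_measurable p_poisson (hM j)).
by move=> C; have /andP[] := low_itv C.
Qed.

Lemma norm_itv (x : R) : 0 <= x <= B -> `|x| <= B.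
Proof. by move=> /andP[h1 h2]; rewrite ger0_norm. Qed.

Lemma phi_limit (e : R) : 0 < e -> exists N, forall j, (N <= j)%N -> mean Q FY - e <= mean Q (phi j).
Proof.
(* [low_ge] bounds [phi] only from below. Truncation at [FY] gives genuine convergence, hence
   dominated convergence, and can only decrease the mean. *)
move=> e0; pose psi j w := Num.min (phi j w) (FY w).
have mphi j := (phi_mean j).1.
have mpsi j : measurable_fun setT (psi j) by exact: measurable_minr.
have psi_itv j w : 0 <= psi j w <= B.
  have /andP[a b] := phi_itv j w; have /andP[c' d'] := FYB w.
  by rewrite /psi le_min a c'/= ge_min b.
have [_ _ cv] : [/\ Q.-integrable setT (EFin \o FY),
   [sequence (\int[Q]_w (`|(EFin \o psi n) w - (EFin \o FY) w|))%E]_n @ \oo --> 0%E &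
   [sequence (\int[Q]_w (EFin \o psi n) w)%E]_n @ \oo --> (\int[Q]_w (EFin \o FY) w)%E].
  apply: (@dominated_convergence _ _ _ Q setT measurableT (fun n => EFin \o psi n) (EFin \o FY) (cst B%:E)).
  - by move=> n; apply/measurable_EFinP.
  - exact/measurable_EFinP.
  - apply: filterS2 hOq FYE => w Ow E _.
    apply: cvg_EFin; first by apply: nearW.
    apply/cvgrPdist_le => dl dl0; have [N HN] := low_ge Ow dl0.
    have [_ [J HJ]] := Oqg Ow; exists (maxn N J) => // j /=; rewrite geq_max => /andP[Nj Jj].
    have [C wC] := HJ j Jj; have := HN j Nj C wC; rewrite -(phiE wC) -E => h.
    rewrite /psi ger0_norm; last by rewrite subr_ge0 ge_min lexx orbT.
    by rewrite lerBlDr -lerBlDl le_min; apply/andP; split; lra.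
  - by apply: finite_measure_integrable_cst.
  - by apply: nearW => w n _; rewrite /= lee_fin; apply: norm_itv; exact: psi_itv.
have psiE j : (\int[Q]_w (EFin \o psi j) w)%E = (mean Q (psi j))%:E.
  by apply: (@meanE _ _ _ Q _ B) => // w; apply: norm_itv.
have FYm : (\int[Q]_w (EFin \o FY) w)%E = (mean Q FY)%:E.
  by apply: (@meanE _ _ _ Q _ B) => // w; apply: norm_itv.
move: cv; rewrite FYm => /fine_cvgP[_ /cvgrPdist_le/(_ e e0)[N _ HN]].
exists N => j Nj; have := HN j Nj; rewrite /= psiE/= ler_norml => /andP[_ h].
have : mean Q (psi j) <= mean Q (phi j).
  apply: (@mean_le _ _ _ Q _ _ B) => // w; try exact: norm_itv (psi_itv j w); try exact: norm_itv (phi_itv j w).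
  by rewrite /psi ge_min lexx.
lra.
Qed.

Lemma sample_lower j (e : R) : 0 < e -> exists N, forall n, (N <= n)%N ->
  \sum_C @low j C * sample_weight ((2 ^+ j.+1)^-1) C - e <= mean P (FX n).
Proof.
move=> e0; set nC := #|{set 'I_(mN (M j)) * 'I_(mq (M j))}|.
have /andP[B00 B01] := f0B (fun=> B0); have B0' : 0 <= B by exact: le_trans B01.
(* The error per pattern, multiplied by at most [B] and by the number of patterns, must stay below
   [e]. *)
pose dl := e / (B * nC%:R + 1).
have D0 : 0 < B * nC%:R + 1 by rewrite ltr_wpDl// mulr_ge0.
have dl0 : 0 < dl by exact: divr_gt0.
have /choice[N HN] := fun C => sample_event_limit hd hK xi_meas xi_unif xi_indep (hM j) C dl0.
exists (mn0 (M j) + \sum_C N C)%N => n Nn.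
have hn : (mn0 (M j) <= n)%N by apply: leq_trans Nn; exact: leq_addr.
have NC C : (N C <= n)%N.
  by apply: leq_trans Nn; rewrite (bigD1 C)//= addnCA leq_addr.
have mE C := sample_event_measurable xi_meas (hM j) hn C.
have l0 C : 0 <= @low j C by have /andP[] := low_itv C.
have [ms sE] := simple_mean P mE l0.
have dj (C C' : {set 'I_(mN (M j)) * 'I_(mq (M j))}) w : sample_event K xi n C w -> sample_event K xi n C' w -> C = C'.
  by move=> h1 h2; exact: (sample_event_disj (hM j) hn h1 h2).
pose s w : R := \sum_C @low j C * \1_(sample_event K xi n C) w.
have sC w (C : {set 'I_(mN (M j)) * 'I_(mq (M j))}) : sample_event K xi n C w -> s w = low C.
  move=> wC; rewrite /s (bigD1 C)//= indicE mem_set// mulr1 big1 ?addr0// => C' CC'.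
  rewrite indicE memNset ?mulr0// => wC'; move/eqP: CC'; apply; exact: dj wC' wC.
have s_itv w : 0 <= s w <= B.
  have [[C wC]|nwC] := pselect (exists C : {set 'I_(mN (M j)) * 'I_(mq (M j))}, sample_event K xi n C w); first by rewrite (sC w C wC) low_itv.
  rewrite /s big1 ?lexx ?B0'// => C _; rewrite indicE memNset ?mulr0// => wC; apply: nwC; by exists C.
have le1 : mean P s <= mean P (FX n).
  rewrite -lee_fin -(@meanE _ _ _ P _ B ms (fun w => norm_itv (s_itv w))) -(@meanE _ _ _ P _ B (mFX n) (fun w => norm_itv (FXB n w))).
  apply: ae_ge0_le_integral => //.
  - by move=> w _; rewrite lee_fin; have /andP[] := s_itv w.
  - exact/measurable_EFinP.
  - by move=> w _; rewrite lee_fin; have /andP[] := FXB n w.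
  - exact/measurable_EFinP.
  - apply: filterS2 (hOm n) (FXE n) => w Ow E _; rewrite lee_fin E; change (s w <= f (X n w)).
    have [[C wC]|nwC] := pselect (exists C : {set 'I_(mN (M j)) * 'I_(mq (M j))}, sample_event K xi n C w); first by rewrite (sC w C wC); exact: low_le.
    rewrite /s big1; first by have /andP[] := f0B (X n w).
    by move=> C _; rewrite indicE memNset ?mulr0// => wC; apply: nwC; exists C.
apply: le_trans le1; rewrite /s sE.
have term C : @low j C * sample_weight ((2 ^+ j.+1)^-1) C - B * dl <= low C * fine (P (sample_event K xi n C)).
  have := HN C n (NC C) hn.
  have fP : P (sample_event K xi n C) \is a fin_num by exact: fin_num_measure.
  rewrite -(fineK fP) lee_fin /= => h; have /andP[a b] := low_itv C.
  have h1 : low C * (sample_weight ((2 ^+ j.+1)^-1) C - dl) <= low C * fine (P (sample_event K xi n C)) by exact: ler_wpM2l.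
  have h2 : low C * dl <= B * dl by rewrite ler_wpM2r// ltW.
  lra.
have := ler_sum (index_enum {set 'I_(mN (M j)) * 'I_(mq (M j))}) (fun C (_ : true) => term C).
rewrite sumrB sumr_const -/nC -[B * dl *+ _]mulr_natl => h.
apply: le_trans h; rewrite lerD2l lerN2.
have -> : nC%:R * (B * dl) = e * (B * nC%:R) / (B * nC%:R + 1) by rewrite /dl; ring.
by rewrite ler_pdivrMr// ler_wpM2l ?(ltW e0)// lerDl.
Qed.

(** The mesh is fixed before the sample size: [j] is taken so large that [phi] and the weight
    deficit are within a third of [e] each, and only then [n] grows. *)
Lemma mean_lower (e : R) : 0 < e -> exists N, forall n, (N <= n)%N -> mean Q FY - e <= mean P (FX n).
Proof.
move=> e0; have e3 : 0 < e / 3 by rewrite divr_gt0.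
have /andP[B00 B01] := f0B (fun=> B0); have B0' : 0 <= B by exact: le_trans B01.
have [N1 HN1] := phi_limit e3.
have [N2 HN2] := fine_mesh (divr_gt0 e3 (ltr_wpDl (mulr_ge0 (ler0n R 2) B0') ltr01)).
pose j := maxn N1 N2; have h1 := HN1 j (leq_maxl _ _); have [h2 _] := HN2 j (leq_maxr _ _).
have [N HN] := sample_lower j e3.
exists N => n Nn; apply: le_trans (HN n Nn).
have [dC [d1 d2 d3]] := limit_event_weights p_poisson (half_pow_le1 _) (hM j).
have key : mean Q (phi j) <= \sum_C @low j C * sample_weight ((2 ^+ j.+1)^-1) C + B * (2 * (2 ^+ j.+1)^-1).
  rewrite (phi_mean j).2; apply: (@le_trans _ _ (\sum_C (@low j C * sample_weight ((2 ^+ j.+1)^-1) C + B * dC C))).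
    apply: ler_sum => C _; have /andP[a b] := low_itv C.
    apply: (@le_trans _ _ (low C * (sample_weight ((2 ^+ j.+1)^-1) C + dC C))); first exact: ler_wpM2l.
    by rewrite mulrDr lerD2l ler_wpM2r.
  by rewrite big_split/= lerD2l -mulr_sumr ler_wpM2l.
have small : B * (2 * (2 ^+ j.+1)^-1) <= e / 3.
  move: h2; rewrite ler_pdivlMr; last by rewrite ltr_wpDl// mulr_ge0.
  have : 0 <= (2 ^+ j.+1)^-1 :> R by rewrite invr_ge0 exprn_ge0.
  move: ((2 ^+ j.+1)^-1) => c c0; lra.
lra.
Qed.

End LowerBound.

Hypothesis mOm : forall n, measurable (Om n).

Lemma peelings_cvg : cvg_in_distribution P Q X Y.
Proof.
have [qn [z hz]] := body_nets hK.
have rX n : random_element P (X n).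
  exact: (sample_random_element hd hK xi_meas (mOm n) (fun w i => @OmK n w i) (fun w i j => @Omd n w i j) hz hg B0 k (hOm n)).
have rY : random_element Q Y := limit_random_element hd p_dom p_poisson hM hg B0 k mOq hOq Oqg.
split=> // f cf [C fC].
have /choice[FX HX] := fun n => bounded_modification (rX n) cf fC.
have [FY [mFY FYC FYE]] := bounded_modification rY cf fC.
have mFX n : measurable_fun setT (FX n) by have [] := HX n.
have FXC n w : `|FX n w| <= C by have [_ h _] := HX n; exact: h.
have FXE n : {ae P, forall w, FX n w = f (X n w)} by have [] := HX n.
have sgn (a : R) : a = 1 \/ a = -1 -> forall e, 0 < e -> exists N, forall n, (N <= n)%N ->
    a * mean Q FY - e <= a * mean P (FX n).
  move=> a1 e e0.
  have bd x : `|x| <= C -> 0 <= a * x + C <= 2 * C.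
    by rewrite ler_norml => /andP[h1 h2]; apply/andP; split; case: a1 => ->; lra.
  have cf' : continuous (fun z => a * f z + C).
    have cg : continuous (fun r : R => a * r + C).
      by move=> r; apply: cvgD; [apply: cvgM; [exact: cvg_cst|exact: cvg_id]|exact: cvg_cst].
    by move=> u; exact: (continuous_comp (cf u) (cg (f u))).
  have mX n : measurable_fun setT (fun w => a * FX n w + C).
    by apply: measurable_funD => //; exact: measurable_funM.
  have mY : measurable_fun setT (fun w => a * FY w + C).
    by apply: measurable_funD => //; exact: measurable_funM.
  have XE n : {ae P, forall w, a * FX n w + C = a * f (X n w) + C} by apply: filterS (FXE n) => w ->.
  have YE : {ae Q, forall w, a * FY w + C = a * f (Y w) + C} by apply: filterS FYE => w ->.
  have [N HN] := mean_lower cf' (fun z => bd _ (fC z)) mX mY (fun n w => bd _ (FXC n w))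
    (fun w => bd _ (FYC w)) XE YE e0.
  exists N => n Nn; have := HN n Nn.
  rewrite (mean_shift Q a C mFY FYC) (mean_shift P a C (mFX n) (FXC n)); lra.
have EX n : ('E_P[f \o X n] = (mean P (FX n))%:E)%E.
  rewrite unlock -(meanE P (mFX n) (FXC n)); apply: ae_eq_integralT.
  by apply: filterS (FXE n) => w ->.
have EY : ('E_Q[f \o Y] = (mean Q FY)%:E)%E.
  by rewrite unlock -(meanE Q mFY FYC); apply: ae_eq_integralT; apply: filterS FYE => w ->.
rewrite EY; under eq_fun do rewrite EX.
apply: cvg_EFin; first exact: nearW.
apply/cvgrPdist_le => e e0.
have [N1 H1] := sgn 1 (or_introl erefl) e e0; have [N2 H2] := sgn (-1) (or_intror erefl) e e0.
exists (maxn N1 N2) => // n /=; rewrite geq_max => /andP[/H1 h1 /H2 h2].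
rewrite ler_norml; apply/andP; split; lra.
Qed.

End Convergence.

(** Needed because the wrappings agree with polars of peelings only for samples in general position
    and good limits. *)
Lemma cvg_in_distribution_ae {R : realType} {T : topologicalType} {dO dO' : measure_display}
    {O : measurableType dO} {O' : measurableType dO'} (P : probability O R) (Q : probability O' R)
    (X X' : nat -> O -> T) (Y Y' : O' -> T) :
  (forall n, {ae P, forall w, X' n w = X n w}) -> {ae Q, forall w, Y' w = Y w} ->
  cvg_in_distribution P Q X Y -> cvg_in_distribution P Q X' Y'.
Proof.
move=> XX YY [rX [YM mY YE] cv]; split.
- by move=> n; have [XM mX XE] := rX n; exists XM => //; apply: filterS2 (XX n) XE => w -> ->.
- by exists YM => //; apply: filterS2 YY YE => w -> ->.
- move=> f cf bf; have := cv f cf bf.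
  have -> : ('E_Q[f \o Y'] = 'E_Q[f \o Y])%E.
    by rewrite unlock; apply: ae_eq_integralT; apply: filterS YY => w /= ->.
  suff -> : (fun n => 'E_P[f \o X' n])%E = (fun n => 'E_P[f \o X n])%E by [].
  by apply/funext => n; rewrite unlock; apply: ae_eq_integralT; apply: filterS (XX n) => w /= ->.
Qed.

Lemma ae_measurable_core {R : realType} {dO : measure_display} {O : measurableType dO}
    (P : probability O R) (A : O -> Prop) : {ae P, forall w, A w} ->
  exists U : set O, [/\ measurable U, {ae P, forall w, U w} & forall w, U w -> A w].
Proof.
move=> [N [mN PN AN]]; exists (~` N); split; first exact: measurableC.
  by exists N; split => // w /= /contrapT.
by move=> w Nw; apply: contrapT => Aw; apply: Nw; exact: AN.
Qed.

Theorem theorem3p1 (R : realType) (d : nat) (hd : (0 < d)%N)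
  (K : set 'rV[R]_d) (hK : in_K0 K)
  (hstrict : strictly_convex K) (hreg : regular_body K)
  (dO : measure_display) (O : measurableType dO) (P : probability O R)
  (xi : nat -> O -> borel_rV R d)
  (xi_meas : forall i, measurable_fun setT (xi i))
  (xi_unif : forall i, uniform_on P K (xi i))
  (xi_indep : independent_seq P xi)
  (S : {finite_measure set (borel_rV R d) -> \bar R})
  (hS : is_surface_area_measure K S)
  (dO' : measure_display) (O' : measurableType dO') (Q : probability O' R)
  (p : nat -> O' -> measurableTypeR R * borel_rV R d)
  (p_dom : forall i w, 0 < (p i w).1 /\ enorm (p i w).2 = 1)
  (p_poisson : poisson_process Q (hyperplane_intensity K S) p)
  (B0 : body0 R d) (m : nat) :
  cvg_in_distribution P Q
    (fun (n : nat) (w : O) =>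
       (fun r : 'I_m =>
          peel_body0 B0 (@scaled_polar_family R d K (xi ^~ w) n) r.+1)
       : {ptws 'I_m -> body0 R d})
    (fun w : O' =>
       (fun r : 'I_m => peel_body0 B0 (segment_family (p ^~ w)) r.+1)
       : {ptws 'I_m -> body0 R d})
  /\
  cvg_in_distribution P Q
    (fun (n : nat) (w : O) =>
       (fun r : 'I_m =>
          wrap_body0 B0 (@scaled_translate_family R d K (xi ^~ w) n) r.+1)
       : {ptws 'I_m -> body0 R d})
    (fun w : O' =>
       (fun r : 'I_m => wrap_body0 B0 (halfspace_family (p ^~ w)) r.+1)
       : {ptws 'I_m -> body0 R d}).
Proof.
have mesh_ex (T eps : R) : 0 < T -> 0 < eps -> exists M, is_mesh K S T eps M.
  exact: (mesh_exists hd hK hreg hS (xi_meas 0%N) (xi_unif 0%N)).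
have volK : 0 < rvol K := vol_body_gt0 (xi_unif 0%N).
have hpos := surface_hemisphere hd hK (xi_meas 0%N) (xi_unif 0%N) hS.
have [M hM] := mesh_sequence mesh_ex.
have [Oq [mOq aeOq HOq]] := ae_measurable_core (filterI (good_ae volK p_dom p_poisson hpos mesh_ex)
  (eventually_resolved p_poisson hM)).
have /choice[Om HOm] := sample_position hd hK xi_meas xi_unif xi_indep.
have mOm n : measurable (Om n) by have [] := HOm n.
have aeOm n : {ae P, forall w, Om n w} by have [] := HOm n.
have OmK n w (i : 'I_n) : Om n w -> K° (xi i w) by have [_ _ + _] := HOm n; exact.
have Omd n w (i j : 'I_n) : Om n w -> xi i w = xi j w -> i = j by have [_ _ _] := HOm n; exact.
have main g (hg : hcont g) := peelings_cvg hd hK xi_meas xi_unif xi_indep p_dom p_poisson hM OmK Omd aeOm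
  mOq aeOq HOq hg B0 m mOm.
(* For the identity, [peelval] unfolds to [peel_body0], default included. *)
split; first exact: (main id (@id_hcont R d)).
apply: cvg_in_distribution_ae (main (@polar_body R d) (@polar_hcont R d)).
- move=> n; apply: filterS (aeOm n) => w Ow; apply/funext => r.
  exact: (prelimit_wrap B0 r.+1 hK (fun i => OmK n w i Ow)).
- apply: filterS aeOq => w Ow; apply/funext => r.
  exact: (limit_wrap B0 r hd (fun i => p_dom i w) (HOq w Ow).1).
Qed.
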